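(* Let $H$, $\ell$, $\rho^0$ satisfy the standing assumptions listed in the context, and let $\rho$ be a solution of the constrained Fokker-Planck equation $$\partial_t\rho=\partial_x\big(\partial_x\rho+(H'-\sigma(t))\rho\big),\quad \rho(0,\cdot)=\rho^0,\quad \int_{\mathbb{R}} x\,\rho(t,x)\,dx=\ell(t),\quad \sigma(t)=\int_{\mathbb{R}} H'(x)\rho(t,x)\,dx+\dot\ell(t).$$ Set $\sigma^*:=\lambda(\ell^* )$. Then there is a constant $C$, depending only on $H$ and the constants in the standing assumptions (including $\|\ell\|_{L^\infty}$), such that for all (i.e. almost every) $t\ge0$ $$(\sigma(t)-\sigma^* )^2\le C\,\mathcal{H}\big(\rho(t)|\gamma_{\lambda(\ell(t))}\big)+4|\dot\ell(t)|^2+\frac{2}{c_{\mathrm{Var}}^2}|\ell(t)-\ell^*|^2.$$ In particular, let $\tau:=C_{\mathrm{LSI},M}^{-1}$ with $M=\|\sigma\|_{L^\infty(\mathbb{R}_+)}$; if there are $L_0>0$ and $\kappa>\tau$ such that $|\dot\ell(t)|\le L_0e^{-\kappa t}$ for all $t\ge0$, then there is a constant $\tilde C<\infty$ such that for all (a.e.) $t\ge 0$ $$(\sigma(t)-\sigma^* )^2\le\tilde C\,e^{-\tau t}.$$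
   Context: Standing assumptions. (a) $H\in C^3(\mathbb{R};[0,\infty))$, there are constants $c_{H,\pm}>0$ with $\liminf_{x\to\pm\infty}H''(x)=c_{H,\pm}$ and $\lim_{x\to\pm\infty}H'''(x)=0$, and for some $C<\infty$ and all $x$: $H(x)\le C(1+x^2)$, $|H'(x)|\le C(1+|x|)$, $|H''(x)|\le C$, $|H'''(x)|\le C/(1+|x|)$. (b) $\ell\in W^{1,\infty}(\mathbb{R}_+;\mathbb{R})$, $\lim_{t\to\infty}\ell(t)=\ell^*\in\mathbb{R}$, $\dot\ell\in L^1(\mathbb{R}_+)$. (c) $\rho^0\in\mathcal{P}_2(\mathbb{R})$, $\int x\rho^0dx=\ell(0)$, and $\mathcal{F}(\rho^0)<\infty$. $\mathcal{P}_2(\mathbb{R})$: absolutely continuous probability measures on $\mathbb{R}$ (identified with densities) with finite second moment. $\mathcal{M}^{\ell}=\{\rho\in\mathcal{P}_2(\mathbb{R}):\int x\rho\,dx=\ell\}$. $M_1(\rho)=\int x\rho\,dx$. Free energy $\mathcal{F}(\rho)=\int\rho\log\rho\,dx+\int H\rho\,dx+\log Z_0$, $Z_0=\int e^{-H}dx$. For $\sigma\in\mathbb{R}$, $\gamma_\sigma(x)=Z_\sigma^{-1}e^{-H(x)+\sigma x}$ with $Z_\sigma=\int e^{-H(x)+\sigma x}dx$. The map $\lambda:\mathbb{R}\to\mathbb{R}$ is defined by letting $\lambda(\ell)$ be the unique real number with $M_1(\gamma_{\lambda(\ell)})=\ell$. With $\mathrm{Var}(\gamma)=\int x^2\gamma\,dx-(\int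 x\gamma\,dx)^2$, set $c_{\mathrm{Var}}=\inf_{\eta\in\mathbb{R}}\mathrm{Var}(\gamma_\eta)$, which is positive under (a). Relative entropy: $\mathcal{H}(\rho|\gamma)=\int\rho\log(\rho/\gamma)\,dx$. Dissipation: $\mathcal{D}(\rho,\sigma)=\int_{\{\rho>0\}}\big|\partial_x\log\rho+H'-\sigma\big|^2\rho\,dx$ for weakly differentiable densities $\rho$, and $+\infty$ otherwise. $C_{\mathrm{LSI},M}\in(0,\infty)$ is a constant such that $\mathcal{H}(\rho|\gamma_\sigma)\le C_{\mathrm{LSI},M}\,\mathcal{D}(\rho,\sigma)$ for all $|\sigma|\le M$ and all $\rho\in\mathcal{P}_2(\mathbb{R})$ with $\mathcal{D}(\rho,\sigma)<\infty$. Solution: $\rho(0)=\rho^0$, $\rho(t)\in\mathcal{M}^{\ell(t)}$, and for every $T>0$ and $\zeta\in C_c^\infty([0,T)\times\mathbb{R})$ one has $0=-\int\zeta(0,x)\rho^0dx-\int_0^T\!\int\rho\,\partial_t\zeta\,dx\,dt+\int_0^T\!\int\rho\big((H'-\sigma)\partial_x\zeta-\partial_{xx}\zeta\big)dx\,dt$ with $\sigma(t)=\int H'\rho(t)\,dx+\dot\ell(t)$. As recorded in the paper, such solutions are understood with the regularity $\rho\in L^2_{\mathrm{loc}}(\mathbb{R}_+;H^2_{\mathrm{loc}}(\mathbb{R}))\cap H^1_{\mathrm{loc}}(\mathbb{R}_+;L^2_{\mathrm{loc}}(\mathbb{R}))$, with the time-continuous representative; conditions involving $\dot\ell$ or $\sigma$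 are understood for a.e. $t$. For such solutions $\|\sigma\|_{L^\infty(\mathbb{R}_+)}<\infty$. *)

(* Defs.v *)
From HB Require Import structures.
From mathcomp Require Import all_boot all_order all_algebra.
From mathcomp Require Import all_classical all_reals all_analysis.

Set Implicit Arguments.
Unset Strict Implicit.
Unset Printing Implicit Defensive.

Import Order.TTheory GRing.Theory Num.Theory.
Import numFieldNormedType.Exports.

Local Open Scope ring_scope.
Local Open Scope classical_set_scope.


Section smooth_functions.
Context {R : realType}.
Notation mu := (@lebesgue_measure R).
Implicit Types (f g : R -> R) (z : R -> R -> R) (D : set R).

Definition Cn (n : nat) f :=
  (forall k x, (k < n)%N -> derivable (f^`(k)) x 1) /\ continuous (f^`(n)).

Definition smooth f := forall k x, derivable (f^`(k)) x 1.

Definition test_function D (phi : R -> R) :=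
  smooth phi /\
  exists K : set R, [/\ compact K, K `<=` D & forall x, ~ K x -> phi x = 0].

Definition weak_derivative D f g :=
  [/\ locally_integrable D f, locally_integrable D g &
   forall phi, test_function D phi ->
     \int[mu]_(x in D) (f x * derive1 phi x) = - \int[mu]_(x in D) (g x * phi x)].

Definition partial_t z : R -> R -> R := fun t x => (fun s => z s x)^`() t.
Definition partial_x z : R -> R -> R := fun t x => (z t)^`() x.

Definition iter_partial (s : seq bool) z : R -> R -> R :=
  foldr (fun b w => if b then partial_t w else partial_x w) z s.

Definition smooth2 z := forall s : seq bool,
  [/\ forall t x, derivable (fun u => iter_partial s z u x) t 1,
      forall t x, derivable (iter_partial s z t) x 1 &
      continuous (fun p : R * R => iter_partial s z p.1 p.2)].

(* C_c^oo([0,T) x R): restrictions to t >= 0 of smooth functions on the plane,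
   with compact support in [0,T) x R; they need not vanish at t = 0. *)
Definition space_time_test_function (T : R) z :=
  smooth2 z /\
  exists T' K : R, T' < T /\
    forall t x, 0 <= t -> z t x != 0 -> t <= T' /\ `|x| <= K.

(* The norm of L^oo(R_+) of a function on R, whose values on t < 0 are
   irrelevant. *)
Definition Linfty_norm f : \bar R :=
  Lnorm mu +oo%E (EFin \o f \_ `[0, +oo[).

End smooth_functions.

Section densities.
Context {R : realType}.
Notation mu := (@lebesgue_measure R).
Implicit Types (H rho gam : R -> R) (s l : R).

Definition M1 rho : R := \int[mu]_(x in setT) (x * rho x).

Definition P2 rho :=
  [/\ measurable_fun setT rho, forall x, 0 <= rho x,
      (\int[mu]_x (rho x)%:E = 1)%E &
      (\int[mu]_x (x ^+ 2 * rho x)%:E < +oo)%E].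

Definition Ml l rho := P2 rho /\ M1 rho = l.

Definition partition_function H s : R :=
  \int[mu]_(x in setT) expR (- H x + s * x).

Definition gamma H s : R -> R :=
  fun x => (partition_function H s)^-1 * expR (- H x + s * x).

(* [ln 0 = 0], so [rho * ln rho] vanishes where [rho] does. *)
Definition free_energy H rho : \bar R :=
  ((\int[mu]_x (rho x * ln (rho x))%:E) + (\int[mu]_x (H x * rho x)%:E)
   + (ln (partition_function H 0))%:E)%E.

(* Under the assumptions on [H], there is exactly one [s] in this set. *)
Definition lambda H l : R := xget 0 [set s | M1 (gamma H s) = l].

Definition Var rho : R :=
  (\int[mu]_(x in setT) (x ^+ 2 * rho x)) - M1 rho ^+ 2.

Definition cVar H : R := inf [set Var (gamma H s) | s in [set: R]].

Definition relative_entropy rho gam : \bar R :=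
  (\int[mu]_x (rho x * ln (rho x / gam x))%:E)%E.

(* On [rho > 0], the derivative of [log rho] is [g / rho], with [g] the weak
   derivative of [rho], which is unique up to a null set. *)
Definition dissipation H rho s : \bar R :=
  if pselect (exists g, weak_derivative setT rho g) then
    let g := xget (cst 0) [set g | weak_derivative setT rho g] in
    (\int[mu]_(x in [set x | (0 < rho x)%R])
       ((g x / rho x + derive1 H x - s) ^+ 2 * rho x)%:E)%E
  else +oo%E.

Definition LSI H (M CLSI : R) :=
  0 < CLSI /\
  forall s rho, `|s| <= M -> P2 rho -> (dissipation H rho s < +oo)%E ->
    (relative_entropy rho (gamma H s) <= CLSI%:E * dissipation H rho s)%E.

End densities.

Section fokker_planck.
Context {R : realType}.
Notation mu := (@lebesgue_measure R).

Record potential_assumptions (H : R -> R) (cHm cHp CH : R) : Prop := {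
  potential_C3 : Cn 3 H;
  potential_ge0 : forall x, 0 <= H x;
  potential_cHm_gt0 : 0 < cHm;
  potential_cHp_gt0 : 0 < cHp;
  potential_liminf_ninfty :
    limf_einf (fun x => (derive1n 2 H x)%:E) (ninfty_nbhs R) = cHm%:E;
  potential_liminf_pinfty :
    limf_einf (fun x => (derive1n 2 H x)%:E) (pinfty_nbhs R) = cHp%:E;
  potential_lim_ninfty : H^`(3) x @[x --> -oo] --> (0 : R);
  potential_lim_pinfty : H^`(3) x @[x --> +oo] --> (0 : R);
  potential_bound0 : forall x, H x <= CH * (1 + x ^+ 2);
  potential_bound1 : forall x, `|H^`(1) x| <= CH * (1 + `|x|);
  potential_bound2 : forall x, `|H^`(2) x| <= CH;
  potential_bound3 : forall x, `|H^`(3) x| <= CH / (1 + `|x|)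
}.

(* [ell] is the continuous representative on [0, +oo[ of an element of
   W^{1,oo}(R_+), and [dell] is its weak derivative. *)
Record constraint_assumptions (ell dell : R -> R) (lstar : R) : Prop := {
  constraint_continuous : {within `[0, +oo[, continuous ell};
  constraint_weak_derivative : weak_derivative `]0, +oo[ ell dell;
  constraint_bounded : (Linfty_norm ell < +oo)%E;
  constraint_derivative_bounded : (Linfty_norm dell < +oo)%E;
  constraint_lim : ell t @[t --> +oo] --> lstar;
  constraint_derivative_integrable : mu.-integrable `[0, +oo[ (EFin \o dell)
}.

Record initial_assumptions (H ell rho0 : R -> R) : Prop := {
  initial_Ml : Ml (ell 0) rho0;
  initial_free_energy : (free_energy H rho0 < +oo)%E
}.

(* The space-time densities are functions of [t] and [x]; their values for
   [t < 0] are irrelevant. *)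
Implicit Types w rho : R -> R -> R.

Definition measurable_space_time w :=
  measurable_fun [set p : R * R | 0 <= p.1] (fun p => w p.1 p.2).

(* Local square-integrability on (0, +oo) x R. *)
Definition L2_loc w :=
  measurable_space_time w /\
  forall a b K : R, 0 < a -> a < b ->
    (\int[mu]_(t in `[a, b]) \int[mu]_(x in `[(- K)%R, K])
       (w t x ^+ 2)%:E < +oo)%E.

(* L^2_loc(R_+; H^2_loc(R)), locality in time being in (0, +oo): regularity up
   to [t = 0] would force [rho 0] to be locally in H^1. *)
Definition L2_H2_loc rho :=
  L2_loc rho /\
  exists rho_x rho_xx : R -> R -> R,
    [/\ L2_loc rho_x, L2_loc rho_xx &
     {ae mu, forall t, 0 < t ->
       weak_derivative setT (rho t) (rho_x t) /\
       weak_derivative setT (rho_x t) (rho_xx t)}].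

(* H^1_loc(R_+; L^2_loc(R)), where the weak derivative in time is the one of
   L^2_loc(R)-valued functions: the two Bochner integrals below are equal
   as elements of L^2_loc(R). *)
Definition H1_L2_loc rho :=
  L2_loc rho /\
  exists rho_t : R -> R -> R,
    L2_loc rho_t /\
    forall phi, test_function `]0, +oo[ phi ->
      {ae mu, forall x,
        \int[mu]_(t in `]0, +oo[) (rho t x * derive1 phi t) =
        - \int[mu]_(t in `]0, +oo[) (rho_t t x * phi t)}.

Definition time_continuous rho :=
  forall t0 K : R, 0 < t0 ->
    (\int[mu]_(x in `[(- K)%R, K]) ((rho t x - rho t0 x) ^+ 2)%:E)%E
      @[t --> t0] --> (0 : \bar R)%E.

Definition sigma (H dell : R -> R) rho : R -> R :=
  fun t => (\int[mu]_(x in setT) (derive1 H x * rho t x)) + dell t.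

(* The local integrability of [sigma] is what gives a meaning to the weak
   formulation. *)
Record solution (H ell dell rho0 : R -> R) rho : Prop := {
  solution_initial : {ae mu, forall x, rho 0 x = rho0 x};
  solution_Ml : forall t, 0 <= t -> Ml (ell t) (rho t);
  solution_measurable : measurable_space_time rho;
  solution_L2_H2 : L2_H2_loc rho;
  solution_H1_L2 : H1_L2_loc rho;
  solution_continuous : time_continuous rho;
  solution_sigma : forall T, 0 < T ->
    mu.-integrable `[0, T] (EFin \o sigma H dell rho);
  solution_weak : forall T zeta, 0 < T -> space_time_test_function T zeta ->
    0 = - (\int[mu]_(x in setT) (zeta 0 x * rho0 x))
        - (\int[mu]_(t in `[0, T])
            \int[mu]_(x in setT) (rho t x * partial_t zeta t x))
        + (\int[mu]_(t in `[0, T]) \int[mu]_(x in setT)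
            (rho t x * ((derive1 H x - sigma H dell rho t) * partial_x zeta t x
                        - partial_x (partial_x zeta) t x)))
}.

End fokker_planck.

(* Main.v *)
(* Under [gamma H s], the function [H' - s] has mean zero and Gaussian moments
   that are uniform for bounded [s]; a weighted Csiszar-Kullback-Pinsker
   inequality bounds [(\int H' rho - s)^2] by a multiple of the entropy of [rho]
   relative to [gamma H s].  With [s = lambda (ell t)] and the Lipschitz constant
   [1 / cVar] of [lambda], this is the first estimate.

   For the decay, [rho] is mollified in space into [rho_b = k_b * rho], where
   [k_b x = b * L (b x) * (1 - L (b x))] and [L] is the logistic function.  All
   derivatives of [k_b] are bounded by multiples of [k_b] itself, so that
   [|rho_b'| <= b * rho_b] and [ln rho_b] has linear growth, and
   [k_b * (ln rho_b + H - sigma_star x)] is admissible in the weak formulation,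
   whatever the regularity of [rho] at time 0.  By Gibbs' inequality, the
   increment of the entropy [G] of [rho_b] relative to [gamma H sigma_star]
   between [t] and [t'] is at most that of the expectation of [ln rho_b t' + H -
   sigma_star x]; summing over finer and finer partitions gives
     [G' <= - (1 - 1/b) D (rho_b, sigma) + (sigma - sigma_star) ell' + O(1/b)].
   The logarithmic Sobolev inequality and the convexity of [ln Z] give
     [D >= tau (G - (sigma - sigma_star) (\int x rho_b - lstar))],
   hence a differential inequality for [G] with an explicit supersolution.  The
   weighted Pinsker inequality turns the bound on [G] into one on
   [\int H' rho - sigma_star] as [b] tends to infinity.  That [sigma] is
   bounded follows from a uniform bound on the second moment of [rho]. *)

Require Import Defs.
From HB Require Import structures.
From mathcomp Require Import all_boot all_order all_algebra.
From mathcomp Require Import all_classical all_reals all_analysis.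
From mathcomp Require Import measurable_realfun ess_sup_inf ring lra.

Set Implicit Arguments.
Unset Strict Implicit.
Unset Printing Implicit Defensive.

Import Order.TTheory GRing.Theory Num.Theory.
Import numFieldNormedType.Exports.

Local Open Scope ring_scope.
Local Open Scope classical_set_scope.

(** * Integrals and derivatives on the line *)

(** The equation gives neither differentiability of the entropy in time nor moment bounds locally
    uniform in time. Identities are therefore proved for smooth observables in integrated form and
    extended by dominated convergence, each moment bound enlarging the class of admissible
    observables. The entropy is taken relative to a fixed measure, not to the moving
    [gamma H (lambda (ell t))], so that no derivative of [lambda (ell t)] appears; the price is the
    factor [sigma - sigma_star], which is merely bounded but multiplies the exponentially small
    [ell'] and [ell - lstar]. Convolution does not commute with the drift: the error [H' y - H' x]
    is of size [1/b] on average, and Young's inequality with weight [1/b] turns it into the factor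
    [1 - 1/b] and an [O(1/b)]. For each [b] the rate is thus below [tau]; [tau] itself is recovered
    because the prefactor does not depend on [b]: the initial entropies are uniformly bounded by
    Jensen's inequality, and [kappa > tau] leaves the margin [kappa - tau] in the supersolution. *)

Section integral_toolkit.
Context {d} {T : measurableType d} {R : realType}.
Variable mu : {measure set T -> \bar R}.
Implicit Types (D : set T) (f g : T -> R).

Lemma integrable_measurable D f : mu.-integrable D (EFin \o f) ->
  measurable_fun D f.
Proof. by move=> /integrableP[/measurable_EFinP]. Qed.

Lemma integrable_le D f g : measurable D -> measurable_fun D f ->
  mu.-integrable D (EFin \o g) -> (forall x, D x -> `|f x| <= g x) ->
  mu.-integrable D (EFin \o f).
Proof.
move=> mD mf ig fg; apply: le_integrable ig => //; first exact/measurable_EFinP.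
by move=> x Dx /=; rewrite lee_fin (le_trans (fg x Dx))// ler_norm.
Qed.

Lemma integrableZ D f (c : R) : measurable D -> mu.-integrable D (EFin \o f) ->
  mu.-integrable D (EFin \o (fun x => c * f x)).
Proof.
move=> mD intf; have := integrableZl mD c intf; apply: eq_integrable => //.
Qed.

Lemma integrable_add D f g : measurable D -> mu.-integrable D (EFin \o f) ->
  mu.-integrable D (EFin \o g) -> mu.-integrable D (EFin \o (fun x => f x + g x)).
Proof. by move=> mD fi gi; have := integrableD mD fi gi; apply: eq_integrable. Qed.

Lemma integrable_sub D f g : measurable D -> mu.-integrable D (EFin \o f) ->
  mu.-integrable D (EFin \o g) -> mu.-integrable D (EFin \o (fun x => f x - g x)).
Proof. by move=> mD fi gi; have := integrableB mD fi gi; apply: eq_integrable. Qed.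

Lemma integrable_nrm D f : measurable D -> mu.-integrable D (EFin \o f) ->
  mu.-integrable D (EFin \o (fun x => `|f x|)).
Proof. by move=> mD fi; exact: integrable_norm. Qed.

Lemma integrable_ext D f g : measurable D -> (forall x, D x -> f x = g x) ->
  mu.-integrable D (EFin \o f) -> mu.-integrable D (EFin \o g).
Proof.
move=> mD fg; apply: eq_integrable => // x; rewrite inE => Dx /=.
by rewrite fg.
Qed.

Lemma Rintegral_ext D f g : (forall x, D x -> f x = g x) ->
  \int[mu]_(x in D) f x = \int[mu]_(x in D) g x.
Proof. by move=> fg; apply: eq_Rintegral => x; rewrite inE; exact: fg. Qed.

Lemma EFin_Rintegral D f : measurable D -> mu.-integrable D (EFin \o f) ->
  ((\int[mu]_(x in D) f x)%:E = \int[mu]_(x in D) (f x)%:E)%E.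
Proof. by move=> mD fi; rewrite /Rintegral fineK//; exact: integrable_fin_num. Qed.

Lemma ge0_Rintegral_integrable D f : measurable D -> measurable_fun D f ->
  (forall x, D x -> 0 <= f x) -> (\int[mu]_(x in D) (f x)%:E < +oo)%E ->
  mu.-integrable D (EFin \o f).
Proof.
move=> mD mf f0 foo; apply/integrableP; split; first exact/measurable_EFinP.
rewrite (eq_integral (fun x => (f x)%:E))// => x; rewrite inE => Dx /=.
by rewrite ger0_norm// f0.
Qed.

(* An extended-valued integral is real as soon as it is not [+oo] and the
   integrand has an integrable minorant. *)
Lemma integrable_minorant D f g : measurable D -> measurable_fun D f ->
  mu.-integrable D (EFin \o g) -> (forall x, D x -> g x <= f x) ->
  (\int[mu]_(x in D) (f x)%:E < +oo)%E -> mu.-integrable D (EFin \o f).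
Proof.
move=> mD mf gi gf foo.
have mg := integrable_measurable gi.
have mfE : measurable_fun D (EFin \o f) by exact/measurable_EFinP.
have nf : (\int[mu]_(x in D) (EFin \o f)^\- x < +oo)%E.
  apply: le_lt_trans (integral_funeneg_lt_pinfty mD gi).
  apply: ge0_le_integral => //.
  - exact: measurable_funeneg.
  - by apply: measurable_funeneg; exact/measurable_EFinP.
  - move=> x Dx; rewrite !funenegE /= ge_max !le_max lexx orbT andbT.
    by rewrite lee_fin lerN2 gf.
apply/integrableP; split => //.
have -> : (\int[mu]_(x in D) `|(EFin \o f) x| =
   \int[mu]_(x in D) ((EFin \o f)^\+ x + (EFin \o f)^\- x))%E.
  by apply: eq_integral => x _; rewrite -[RHS]/((_ \+ _)%E x) -fune_abse.
rewrite ge0_integralD//; [|exact: measurable_funepos|exact: measurable_funeneg].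
rewrite lte_add_pinfty//.
have nfin : (\int[mu]_(x in D) (EFin \o f)^\- x \is a fin_num)%E.
  by rewrite ge0_fin_numE//; exact: integral_ge0.
move: foo; rewrite (integralE mu D (fun x => (f x)%:E)).
move: nfin; set a := integral _ _ _; set b := integral _ _ _.
by case: a => // r _; case: b => [s| |] //= _; exact: ltry.
Qed.

Lemma Rdominated_cvg D (f_ : nat -> T -> R) (f g : T -> R) : measurable D ->
  (forall n, measurable_fun D (f_ n)) ->
  (forall x, D x -> f_ n x @[n --> \oo] --> f x) ->
  mu.-integrable D (EFin \o g) ->
  (forall n x, D x -> `|f_ n x| <= g x) ->
  mu.-integrable D (EFin \o f) /\
  \int[mu]_(x in D) f_ n x @[n --> \oo] --> \int[mu]_(x in D) f x.
Proof.
move=> mD mf ff gi fg.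
have mfE n : measurable_fun D (EFin \o f_ n) by exact/measurable_EFinP.
have mlim : measurable_fun D (EFin \o f).
  apply/measurable_EFinP; apply: (measurable_fun_cvg mf) => //.
have ae1 : {ae mu, forall x, D x -> (EFin \o f_ n) x @[n --> \oo] --> (EFin \o f) x}.
  by apply: aeW => x Dx; apply: cvg_EFin; [exact: nearW|exact: ff].
have ae2 : {ae mu, forall x n, D x -> (`|(EFin \o f_ n) x| <= (EFin \o g) x)%E}.
  by apply: aeW => x n Dx /=; rewrite lee_fin fg.
have [fi _ cv] := dominated_convergence mD mfE mlim ae1 gi ae2.
split => //.
apply: fine_cvg; rewrite fineK//.
exact: integrable_fin_num.
Qed.

Lemma integrable_patch D f : measurable D ->
  mu.-integrable D (EFin \o f) <-> mu.-integrable setT (EFin \o (f \_ D)).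
Proof. by move=> mD; rewrite -restrict_EFin; exact: integrable_mkcond. Qed.

End integral_toolkit.

Arguments integrable_measurable {d T R} mu {D f}.
Arguments integrable_le {d T R} mu {D f g}.
Arguments integrableZ {d T R} mu {D f} c.
Arguments integrable_add {d T R} mu {D f g}.
Arguments integrable_sub {d T R} mu {D f g}.
Arguments integrable_nrm {d T R} mu {D f}.
Arguments integrable_ext {d T R} mu {D f g}.
Arguments Rintegral_ext {d T R} mu {D f g}.
Arguments EFin_Rintegral {d T R} mu {D f}.
Arguments ge0_Rintegral_integrable {d T R} mu {D f}.
Arguments integrable_minorant {d T R} mu {D f g}.
Arguments Rdominated_cvg {d T R} mu {D f_ f g}.
Arguments integrable_patch {d T R} mu {D f}.

(** * Calculus on the real line with explicit derivatives *)

Section real_line.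
Context {R : realType}.
Notation mu := (@lebesgue_measure R).
Implicit Types (f g F G : R -> R).

(** The derivative is a parameter rather than the term [derive1 F]: the rules below then compute
    derivatives of composite functions explicitly, and derivability comes along with them. *)
Definition has_deriv F f := forall x, is_derive x (1 : R) F (f x).

Lemma has_deriv_ext F G f g : F =1 G -> f =1 g -> has_deriv F f -> has_deriv G g.
Proof. by move=> /funext <- /funext <-. Qed.

Lemma has_deriv_eq F f g : has_deriv F f -> f =1 g -> has_deriv F g.
Proof. by move=> h /funext <-. Qed.

Lemma has_deriv_derivable F f x : has_deriv F f -> derivable F x 1.
Proof. by move=> /(_ x)[]. Qed.

Lemma has_deriv_derive1 F f : has_deriv F f -> F^`() = f.
Proof. by move=> h; apply/funext => x; rewrite derive1E; case: (h x). Qed.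

Lemma derivable_has_deriv F : (forall x, derivable F x 1) -> has_deriv F F^`().
Proof. by move=> h x; split => //; rewrite derive1E. Qed.

Lemma has_deriv_continuous F f : has_deriv F f -> continuous F.
Proof. by move=> h x; apply/differentiable_continuous/derivable1_diffP; case: (h x). Qed.

Lemma has_deriv_cst c : has_deriv (fun=> c) (fun=> 0).
Proof. by move=> x; exact: is_derive_cst. Qed.

Lemma has_deriv_id : has_deriv (fun x => x) (fun=> 1).
Proof. by move=> x; exact: is_derive_id. Qed.

Lemma has_derivD F G f g : has_deriv F f -> has_deriv G g ->
  has_deriv (fun x => F x + G x) (fun x => f x + g x).
Proof. by move=> hf hg x; exact: is_deriveD. Qed.

Lemma has_derivB F G f g : has_deriv F f -> has_deriv G g ->
  has_deriv (fun x => F x - G x) (fun x => f x - g x).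
Proof. by move=> hf hg x; exact: is_deriveB. Qed.

Lemma has_derivN F f : has_deriv F f -> has_deriv (fun x => - F x) (fun x => - f x).
Proof. by move=> hf x; exact: is_deriveN. Qed.

Lemma has_derivZ c F f : has_deriv F f ->
  has_deriv (fun x => c * F x) (fun x => c * f x).
Proof. by move=> hf x; exact: is_deriveZ. Qed.

Lemma has_derivM F G f g : has_deriv F f -> has_deriv G g ->
  has_deriv (fun x => F x * G x) (fun x => f x * G x + F x * g x).
Proof.
move=> hf hg x; have [h1 h2] := is_deriveM (hf x) (hg x); split => //.
by rewrite h2 /= addrC mulrC.
Qed.

Lemma has_deriv_comp F G f g : has_deriv F f -> has_deriv G g ->
  has_deriv (fun x => F (G x)) (fun x => f (G x) * g x).
Proof. by move=> hf hg x; exact: is_derive1_comp. Qed.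

Lemma has_deriv_affine b c : has_deriv (fun x => b * x + c) (fun=> b).
Proof.
apply: (has_deriv_eq (has_derivD (has_derivZ b has_deriv_id) (has_deriv_cst c))).
by move=> x; rewrite mulr1 addr0.
Qed.

Lemma has_deriv_expR F f : has_deriv F f ->
  has_deriv (fun x => expR (F x)) (fun x => f x * expR (F x)).
Proof.
move=> h; apply: has_deriv_eq; first by
  apply: (@has_deriv_comp expR F expR f) => // x; exact: is_derive_expR.
by move=> x; rewrite mulrC.
Qed.

Lemma has_deriv_ln F f : (forall x, 0 < F x) -> has_deriv F f ->
  has_deriv (fun x => ln (F x)) (fun x => f x / F x).
Proof.
move=> F0 h x; have dl := is_derive1_ln (F0 x).
have [h1 h2] := is_derive1_comp dl (h x); split => //.
by rewrite -[LHS]/('D_1 (@ln R \o F) x) h2 mulrC.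
Qed.

Lemma has_derivV F f : (forall x, F x != 0) -> has_deriv F f ->
  has_deriv (fun x => (F x)^-1) (fun x => - f x / F x ^+ 2).
Proof.
move=> F0 h x; have [h1 h2] := is_deriveV (F0 x) (h x); split => //.
by rewrite h2 scaleNr /= /GRing.scale /= mulNr mulrC.
Qed.

Lemma has_deriv_sqr : has_deriv (fun x => x ^+ 2) (fun x => 2 * x).
Proof.
apply: (has_deriv_ext _ _ (has_derivM has_deriv_id has_deriv_id)) => x.
  by rewrite expr2.
by rewrite mul1r mulr1 mulr_natl mulr2n.
Qed.

Lemma mean_value F f a b : has_deriv F f -> a <= b ->
  exists2 c, a <= c <= b & F b - F a = f c * (b - a).
Proof.
move=> h ab; have [//|c] := @MVT_segment R F f a b ab (fun x _ => h x).
  exact/continuous_subspaceT/(has_deriv_continuous h).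
by rewrite in_itv /= => ? ?; exists c.
Qed.

Lemma has_deriv_le F f a b : has_deriv F f -> a <= b ->
  (forall x, a <= x <= b -> 0 <= f x) -> F a <= F b.
Proof.
move=> h ab f0; have [c /f0 c0 e] := mean_value h ab.
by rewrite -subr_ge0 e mulr_ge0// subr_ge0.
Qed.

Lemma has_deriv_lip F f c a b : has_deriv F f -> (forall x, `|f x| <= c) ->
  `|F b - F a| <= c * `|b - a|.
Proof.
move=> h fc; wlog ab : a b / a <= b => [wl|].
  have [/wl//|/ltW/wl] := leP a b; by rewrite distrC (distrC a).
have [y _ ->] := mean_value h ab; rewrite normrM ler_wpM2r//.
Qed.

Lemma FTC2 F f a b : a <= b -> has_deriv F f -> continuous f ->
  \int[mu]_(x in `[a, b]) f x = F b - F a.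
Proof.
rewrite le_eqVlt => /predU1P[<-|ab] h cf.
  by rewrite set_itv1 Rintegral_set1 subrr.
have cF := has_deriv_continuous h.
rewrite /Rintegral (@continuous_FTC2 _ f F)//.
- exact: continuous_subspaceT.
- split; first by move=> x _; case: (h x).
  + by apply: cvg_at_right_filter; exact: cF.
  + by apply: cvg_at_left_filter; exact: cF.
- by move=> x _; rewrite (has_deriv_derive1 h).
Qed.

Lemma continuous_integrable_itv f a b : continuous f ->
  mu.-integrable `[a, b] (EFin \o f).
Proof.
move=> cf; apply: continuous_compact_integrable; first exact: segment_compact.
exact: continuous_subspaceT.
Qed.

Lemma continuous_measurable f (D : set R) : measurable D -> continuous f ->
  measurable_fun D f.
Proof.
move=> mD cf; apply: (@measurable_funS _ _ _ _ setT) => //.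
exact: continuous_measurable_fun.
Qed.

Lemma itv_exhaust (x : R) : \forall n \near \oo, x \in `[- (n%:R : R), n%:R]%R.
Proof.
near=> n; rewrite in_itv /= -ler_norml; near: n; exact: nbhs_infty_ger.
Unshelve. all: by end_near. Qed.

Lemma sym_itv_le (n : nat) : - (n%:R : R) <= n%:R.
Proof. by rewrite (le_trans _ (ler0n _ n))// oppr_le0. Qed.

(** Dominated convergence over the intervals [-n, n]; since [f] is already integrable, limits of [F]
    along the integers are enough. *)
Lemma FTC_line F f (lm lp : R) : has_deriv F f -> continuous f ->
  mu.-integrable setT (EFin \o f) ->
  F n%:R @[n --> \oo] --> lp -> F (- n%:R) @[n --> \oo] --> lm ->
  \int[mu]_x f x = lp - lm.
Proof.
move=> h cf fi Fp Fm.
pose f_ n := f \_ `[- (n%:R : R), n%:R].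
have mf_ n : measurable_fun setT (f_ n).
  apply/(measurable_restrictT _ _).1 => //.
  exact: continuous_measurable.
have cf_ x : setT x -> f_ n x @[n --> \oo] --> f x.
  move=> _; apply: cvg_near_cst; near=> n; rewrite /f_ patchE ifT//.
  by rewrite inE; near: n; apply: filterS (itv_exhaust x).
have df_ n x : setT x -> `|f_ n x| <= `|f x|.
  by move=> _; rewrite /f_ patchE; case: ifP => _ //; rewrite normr0.
have [_ cv] := Rdominated_cvg mu measurableT mf_ cf_ (integrable_nrm mu measurableT fi) df_.
have cv2 : \int[mu]_(x in setT) f_ n x @[n --> \oo] --> lp - lm.
  have -> : (fun n => \int[mu]_(x in setT) f_ n x) = (fun n => F n%:R - F (- n%:R)).
    apply/funext => n; rewrite -Rintegral_mkcond.
    by rewrite (FTC2 (sym_itv_le n) h cf).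
  exact: cvgB.
exact: (cvg_unique _ cv cv2).
Unshelve. all: by end_near. Qed.

(** For a nonnegative [f], monotone convergence of the integrals over [-n, n] makes integrability a
    conclusion; this normalizes the kernel, whose antiderivative is explicit. *)
Lemma ge0_FTC_line F f (lm lp : R) : has_deriv F f -> continuous f ->
  (forall x, 0 <= f x) ->
  F n%:R @[n --> \oo] --> lp -> F (- n%:R) @[n --> \oo] --> lm ->
  mu.-integrable setT (EFin \o f) /\ \int[mu]_x f x = lp - lm.
Proof.
move=> h cf f0 Fp Fm.
suff fi : mu.-integrable setT (EFin \o f) by split => //; exact: FTC_line Fp Fm.
have mf : measurable_fun setT f by exact: continuous_measurable.
apply: (ge0_Rintegral_integrable mu) => //.
have Un : \bigcup_n `[- (n%:R : R), n%:R]%classic = setT.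
  rewrite -subTset => x _; have [n _ hn] := itv_exhaust x.
  by exists n => //=; exact: (hn n (leqnn n)).
have nd : nondecreasing_seq (fun n : nat => `[- (n%:R : R), n%:R]%classic).
  move=> m n mn; apply/subsetPset/subset_itv; rewrite bnd_simp ?lerN2 ?ler_nat//.
have /= := @ge0_nondecreasing_set_cvg_integral _ (measurableTypeR R) R
  (fun n : nat => `[- (n%:R : R), n%:R]%classic) (EFin \o f) mu nd
  (fun _ => measurable_itv _) _ _.
rewrite Un => cv.
have cv2 : (\int[mu]_(x in `[(- (n%:R : R))%R, n%:R]) (f x)%:E)%E @[n --> \oo] --> (lp - lm)%:E.
  have -> : (fun n : nat => (\int[mu]_(x in `[(- (n%:R : R))%R, n%:R]) (f x)%:E)%E) =
      (fun n => (F n%:R - F (- n%:R))%:E).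
    apply/funext => n; rewrite -(FTC2 (sym_itv_le n) h cf).
    by rewrite (EFin_Rintegral mu)//; exact: continuous_integrable_itv.
  by apply: cvg_EFin; [exact: nearW|exact: cvgB].
have -> : (\int[mu]_x (f x)%:E)%E = (lp - lm)%:E.
  apply: (cvg_unique _ _ cv2) => //; apply: cv => //.
  - by move=> n; apply/measurable_EFinP; exact: continuous_measurable.
  - by move=> n x _; rewrite lee_fin.
exact: ltry.
Qed.

(** A bound on the integrals in [x] by an integrable function of [y] gives integrability on the
    plane by Tonelli's theorem; the statement stays with real-valued integrals. *)
Lemma Rfubini (F : R * R -> R) (G : R -> R) :
  measurable_fun setT F ->
  (forall x, mu.-integrable setT (EFin \o (fun y => F (x, y)))) ->
  (forall y, mu.-integrable setT (EFin \o (fun x => F (x, y)))) ->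
  (forall y, \int[mu]_x `|F (x, y)| <= G y) -> mu.-integrable setT (EFin \o G) ->
  [/\ mu.-integrable setT (EFin \o (fun x => \int[mu]_y F (x, y))),
      mu.-integrable setT (EFin \o (fun y => \int[mu]_x F (x, y))) &
      \int[mu]_x (\int[mu]_y F (x, y)) = \int[mu]_y (\int[mu]_x F (x, y))].
Proof.
move=> mF i1 i2 FG iG.
have mFE : measurable_fun setT (EFin \o F) by exact/measurable_EFinP.
have iF : (mu \x mu)%E.-integrable setT (EFin \o F).
  apply/(@integrable21ltyP _ _ (measurableTypeR R) (measurableTypeR R) R mu mu (EFin \o F) mFE); apply: (@le_lt_trans _ _ (\int[mu]_y `|(G y)%:E|)%E).
    apply: ge0_le_integral => //.
    - by move=> y _; exact: integral_ge0.
    - apply: (measurable_fun_fubini_tonelli_G (m1 := mu) (abse \o (EFin \o F))) => //=.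
      exact: measurableT_comp.
    - by move/integrableP : iG => [m _]; exact: measurableT_comp.
    - move=> y _; have /= := EFin_Rintegral mu measurableT (integrable_nrm mu measurableT (i2 y)).
      by move=> <-; rewrite lee_fin (le_trans (FG y))// ler_norm.
  by move/integrableP : iG => [].
have E1 : (fun x => (\int[mu]_y F (x, y))%:E) = fubini_F mu (EFin \o F).
  by apply/funext => x; rewrite (EFin_Rintegral mu).
have E2 : (fun y => (\int[mu]_x F (x, y))%:E) = fubini_G mu (EFin \o F).
  by apply/funext => x; rewrite (EFin_Rintegral mu).
split.
- by rewrite [X in integrable _ _ X]E1; exact: integrable_fubini_F iF.
- apply: (integrable_le mu (g := G)) => //.
    apply/measurable_EFinP; rewrite [X in measurable_fun _ X]E2.
    exact: (measurable_fubini_G iF).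
  by move=> y _; apply: le_trans (FG y); exact: le_normr_Rintegral.
- rewrite /Rintegral; congr fine.
  under eq_integral do rewrite (EFin_Rintegral mu)//.
  under [RHS]eq_integral do rewrite (EFin_Rintegral mu)//.
  exact: (Fubini iF).
Qed.

(** The majorant is only required on a unit neighbourhood of each parameter: exponential tilts and
    translated kernels admit no global one in general. *)
Lemma has_deriv_integral (f df : R -> R -> R) :
  (forall x, mu.-integrable setT (EFin \o f x)) ->
  (forall y, has_deriv (f ^~ y) (df ^~ y)) ->
  (forall a, exists2 G : R -> R, mu.-integrable setT (EFin \o G) &
    forall x y, a - 1 < x < a + 1 -> `|df x y| <= G y) ->
  has_deriv (fun x => \int[mu]_y f x y) (fun x => \int[mu]_y df x y).
Proof.
move=> fi hd dom a; have [G iG dG] := dom a.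
have Ia : `]a - 1, a + 1[%classic a by rewrite /= in_itv /= ltrDl ltrBlDr ltrDl ltr01.
have G0 y : 0 <= G y.
  by apply: le_trans (dG a y _); rewrite // ltrDl ltrBlDr ltrDl ltr01.
have dfE x y : partial1of2 f x y = df x y.
  by rewrite /partial1of2 (has_deriv_derive1 (hd y)).
have D x y : `]a - 1, a + 1[%classic x -> setT y -> derivable (f ^~ y) x 1.
  by move=> _ _; exact: has_deriv_derivable (hd y).
have B x y : `]a - 1, a + 1[%classic x -> setT y -> `|partial1of2 f x y| <= G y.
  by rewrite dfE /= in_itv /= => ? _; exact: dG.
have e := differentiation_under_integral (mu := mu) measurableT Ia (fun x _ => fi x) D G0 iG B.
have d := derivable_under_integral (mu := mu) measurableT Ia (fun x _ => fi x) D G0 iG B.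
split=> //; rewrite -derive1E e; apply: (Rintegral_ext mu) => y _; exact: dfE.
Qed.

End real_line.

(** * The logistic kernel *)

Section logistic_kernel.
Context {R : realType}.
Notation mu := (@lebesgue_measure R).
Implicit Types (b x y h : R) (Q : {poly R}).

Definition logistic x : R := (1 + expR (- x))^-1.

Lemma logistic_den_gt0 x : 0 < 1 + expR (- x) :> R.
Proof. by rewrite addr_gt0// expR_gt0. Qed.

Lemma logistic_gt0 x : 0 < logistic x.
Proof. by rewrite invr_gt0 logistic_den_gt0. Qed.

Lemma logistic_lt1 x : logistic x < 1.
Proof. by rewrite invf_lt1 ?logistic_den_gt0// ltrDl expR_gt0. Qed.

Lemma has_deriv_logistic :
  has_deriv logistic (fun x => logistic x * (1 - logistic x)).
Proof.
have d1 : has_deriv (fun x => 1 + expR (- x)) (fun x => - expR (- x)).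
  apply: (has_deriv_eq (has_derivD (has_deriv_cst 1)
    (has_deriv_expR (has_derivN (@has_deriv_id R))))) => x.
  by rewrite add0r mulN1r.
have d2 := has_derivV (fun x => lt0r_neq0 (logistic_den_gt0 x)) d1.
apply: (has_deriv_eq d2) => x; rewrite opprK /logistic.
have := logistic_den_gt0 x; set e := expR (- x) => e0.
by field; lra.
Qed.

(** The logistic density of scale [1/b], that is [b / (4 cosh^2 (b x / 2))]. *)
Definition ker b x : R := b * (logistic (b * x) * (1 - logistic (b * x))).

(** Since [L' = L (1 - L)], differentiating [Q(L) * ker] amounts, up to a factor [b], to replacing
    [Q] by [ker_step Q]; the class of such products is closed under differentiation. *)
Definition ker_step Q := 'X * (1 - 'X) * Q^`() + (1 - 'X *+ 2) * Q.

(* The derivatives of the kernel are all of the form [Q(logistic) * ker]. *)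
Definition poly_ker b Q x : R := Q.[logistic (b * x)] * ker b x.

Lemma poly_ker1 b x : poly_ker b 1 x = ker b x.
Proof. by rewrite /poly_ker hornerC mul1r. Qed.

Lemma has_deriv_poly (Q : {poly R}) : has_deriv (fun x => Q.[x]) (fun x => Q^`().[x]).
Proof. by move=> x; exact: is_derive_poly. Qed.

Lemma has_deriv_poly_ker b Q :
  has_deriv (poly_ker b Q) (fun x => b * poly_ker b (ker_step Q) x).
Proof.
have dl : has_deriv (fun x => logistic (b * x))
    (fun x => logistic (b * x) * (1 - logistic (b * x)) * b).
  have db : has_deriv (fun x => b * x) (fun=> b).
    by apply: (has_deriv_eq (has_derivZ b (@has_deriv_id R))) => x; rewrite mulr1.
  exact: (has_deriv_comp has_deriv_logistic db).
have dk := has_derivZ b (has_derivM dl (has_derivB (has_deriv_cst 1) dl)).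
have dQ := has_deriv_comp (has_deriv_poly Q) dl.
apply: (has_deriv_eq (has_derivM dQ dk)) => x.
rewrite /poly_ker /ker_step /ker; set l := logistic _.
by rewrite !hornerE /=; ring.
Qed.

Lemma has_deriv_ker b :
  has_deriv (ker b) (fun x => b * ((1 - 2 * logistic (b * x)) * ker b x)).
Proof.
apply: (has_deriv_ext _ _ (has_deriv_poly_ker b 1)) => x; first exact: poly_ker1.
by rewrite /poly_ker /ker_step derivC mulr0 add0r !hornerE /=; ring.
Qed.

Lemma poly_bounded01 Q : exists2 M : R, 0 <= M &
  forall l, 0 <= l <= 1 -> `|Q.[l]| <= M.
Proof.
elim/poly_ind: Q => [|Q c [M M0 HM]].
  by exists 0 => // l _; rewrite horner0 normr0.
exists (M + `|c|) => [|l l01]; first by rewrite addr_ge0.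
rewrite hornerMXaddC (le_trans (ler_normD _ _))// lerD2r normrM.
rewrite (le_trans (ler_pM _ _ (HM _ l01) (_ : `|l| <= 1)))// ?mulr1//.
by case/andP: l01 => l0 l1; rewrite ger0_norm.
Qed.

Lemma poly_ker_bounded b Q : 0 < b -> exists2 M : R, 0 <= M &
  forall x, `|poly_ker b Q x| <= M * ker b x.
Proof.
move=> b0; have [M M0 HM] := poly_bounded01 Q; exists M => // x.
have l0 := logistic_gt0 (b * x); have l1 := logistic_lt1 (b * x).
have k0 : 0 <= ker b x.
  by apply: mulr_ge0 (ltW b0) (mulr_ge0 (ltW l0) _); rewrite subr_ge0 ltW.
rewrite /poly_ker normrM (ger0_norm k0) ler_wpM2r// HM//.
by rewrite !ltW.
Qed.

Lemma kerE b x : ker b x = b / (2 + expR (b * x) + expR (- (b * x))).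
Proof.
rewrite /ker /logistic; have e0 := expR_gt0 (b * x).
rewrite expRN; set e := expR _ in e0 *.
by field; rewrite !gt_eqF// ?addr_gt0// ?mulr_gt0// addr_gt0.
Qed.

Lemma ker_gt0 b x : 0 < b -> 0 < ker b x.
Proof. by move=> b0; rewrite kerE divr_gt0// !addr_gt0// expR_gt0. Qed.

Lemma ker_ge0 b x : 0 < b -> 0 <= ker b x.
Proof. by move=> b0; rewrite ltW// ker_gt0. Qed.

(** A Harnack-type bound: a translation by [h] changes each exponential in the denominator by a
    factor at most [e^(b|h|)]. It gives majorants that are uniform for nearby translates. *)
Lemma ker_shift b x h : 0 < b -> ker b (x + h) <= expR (b * `|h|) * ker b x.
Proof.
move=> b0; rewrite !kerE.
set E := expR (b * `|h|); set u := b * x; set v := b * h.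
have D0 y : 0 < 2 + expR y + expR (- y) :> R by rewrite !addr_gt0// expR_gt0.
have nv : `|v| = b * `|h| by rewrite normrM gtr0_norm.
have E1 : 1 <= E by rewrite /E -expR0 ler_expR mulr_ge0// ltW.
have Ev : expR (- v) <= E by rewrite ler_expR -nv -normrN ler_norm.
have Ev' : expR v <= E by rewrite ler_expR -nv ler_norm.
have -> : b * (x + h) = u + v by rewrite mulrDr.
have e1 : expR u = expR (- v) * expR (u + v) by rewrite -expRD; congr expR; ring.
have e2 : expR (- u) = expR v * expR (- (u + v)) by rewrite -expRD; congr expR; ring.
have main : 2 + expR u + expR (- u) <= E * (2 + expR (u + v) + expR (- (u + v))).
  have p1 : expR (- v) * expR (u + v) <= E * expR (u + v) by rewrite ler_wpM2r// expR_ge0.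
  have p2 : expR v * expR (- (u + v)) <= E * expR (- (u + v)).
    by rewrite ler_wpM2r// expR_ge0.
  rewrite e1 e2; lra.
rewrite ler_pdivrMr// (_ : E * _ * _ = b * (E * (2 + expR (u + v) + expR (- (u + v))) /
  (2 + expR u + expR (- u)))); last by ring.
by rewrite ler_peMr ?(ltW b0)// ler_pdivlMr// mul1r.
Qed.

Lemma ker_le b x : 0 < b -> ker b x <= b * expR (- (b * `|x|)).
Proof.
move=> b0; rewrite kerE ler_pM2l// (expRN (b * `|x|)) lef_pV2 ?posrE ?addr_gt0 ?expR_gt0//.
have [x0|x0] := leP 0 x; have := expR_gt0 (b * x); have := expR_gt0 (- (b * x)).
  by rewrite ger0_norm//; lra.
by rewrite ltr0_norm// mulrN; lra.
Qed.

Lemma ker_ge b x : 0 < b -> b / 4 * expR (- (b * `|x|)) <= ker b x.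
Proof.
move=> b0; rewrite kerE -mulrA ler_pM2l// (expRN (b * `|x|)) -invfM lef_pV2 ?posrE ?mulr_gt0 ?addr_gt0 ?expR_gt0//.
have e1 : expR (b * x) <= expR (b * `|x|) by rewrite ler_expR ler_pM2l// ler_norm.
have e2 : expR (- (b * x)) <= expR (b * `|x|).
  by rewrite ler_expR -mulrN ler_pM2l// -normrN ler_norm.
have e3 : 1 <= expR (b * `|x|) by rewrite -expR0 ler_expR mulr_ge0// ltW.
lra.
Qed.

Lemma ker_le_cst b x : 0 < b -> ker b x <= b.
Proof.
move=> b0; rewrite (le_trans (ker_le x b0))// ler_piMr ?(ltW b0)//.
by rewrite -expR0 ler_expR oppr_le0 mulr_ge0// ltW.
Qed.

(** Half of the exponential rate pays for the square: with [u = b|x|/2], [u^2 <= 2 e^u] and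
    [ker b x <= b e^(-2u)], while [e^(-u)] is at most [8/b] times the kernel of rate [b/2]; whence
    64 = 4 * 2 * 8. *)
Lemma sqr_ker_le b x : 0 < b -> x ^+ 2 * ker b x <= 64 / b ^+ 2 * ker (b / 2) x.
Proof.
move=> b0; have b20 : 0 < b / 2 by rewrite divr_gt0.
have := ker_le x b0; have := ker_ge x b20.
set u := b / 2 * `|x|; set k := ker b x; set k' := ker (b / 2) x => h1 h2.
have u0 : 0 <= u by rewrite mulr_ge0// ltW.
have e2 : u ^+ 2 <= 2 * expR u.
  have := @expR_ge1Dxn R u 1 u0; rewrite (_ : 2`!%:R = 2)//.
  have := expR_gt0 u; lra.
have ee : expR (- (b * `|x|)) = expR (- u) * expR (- u).
  by rewrite -expRD; congr expR; rewrite /u; lra.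
have eu : expR u * expR (- u) = 1 by exact: expRxMexpNx_1.
have x2 : x ^+ 2 = 4 / b ^+ 2 * u ^+ 2.
  by rewrite /u exprMn real_normK ?num_real//; field; lra.
have b2 : 0 < b ^+ 2 by rewrite exprn_gt0.
rewrite ee in h2; have en := expR_gt0 (- u).
have bi : 0 < (b ^+ 2)^-1 by rewrite invr_gt0.
have h3 : u ^+ 2 * k <= 2 * b * expR (- u).
  apply: (@le_trans _ _ (2 * expR u * (b * (expR (- u) * expR (- u))))).
    by apply: ler_pM => //; [exact: sqr_ge0|exact: ker_ge0].
  rewrite (_ : _ * _ = 2 * b * (expR u * expR (- u)) * expR (- u)); last by ring.
  by rewrite eu mulr1.
have h4 : b * expR (- u) <= 8 * k' by rewrite /u; move: h1; rewrite -/u; lra.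
rewrite x2 (_ : _ * k = 4 / b ^+ 2 * (u ^+ 2 * k)); last by ring.
apply: (@le_trans _ _ (4 / b ^+ 2 * (16 * k'))).
  by rewrite ler_pM2l ?divr_gt0//; lra.
by rewrite le_eqVlt; apply/orP; left; apply/eqP; ring.
Qed.

Lemma continuous_ker b : continuous (ker b).
Proof. exact: has_deriv_continuous (@has_deriv_ker b). Qed.

Lemma continuous_poly_ker b Q : continuous (poly_ker b Q).
Proof. exact: has_deriv_continuous (@has_deriv_poly_ker b Q). Qed.

Lemma logistic_cvg_pinfty b y : 0 < b -> logistic (b * (n%:R - y)) @[n --> \oo] --> (1 : R).
Proof.
move=> b0; have c1 : expR (- (b * (n%:R - y))) @[n --> \oo] --> (0 : R).
  apply: (@cvg_comp _ _ _ (fun n : nat => b * (n%:R - y)) (fun x : R => expR (- x)) _ +oo%R).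
    apply/cvgryPge => A; near=> n.
    rewrite -ler_pdivrMl// lerBrDr; near: n; exact: nbhs_infty_ger.
  exact: cvgr_expR.
rewrite -[X in _ --> X]invr1 -[X in X^-1]addr0.
apply: cvgV; first by rewrite addr0 oner_neq0.
by apply: cvgD => //; exact: cvg_cst.
Unshelve. all: by end_near. Qed.

Lemma logistic_opp x : logistic (- x) = 1 - logistic x.
Proof.
rewrite /logistic opprK expRN; have := expR_gt0 x; set e := expR _ => e0.
by field; rewrite !gt_eqF// ?addr_gt0.
Qed.

Lemma logistic_cvg_ninfty b y : 0 < b ->
  logistic (b * (- n%:R - y)) @[n --> \oo] --> (0 : R).
Proof.
move=> b0; have -> : (fun n => logistic (b * (- n%:R - y))) =
    (fun n => 1 - logistic (b * (n%:R - - y))).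
  by apply/funext => n; rewrite -logistic_opp; congr logistic; ring.
rewrite -[X in _ --> X](subrr 1); apply: cvgB; first exact: cvg_cst.
exact: logistic_cvg_pinfty.
Qed.

Lemma has_deriv_logistic_shift b y :
  has_deriv (fun x => logistic (b * (x - y))) (fun x => ker b (x - y)).
Proof.
have d : has_deriv (fun x => b * (x - y)) (fun=> b).
  apply: (has_deriv_ext _ _ (has_deriv_affine b (- (b * y)))) => // x; ring.
apply: (has_deriv_eq (has_deriv_comp has_deriv_logistic d)) => x.
by rewrite /ker mulrC.
Qed.

Lemma has_deriv_shift (F f : R -> R) y : has_deriv F f ->
  has_deriv (fun x => F (x - y)) (fun x => f (x - y)).
Proof.
move=> h; have d : has_deriv (fun x => x - y) (fun=> 1).
  by apply: (has_deriv_ext _ _ (has_deriv_affine 1 (- y))) => // x; rewrite mul1r.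
by apply: (has_deriv_eq (has_deriv_comp h d)) => x; rewrite mulr1.
Qed.

Lemma continuous_shift (F : R -> R) y : continuous F -> continuous (fun x => F (x - y)).
Proof.
move=> cF x; apply: (@continuous_comp _ _ _ (fun x => x - y) F); last exact: cF.
by apply: cvgB; [exact: cvg_id|exact: cvg_cst].
Qed.

Lemma ker_mass b y : 0 < b ->
  mu.-integrable setT (EFin \o (fun x => ker b (x - y))) /\
  \int[mu]_x ker b (x - y) = 1.
Proof.
move=> b0; rewrite -[X in _ = X]subr0; apply: ge0_FTC_line.
- exact: has_deriv_logistic_shift.
- exact/continuous_shift/continuous_ker.
- by move=> x; exact: ker_ge0.
- exact: logistic_cvg_pinfty.
- exact: logistic_cvg_ninfty.
Qed.

Lemma ker_even b x : ker b (- x) = ker b x.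
Proof. by rewrite /ker mulrN logistic_opp; ring. Qed.

Lemma integrable_ker b : 0 < b -> mu.-integrable setT (EFin \o ker b).
Proof.
move=> b0; have [+ _] := ker_mass 0 b0; apply: integrable_ext => // x _.
by rewrite subr0.
Qed.

End logistic_kernel.

(** * Gibbs measures of a confining potential *)

Section confining_potential.
Context {R : realType}.
Implicit Types (H rho f : R -> R).

(** Coercivity appears twice with the same constants: that of [H] gives Gaussian tails of the Gibbs
    measures, that of [x * H'] is the Lyapunov condition behind the moment bounds. [CH] serves as a
    common growth constant. *)
Record confining H (h1 h2 : R -> R) (CH al be : R) : Prop := {
  conf_d1 : has_deriv H h1;
  conf_d2 : has_deriv h1 h2;
  conf_c2 : continuous h2;
  conf_CH : 0 < CH;
  conf_ge0 : forall x, 0 <= H x;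
  conf_le : forall x, H x <= CH * (1 + x ^+ 2);
  conf_h1 : forall x, `|h1 x| <= CH * (1 + `|x|);
  conf_h2 : forall x, `|h2 x| <= CH;
  conf_al : 0 < al;
  conf_H_ge : forall x, al * x ^+ 2 - be <= H x;
  conf_xh1_ge : forall x, al * x ^+ 2 - be <= x * h1 x
}.

Lemma liminf_pinfty_ge (f : R -> R) (c : R) : 0 < c ->
  limf_einf (fun x => (f x)%:E) (pinfty_nbhs R) = c%:E ->
  exists M, forall x, M < x -> c / 2 <= f x.
Proof.
move=> c0; rewrite limf_einfE => E.
have /ereal_sup_gt[_ [V FV <-] cV] :
    ((c / 2)%:E < ereal_sup [set ereal_inf ((fun x => (f x)%:E) @` V) | V in pinfty_nbhs R])%E.
  by rewrite E lte_fin; lra.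
case: FV => M [_ MV]; exists M => x /MV Vx.
by rewrite -lee_fin (le_trans (ltW cV))//; apply: ereal_inf_lbound; exists x.
Qed.

Lemma liminf_ninfty_ge (f : R -> R) (c : R) : 0 < c ->
  limf_einf (fun x => (f x)%:E) (ninfty_nbhs R) = c%:E ->
  exists M, forall x, x < M -> c / 2 <= f x.
Proof.
move=> c0; rewrite limf_einfE => E.
have /ereal_sup_gt[_ [V FV <-] cV] :
    ((c / 2)%:E < ereal_sup [set ereal_inf ((fun x => (f x)%:E) @` V) | V in ninfty_nbhs R])%E.
  by rewrite E lte_fin; lra.
case: FV => M [_ MV]; exists M => x /MV Vx.
by rewrite -lee_fin (le_trans (ltW cV))//; apply: ereal_inf_lbound; exists x.
Qed.

(** The bound [h2 >= c] is integrated from [x0], and the resulting bound on [h1] from 0. On [0, x0],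
    where nothing is known of the convexity, the growth bound on [h1] is absorbed into the
    constant. *)
Lemma confining_half (H h1 h2 : R -> R) (CH c x0 : R) :
  has_deriv H h1 -> has_deriv h1 h2 -> 0 < c -> 0 <= x0 -> 0 <= CH ->
  (forall x, `|h1 x| <= CH * (1 + `|x|)) ->
  (forall x, 0 <= H x) ->
  (forall x, x0 <= x -> c <= h2 x) ->
  forall x, 0 <= x ->
    c * x - (c * x0 + CH * (1 + x0)) <= h1 x /\
    c / 2 * x ^+ 2 - (c * x0 + CH * (1 + x0)) * x <= H x.
Proof.
move=> d1 d2 c0 x00 CH0 bh1 H0 bh2; set K := c * x0 + _.
have K0 : 0 <= K by rewrite addr_ge0// mulr_ge0// ?(ltW c0)// addr_ge0.
have A x : 0 <= x -> c * x - K <= h1 x.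
  move=> x_ge0; have b0 := lerNnormlW (bh1 x0); have bx := lerNnormlW (bh1 x).
  rewrite (ger0_norm x00) in b0; rewrite (ger0_norm x_ge0) in bx.
  have [xx0|x0x] := leP x x0.
    have : CH * (1 + x) <= CH * (1 + x0) by rewrite ler_wpM2l// lerD2l.
    have : c * x <= c * x0 by rewrite ler_wpM2l// ltW.
    rewrite /K; lra.
  have dl : has_deriv (fun y => h1 y - c * y) (fun y => h2 y - c).
    apply: has_derivB => //.
    by apply: (has_deriv_eq (has_derivZ c (@has_deriv_id R))) => z; rewrite mulr1.
  have : h1 x0 - c * x0 <= h1 x - c * x.
    by apply: (has_deriv_le dl (ltW x0x)) => y /andP[y0 _]; rewrite subr_ge0 bh2.
  rewrite /K; lra.
move=> x x_ge0; split; first exact: A.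
have dl : has_deriv (fun y => H y - (c / 2 * y ^+ 2 - K * y)) (fun y => h1 y - (c * y - K)).
  apply: has_derivB => //; apply: has_derivB.
    by apply: (has_deriv_eq (has_derivZ (c / 2) (@has_deriv_sqr R))) => z; lra.
  by apply: (has_deriv_eq (has_derivZ K (@has_deriv_id R))) => z; rewrite mulr1.
have : H 0 - (c / 2 * 0 ^+ 2 - K * 0) <= H x - (c / 2 * x ^+ 2 - K * x).
  by apply: (has_deriv_le dl x_ge0) => y /andP[y0 _]; rewrite subr_ge0 A.
by have := H0 0; rewrite expr0n /=; lra.
Qed.

Lemma confining_of_potential (H : R -> R) (cHm cHp CH : R) :
  potential_assumptions H cHm cHp CH ->
  exists CH' al be : R, confining H (derive1 H) (derive1 (derive1 H)) CH' al be.
Proof.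
case=> [[dH cH3] H0 cm0 cp0 lm lp _ _ b0 b1 b2 b3].
have d1 : has_deriv H (derive1 H) by apply: derivable_has_deriv => x; exact: (dH 0%N x).
have d2 : has_deriv (derive1 H) (derive1 (derive1 H)).
  by apply: derivable_has_deriv => x; exact: (dH 1%N x).
have d3 : has_deriv (derive1 (derive1 H)) (derive1 (derive1 (derive1 H))).
  by apply: derivable_has_deriv => x; exact: (dH 2%N x).
have [Mp hp] := liminf_pinfty_ge cp0 lp; have [Mm hm] := liminf_ninfty_ge cm0 lm.
have CH0 : 0 <= CH by apply: le_trans (b2 0).
pose c := Num.min cHp cHm / 2; pose x0 := `|Mp| + `|Mm| + 1.
have c0 : 0 < c by rewrite /c divr_gt0// lt_min cp0.
have x00 : 0 <= x0 by rewrite /x0 !addr_ge0.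
have hcp x : x0 <= x -> c <= (derive1 (derive1 H)) x.
  move=> x0x; apply: le_trans (hp x _).
    by rewrite /c ler_pM2r// ge_min lexx.
  by move: x0x; rewrite /x0; have := ler_norm Mp; have := normr_ge0 Mm; lra.
have hcm x : x0 <= x -> c <= (derive1 (derive1 H)) (- x).
  move=> x0x; apply: le_trans (hm (- x) _).
    by rewrite /c ler_pM2r// ge_min lexx orbT.
  by move: x0x; rewrite /x0; have := ler_norm (- Mm); rewrite normrN; have := normr_ge0 Mp; lra.
(* The negative half-line is handled through the reflected potential [x |-> H (- x)]. *)
have dN : has_deriv (fun x : R => - x) (fun=> -1) by exact: has_derivN (@has_deriv_id R).
have d1m : has_deriv (fun x => H (- x)) (fun x => - (derive1 H) (- x)).
  by apply: (has_deriv_eq (has_deriv_comp d1 dN)) => x; rewrite mulrN1.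
have d2m : has_deriv (fun x => - (derive1 H) (- x)) (fun x => (derive1 (derive1 H)) (- x)).
  by apply: (has_deriv_eq (has_derivN (has_deriv_comp d2 dN))) => x; rewrite mulrN1 opprK.
have b1m x : `|- (derive1 H) (- x)| <= CH * (1 + `|x|).
  by rewrite normrN (le_trans (b1 _))// normrN.
have HP := confining_half d1 d2 c0 x00 CH0 b1 H0 hcp.
have HM := confining_half d1m d2m c0 x00 CH0 b1m (fun x => H0 (- x)) hcm.
pose K := c * x0 + CH * (1 + x0).
have K0 : 0 <= K by rewrite addr_ge0// mulr_ge0// ?(ltW c0)// addr_ge0.
(* Young's inequality absorbs the linear term into half of the quadratic one, whence the witnesses
   [c / 4] and [K^2 / c] below. *)
have am y : 0 <= y -> c / 4 * y ^+ 2 - K ^+ 2 / c <= c / 2 * y ^+ 2 - K * y.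
  move=> y0; rewrite -subr_ge0.
  rewrite (_ : _ - _ = (c * y / 2 - K) ^+ 2 / c); last by field; rewrite gt_eqF.
  by rewrite mulr_ge0 ?sqr_ge0// invr_ge0 ltW.
(* The shift by 1 makes the growth constant positive. *)
exists (CH + 1), (c / 4), (K ^+ 2 / c); split.
- exact: d1.
- exact: d2.
- exact: has_deriv_continuous d3.
- by rewrite ltr_wpDl.
- exact: H0.
- by move=> x; rewrite (le_trans (b0 x))// ler_wpM2r// ?lerDl// addr_ge0// sqr_ge0.
- by move=> x; rewrite (le_trans (b1 x))// ler_wpM2r// ?lerDl// addr_ge0.
- by move=> x; rewrite (le_trans (b2 x))// lerDl.
- by rewrite divr_gt0.
- move=> x; have [x_ge0|x_lt0] := leP 0 x.
    by rewrite (le_trans (am x x_ge0))//; have [] := HP x x_ge0.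
  have x1 : 0 <= - x by rewrite oppr_ge0 ltW.
  have [_ h] := HM _ x1; rewrite opprK in h.
  by rewrite -sqrrN; apply: le_trans (am _ x1) h.
- move=> x; have [x_ge0|x_lt0] := leP 0 x.
    have [h _] := HP x x_ge0; apply: le_trans (am x x_ge0) _.
    have h' : x * (c * x - K) <= x * (derive1 H) x by rewrite ler_wpM2l.
    have h'' : 0 <= c / 2 * x ^+ 2 by rewrite mulr_ge0 ?sqr_ge0// divr_ge0// ltW.
    apply: le_trans h'.
    by rewrite -subr_ge0 (_ : _ - _ = c / 2 * x ^+ 2)//; field.
  have x1 : 0 <= - x by rewrite oppr_ge0 ltW.
  have [h _] := HM _ x1; rewrite -sqrrN; apply: le_trans (am _ x1) _.
  rewrite opprK -/K in h.
  have h' : - x * (c * - x - K) <= - x * - (derive1 H) x by rewrite ler_wpM2l.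
  have h'' : 0 <= c / 2 * x ^+ 2 by rewrite mulr_ge0 ?sqr_ge0// divr_ge0// ltW.
  rewrite mulrNN in h'; apply: le_trans h'.
  by rewrite -subr_ge0 (_ : _ - _ = c / 2 * x ^+ 2)//; field.
Qed.

End confining_potential.

(** * Moments of the tilted Gibbs measures *)

Section gibbs_measures.
Context {R : realType}.
Notation mu := (@lebesgue_measure R).
Variables (H h1 h2 : R -> R) (CH al be : R).
Hypothesis cH : confining H h1 h2 CH al be.
Implicit Types (s S x : R) (f rho : R -> R).

Let al0 : 0 < al. Proof. exact: conf_al cH. Qed.
Let CH0 : 0 < CH. Proof. exact: conf_CH cH. Qed.

Definition boltz s x : R := expR (- H x + s * x).

Lemma boltz_gt0 s x : 0 < boltz s x.
Proof. exact: expR_gt0. Qed.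

Lemma conf_cH : continuous H.
Proof. exact: has_deriv_continuous (conf_d1 cH). Qed.

Lemma conf_ch1 : continuous h1.
Proof. exact: has_deriv_continuous (conf_d2 cH). Qed.

Lemma has_deriv_boltz s : has_deriv (boltz s) (fun x => - (h1 x - s) * boltz s x).
Proof.
have d : has_deriv (fun x => - H x + s * x) (fun x => - h1 x + s).
  apply: has_derivD; first exact: has_derivN (conf_d1 cH).
  by apply: (has_deriv_eq (has_derivZ s (@has_deriv_id R))) => x; rewrite mulr1.
apply: (has_deriv_eq (has_deriv_expR d)) => x; rewrite /boltz; ring.
Qed.

Lemma continuous_boltz s : continuous (boltz s).
Proof. exact: has_deriv_continuous (has_deriv_boltz s). Qed.

(** In [- H <= be - al x^2], a quarter of the coercivity is spent on the factor [exp (al x^2 / 4)];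
    the other three quarters absorb [S|x|] and a further [|x|], which leaves the tail
    [e^(-|x|) <= 4 ker 1 x]. Completing the square gives the exponent. *)
Definition boltz_cst S := 4 * expR (be + (1 + S) ^+ 2 / (3 * al)).

Lemma boltz_cst_gt0 S : 0 < boltz_cst S.
Proof. by rewrite mulr_gt0// expR_gt0. Qed.

Lemma boltz_le S s x : `|s| <= S ->
  expR (al / 4 * x ^+ 2) * boltz s x <= boltz_cst S * ker 1 x.
Proof.
move=> sS; have S0 : 0 <= S by exact: le_trans sS.
have kx := @ker_ge R 1 x ltr01; rewrite !mul1r in kx.
rewrite /boltz -expRD.
apply: (@le_trans _ _ (expR (be + (1 + S) ^+ 2 / (3 * al)) * expR (- `|x|))); last first.
  rewrite /boltz_cst -mulrA mulrCA ler_pM2l ?expR_gt0//.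
  lra.
rewrite -expRD ler_expR.
have hx := conf_H_ge cH x.
have sx : s * x <= S * `|x|.
  by rewrite (le_trans (ler_norm _))// normrM ler_wpM2r.
have sq : 0 <= (3 * al / 2 * `|x| - (1 + S)) ^+ 2 / (3 * al).
  by rewrite mulr_ge0 ?sqr_ge0// invr_ge0 mulr_ge0// ltW.
have e : (3 * al / 2 * `|x| - (1 + S)) ^+ 2 / (3 * al) =
   3 * al / 4 * x ^+ 2 - (1 + S) * `|x| + (1 + S) ^+ 2 / (3 * al).
  rewrite -(real_normK (num_real x)); by field; rewrite gt_eqF.
rewrite e in sq; lra.
Qed.

(* Functions of at most this growth are integrable against every Gibbs
   measure, uniformly for bounded tilts. *)
Definition subgauss f := exists c, forall x, `|f x| <= c * expR (al / 4 * x ^+ 2).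

Lemma quad_subgauss f c : (forall x, `|f x| <= c * (1 + x ^+ 2)) -> subgauss f.
Proof.
move=> fc; have c0 : 0 <= c.
  by have := le_trans (normr_ge0 _) (fc 0); rewrite expr0n /= addr0 mulr1.
exists (c * (1 + 4 / al)) => x; apply: le_trans (fc x) _.
rewrite -mulrA ler_wpM2l//.
have e1 := expR_ge1Dx (al / 4 * x ^+ 2).
have x2 : 0 <= al / 4 * x ^+ 2 by rewrite mulr_ge0 ?sqr_ge0// divr_ge0// ltW.
have e2 : x ^+ 2 <= 4 / al * expR (al / 4 * x ^+ 2).
  apply: (@le_trans _ _ (4 / al * (al / 4 * x ^+ 2))).
    rewrite le_eqVlt; apply/orP; left; apply/eqP; field; rewrite gt_eqF//.
  by rewrite ler_wpM2l// ?divr_ge0 ?(ltW al0)//; lra.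
lra.
Qed.

Lemma subgauss_boltz f : subgauss f -> exists c, 0 <= c /\
  forall S s x, `|s| <= S -> `|f x * boltz s x| <= c * boltz_cst S * ker 1 x.
Proof.
move=> [c fc]; have c0 : 0 <= c.
  by have := le_trans (normr_ge0 _) (fc 0); rewrite expr0n /= mulr0 expR0 mulr1.
exists c; split => // S s x sS.
rewrite normrM (gtr0_norm (boltz_gt0 _ _)).
apply: (@le_trans _ _ (c * (expR (al / 4 * x ^+ 2) * boltz s x))).
  by rewrite mulrA ler_wpM2r// ltW// boltz_gt0.
by rewrite -[leRHS]mulrA ler_wpM2l// boltz_le.
Qed.

Lemma integrable_boltz f s : measurable_fun setT f -> subgauss f ->
  mu.-integrable setT (EFin \o (fun x => f x * boltz s x)).
Proof.
move=> mf /subgauss_boltz[c [c0 fc]].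
apply: (integrable_le mu (g := fun x => c * boltz_cst `|s| * ker 1 x)) => //.
- apply: measurable_funM => //; apply: continuous_measurable => //; exact: continuous_boltz.
- by apply: (integrableZ mu) => //; exact: integrable_ker.
- by move=> x _; exact: fc.
Qed.

Lemma quad_integrable_boltz f c s : measurable_fun setT f ->
  (forall x, `|f x| <= c * (1 + x ^+ 2)) ->
  mu.-integrable setT (EFin \o (fun x => f x * boltz s x)).
Proof. by move=> mf /quad_subgauss; exact: integrable_boltz. Qed.

Lemma abs_le_quad x : `|x| <= 1 + x ^+ 2.
Proof.
rewrite -(real_normK (num_real x)); have := sqr_ge0 (`|x| - 1); have := sqr_ge0 `|x|.
by rewrite sqrrB; lra.
Qed.

Lemma ker1_cvg0 c (F : R -> R) : (forall x, `|F x| <= c * ker 1 x) ->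
  F n%:R @[n --> \oo] --> (0 : R) /\ F (- n%:R) @[n --> \oo] --> (0 : R).
Proof.
move=> Fc; have c0 : 0 <= c.
  by have := le_trans (normr_ge0 _) (Fc 0); rewrite pmulr_lge0// ker_gt0.
have kn (n : nat) : ker 1 n%:R <= expR (- n%:R) :> R.
  by have := @ker_le R 1 n%:R ltr01; rewrite !mul1r ger0_norm.
have lim0 : (fun n => c * expR (- n%:R)) @ \oo --> (0 : R).
  rewrite -[X in _ --> X](mulr0 c); apply: cvgMl_tmp; exact: cvgn_expR.
have lim0' : (fun n => - (c * expR (- n%:R))) @ \oo --> (0 : R).
  by rewrite -[X in _ --> X]oppr0; exact: cvgN.
split.
- apply: (squeeze_cvgr _ lim0' lim0); near=> n; rewrite -ler_norml.
  by apply: le_trans (Fc _) _; rewrite ler_wpM2l.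
- apply: (squeeze_cvgr _ lim0' lim0); near=> n; rewrite -ler_norml.
  by apply: le_trans (Fc _) _; rewrite ler_wpM2l// ker_even.
Unshelve. all: by end_near. Qed.

(** Integration by parts, the logarithmic derivative of [boltz s] being [- (h1 - s)]; the boundary
    terms vanish because a subgaussian function times the weight is dominated by [ker 1]. *)
Lemma gibbs_ibp (phi dphi : R -> R) s : has_deriv phi dphi -> continuous dphi ->
  subgauss phi -> subgauss dphi -> subgauss (fun x => phi x * (h1 x - s)) ->
  \int[mu]_x (phi x * (h1 x - s) * boltz s x) = \int[mu]_x (dphi x * boltz s x).
Proof.
move=> dp cdp gp gdp gph.
have cp := has_deriv_continuous dp.
have cph : continuous (fun x => phi x * (h1 x - s)).
  move=> x; apply: cvgM; first exact: cp.
  by apply: cvgB; [exact: conf_ch1|exact: cvg_cst].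
have i1 : mu.-integrable setT (EFin \o (fun x => dphi x * boltz s x)).
  by apply: integrable_boltz => //; exact: continuous_measurable.
have i2 : mu.-integrable setT (EFin \o (fun x => phi x * (h1 x - s) * boltz s x)).
  by apply: integrable_boltz => //; exact: continuous_measurable.
have d : has_deriv (fun x => phi x * boltz s x)
   (fun x => dphi x * boltz s x - phi x * (h1 x - s) * boltz s x).
  apply: (has_deriv_eq (has_derivM dp (has_deriv_boltz s))) => x; ring.
have [c [c0 bc]] := subgauss_boltz gp.
have [l1 l2] := ker1_cvg0 (fun x => bc `|s| s x (lexx _)).
have := FTC_line d _ (integrable_sub mu measurableT i1 i2) l1 l2.
rewrite RintegralB// subr0 => /(_ _)/eqP; rewrite subr_eq0 => H0.
apply/esym/eqP/H0 => x; apply: cvgB.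
  by apply: cvgM; [exact: cdp|exact: continuous_boltz].
by apply: cvgM; [exact: cph|exact: continuous_boltz].
Qed.

Lemma h1_quad x : `|h1 x| <= 2 * CH * (1 + x ^+ 2).
Proof.
apply: le_trans (conf_h1 cH x) _; rewrite (mulrC 2) -mulrA ler_pM2l//.
have := abs_le_quad x; have := sqr_ge0 x; lra.
Qed.

Lemma h1_sqr x : h1 x ^+ 2 <= 2 * CH ^+ 2 * (1 + x ^+ 2).
Proof.
rewrite -(real_normK (num_real (h1 x))).
apply: (@le_trans _ _ ((CH * (1 + `|x|)) ^+ 2)).
  have hb := conf_h1 cH x.
  by rewrite lerXn2r// nnegrE// (le_trans _ hb).
rewrite exprMn -(real_normK (num_real x)).
rewrite (_ : 2 * CH ^+ 2 * _ = CH ^+ 2 * (2 * (1 + `|x| ^+ 2))); last by ring.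
rewrite ler_wpM2l ?sqr_ge0//; have := sqr_ge0 (`|x| - 1); rewrite sqrrB sqrrD; lra.
Qed.

Lemma h1_sub_sqr s x : (h1 x - s) ^+ 2 <= (4 * CH ^+ 2 + 2 * s ^+ 2) * (1 + x ^+ 2).
Proof.
have := h1_sqr x; have := sqr_ge0 (h1 x + s); have := sqr_ge0 (s * x); have := sqr_ge0 x.
by rewrite sqrrB sqrrD exprMn; lra.
Qed.

(** Each of these three is the derivative in [s] of the preceding one, so that [gmean] and [gvar]
    below are the first two derivatives of [ln (Zf s)]. *)
Definition Zf s := \int[mu]_x boltz s x.
Definition N1 s := \int[mu]_x (x * boltz s x).
Definition N2 s := \int[mu]_x (x ^+ 2 * boltz s x).

Lemma subgauss1 : subgauss (fun=> 1).
Proof. by apply: (@quad_subgauss _ 1) => x; rewrite normr1 mul1r lerDl sqr_ge0. Qed.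

Lemma subgauss_id : subgauss (fun x => x).
Proof. by apply: (@quad_subgauss _ 1) => x; rewrite mul1r abs_le_quad. Qed.

Lemma subgauss_sqr : subgauss (fun x => x ^+ 2).
Proof.
by apply: (@quad_subgauss _ 1) => x; rewrite mul1r ger0_norm ?sqr_ge0// lerDr.
Qed.

Lemma measurable_sqr : measurable_fun setT (fun x : R => x ^+ 2).
Proof. exact: measurable_funX. Qed.

Lemma iZ s : mu.-integrable setT (EFin \o boltz s).
Proof.
have := @integrable_boltz (fun=> 1) s (measurable_cst _) subgauss1.
by apply: (integrable_ext mu) => // x _; rewrite mul1r.
Qed.

Lemma iN1 s : mu.-integrable setT (EFin \o (fun x => x * boltz s x)).
Proof. by apply: integrable_boltz => //; exact: subgauss_id. Qed.

Lemma iN2 s : mu.-integrable setT (EFin \o (fun x => x ^+ 2 * boltz s x)).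
Proof. by apply: integrable_boltz; [exact: measurable_sqr|exact: subgauss_sqr]. Qed.

(** The integral is restricted to [0, 1], where [H <= 2 CH]. *)
Lemma Zf_ge S s : `|s| <= S -> expR (- (2 * CH + S)) <= Zf s.
Proof.
move=> sS; have S0 : 0 <= S by exact: le_trans sS.
have <- : \int[mu]_(x in `[(0 : R), 1]) expR (- (2 * CH + S)) = expR (- (2 * CH + S)).
  by rewrite Rintegral_cst//= lebesgue_measure_itv /= lte_fin ltr01 oppr0 adde0 mulr1.
rewrite Rintegral_mkcond; apply: le_Rintegral => //; last first.
- move=> x _; rewrite patchE; case: ifPn => [|_]; last exact: expR_ge0.
  rewrite inE /= in_itv /= => /andP[x0 x1]; rewrite ler_expR.
  have x2 : x ^+ 2 <= 1 by rewrite expr_le1.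
  have hx := conf_le cH x.
  have : CH * (1 + x ^+ 2) <= CH * 2 by rewrite ler_wpM2l ?(ltW CH0)//; lra.
  have : - (s * x) <= S.
    rewrite -mulNr (le_trans (ler_norm _))// normrM normrN -[leRHS]mulr1.
    by rewrite ler_pM// ger0_norm.
  by move: hx; lra.
- exact: iZ.
- apply/(integrable_patch mu (measurable_itv _)).
  by apply: continuous_integrable_itv; exact: cst_continuous.
Qed.

Lemma Zf_gt0 s : 0 < Zf s.
Proof. by apply: lt_le_trans (Zf_ge (lexx `|s|)); exact: expR_gt0. Qed.

Lemma has_deriv_tilt (f : R -> R) : measurable_fun setT f -> subgauss f ->
  subgauss (fun x => x * f x) ->
  has_deriv (fun s => \int[mu]_x (f x * boltz s x))
            (fun s => \int[mu]_x (x * f x * boltz s x)).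
Proof.
move=> mf gf gxf; apply: has_deriv_integral.
- by move=> s; exact: integrable_boltz.
- move=> x.
  have d : has_deriv (fun s => - H x + s * x) (fun=> x).
    by apply: (has_deriv_ext _ _ (has_deriv_affine x (- H x))) => // s; rewrite addrC mulrC.
  apply: (has_deriv_eq (has_derivZ (f x) (has_deriv_expR d))) => s.
  by rewrite /boltz; ring.
- move=> a; have [c [c0 bc]] := subgauss_boltz gxf.
  exists (fun x => c * boltz_cst (`|a| + 1) * ker 1 x).
    by apply: (integrableZ mu) => //; exact: integrable_ker.
  move=> s x /andP[s1 s2]; apply: bc.
  have := ler_norm a; have := ler_norm (- a); rewrite normrN ler_norml; lra.
Qed.

Lemma has_deriv_Zf : has_deriv Zf N1.
Proof.
have h := @has_deriv_tilt (fun=> 1) (measurable_cst _) subgauss1 _.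
apply: (has_deriv_ext _ _ (h _)) => [s|s|].
- by apply: (Rintegral_ext mu) => x _; rewrite mul1r.
- by apply: (Rintegral_ext mu) => x _; rewrite mulr1.
- by rewrite (_ : (fun x => _) = (fun x => x)); [exact: subgauss_id|apply/funext => x; rewrite mulr1].
Qed.

Lemma has_deriv_N1 : has_deriv N1 N2.
Proof.
have e : (fun x : R => x * x) = (fun x => x ^+ 2) by apply/funext => x; rewrite expr2.
have h := @has_deriv_tilt (fun x => x) (@measurable_id _ _ _) subgauss_id _.
apply: (has_deriv_ext _ _ (h _)) => [s|s|] //; last by rewrite e; exact: subgauss_sqr.
Qed.

Definition gmean s := N1 s / Zf s.
Definition gvar s := N2 s / Zf s - gmean s ^+ 2.

Lemma has_deriv_gmean : has_deriv gmean gvar.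
Proof.
have Z0 s : Zf s != 0 by rewrite gt_eqF// Zf_gt0.
apply: (has_deriv_eq (has_derivM has_deriv_N1 (has_derivV Z0 has_deriv_Zf))) => s.
by rewrite /gvar /gmean; field.
Qed.

Lemma M1_gamma s : M1 (gamma H s) = gmean s.
Proof.
rewrite /M1 /gamma /gmean mulrC -RintegralZl//; last exact: iN1.
by apply: (Rintegral_ext mu) => x _; rewrite mulrCA.
Qed.

Lemma Var_gamma s : Var (gamma H s) = gvar s.
Proof.
rewrite /Var M1_gamma /gvar; congr (_ - _).
rewrite mulrC -RintegralZl//; last exact: iN2.
by apply: (Rintegral_ext mu) => x _; rewrite mulrCA.
Qed.

Lemma gibbs_h1 s : \int[mu]_x (h1 x * boltz s x) = s * Zf s.
Proof.
have gh : subgauss (fun x => 1 * (h1 x - s)).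
  apply: (@quad_subgauss _ (2 * CH + `|s|)) => x; rewrite mul1r.
  rewrite (le_trans (ler_normB _ _))//; have := h1_quad x.
  have := sqr_ge0 x; have : 0 <= `|s| * x ^+ 2 by rewrite mulr_ge0 ?sqr_ge0.
  lra.
have g0 : subgauss (fun=> 0) by exists 0 => x; rewrite normr0 mul0r.
have := @gibbs_ibp (fun=> 1) (fun=> 0) s (has_deriv_cst 1) (@cst_continuous _ _ 0)
  subgauss1 g0 gh.
have ih : mu.-integrable setT (EFin \o (fun x => h1 x * boltz s x)).
  apply: (@quad_integrable_boltz _ (2 * CH)); last exact: h1_quad.
  by apply: continuous_measurable => //; exact: conf_ch1.
rewrite [RHS](_ : _ = 0); last first.
  rewrite (Rintegral_ext mu (g := fun=> 0)); first by rewrite Rintegral_cst// mul0r.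
  by move=> x _; rewrite mul0r.
rewrite (Rintegral_ext mu (g := fun x => h1 x * boltz s x - s * boltz s x)); last first.
  by move=> x _; ring.
rewrite RintegralB//; last by apply: (integrableZ mu) => //; exact: iZ.
rewrite RintegralZl//; last exact: iZ.
by move/eqP; rewrite subr_eq0 => /eqP.
Qed.

(* Cramer-Rao: [x - mean] and [H' - s] have covariance 1, and [H' - s] has
   variance at most [sup H'']. *)
Lemma gvar_ge s : CH^-1 <= gvar s.
Proof.
have Z0 := Zf_gt0 s.
have gh : subgauss (fun x => h1 x - s).
  apply: (@quad_subgauss _ (2 * CH + `|s|)) => x.
  rewrite (le_trans (ler_normB _ _))//; have := h1_quad x.
  have := sqr_ge0 x; have : 0 <= `|s| * x ^+ 2 by rewrite mulr_ge0 ?sqr_ge0.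
  lra.
have gh2 : subgauss (fun x => (h1 x - s) * (h1 x - s)).
  apply: (@quad_subgauss _ (4 * CH ^+ 2 + 2 * s ^+ 2)) => x.
  by rewrite -expr2 ger0_norm ?sqr_ge0// h1_sub_sqr.
have gxh : subgauss (fun x => x * (h1 x - s)).
  apply: (@quad_subgauss _ (1 + (4 * CH ^+ 2 + 2 * s ^+ 2))) => x.
  rewrite normrM; have a2 := h1_sub_sqr s x.
  have := sqr_ge0 (`|x| - `|h1 x - s|); rewrite sqrrB !real_normK ?num_real//.
  have := sqr_ge0 (h1 x - s); have := sqr_ge0 x; lra.
have g2 : subgauss h2.
  apply: (@quad_subgauss _ CH) => x; rewrite (le_trans (conf_h2 cH x))//.
  by rewrite ler_peMr ?(ltW CH0)// lerDl sqr_ge0.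
have dh : has_deriv (fun x => h1 x - s) h2.
  by apply: (has_deriv_eq (has_derivB (conf_d2 cH) (has_deriv_cst s))) => x; rewrite subr0.
have E1 := gibbs_ibp (@has_deriv_id R) (@cst_continuous _ _ (1 : R)) subgauss_id subgauss1 gxh.
have E2 := gibbs_ibp dh (conf_c2 cH) gh g2 gh2.
have E0 := gibbs_h1 s.
have mh : measurable_fun setT (fun x => h1 x - s).
  by apply: measurable_funB => //; apply: continuous_measurable => //; exact: conf_ch1.
have ih0 := integrable_boltz s mh gh.
have ih2 := integrable_boltz s (measurable_funM mh mh) gh2.
have ixh := integrable_boltz s (measurable_funM (@measurable_id _ _ _) mh) gxh.
have I2 : \int[mu]_x (h2 x * boltz s x) <= CH * Zf s.
  rewrite -RintegralZl//; last exact: iZ.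
  apply: le_Rintegral => //.
  - apply: integrable_boltz => //; apply: continuous_measurable => //; exact: conf_c2 cH.
  - by apply: (integrableZ mu) => //; exact: iZ.
  - move=> x _; rewrite ler_wpM2r ?(ltW (boltz_gt0 _ _))//.
    by apply: le_trans (conf_h2 cH x); exact: ler_norm.
rewrite -E2 in I2.
have E1' : \int[mu]_x (x * (h1 x - s) * boltz s x) = Zf s.
  by rewrite E1; apply: (Rintegral_ext mu) => x _; rewrite mul1r.
have E0' : \int[mu]_x ((h1 x - s) * boltz s x) = 0.
  rewrite (Rintegral_ext mu (g := fun x => h1 x * boltz s x - s * boltz s x)); last first.
    by move=> x _; ring.
  rewrite RintegralB//; last 2 first.
  - apply: (@quad_integrable_boltz _ (2 * CH)); last exact: h1_quad.
    by apply: continuous_measurable => //; exact: conf_ch1.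
  - by apply: (integrableZ mu) => //; exact: iZ.
  by rewrite E0 RintegralZl ?subrr//; exact: iZ.
(* Expanding the mean of [((x - m) - t (H' - s))^2] gives [gvar s - 2 t + t^2 V], where the variance
   [V] of [H'] is at most [CH]; [t = 1/CH] optimizes the resulting bound. *)
set m := gmean s; set t := CH^-1.
have i1 := iN1 s; have i2 := iN2 s; have iz := iZ s.
have : 0 <= \int[mu]_x (((x - m) - t * (h1 x - s)) ^+ 2 * boltz s x).
  by apply: Rintegral_ge0 => x _; rewrite mulr_ge0 ?sqr_ge0// ltW// boltz_gt0.
rewrite (Rintegral_ext mu (g := fun x => (x ^+ 2 * boltz s x + (- 2 * m) * (x * boltz s x)
  + m ^+ 2 * boltz s x) + ((- 2 * t) * (x * (h1 x - s) * boltz s x)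
  + (2 * t * m) * ((h1 x - s) * boltz s x)
  + t ^+ 2 * ((h1 x - s) * (h1 x - s) * boltz s x)))); last by move=> x _; ring.
have Zc c f : mu.-integrable setT (EFin \o f) ->
  mu.-integrable setT (EFin \o (fun x => c * f x)) by exact: (integrableZ mu).
have Ad f g : mu.-integrable setT (EFin \o f) -> mu.-integrable setT (EFin \o g) ->
  mu.-integrable setT (EFin \o (fun x => f x + g x)) by exact: (integrable_add mu).
have J1 := Ad _ _ i2 (Zc (- 2 * m) _ i1).
have J2 := Ad _ _ J1 (Zc (m ^+ 2) _ iz).
have J3 := Ad _ _ (Zc (- 2 * t) _ ixh) (Zc (2 * t * m) _ ih0).
have J4 := Ad _ _ J3 (Zc (t ^+ 2) _ ih2).
rewrite (RintegralD _ J2 J4)// (RintegralD _ J1 (Zc _ _ iz))// (RintegralD _ i2 (Zc _ _ i1))//.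
rewrite (RintegralD _ J3 (Zc _ _ ih2))// (RintegralD _ (Zc _ _ ixh) (Zc _ _ ih0))//.
rewrite !RintegralZl// E1' E0' -/(N1 s) -/(N2 s) -/(Zf s).
set Q := Rintegral _ _ _ in I2 *.
move=> P.
have mE : N1 s = m * Zf s by rewrite /m /gmean mulfVK// gt_eqF.
have P2 : 0 <= (gvar s - 2 * t + t ^+ 2 * CH) * Zf s.
  have vE : gvar s * Zf s = N2 s - m ^+ 2 * Zf s.
    by rewrite /gvar mulrBl mulfVK// gt_eqF.
  rewrite mulrDl mulrBl vE; move: P; rewrite mE.
  have : t ^+ 2 * Q <= t ^+ 2 * (CH * Zf s) by rewrite ler_wpM2l ?sqr_ge0.
  lra.
rewrite pmulr_lge0// in P2.
have tC : t ^+ 2 * CH = t by rewrite /t; field; rewrite gt_eqF.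
move: P2; rewrite tC; lra.
Qed.

End gibbs_measures.

(** * Entropy inequalities *)

Section densities.
Context {R : realType}.
Notation mu := (@lebesgue_measure R).
Implicit Types (rho f : R -> R).

Lemma P2_measurable rho : P2 rho -> measurable_fun setT rho.
Proof. by case. Qed.

Lemma P2_ge0 rho x : P2 rho -> 0 <= rho x.
Proof. by case. Qed.

Lemma P2_integrable1 rho : P2 rho -> mu.-integrable setT (EFin \o rho).
Proof.
case=> m r0 I1 _; apply: (ge0_Rintegral_integrable mu) => //.
by rewrite I1 ltry.
Qed.

Lemma P2_mass rho : P2 rho -> \int[mu]_x rho x = 1.
Proof. by case=> m r0 I1 _; rewrite /Rintegral I1. Qed.

Lemma P2_integrable2 rho : P2 rho ->
  mu.-integrable setT (EFin \o (fun x => x ^+ 2 * rho x)).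
Proof.
case=> m r0 _ I2; apply: (ge0_Rintegral_integrable mu) => //.
  by apply: measurable_funM => //; exact: measurable_funX.
by move=> x _; rewrite mulr_ge0// sqr_ge0.
Qed.

Lemma P2_integrable rho f c : P2 rho -> measurable_fun setT f ->
  (forall x, `|f x| <= c * (1 + x ^+ 2)) ->
  mu.-integrable setT (EFin \o (fun x => f x * rho x)).
Proof.
move=> Pr mf fc; apply: (integrable_le mu (g := fun x => c * (rho x + x ^+ 2 * rho x))) => //.
- by apply: measurable_funM => //; exact: P2_measurable.
- apply: (integrableZ mu) => //; apply: (integrable_add mu) => //.
    exact: P2_integrable1.
  exact: P2_integrable2.
- move=> x _; have r0 := P2_ge0 x Pr.
  rewrite normrM (ger0_norm r0) (_ : c * _ = c * (1 + x ^+ 2) * rho x); last by ring.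
  by rewrite ler_wpM2r.
Qed.

Lemma P2_bounded_integrable rho f c : P2 rho -> measurable_fun setT f ->
  (forall x, `|f x| <= c) -> mu.-integrable setT (EFin \o (fun x => f x * rho x)).
Proof.
move=> Pr mf fc; apply: (@P2_integrable _ _ c) => // x.
apply: le_trans (fc x) _; rewrite ler_peMr ?lerDl ?sqr_ge0//.
exact: le_trans (fc 0).
Qed.

End densities.

Lemma sub_exchange (R : realDomainType) (a b c d : R) :
  a - b <= c - d -> d - b <= c - a.
Proof. lra. Qed.

(** The optimal exponent in the linear bound is [theta = a D / (2 B)], admissible when
    [a D^2 <= 4 B^2]. Otherwise [theta = 2 B / D] yields [B <= h], and then the quadratic bound
    gives [a D^2 <= 2 h]. *)
Lemma ckp_optimize (R : realFieldType) (a B D h : R) : 0 < a -> 0 < B ->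
  (forall theta, theta ^+ 2 <= a -> theta * D <= h + B / a * theta ^+ 2) ->
  a * D ^+ 2 <= h + B -> D ^+ 2 <= (4 * B / a + 2 / a) * h.
Proof.
move=> a0 B0 lin quad.
have a_n0 : a != 0 by rewrite gt_eqF.
have B_n0 : B != 0 by rewrite gt_eqF.
have h0 : 0 <= h by have := lin 0; rewrite expr0n /= mul0r mulr0 addr0; apply; exact: ltW.
have e : (4 * B / a + 2 / a) * h = (4 * B * h + 2 * h) / a by field.
rewrite e ler_pdivlMr// mulrC.
have Bh : 0 <= B * h by rewrite mulr_ge0// ltW.
have [small|big] := leP (a * D ^+ 2) (4 * B ^+ 2).
  have := lin (a * D / (2 * B)).
  have -> : (a * D / (2 * B)) ^+ 2 = a * (a * D ^+ 2) / (4 * B ^+ 2) by field.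
  have B4 : 0 < 4 * B ^+ 2 by rewrite mulr_gt0// exprn_gt0.
  rewrite ler_pdivrMr// ler_pM2l// => /(_ small).
  have -> : a * D / (2 * B) * D = (2 * (a * D ^+ 2)) / (4 * B) by field.
  have -> : B / a * (a * (a * D ^+ 2) / (4 * B ^+ 2)) = (a * D ^+ 2) / (4 * B).
    by field; rewrite B_n0.
  rewrite -lerBlDr -mulrBl ler_pdivrMr ?mulr_gt0// => le1.
  move: le1 Bh h0; set X := a * D ^+ 2; set Y := B * h.
  rewrite (_ : h * (4 * B) = 4 * Y); last by rewrite /Y; ring.
  rewrite (_ : 4 * B * h = 4 * Y); last by rewrite /Y; ring.
  clear; lra.
have D_n0 : D != 0.
  apply: contraTN big => /eqP ->; rewrite expr0n /= mulr0 -leNgt.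
  by rewrite mulr_ge0// sqr_ge0.
have D2 : 0 < D ^+ 2 by rewrite exprn_even_gt0.
have hB : B <= h.
  have := lin (2 * B / D).
  have -> : (2 * B / D) ^+ 2 = 4 * B ^+ 2 / D ^+ 2 by field.
  rewrite ler_pdivrMr// (ltW big) => /(_ isT).
  have -> : 2 * B / D * D = 2 * B by field.
  have le2 : B / a * (4 * B ^+ 2 / D ^+ 2) <= B.
    rewrite (_ : _ * _ = B * ((4 * B ^+ 2) / (a * D ^+ 2))); last by field; rewrite ?a_n0 ?D_n0.
    have aD : 0 < a * D ^+ 2 by rewrite mulr_gt0.
    have q1 : 4 * B ^+ 2 / (a * D ^+ 2) <= 1 by rewrite ler_pdivrMr// mul1r ltW.
    by rewrite ler_piMr// ltW.
  move: le2; clear; lra.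
move: quad hB Bh h0; set X := a * D ^+ 2.
rewrite (_ : 4 * B * h = 4 * (B * h)); last by ring.
clear; lra.
Qed.

(** * Tilt as a function of the mean, and relative entropy *)

Section gibbs_tilt.
Context {R : realType}.
Notation mu := (@lebesgue_measure R).
Variables (H h1 h2 : R -> R) (CH al be : R).
Hypothesis cH : confining H h1 h2 CH al be.
Implicit Types (s S x l : R) (f rho : R -> R).

Let CH0 : 0 < CH. Proof. exact: conf_CH cH. Qed.
Let al0 : 0 < al. Proof. exact: conf_al cH. Qed.

Notation gmean := (gmean H).
Notation gvar := (gvar H).
Notation Zf := (Zf H).

Lemma mean_incr c a b : (forall s, c <= gvar s) -> a <= b ->
  c * (b - a) <= gmean b - gmean a.
Proof.
move=> hc ab; have [y _ ->] := mean_value (has_deriv_gmean cH) ab.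
by rewrite ler_wpM2r// subr_ge0.
Qed.

Lemma mean_expand c a b : (forall s, c <= gvar s) ->
  c * `|b - a| <= `|gmean b - gmean a|.
Proof.
move=> hc; wlog ab : a b / a <= b => [wl|].
  have [/wl//|/ltW/wl] := leP a b; by rewrite distrC (distrC (gmean a)).
by rewrite (ger0_norm (_ : 0 <= b - a)) ?subr_ge0// (le_trans (mean_incr hc ab))// ler_norm.
Qed.

(** The mean increases at rate at least [1/CH], so that it passes through [l] between [- T] and
    [T]. *)
Lemma mean_surj l : exists s, gmean s = l.
Proof.
set T := CH * (`|l| + `|gmean 0|).
have T0 : 0 <= T by rewrite mulr_ge0 ?addr_ge0// ltW.
have TC : CH^-1 * T = `|l| + `|gmean 0| by rewrite /T mulKf// gt_eqF.
have v := gvar_ge cH.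
have up : CH^-1 * (T - 0) <= gmean T - gmean 0 by apply: mean_incr.
have lo : CH^-1 * (0 - - T) <= gmean 0 - gmean (- T) by apply: mean_incr; rewrite ?oppr_le0.
rewrite subr0 TC in up; rewrite sub0r opprK TC in lo.
have l1 := ler_norm l; have l2 := ler_norm (- l); rewrite normrN in l2.
have m1 := ler_norm (gmean 0); have m2 := ler_norm (- gmean 0); rewrite normrN in m2.
have TT : - T <= T by rewrite (le_trans _ T0)// oppr_le0.
have [|c _ <-] := IVT (v := l) TT
   (continuous_subspaceT (has_deriv_continuous (has_deriv_gmean cH))); last by exists c.
rewrite ge_min le_max; apply/andP; split; apply/orP; [left|right].
  clear v up TC TT T0 l1 m2; clearbody T; lra.
clear v lo TC TT T0 l2 m1; clearbody T; lra.
Qed.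

Lemma mean_lambda l : gmean (lambda H l) = l.
Proof.
rewrite -(M1_gamma cH) /lambda.
have [s sl] := mean_surj l.
have := @xgetPex _ 0 [set s | M1 (gamma H s) = l].
by apply; exists s => /=; rewrite (M1_gamma cH).
Qed.

Lemma lambda_bounded l : `|lambda H l| <= CH * (`|l| + `|gmean 0|).
Proof.
have := mean_expand 0 (lambda H l) (gvar_ge cH).
rewrite subr0 mean_lambda -ler_pdivlMl ?invr_gt0// invrK => h.
by apply: le_trans h _; rewrite ler_pM2l// ler_normB.
Qed.

Lemma cVar_gt0 : 0 < cVar H.
Proof.
apply: lt_le_trans (_ : CH^-1 <= _); first by rewrite invr_gt0.
apply: lb_le_inf; first by exists (Var (gamma H 0)); exists 0.
by move=> _ [s _ <-]; rewrite (Var_gamma cH) (gvar_ge cH).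
Qed.

Lemma cVar_le s : cVar H <= gvar s.
Proof.
apply: ge_inf; last by exists s => //; rewrite (Var_gamma cH).
by exists 0 => _ [r _ <-]; rewrite (Var_gamma cH) (le_trans _ (gvar_ge cH r))// invr_ge0 ltW.
Qed.

Lemma lambda_lipschitz l l' : `|lambda H l - lambda H l'| <= `|l - l'| / cVar H.
Proof.
have := mean_expand (lambda H l') (lambda H l) cVar_le.
by rewrite !mean_lambda ler_pdivlMr ?cVar_gt0// mulrC.
Qed.

(** [ln Zf] is convex because its derivative [gmean] is nondecreasing; the sign of [r - s] decides
    on which side of the point of tangency to integrate. *)
Lemma lnZ_tangent s r : gmean s * (r - s) <= ln (Zf r) - ln (Zf s).
Proof.
have d : has_deriv (fun x => ln (Zf x) - gmean s * x) (fun x => gmean x - gmean s).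
  apply: (has_derivB (has_deriv_ln (Zf_gt0 cH) (has_deriv_Zf cH))).
  by apply: (has_deriv_eq (has_derivZ (gmean s) (@has_deriv_id R))) => x; rewrite mulr1.
have v0 x : 0 <= gvar x.
  by apply: le_trans (gvar_ge cH x); rewrite invr_ge0 ltW.
have mono a b : a <= b -> gmean a <= gmean b.
  by move=> ab; have := mean_incr v0 ab; rewrite mul0r subr_ge0.
have [sr|rs] := leP s r.
  have := has_deriv_le d sr (fun x => _).
  have /[swap] /[apply] : forall x, s <= x <= r -> 0 <= gmean x - gmean s.
    by move=> x /andP[sx _]; rewrite subr_ge0 mono.
  by rewrite mulrBr; exact: sub_exchange.
have dN : has_deriv (fun x => - (ln (Zf x) - gmean s * x)) (fun x => - (gmean x - gmean s)).
  exact: has_derivN.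
have := has_deriv_le dN (ltW rs) (fun x => _).
have /[swap] /[apply] : forall x, r <= x <= s -> 0 <= - (gmean x - gmean s).
  by move=> x /andP[_ sx]; rewrite oppr_ge0 subr_le0 mono.
by rewrite lerN2 mulrBr; exact: sub_exchange.
Qed.

Lemma gammaE s x : gamma H s x = boltz H s x / Zf s.
Proof. by rewrite /gamma mulrC. Qed.

Lemma gamma_gt0 s x : 0 < gamma H s x.
Proof. by rewrite gammaE divr_gt0// ?(Zf_gt0 cH)// boltz_gt0. Qed.

Lemma continuous_gamma s : continuous (gamma H s).
Proof.
move=> x; rewrite [gamma H s](_ : _ = fun x => boltz H s x * (Zf s)^-1).
  by apply: cvgMr_tmp; exact: continuous_boltz cH s x.
by apply/funext => y; exact: gammaE.
Qed.

Lemma ln_gamma s x : ln (gamma H s x) = - H x + s * x - ln (Zf s).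
Proof. by rewrite gammaE ln_div ?posrE ?boltz_gt0 ?(Zf_gt0 cH)// /boltz expRK. Qed.

(* Legendre duality [u * x <= x * ln x - x + e^u] at [x = r / g] *)
Lemma entropy_young (r g u : R) : 0 <= r -> 0 < g ->
  u * r + r - g * expR u <= r * ln (r / g).
Proof.
rewrite le_eqVlt => /predU1P[<-|r0] g0.
  by rewrite !mul0r mulr0 add0r subr_le0 mulr_ge0 ?expR_ge0// ltW.
have rg : 0 < r / g by rewrite divr_gt0.
have := expR_ge1Dx (u - ln (r / g)).
rewrite expRB lnK ?posrE// => h.
have : r * (1 + (u - ln (r / g))) <= r * (expR u / (r / g)) by rewrite ler_wpM2l// ltW.
rewrite (_ : r * (expR u / _) = g * expR u); last by field; rewrite !gt_eqF.
lra.
Qed.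

Lemma measurable_entropy_density rho s : measurable_fun setT rho ->
  measurable_fun setT (fun x => rho x * ln (rho x / gamma H s x)).
Proof.
move=> mr; apply: measurable_funM => //; apply: measurableT_comp; first exact: measurable_ln.
apply: measurable_funM => //; apply: continuous_measurable => // x.
by apply: cvgV; [rewrite gt_eqF// gamma_gt0|exact: continuous_gamma].
Qed.

Lemma gamma_integrable s : mu.-integrable setT (EFin \o gamma H s).
Proof.
have := integrableZ mu (Zf s)^-1 measurableT (iZ cH s).
by apply: (integrable_ext mu) => // x _; rewrite gammaE mulrC.
Qed.

Lemma gamma_mass s : \int[mu]_x gamma H s x = 1.
Proof.
have <- : (Zf s)^-1 * Zf s = 1 by rewrite mulVf// gt_eqF// (Zf_gt0 cH).
by rewrite -RintegralZl//; exact: iZ cH s.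
Qed.

(** [entropy_young] with exponent 0 provides the integrable minorant [rho - gamma], so that an
    entropy other than [+oo] is an absolutely convergent integral. *)
Lemma relative_entropy_integrable rho s : P2 rho ->
  (relative_entropy rho (gamma H s) < +oo)%E ->
  mu.-integrable setT (EFin \o (fun x => rho x * ln (rho x / gamma H s x))).
Proof.
move=> Pr; apply: (integrable_minorant mu) => //.
- by apply: measurable_entropy_density; exact: P2_measurable.
- apply: (integrable_sub mu) => //; [exact: P2_integrable1 Pr|exact: (gamma_integrable s)].
- move=> x _; have := @entropy_young (rho x) (gamma H s x) 0 (P2_ge0 x Pr) (gamma_gt0 s x).
  by rewrite mul0r add0r expR0 mulr1.
Qed.

(** The Donsker-Varadhan inequality with [ln z] weakened to [z - 1]: in this linear form it is the
    integral of a pointwise inequality. *)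
Lemma entropy_ineq rho s (u : R -> R) (h : R) : P2 rho ->
  relative_entropy rho (gamma H s) = h%:E ->
  mu.-integrable setT (EFin \o (fun x => u x * rho x)) ->
  mu.-integrable setT (EFin \o (fun x => gamma H s x * expR (u x))) ->
  \int[mu]_x (u x * rho x) + 1 - \int[mu]_x (gamma H s x * expR (u x)) <= h.
Proof.
move=> Pr hE iu ie.
have ir := P2_integrable1 Pr.
have il : mu.-integrable setT (EFin \o (fun x => rho x * ln (rho x / gamma H s x))).
  by apply: relative_entropy_integrable; rewrite // hE ltry.
have -> : h = \int[mu]_x (rho x * ln (rho x / gamma H s x)).
  by have := EFin_Rintegral mu measurableT il; rewrite -/(relative_entropy rho (gamma H s)) hE => -[].
rewrite -(P2_mass Pr).
have i1 := integrable_add mu measurableT iu ir.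
rewrite -RintegralD// -RintegralB//; apply: le_Rintegral => //.
- exact: (integrable_sub mu).
- by move=> x _; apply: entropy_young; [exact: P2_ge0|exact: gamma_gt0].
Qed.

Lemma relative_entropy_ge0 rho s : P2 rho -> (0 <= relative_entropy rho (gamma H s))%E.
Proof.
move=> Pr; have [|lt] := leP +oo%E (relative_entropy rho (gamma H s)).
  by rewrite leye_eq => /eqP ->.
have il := relative_entropy_integrable Pr lt.
have E := EFin_Rintegral mu measurableT il.
have := @entropy_ineq rho s (fun=> 0) _ Pr (esym E).
have iu : mu.-integrable setT (EFin \o (fun x => 0 * rho x)).
  by apply: (integrableZ mu) => //; exact: P2_integrable1.
have ie : mu.-integrable setT (EFin \o (fun x => gamma H s x * expR 0)).
  apply: (integrable_ext mu (f := gamma H s)) => //; last exact: gamma_integrable.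
  by move=> x _; rewrite expR0 mulr1.
move=> /(_ iu ie).
rewrite (Rintegral_ext mu (g := fun=> 0)); last by move=> x _; rewrite mul0r.
rewrite [X in _ - X](Rintegral_ext mu (g := gamma H s)); last first.
  by move=> x _; rewrite expR0 mulr1.
rewrite gamma_mass Rintegral_cst// mul0r add0r subrr => h.
by rewrite /relative_entropy -E lee_fin.
Qed.

(** Since [(H' - s)^2 <= 4 CH^2 (1 + x^2) + 2 s^2], this exponent turns the quadratic part into
    exactly [al x^2 / 4], the growth that [boltz_le] tolerates. *)
Definition expmom := al / (16 * CH ^+ 2).

Lemma expmom_gt0 : 0 < expmom.
Proof. by rewrite divr_gt0// mulr_gt0// exprn_gt0. Qed.

(** The three factors are the constant part of the exponent, the bound of [boltz_le] and the bound
    on [1 / Zf]. *)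
Definition expmom_bound S :=
  expR (expmom * (4 * CH ^+ 2 + 2 * S ^+ 2)) * boltz_cst al be S * expR (2 * CH + S).

Lemma expmom_bound_gt0 S : 0 < expmom_bound S.
Proof. by rewrite !mulr_gt0// ?boltz_cst_gt0// expR_gt0. Qed.

Lemma h1_expmom S s x : `|s| <= S ->
  gamma H s x * expR (expmom * (h1 x - s) ^+ 2) <= expmom_bound S * ker 1 x.
Proof.
move=> sS; have S0 : 0 <= S by exact: le_trans sS.
have a0 := expmom_gt0.
have e1 : expmom * (h1 x - s) ^+ 2 <= expmom * (4 * CH ^+ 2 + 2 * S ^+ 2) + al / 4 * x ^+ 2.
  have -> : al / 4 * x ^+ 2 = expmom * (4 * CH ^+ 2 * x ^+ 2).
    by rewrite /expmom; field; rewrite gt_eqF.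
  rewrite -mulrDr ler_pM2l//.
  have hh := h1_sqr cH x; have sq := sqr_ge0 (h1 x + s); rewrite sqrrD in sq; rewrite sqrrB.
  have s2 : s ^+ 2 <= S ^+ 2 by rewrite -(real_normK (num_real s)) lerXn2r// nnegrE.
  lra.
have z := Zf_ge cH sS; have zi : (Zf s)^-1 <= expR (2 * CH + S).
  rewrite -[leRHS]invrK lef_pV2 ?posrE ?invr_gt0 ?expR_gt0 ?(Zf_gt0 cH)//.
  by rewrite -expRN.
rewrite gammaE.
apply: (@le_trans _ _ (expR (expmom * (4 * CH ^+ 2 + 2 * S ^+ 2)) *
   (expR (al / 4 * x ^+ 2) * boltz H s x) * (Zf s)^-1)).
  rewrite [leLHS](_ : _ = expR (expmom * (h1 x - s) ^+ 2) *
    (boltz H s x / Zf s)); last by ring.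
  rewrite [leRHS](_ : _ = expR (expmom * (4 * CH ^+ 2 + 2 * S ^+ 2) + al / 4 * x ^+ 2) *
    (boltz H s x / Zf s)); last by rewrite expRD; ring.
  by rewrite ler_wpM2r ?ler_expR// divr_ge0 ?(ltW (boltz_gt0 _ _ _))// ltW// (Zf_gt0 cH).
rewrite (_ : expmom_bound S * ker 1 x = expR (expmom * (4 * CH ^+ 2 + 2 * S ^+ 2)) *
   (boltz_cst al be S * ker 1 x) * expR (2 * CH + S)); last by rewrite /expmom_bound; ring.
apply: ler_pM => //.
- by rewrite !mulr_ge0 ?expR_ge0// ltW// boltz_gt0.
- by rewrite invr_ge0 ltW// (Zf_gt0 cH).
- by rewrite ler_wpM2l ?expR_ge0// (boltz_le cH).
Qed.

Lemma measurable_h1 : measurable_fun setT h1.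
Proof. by apply: continuous_measurable => //; exact: conf_ch1 cH. Qed.

Lemma expmom_integrable S s : `|s| <= S ->
  mu.-integrable setT (EFin \o (fun x => gamma H s x * expR (expmom * (h1 x - s) ^+ 2))) /\
  \int[mu]_x (gamma H s x * expR (expmom * (h1 x - s) ^+ 2)) <= expmom_bound S.
Proof.
move=> sS.
have ik : mu.-integrable setT (EFin \o (fun x => expmom_bound S * ker 1 x)).
  by apply: (integrableZ mu) => //; exact: integrable_ker.
have i1 : mu.-integrable setT
    (EFin \o (fun x => gamma H s x * expR (expmom * (h1 x - s) ^+ 2))).
  apply: (integrable_le mu _ _ ik) => //.
    apply: measurable_funM; first by apply: continuous_measurable => //; exact: continuous_gamma.
    apply: measurableT_comp => //; apply: measurable_funM => //; apply: measurable_funX.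
    by apply: measurable_funB => //; exact: measurable_h1.
  move=> x _; rewrite ger0_norm; first exact: h1_expmom.
  by rewrite mulr_ge0 ?expR_ge0// ltW// gamma_gt0.
split => //; apply: le_trans (le_Rintegral measurableT i1 ik _) _.
  by move=> x _; exact: h1_expmom.
rewrite RintegralZl//; last exact: integrable_ker.
have [_] := @ker_mass R 1 0 ltr01.
rewrite (Rintegral_ext mu (g := ker 1)); last by move=> x _; rewrite subr0.
by move=> ->; rewrite mulr1.
Qed.

Lemma integrable_h1 rho : P2 rho -> mu.-integrable setT (EFin \o (fun x => h1 x * rho x)).
Proof. by move=> Pr; apply: (P2_integrable Pr measurable_h1); exact: h1_quad cH. Qed.

(** The difference of the two sides is convex and vanishes with its derivative at 0. Against a
    centered variable the linear term integrates to 0, which leaves a correction of second order. *)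
Lemma exp_le_id_sqr (v : R) : expR v <= v + expR (v ^+ 2).
Proof.
have dsq := has_deriv_expR (@has_deriv_sqr R).
have de : has_deriv (@expR R) expR by exact: is_derive_expR.
have g : has_deriv (fun x => x + expR (x ^+ 2) - expR x)
    (fun x => 1 + 2 * x * expR (x ^+ 2) - expR x).
  exact: (has_derivB (has_derivD (@has_deriv_id R) dsq)).
have g' : has_deriv (fun x => 1 + 2 * x * expR (x ^+ 2) - expR x)
    (fun x => 2 * expR (x ^+ 2) + 4 * x ^+ 2 * expR (x ^+ 2) - expR x).
  apply: has_derivB => //.
  have d2 := has_derivM (has_derivZ 2 (@has_deriv_id R)) dsq.
  by apply: (has_deriv_eq (has_derivD (has_deriv_cst 1) d2)) => x; ring.
have g''0 (x : R) : 0 <= 2 * expR (x ^+ 2) + 4 * x ^+ 2 * expR (x ^+ 2) - expR x.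
  have e1 := expR_ge1Dx (x ^+ 2 - x).
  have e2 : 1 / 2 <= expR (x ^+ 2 - x).
    by have := sqr_ge0 (x - 2^-1); rewrite sqrrB; lra.
  have e3 : expR (x ^+ 2) = expR (x ^+ 2 - x) * expR x by rewrite -expRD subrK.
  have e4 : 1 / 2 * expR x <= expR (x ^+ 2) by rewrite e3 ler_wpM2r// expR_ge0.
  have : 0 <= x ^+ 2 * expR (x ^+ 2) by rewrite mulr_ge0 ?expR_ge0// sqr_ge0.
  lra.
have g'm (x y : R) : x <= y -> 1 + 2 * x * expR (x ^+ 2) - expR x <=
    1 + 2 * y * expR (y ^+ 2) - expR y.
  by move=> xy; apply: (has_deriv_le g' xy) => z _; exact: g''0.
have f0 : 0 + expR (0 ^+ 2) - expR 0 = 0 :> R by rewrite expr0n /= expR0; lra.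
have f'0 : 1 + 2 * 0 * expR (0 ^+ 2) - expR 0 = 0 :> R by rewrite expR0; lra.
rewrite -subr_ge0.
have [v0|v0] := leP 0 v.
  rewrite -[leLHS]f0; apply: (has_deriv_le g v0) => x /andP[x0 _].
  by rewrite -[leLHS]f'0 g'm.
rewrite -[leLHS]f0 -lerN2; apply: (has_deriv_le (has_derivN g) (ltW v0)) => x /andP[_ x0].
by rewrite oppr_ge0 -[leRHS]f'0 g'm.
Qed.

(** Convexity of the exponential between 0 and [b]; a small fraction [p] of an exponent thus costs
    only the fraction [p] of the excess over 1. *)
Lemma exp_sub1_scale (p b : R) : 0 <= p <= 1 -> expR (p * b) - 1 <= p * (expR b - 1).
Proof.
move=> /andP[p0 p1].
have A := expR_ge1Dx (b - p * b); have B := expR_ge1Dx (- (p * b)).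
rewrite expRD expRN in A; rewrite expRN in B.
have E0 := expR_gt0 (p * b); have Ei : 0 < (expR (p * b))^-1 by rewrite invr_gt0.
have EE : expR (p * b) * (expR (p * b))^-1 = 1 by rewrite mulfV// gt_eqF.
have A' : expR (p * b) * (1 + (b - p * b)) <= expR b.
  rewrite (_ : expR b = expR (p * b) * (expR b / expR (p * b))).
    by rewrite ler_pM2l.
  by rewrite mulrCA EE mulr1.
have B' : expR (p * b) * (1 - p * b) <= 1 by rewrite -[leRHS]EE ler_pM2l.
have : p * (expR (p * b) * (1 + (b - p * b))) <= p * expR b by rewrite ler_wpM2l.
have : (1 - p) * (expR (p * b) * (1 - p * b)) <= (1 - p) * 1 by rewrite ler_wpM2l// subr_ge0.
lra.
Qed.

Definition ckp_cst S := 4 * expmom_bound S / expmom + 2 / expmom.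

Lemma ckp_cst_gt0 S : 0 < ckp_cst S.
Proof.
have a0 := expmom_gt0; have B0 := expmom_bound_gt0 S.
by rewrite /ckp_cst addr_gt0// divr_gt0// mulr_gt0.
Qed.

(* Weighted Csiszar-Kullback-Pinsker inequality, from the entropy inequality
   with exponents [theta * (H' - s)] and [expmom * (H' - s)^2]. *)
Lemma ckp S s rho : `|s| <= S -> P2 rho ->
  (((\int[mu]_x (h1 x * rho x) - s) ^+ 2)%:E <=
     (ckp_cst S)%:E * relative_entropy rho (gamma H s))%E.
Proof.
move=> sS Pr.
have [|lt] := leP +oo%E (relative_entropy rho (gamma H s)).
  by rewrite leye_eq => /eqP ->; rewrite gt0_muley ?leey// lte_fin ckp_cst_gt0.
have Eh := EFin_Rintegral mu measurableT (relative_entropy_integrable Pr lt).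
move: Eh; rewrite -/(relative_entropy rho (gamma H s)); set h := Rintegral _ _ _ => Eh.
rewrite -Eh -EFinM lee_fin.
set a := expmom; set B := expmom_bound S.
have a0 : 0 < a := expmom_gt0; have B0 : 0 < B := expmom_bound_gt0 S.
have ir := P2_integrable1 Pr; have ih := integrable_h1 Pr.
have [ie IB] := expmom_integrable sS; rewrite -/a -/B in ie IB.
have ig := gamma_integrable s.
set D := _ - s.
have mY : measurable_fun setT (fun x => h1 x - s) by apply: measurable_funB => //; exact: measurable_h1.
have iY : mu.-integrable setT (EFin \o (fun x => (h1 x - s) * rho x)).
  apply: (integrable_ext mu (f := fun x => h1 x * rho x - s * rho x)) => //.
    by move=> x _; ring.
  by apply: (integrable_sub mu) => //; exact: (integrableZ mu).
have DE : D = \int[mu]_x ((h1 x - s) * rho x).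
  rewrite /D -[X in _ - X]mulr1 -(P2_mass Pr) -RintegralZl// -RintegralB//.
    by apply: (Rintegral_ext mu) => x _; ring.
  exact: (integrableZ mu).
have iY2 : mu.-integrable setT (EFin \o (fun x => (h1 x - s) ^+ 2 * rho x)).
  apply: (@P2_integrable _ _ _ (4 * CH ^+ 2 + 2 * s ^+ 2)) => //.
    exact: measurable_funX.
  by move=> x; rewrite ger0_norm ?sqr_ge0// (h1_sub_sqr cH).
have iYg : mu.-integrable setT (EFin \o (fun x => (h1 x - s) * gamma H s x)).
  apply: (integrable_ext mu (f := fun x => (Zf s)^-1 * ((h1 x - s) * boltz H s x))) => //.
    by move=> x _; rewrite gammaE; ring.
  apply: (integrableZ mu) => //; apply: (integrable_boltz cH) => //.
  apply: (@quad_subgauss _ _ _ _ _ _ _ cH _ (2 * CH + `|s|)) => x.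
  rewrite (le_trans (ler_normB _ _))// mulrDl lerD ?(h1_quad cH)//.
  by rewrite ler_peMr// lerDl sqr_ge0.
have Yg0 : \int[mu]_x ((h1 x - s) * gamma H s x) = 0.
  have ihb : mu.-integrable setT (EFin \o (fun x => h1 x * boltz H s x)).
    by apply: (quad_integrable_boltz cH s measurable_h1); exact: h1_quad cH.
  have izs := integrableZ mu s measurableT (iZ cH s).
  rewrite (Rintegral_ext mu (g := fun x => (Zf s)^-1 * (h1 x * boltz H s x - s * boltz H s x))).
    rewrite RintegralZl//; last exact: (integrable_sub mu).
    by rewrite RintegralB// (gibbs_h1 cH) RintegralZl ?subrr ?mulr0//; exact: iZ cH s.
  by move=> x _; rewrite gammaE; ring.
have ent u := @entropy_ineq rho s u h Pr (esym Eh).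
have linear theta : theta ^+ 2 <= a -> theta * D <= h + B / a * theta ^+ 2.
  move=> ta; have ta0 : 0 <= theta ^+ 2 / a by rewrite divr_ge0 ?sqr_ge0// ltW.
  have mth : measurable_fun setT (fun x => expR (theta * (h1 x - s))).
    by apply: measurableT_comp => //; apply: measurable_funM.
  (* [exp_le_id_sqr] at [theta (H' - s)], whose square is [theta^2 / a] times [a (H' - s)^2]; the
     restriction [theta^2 <= a] makes this fraction admissible for [exp_sub1_scale]. *)
  have bnd x : expR (theta * (h1 x - s)) <=
      theta * (h1 x - s) + (1 + theta ^+ 2 / a * (expR (a * (h1 x - s) ^+ 2) - 1)).
    apply: le_trans (exp_le_id_sqr _) _; rewrite lerD2l.
    have := @exp_sub1_scale (theta ^+ 2 / a) (a * (h1 x - s) ^+ 2).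
    rewrite divr_ge0 ?sqr_ge0 ?(ltW a0)// ler_pdivrMr// mul1r ta => /(_ isT).
    rewrite (_ : _ * (a * _) = (theta * (h1 x - s)) ^+ 2); first by lra.
    by field; rewrite gt_eqF.
  have iub : mu.-integrable setT (EFin \o (fun x => theta * ((h1 x - s) * gamma H s x) +
      (gamma H s x + theta ^+ 2 / a * (gamma H s x * expR (a * (h1 x - s) ^+ 2) - gamma H s x)))).
    apply: (integrable_add mu) => //.
      exact: (integrableZ mu).
    apply: (integrable_add mu) => //; apply: (integrableZ mu) => //.
    exact: (integrable_sub mu).
  have ieu : mu.-integrable setT (EFin \o (fun x => gamma H s x * expR (theta * (h1 x - s)))).
    apply: (integrable_le mu _ _ iub) => //.
      by apply: measurable_funM => //; apply: continuous_measurable => //; exact: continuous_gamma.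
    move=> x _; have g0 := gamma_gt0 s x; rewrite ger0_norm; last first.
      by rewrite mulr_ge0 ?expR_ge0// ltW.
    rewrite [leRHS](_ : _ = gamma H s x * (theta * (h1 x - s) +
      (1 + theta ^+ 2 / a * (expR (a * (h1 x - s) ^+ 2) - 1)))); last by ring.
    by rewrite ler_pM2l.
  have iu : mu.-integrable setT (EFin \o (fun x => theta * (h1 x - s) * rho x)).
    apply: (integrable_ext mu (f := fun x => theta * ((h1 x - s) * rho x))) => //.
      by move=> x _; ring.
    exact: (integrableZ mu).
  have := ent _ iu ieu.
  rewrite (Rintegral_ext mu (g := fun x => theta * ((h1 x - s) * rho x))); last first.
    by move=> x _; ring.
  rewrite RintegralZl// -DE => L.
  have U : \int[mu]_x (gamma H s x * expR (theta * (h1 x - s))) <= 1 + B / a * theta ^+ 2.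
    apply: (@le_trans _ _ (1 + theta ^+ 2 / a * (B - 1))); last first.
      rewrite lerD2l (_ : B / a * theta ^+ 2 = theta ^+ 2 / a * B); last by ring.
      by apply: ler_wpM2l => //; rewrite lerBlDr lerDl.
    apply: le_trans (le_Rintegral measurableT ieu iub _) _.
      move=> x _; rewrite [leRHS](_ : _ = gamma H s x * (theta * (h1 x - s) +
        (1 + theta ^+ 2 / a * (expR (a * (h1 x - s) ^+ 2) - 1)))); last by ring.
      by rewrite ler_pM2l ?gamma_gt0.
    have j1 := integrable_sub mu measurableT ie ig.
    have j2 := integrableZ mu (theta ^+ 2 / a) measurableT j1.
    rewrite (RintegralD _ (integrableZ mu theta measurableT iYg) (integrable_add mu measurableT ig j2))//.
    rewrite (RintegralD _ ig j2)//.
    rewrite (RintegralZl theta _ iYg)// (RintegralZl (theta ^+ 2 / a) _ j1)//.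
    rewrite (RintegralB _ ie ig)// Yg0 mulr0 add0r gamma_mass.
    by rewrite lerD2l; apply: ler_wpM2l => //; rewrite lerD2r.
  rewrite lerBlDr in L; move: (le_trans L (lerD (lexx h) U)).
  by rewrite (addrCA h) [leLHS]addrC lerD2l.
(* There remains the quadratic bound, from the exponent [a (H' - s)^2] and Jensen's inequality. *)
apply: ckp_optimize => //.
have := @ent (fun x => a * (h1 x - s) ^+ 2) _ ie.
have iu2 : mu.-integrable setT (EFin \o (fun x => a * (h1 x - s) ^+ 2 * rho x)).
  apply: (integrable_ext mu (f := fun x => a * ((h1 x - s) ^+ 2 * rho x))) => //.
    by move=> x _; ring.
  exact: (integrableZ mu).
move=> /(_ iu2).
rewrite (Rintegral_ext mu (g := fun x => a * ((h1 x - s) ^+ 2 * rho x))); last first.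
  by move=> x _; ring.
rewrite RintegralZl// => L2.
have V : D ^+ 2 <= \int[mu]_x ((h1 x - s) ^+ 2 * rho x).
  have : 0 <= \int[mu]_x ((h1 x - s - D) ^+ 2 * rho x).
    by apply: Rintegral_ge0 => x _; rewrite mulr_ge0 ?sqr_ge0 ?P2_ge0.
  have z1 := integrableZ mu (- 2 * D) measurableT iY.
  have z2 := integrableZ mu (D ^+ 2) measurableT ir.
  rewrite (Rintegral_ext mu (g := fun x => (h1 x - s) ^+ 2 * rho x +
    (- 2 * D * ((h1 x - s) * rho x) + D ^+ 2 * rho x))); last by move=> x _; ring.
  rewrite (RintegralD _ iY2 (integrable_add mu measurableT z1 z2))// (RintegralD _ z1 z2)//.
  rewrite !RintegralZl// -DE (P2_mass Pr).
  rewrite -mulrA -expr2 mulr1 -{2}[D ^+ 2]mul1r -mulrDl.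
  rewrite (_ : - 2 + 1 = -1 :> R); last by ring.
  by rewrite mulN1r subr_ge0.
have aV : a * D ^+ 2 <= a * \int[mu]_x ((h1 x - s) ^+ 2 * rho x) by rewrite ler_pM2l.
apply: le_trans aV _; move: L2; rewrite lerBlDr => L2.
by apply: le_trans (le_trans L2 (lerD (lexx h) IB)); rewrite lerDl.
Qed.

End gibbs_tilt.

(** * Smooth functions *)

Section interval_integrals.
Context {R : realType}.
Notation mu := (@lebesgue_measure R).
Implicit Types (f F : R -> R) (a b c : R).

Lemma integrable_subitv f a b c d : a <= c -> d <= b ->
  mu.-integrable `[a, b] (EFin \o f) -> mu.-integrable `[c, d] (EFin \o f).
Proof.
move=> ac db; apply: integrableS => //.
by apply: subset_itv; rewrite bnd_simp.
Qed.

Lemma Rintegral_itv_cat f a b c : a <= b -> b <= c ->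
  mu.-integrable `[a, c] (EFin \o f) ->
  \int[mu]_(x in `[a, c]) f x = \int[mu]_(x in `[a, b]) f x + \int[mu]_(x in `[b, c]) f x.
Proof.
move=> ab bc fi; apply/eqP; rewrite addrC -subr_eq.
rewrite (@Rintegral_itvB _ _ (BLeft a) (BRight c) b) ?bnd_simp//.
rewrite Rintegral_itv_obnd_cbnd//; apply: integrableS fi => //.
by apply: subset_itv; rewrite bnd_simp.
Qed.

Lemma antiderivative_exists f c : continuous f -> exists2 F, has_deriv F f & F 0 = c.
Proof.
move=> cf; have ci a b : mu.-integrable `[a, b] (EFin \o f) by exact: continuous_integrable_itv.
pose F x := c + \int[mu]_(t in `[0, x]) f t - \int[mu]_(t in `[x, 0]) f t.
exists F; last by rewrite /F set_itv1 Rintegral_set1 subr0 addr0.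
have FE a x : a <= 0 -> a <= x ->
    F x = \int[mu]_(t in `[a, x]) f t + (c - \int[mu]_(t in `[a, 0]) f t).
  move=> a0 ax; rewrite /F; have [x0|x0] := leP 0 x.
    rewrite (Rintegral_itv_cat a0 x0)//.
    have -> : \int[mu]_(t in `[x, 0]) f t = 0.
      move: x0; rewrite le_eqVlt => /predU1P[<-|x0]; first by rewrite set_itv1 Rintegral_set1.
      by rewrite set_itv_ge ?Rintegral_set0// bnd_simp -ltNge.
    by ring.
  rewrite (Rintegral_itv_cat ax (ltW x0))// set_itv_ge ?Rintegral_set0; last by rewrite bnd_simp -ltNge.
  by ring.
(* A base point to the left of both 0 and [x]: near [x] the two-sided definition of [F] is, up to a
   constant, a single integral from [a]. *)
move=> x; pose a := Num.min x 0 - 1.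
have a0 : a <= 0 by rewrite /a lerBlDr ge_min; apply/orP; right; rewrite add0r.
have ax : a < x by rewrite /a ltrBlDr (@le_lt_trans _ _ x) ?ge_min ?lexx// ltrDl.
have x1 : x < x + 1 by rewrite ltrDl.
have [dG eG] := continuous_FTC1_closed x1 (ci a (x + 1)) ax (cf x).
have dG' : is_derive x 1 (fun y => \int[mu]_(t in `[a, y]) f t) (f x).
  by split; [exact: dG|rewrite -derive1E; exact: eG].
apply: (@near_eq_is_derive _ _ _ (fun y => \int[mu]_(t in `[a, y]) f t +
    (c - \int[mu]_(t in `[a, 0]) f t))).
  by near=> y; rewrite (FE a y)//; near: y; exact: lt_le_nbhsr.
have := is_deriveD dG' (is_derive_cst (c - \int[mu]_(t in `[a, 0]) f t) x 1).
by rewrite addr0.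
Unshelve. all: by end_near. Qed.

End interval_integrals.

Section smooth_calculus.
Context {R : realType}.
Implicit Types (f g F : R -> R).

Lemma deriv_seq_derive1n (F : nat -> R -> R) n :
  (forall n, has_deriv (F n) (F n.+1)) -> derive1n n (F 0%N) = F n.
Proof.
by move=> h; elim: n => [|n IHn]; rewrite ?derive1n0 ?derive1nS ?IHn// (has_deriv_derive1 (h n)).
Qed.

Lemma deriv_seq_smooth (F : nat -> R -> R) :
  (forall n, has_deriv (F n) (F n.+1)) -> smooth (F 0%N).
Proof. by move=> h n x; rewrite deriv_seq_derive1n//; exact: has_deriv_derivable (h n). Qed.

Lemma smooth_has_deriv f n : smooth f -> has_deriv (derive1n n f) (derive1n n.+1 f).
Proof. by move=> sf; rewrite derive1nS; apply: derivable_has_deriv => x; exact: sf. Qed.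

Lemma smooth_deriv f f' : smooth f -> has_deriv f f' -> smooth f'.
Proof.
move=> sf d k x; rewrite -(has_deriv_derive1 d) -derive1Sn; exact: sf.
Qed.

Lemma smooth_antideriv f f' : has_deriv f f' -> smooth f' -> smooth f.
Proof.
move=> d sf' [|k] x; first by rewrite derive1n0; exact: has_deriv_derivable d.
by rewrite derive1Sn (has_deriv_derive1 d).
Qed.

Lemma smooth_continuous f : smooth f -> continuous f.
Proof. by move=> /(@smooth_has_deriv _ 0) /has_deriv_continuous; rewrite derive1n0. Qed.

(** A recursive form of smoothness: the product rule gives closure under products by induction on
    the order, without Leibniz' formula for iterated derivatives. *)
Fixpoint ntimes_derivable (n : nat) f : Prop :=
  if n is m.+1 then (forall x, derivable f x 1) /\ ntimes_derivable m (derive1 f) else True.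

Lemma smoothP f : smooth f <-> forall n, ntimes_derivable n f.
Proof.
split=> [sf n|h k x].
  elim: n f sf => //= n IHn f sf; split; first by move=> x; exact: (sf 0%N).
  by apply: IHn; apply: (smooth_deriv sf); apply: derivable_has_deriv => x; exact: (sf 0%N).
have := h k.+1; elim: k f {h} => [|k IHk] f; first by move=> [df _]; exact: df.
by move=> [_ nf]; rewrite derive1Sn; exact: IHk.
Qed.

Lemma ntimes_derivableW n f : ntimes_derivable n.+1 f -> ntimes_derivable n f.
Proof. by elim: n f => //= n IHn f [df nf]; split => //; exact: IHn. Qed.

Lemma ntimes_derivableD n f g : ntimes_derivable n f -> ntimes_derivable n g ->
  ntimes_derivable n (fun x => f x + g x).
Proof.
elim: n f g => //= n IHn f g [df nf] [dg ng].
have d := has_derivD (derivable_has_deriv df) (derivable_has_deriv dg).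
split; first by move=> x; exact: has_deriv_derivable d.
by rewrite (has_deriv_derive1 d); exact: IHn.
Qed.

Lemma ntimes_derivableM n f g : ntimes_derivable n f -> ntimes_derivable n g ->
  ntimes_derivable n (fun x => f x * g x).
Proof.
elim: n f g => //= n IHn f g nf ng.
have [df nf'] := nf; have [dg ng'] := ng.
have d := has_derivM (derivable_has_deriv df) (derivable_has_deriv dg).
split; first by move=> x; exact: has_deriv_derivable d.
rewrite (has_deriv_derive1 d); apply: ntimes_derivableD; apply: IHn => //.
- exact: (@ntimes_derivableW n).
- exact: (@ntimes_derivableW n).
Qed.

Lemma smoothM f g : smooth f -> smooth g -> smooth (fun x => f x * g x).
Proof. by move=> /smoothP sf /smoothP sg; apply/smoothP => n; exact: ntimes_derivableM. Qed.

Lemma smooth_cst c : smooth (fun=> c : R).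
Proof.
have h n : has_deriv (fun=> if n is 0%N then c else 0 : R) (fun=> 0) by exact: has_deriv_cst.
exact: (@deriv_seq_smooth (fun n => fun=> if n is 0%N then c else 0 : R) h).
Qed.

Lemma smooth_id : smooth (fun x : R => x).
Proof. exact (smooth_antideriv (@has_deriv_id R) (@smooth_cst 1)). Qed.

Lemma smoothZ c f : smooth f -> smooth (fun x => c * f x).
Proof. by move=> sf; apply: smoothM; [exact: smooth_cst|exact: sf]. Qed.

Lemma smooth_affine_comp f b c : smooth f -> smooth (fun x => f (b * x + c)).
Proof.
move=> sf; have h n : has_deriv (fun x => b ^+ n * derive1n n f (b * x + c))
    (fun x => b ^+ n.+1 * derive1n n.+1 f (b * x + c)).
  apply: (has_deriv_eq (has_derivZ _ (has_deriv_comp (smooth_has_deriv n sf)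
    (has_deriv_affine b c)))) => x.
  by rewrite exprSr; ring.
have := deriv_seq_smooth h; rewrite (_ : (fun x => _) = fun x => f (b * x + c))//.
by apply/funext => x; rewrite derive1n0 expr0 mul1r.
Qed.

Lemma iter_partial_tensor (theta phi : R -> R) s : smooth theta -> smooth phi ->
  exists i j, iter_partial s (fun t x => theta t * phi x) =
    fun t x => derive1n i theta t * derive1n j phi x.
Proof.
move=> st sp; elim: s => [|b s [i [j IHs]]] /=.
  by exists 0%N, 0%N; rewrite !derive1n0.
rewrite IHs; case: b.
  exists i.+1, j; apply/funext => t; apply/funext => x; rewrite /partial_t.
  have d : has_deriv (fun s => derive1n i theta s * derive1n j phi x)
      (fun s => derive1n i.+1 theta s * derive1n j phi x).
    apply: (has_deriv_ext _ _ (has_derivZ (derive1n j phi x) (smooth_has_deriv i st))) => u;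
    by rewrite mulrC.
  by rewrite (has_deriv_derive1 d).
exists i, j.+1; apply/funext => t; apply/funext => x; rewrite /partial_x.
by rewrite (has_deriv_derive1 (has_derivZ (derive1n i theta t) (smooth_has_deriv j sp))).
Qed.

Lemma smooth2_tensor (theta phi : R -> R) : smooth theta -> smooth phi ->
  smooth2 (fun t x => theta t * phi x).
Proof.
move=> st sp s; have [i [j ->]] := iter_partial_tensor s st sp; split.
- move=> t x; have d := has_derivZ (derive1n j phi x) (smooth_has_deriv i st).
  rewrite (_ : (fun u => _) = fun u => derive1n j phi x * derive1n i theta u).
    exact: has_deriv_derivable d.
  by apply/funext => u; rewrite mulrC.
- move=> t x; exact: has_deriv_derivable (has_derivZ (derive1n i theta t) (smooth_has_deriv j sp)).
- have c1 := has_deriv_continuous (smooth_has_deriv i st).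
  have c2 := has_deriv_continuous (smooth_has_deriv j sp).
  move=> p; apply: cvgM.
    apply: (@continuous_comp _ _ _ fst (derive1n i theta)); first exact: cvg_fst.
    exact: c1.
  apply: (@continuous_comp _ _ _ snd (derive1n j phi)); first exact: cvg_snd.
  exact: c2.
Qed.

End smooth_calculus.

(** * Smooth bump functions *)

Section bump_functions.
Context {R : realType}.
Implicit Types (P Q : {poly R}) (x : R).

(* The derivatives of [exp (- 1 / x)], extended by 0 to [x <= 0]. *)
Definition flat P x : R := if 0 < x then P.[x^-1] * expR (- x^-1) else 0.

Lemma poly_exp_bound P (r : R) : 0 < r -> exists2 C, 0 <= C &
  forall u, 0 <= u -> `|P.[u]| <= C * expR (r * u).
Proof.
elim/poly_ind: P r => [|P c IHP] r r0.
  by exists 0 => // u _; rewrite horner0 normr0 mul0r.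
have [|C C0 HC] := IHP (r / 2); first by rewrite divr_gt0.
exists (C * (2 / r) + `|c|) => [|u u0].
  by rewrite addr_ge0// mulr_ge0// divr_ge0// ltW.
rewrite hornerMXaddC (le_trans (ler_normD _ _))// mulrDl lerD//; last first.
  by rewrite ler_peMr// -expR0 ler_expR mulr_ge0// ltW.
rewrite normrM (ger0_norm u0).
have ru0 : 0 <= r / 2 * u by rewrite mulr_ge0// divr_ge0// ltW.
have u1 : u <= 2 / r * expR (r / 2 * u).
  rewrite -ler_pdivrMl ?divr_gt0// invf_div.
  by apply: le_trans (expR_ge1Dx _); rewrite lerDr.
apply: (@le_trans _ _ (C * expR (r / 2 * u) * (2 / r * expR (r / 2 * u)))).
  by apply: ler_pM => //; exact: HC.
rewrite (_ : r * u = r / 2 * u + r / 2 * u); last by field.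
by rewrite expRD le_eqVlt; apply/orP; left; apply/eqP; ring.
Qed.

Lemma flat_bounded P : exists2 C, 0 <= C & forall x, `|flat P x| <= C.
Proof.
have [C C0 HC] := poly_exp_bound P (ltr01 : 0 < 1 :> R).
exists C => // x; rewrite /flat; case: ifPn => [x0|_]; last by rewrite normr0.
rewrite normrM (gtr0_norm (expR_gt0 _)).
have x'0 : 0 <= x^-1 by rewrite invr_ge0 ltW.
apply: (@le_trans _ _ (C * expR (1 * x^-1) * expR (- x^-1))).
  by rewrite ler_wpM2r ?expR_ge0 ?HC.
by rewrite mul1r -mulrA expRxMexpNx_1 mulr1.
Qed.

Lemma flat_le_abs P : exists2 C, 0 <= C & forall x, `|flat P x| <= C * `|x|.
Proof.
have [C C0 HC] := flat_bounded (P * 'X); exists C => // x.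
have := HC x; rewrite /flat; case: ifPn => [x0|_]; last by rewrite normr0 mulr_ge0.
rewrite hornerMX => h; rewrite -ler_pdivrMr ?normr_gt0 ?gt_eqF//.
by rewrite -(normfV x) -normrM mulrAC.
Qed.

Lemma flat_cts0 P : {for 0, continuous (flat P)}.
Proof.
have [C C0 HC] := flat_le_abs P.
rewrite /prop_for /continuous_at {2}/flat ltxx.
have l0 : C * `|x| @[x --> (0 : R)] --> (0 : R).
  rewrite -[X in _ --> X](mulr0 C); apply: cvgMl_tmp; rewrite -[X in _ --> X](@normr0 _ R).
  by apply: cvg_norm; exact: cvg_id.
have l0' : - (C * `|x|) @[x --> (0 : R)] --> (0 : R).
  by rewrite -[X in _ --> X]oppr0; exact: cvgN.
by apply: (squeeze_cvgr _ l0' l0); near=> x; rewrite -ler_norml; exact: HC.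
Unshelve. all: by end_near. Qed.

(** For [x > 0] this is the chain rule with [u = 1/x] and [u' = - u^2]. At 0 the difference quotient
    of [flat P] is [flat (P * 'X)], since dividing by [x] multiplies a polynomial in [1/x] by its
    variable; it is continuous at 0, where it vanishes. *)
Lemma has_deriv_flat P : has_deriv (flat P) (flat ('X ^+ 2 * (P - P^`()))).
Proof.
move=> x; have [x0|x0|->] := ltgtP x 0.
- rewrite (_ : flat ('X ^+ 2 * _) x = 0); last by rewrite /flat ltNge (ltW x0).
  apply: (@near_eq_is_derive _ _ _ (fun=> 0)).
  near=> y; rewrite /flat ifF//; apply/negbTE; rewrite -leNgt.
  near: y; exact: lt_le_nbhsl.
- rewrite (_ : flat ('X ^+ 2 * (P - P^`())) x =
    ('X ^+ 2 * (P - P^`())).[x^-1] * expR (- x^-1)); last by rewrite /flat x0.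
  have dV : is_derive x 1 (fun y : R => y^-1) (- x ^- 2).
    have [d1 d2] := @is_deriveV R (fun y => y) x 1 1 (lt0r_neq0 x0) (is_derive_id _ _).
    by split => //; rewrite d2 /GRing.scale /= mulr1.
  have dP : is_derive x 1 (fun y : R => P.[y^-1]) (P^`().[x^-1] * - x ^- 2).
    exact: (is_derive1_comp (is_derive_poly P x^-1) dV).
  have dN : is_derive x 1 (fun y : R => - y^-1) (x ^- 2).
    by rewrite -[x ^- 2]opprK; exact: is_deriveN.
  have dE : is_derive x 1 (fun y : R => expR (- y^-1)) (expR (- x^-1) * x ^- 2).
    exact: (is_derive1_comp (is_derive_expR _) dN).
  have nr : \near x, P.[x^-1] * expR (- x^-1) = flat P x.
    by near=> y; rewrite /flat ifT//; near: y; exact: lt_nbhsr.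
  apply: (near_eq_is_derive nr).
  have [m1 m2] := is_deriveM dP dE; split; first exact: m1.
  rewrite m2 /GRing.scale /= !hornerE /= -exprVn; ring.
- have f0 Q : flat Q 0 = 0 by rewrite /flat ltxx.
  apply/is_derive1_caratheodory; exists (flat (P * 'X)); split.
  + move=> z; rewrite f0 !subr0 /flat; case: ifPn => [z0|_]; last by rewrite mul0r.
    by rewrite hornerMX mulrAC -(mulrA P.[_]) mulVf ?mulr1// gt_eqF.
  + exact: flat_cts0.
  + by rewrite !f0.
Unshelve. all: by end_near. Qed.

Lemma smooth_flat P : smooth (flat P).
Proof.
pose step Q : {poly R} := 'X ^+ 2 * (Q - Q^`()).
have h n : has_deriv (flat (iter n step P)) (flat (iter n.+1 step P)).
  exact: has_deriv_flat.
exact: (@deriv_seq_smooth R (fun n => flat (iter n step P)) h).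
Qed.

(* [sbump a b n] tends to the indicator function of ]a, b[ as [n] tends to
   infinity. *)
Definition sbump (a b n x : R) : R := flat 1 (n * (x - a)) * flat 1 (n * (b - x)).

Lemma flat1_ge0 x : 0 <= flat 1 x.
Proof. by rewrite /flat; case: ifP => // _; rewrite hornerC mul1r expR_ge0. Qed.

Lemma flat1_le1 x : flat 1 x <= 1.
Proof.
rewrite /flat; case: ifPn => // x0; rewrite hornerC mul1r -expR0 ler_expR oppr_le0.
by rewrite invr_ge0 ltW.
Qed.

Lemma flat1_gt0 x : 0 < x -> 0 < flat 1 x.
Proof. by move=> x0; rewrite /flat x0 hornerC mul1r expR_gt0. Qed.

Lemma smooth_sbump a b n : smooth (sbump a b n).
Proof.
apply: smoothM.
  rewrite (_ : (fun x => _) = fun x => flat 1 (n * x + (- (n * a)))).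
    exact/smooth_affine_comp/smooth_flat.
  by apply/funext => x; congr flat; ring.
rewrite (_ : (fun x => _) = fun x => flat 1 (- n * x + n * b)).
  exact/smooth_affine_comp/smooth_flat.
by apply/funext => x; congr flat; ring.
Qed.

Lemma sbump_ge0 a b n x : 0 <= sbump a b n x.
Proof. by rewrite mulr_ge0// flat1_ge0. Qed.

Lemma sbump_le1 a b n x : sbump a b n x <= 1.
Proof. by rewrite mulr_ile1 ?flat1_ge0 ?flat1_le1. Qed.

Lemma sbump_out a b n x : 0 < n -> ~~ (a < x < b) -> sbump a b n x = 0.
Proof.
move=> n0; rewrite negb_and -!leNgt => /orP[xa|bx]; rewrite /sbump /flat.
  by rewrite [in X in X * _]ifF ?mul0r// pmulr_rgt0// subr_gt0 ltNge xa.
by rewrite [in X in _ * X]ifF ?mulr0// pmulr_rgt0// subr_gt0 ltNge bx.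
Qed.

Lemma sbump_gt0 a b n x : 0 < n -> a < x < b -> 0 < sbump a b n x.
Proof. by move=> n0 /andP[ax xb]; rewrite mulr_gt0// flat1_gt0// mulr_gt0// subr_gt0. Qed.

Lemma sbump_cvg a b x : a < x < b -> sbump a b k.+1%:R x @[k --> \oo] --> (1 : R).
Proof.
move=> /andP[ax xb]; rewrite -[X in _ --> X]mulr1.
have fl c : 0 < c -> flat 1 (k.+1%:R * c) @[k --> \oo] --> (1 : R).
  move=> c0; have -> : (fun k : nat => flat 1 (k.+1%:R * c)) = (fun k => expR (- (c^-1 * k.+1%:R^-1))).
    by apply/funext => k; rewrite /flat mulr_gt0// hornerC mul1r invfM mulrC.
  rewrite -[X in _ --> X]expR0 -[X in expR X]oppr0 -[X in expR (- X)](mulr0 c^-1).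
  apply: (@continuous_cvg _ _ _ _ _ _ expR); first exact: continuous_expR.
  by apply: cvgN; apply: cvgMl_tmp; exact: cvg_harmonic.
by apply: cvgM; apply: fl; rewrite subr_gt0.
Qed.

Lemma test_function_sbump (a b n : R) : 0 < n -> test_function setT (sbump a b n).
Proof.
move=> n0; split; first exact: smooth_sbump.
exists `[a, b]%classic; split => //; first exact: segment_compact.
move=> x /= nx; apply: sbump_out => //; apply/negP => /andP[ax xb]; apply: nx.
by rewrite in_itv /= !ltW.
Qed.

End bump_functions.

(** * Comparison and weak formulation *)

Section comparison_principle.
Context {R : realType}.
Implicit Types (f y : R -> R).

(* Only upward jumps of [f] have to be excluded: at the last time before [t] at
   which [f <= y], the inequality still holds, and it then propagates to [t]. *)
Lemma comparison f y (C t : R) : continuous y -> 0 <= t -> f 0 <= y 0 -> 0 <= C ->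
  (forall s r, 0 <= s -> s <= r -> r <= t -> f r - f s <= C * (r - s)) ->
  (forall s r, 0 <= s -> s <= r -> r <= t -> (forall u, s < u -> u <= r -> y u < f u) ->
     f r - f s <= y r - y s) ->
  f t <= y t.
Proof.
move=> cy t0 fy0 C0 jump prop.
rewrite leNgt; apply/negP => yft.
pose S := [set s | 0 <= s <= t /\ f s <= y s].
have S0 : S 0 by split; rewrite // lexx.
have ubS : has_ubound S by exists t => s [/andP[]].
have hS : has_sup S by split => //; exists 0.
pose s1 := sup S.
have s1t : s1 <= t by apply: ge_sup; [exists 0|move=> s [/andP[]]].
have s10 : 0 <= s1 by exact: ub_le_sup.
(* At times of [S] close to [s1], [f] is below [y]; from there to [s1], [y] varies little and [f]
   rises at most at rate [C]. *)
have fs1 : f s1 <= y s1.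
  apply/ler_addgt0Pr => e e0.
  have C1 : 0 < 2 * (C + 1) by rewrite mulr_gt0// ltr_wpDl.
  have [d /= d0 hd] : \forall s \near s1, `|y s1 - y s| < e / 2.
    by have /cvgrPdist_lt := cy s1; apply; rewrite divr_gt0.
  pose d' := Num.min d (e / (2 * (C + 1))).
  have d'0 : 0 < d' by rewrite lt_min d0 divr_gt0.
  have [s [/andP[s0 st] fys] s1s] := sup_adherent d'0 hS.
  have ss1 : s <= s1 by apply: ub_le_sup => //; split; rewrite ?s0.
  have sd : s1 - s < d' by rewrite ltrBlDr -ltrBlDl.
  have /hd hy : `|s1 - s| < d.
    by rewrite ger0_norm ?subr_ge0// (lt_le_trans sd)// ge_min lexx.
  have sC : s1 - s <= e / (2 * (C + 1)).
    by rewrite (le_trans (ltW sd))// ge_min lexx orbT.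
  have CC : C * (s1 - s) <= e / 2.
    apply: (@le_trans _ _ ((C + 1) * (e / (2 * (C + 1))))).
      by apply: ler_pM => //; rewrite ?subr_ge0// lerDl.
    rewrite le_eqVlt; apply/orP; left; apply/eqP; field.
    by rewrite gt_eqF// ltr_wpDl.
  have yy : y s <= y s1 + e / 2 by have := ltW hy; rewrite ler_norml => /andP[+ _]; lra.
  have J := jump s s1 s0 ss1 s1t.
  rewrite (splitr e) addrA; apply: le_trans (lerD yy CC).
  by apply: le_trans (lerD fys (lexx _)); rewrite -lerBlDl.
have /prop -/(_ s10 s1t (lexx t)) : forall u, s1 < u -> u <= t -> y u < f u.
  move=> u s1u ut; rewrite ltNge; apply/negP => fyu.
  suff : u <= s1 by rewrite leNgt s1u.
  by apply: ub_le_sup => //; split => //; rewrite ut (le_trans s10)// ltW.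
move=> P; have := lerD P fs1; rewrite !subrK => fyt.
by move: yft; rewrite ltNge fyt.
Qed.

End comparison_principle.

(** * Pointwise values from the weak time derivative *)

Section weak_time_derivative.
Context {R : realType}.
Notation mu := (@lebesgue_measure R).
Implicit Types (f g : R -> R).

(* A smooth approximation from below of the indicator function of [s <= t]. *)
Lemma smooth_cutoff (a t : R) : a < t ->
  exists theta beta : R -> R, [/\ smooth theta, continuous beta,
    has_deriv theta (fun s => - beta s) &
    [/\ forall s, s <= a -> theta s = 1, forall s, t <= s -> theta s = 0,
        forall s, 0 <= theta s <= 1, forall s, 0 <= beta s &
        forall s, ~~ (a < s < t) -> beta s = 0]].
Proof.
move=> at_; have cb : continuous (sbump a t 1).
  apply: smooth_continuous; exact: smooth_sbump.
have [B dB Ba] := antiderivative_exists 0 cb.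
have b_out s : ~~ (a < s < t) -> sbump a t 1 s = 0 by exact: sbump_out.
have cstB x y : x <= y -> (forall c, x <= c <= y -> ~~ (a < c < t)) -> B y = B x.
  move=> xy h; have [c /h cxy e] := mean_value dB xy.
  by move/eqP : e; rewrite b_out// mul0r subr_eq0 => /eqP.
have mono x y : x <= y -> B x <= B y.
  by move=> xy; apply: (has_deriv_le dB xy) => c _; exact: sbump_ge0.
have Bl s : s <= a -> B s = B a.
  move=> sa; apply/esym/cstB => // c /andP[_ ca].
  by rewrite negb_and -leNgt ca.
have Br s : t <= s -> B s = B t.
  move=> ts; apply: cstB => // c /andP[tc _].
  by rewrite negb_and -!leNgt tc orbT.
pose m := B t - B a.
(* The bump is positive on the middle third of ]a, t[. *)
have m0 : 0 < m.
  pose x := a + (t - a) / 3; pose y := a + (t - a) / 3 *+ 2.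
  have d0 : 0 < (t - a) / 3 by rewrite divr_gt0// subr_gt0.
  have xy : x < y by rewrite /x /y ltrD2l mulr2n ltrDl.
  have ax : a < x by rewrite /x ltrDl.
  have yt : y < t by rewrite /y mulr2n; lra.
  have [c /andP[xc cy] e] := mean_value dB (ltW xy).
  have : 0 < B y - B x.
    rewrite e mulr_gt0 ?subr_gt0// sbump_gt0// (lt_le_trans ax xc)/=.
    exact: le_lt_trans cy yt.
  rewrite subr_gt0 => Bxy; rewrite subr_gt0.
  by rewrite (le_lt_trans (mono _ _ (ltW ax)))// (lt_le_trans Bxy)// mono// ltW.
have dth : has_deriv (fun s => 1 - m^-1 * (B s - B a)) (fun s => - (m^-1 * sbump a t 1 s)).
  apply: (has_deriv_eq (has_derivB (has_deriv_cst 1)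
    (has_derivZ m^-1 (has_derivB dB (has_deriv_cst (B a)))))) => s.
  by rewrite subr0 sub0r.
exists (fun s => 1 - m^-1 * (B s - B a)), (fun s => m^-1 * sbump a t 1 s); split.
- apply: (smooth_antideriv dth).
  rewrite (_ : (fun s => _) = fun s => (- m^-1) * sbump a t 1 s).
    apply: smoothZ; exact: smooth_sbump.
  by apply/funext => s; rewrite mulNr.
- by move=> s; apply: cvgMl_tmp; exact: cb.
- exact: dth.
- split=> [s /Bl ->|s /Br ->|s|s|s /b_out ->].
  + by rewrite subrr mulr0 subr0.
  + by rewrite mulVf ?subrr// gt_eqF.
  + have [Bs1 Bs2] : B a <= B s /\ B s <= B t.
      have [sa|/ltW as_] := leP s a.
        by rewrite Bl//; split=> //; apply: mono; exact: ltW.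
      split; first exact: mono.
      by have [ts|/ltW st] := leP t s; [rewrite (Br _ ts)|exact: mono].
    apply/andP; split; first by rewrite subr_ge0 ler_pdivrMl// mulr1 lerD2r.
    by rewrite lerBlDr lerDl mulr_ge0// ?subr_ge0// invr_ge0 ltW.
  + by rewrite mulr_ge0 ?sbump_ge0// invr_ge0 ltW.
  + by rewrite mulr0.
Qed.

(** The cut-offs equal 1 up to [a n] and 0 from [t] on, so that [be n] is a probability density on
    ]a n, t[ concentrating at [t]: the term in [f] tends to [f t], the term in [g] to its integral
    up to [t]. The boundary term is [c] because the cut-offs are 1 at time 0. *)
Lemma weak_pointwise f g (c t T : R) : 0 < t -> t < T ->
  mu.-integrable `[0, T] (EFin \o f) -> mu.-integrable `[0, T] (EFin \o g) ->
  {for t, continuous f} ->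
  (forall theta beta, smooth theta -> has_deriv theta (fun s => - beta s) ->
     continuous beta -> (forall s, t <= s -> theta s = 0) ->
     0 = - (theta 0 * c) + \int[mu]_(s in `[0, T]) (beta s * f s)
         - \int[mu]_(s in `[0, T]) (theta s * g s)) ->
  f t = c + \int[mu]_(s in `[0, t]) g s.
Proof.
move=> t0 tT fi gi cf weak.
have mT : measurable (`[0, T] : set R) by exact: measurable_itv.
pose a (n : nat) := t - t / n.+2%:R.
have at_ n : a n < t by rewrite /a ltrBlDr ltrDl divr_gt0.
have a0 n : 0 <= a n.
  by rewrite /a subr_ge0 ler_pdivrMr// ler_peMr ?(ltW t0)// ler1n.
have acv : a n @[n --> \oo] --> t.
  rewrite -[X in _ --> X]subr0 -[X in _ - X](mulr0 t); apply: cvgB; first exact: cvg_cst.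
  apply: cvgMl_tmp; have := @cvg_harmonic R; rewrite -(cvg_shiftS (harmonic : nat -> R)).
  exact.
have /choice[th /choice[be H]] := fun n => smooth_cutoff (at_ n).
have th0 n : th n 0 = 1 by have [_ _ _ [h _ _ _ _]] := H n; exact: h.
have W n : c = \int[mu]_(s in `[0, T]) (be n s * f s) - \int[mu]_(s in `[0, T]) (th n s * g s).
  have [sm cb db [_ h2 _ _ _]] := H n; have := weak _ _ sm db cb h2.
  by rewrite th0 mul1r -addrA => /esym/eqP; rewrite addrC addr_eq0 opprK => /eqP ->.
have mass n : \int[mu]_(s in `[0, T]) be n s = 1.
  have [_ cb db [_ h2 _ _ _]] := H n.
  have := @FTC2 R _ _ 0 T (le_trans (ltW t0) (ltW tT)) (has_derivN db).
  rewrite th0 (h2 T (ltW tT)) oppr0 sub0r opprK => <-.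
    by apply: (Rintegral_ext mu) => s _; rewrite opprK.
  by rewrite (_ : (fun x => _) = be n)//; apply/funext => s; rewrite opprK.
have L1 : \int[mu]_(s in `[0, T]) (th n s * g s) @[n --> \oo] --> \int[mu]_(s in `[0, t]) g s.
  have -> : \int[mu]_(s in `[0, t]) g s = \int[mu]_(s in `[0, T]) (g \_ `[0, t[) s.
    rewrite -Rintegral_itv_bndo_bndc; last first.
      by apply: integrableS gi => //; apply: subset_itv; rewrite bnd_simp// ltW.
    rewrite -Rintegral_mkcondr; congr (Rintegral _ _ _).
    rewrite setIidr//; by apply: subset_itv; rewrite bnd_simp// ltW.
  have bd n s : `[0, T]%classic s -> `|th n s * g s| <= `|g s|.
    move=> _; have [_ _ _ [_ _ h _ _]] := H n; have /andP[p1 p2] := h s.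
    by rewrite normrM ger0_norm// ler_piMl.
  have mf n : measurable_fun `[0, T] (fun s => th n s * g s).
    have [sm _ _ _] := H n.
    apply: measurable_funM; last exact: (integrable_measurable mu gi).
    apply: continuous_measurable => //; exact: smooth_continuous.
  apply: (proj2 (Rdominated_cvg mu mT mf _ (integrable_nrm mu mT gi) bd)).
  move=> s /=; rewrite in_itv /= => /andP[s0 sT]; apply: cvg_near_cst.
  rewrite patchE; have [ts|st] := leP t s.
    rewrite ifF; last by apply/negbTE; rewrite notin_setE /= in_itv /= s0 /= => st; rewrite ltNge ts in st.
    by apply: nearW => n; have [_ _ _ [_ h _ _ _]] := H n; rewrite h// mul0r.
  rewrite ifT; last by rewrite inE /= in_itv /= s0.
  near=> n; have [_ _ _ [h _ _ _ _]] := H n; rewrite h ?mul1r//.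
  by apply/ltW; near: n; exact: (cvgr_gt _ acv).
have L2 : \int[mu]_(s in `[0, T]) (be n s * f s) @[n --> \oo] --> f t.
  apply/cvgrPdist_le => e e0.
  have [d /= d0 hd] : \forall s \near t, `|f t - f s| < e.
    by have /cvgrPdist_lt := cf; apply.
  near=> n; have [sm cb db [_ h2 _ b0 bout]] := H n.
  have ib : mu.-integrable `[0, T] (EFin \o be n) by exact: continuous_integrable_itv.
  have ibf : mu.-integrable `[0, T] (EFin \o (fun s => be n s * f s)).
    have [K bK] : exists K, forall s, `|be n s| <= K.
      have /compact_bounded[K [_ HK]] : compact (be n @` `[a n, t]).
        by apply: continuous_compact; [exact: continuous_subspaceT|exact: segment_compact].
      exists (`|K| + 1) => s.
      have [ats|/bout ->] := boolP (a n < s < t); last by rewrite normr0 addr_ge0.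
      apply: HK; first by rewrite (le_lt_trans (ler_norm K))// ltrDl.
      by exists s => //=; rewrite in_itv /=; case/andP: ats => ? ?; rewrite !ltW.
    apply: (integrable_le mu (g := fun s => K * `|f s|)) => //.
    - apply: measurable_funM; last exact: (integrable_measurable mu fi).
      exact: continuous_measurable.
    - by apply: (integrableZ mu) => //; exact: (integrable_nrm mu).
    - by move=> s _; rewrite normrM ler_wpM2r.
  have ic : mu.-integrable `[0, T] (EFin \o (fun s => f t * be n s)) by exact: (integrableZ mu).
  have -> : f t - \int[mu]_(s in `[0, T]) (be n s * f s) =
      \int[mu]_(s in `[0, T]) (f t * be n s - be n s * f s).
    by rewrite RintegralB// RintegralZl// mass mulr1.
  have iB := integrable_sub mu mT ic ibf.
  apply: (@le_trans _ _ (\int[mu]_(s in `[0, T]) `|f t * be n s - be n s * f s|)).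
    exact: le_normr_Rintegral.
  have ie : mu.-integrable `[0, T] (EFin \o (fun s => e * be n s)) by exact: (integrableZ mu).
  apply: (@le_trans _ _ (\int[mu]_(s in `[0, T]) (e * be n s))); last first.
    by rewrite RintegralZl// mass mulr1.
  apply: le_Rintegral => //; first exact: (integrable_nrm mu).
  move=> s _; rewrite (mulrC (f t)) -mulrBr normrM (ger0_norm (b0 s)) mulrC.
  have [/andP[as_ st]|/bout ->] := boolP (a n < s < t); last by rewrite !mulr0.
  rewrite ler_wpM2r//; apply/ltW/hd => /=.
  rewrite ger0_norm ?subr_ge0 ?(ltW st)//.
  suff : t - d < a n by move=> h; rewrite ltrBlDr -ltrBlDl (lt_trans h).
  by near: n; apply: (cvgr_gt _ acv); rewrite ltrBlDr ltrDl.
have : (fun n => \int[mu]_(s in `[0, T]) (be n s * f s) -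
    \int[mu]_(s in `[0, T]) (th n s * g s)) @ \oo --> f t - \int[mu]_(s in `[0, t]) g s.
  exact: cvgB.
rewrite (_ : (fun n => _) = fun=> c); last by apply/funext => n; rewrite -W.
move=> L; have Lc : (fun _ : nat => c) @ \oo --> c by exact: cvg_cst.
have : c = f t - \int[mu]_(s in `[0, t]) g s by exact: (cvg_unique _ Lc L).
by move=> ->; rewrite subrK.
Unshelve. all: by end_near. Qed.

End weak_time_derivative.

Section compact_support.
Context {R : realType}.
Implicit Types (f p : R -> R).

Definition csupp f := exists K : R, forall x, K < `|x| -> f x = 0.

Lemma csupp_deriv f p : has_deriv f p -> csupp f -> csupp p.
Proof.
move=> d [K HK]; exists K => x Kx.
have nr : \near x, 0 = f x.
  have : \forall y \near x, K < `|y| by exact: (cvgr_norm_gt x cvg_id).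
  by apply: filterS => y /HK ->.
have [_ e1] := near_eq_is_derive nr (is_derive_cst (0 : R) x 1).
by have [_ e2] := d x; rewrite -e2.
Qed.

Lemma csupp_bounded f : continuous f -> csupp f -> exists2 c, 0 <= c & forall x, `|f x| <= c.
Proof.
move=> cf [K HK].
have /compact_bounded[M [_ HM]] : compact (f @` `[- `|K|, `|K|]).
  by apply: continuous_compact; [exact: continuous_subspaceT|exact: segment_compact].
exists (`|M| + 1) => [|x]; first by rewrite addr_ge0.
have [xK|/HK ->] := leP `|x| K; last by rewrite normr0 addr_ge0.
apply: HM; first by rewrite (le_lt_trans (ler_norm M))// ltrDl.
by exists x => //=; rewrite in_itv /= -ler_norml (le_trans xK)// ler_norm.
Qed.

Lemma csuppM f g : csupp g -> csupp (fun x => f x * g x).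
Proof. by move=> [K HK]; exists K => x /HK ->; rewrite mulr0. Qed.

Lemma test_functionP f : test_function setT f <-> smooth f /\ csupp f.
Proof.
split=> [[sf [K [cK _ HK]]]|[sf [K HK]]]; split => //.
  have [M [_ HM]] := compact_bounded cK; exists (`|M| + 1) => x xM; apply: HK => Kx.
  have hM : M < `|M| + 1 by rewrite (le_lt_trans (ler_norm M))// ltrDl.
  by have /= := HM _ hM x Kx; rewrite leNgt xM.
exists `[- `|K|, `|K|]%classic; split => //; first exact: segment_compact.
move=> x /= xK; apply: HK; rewrite ltNge; apply/negP => h; apply: xK.
by rewrite in_itv /= -ler_norml (le_trans h)// ler_norm.
Qed.

End compact_support.

(** * Expectations of observables *)

Section expectations.
Context {R : realType}.
Notation mu := (@lebesgue_measure R).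
Variable rho : R -> R -> R.
Hypothesis rP : forall t, 0 <= t -> P2 (rho t).
Hypothesis rM : measurable_space_time rho.
Implicit Types (psi f : R -> R) (s t : R).

Definition ev psi s : R := \int[mu]_x (psi x * rho s x).

Let D := [set p : R * R | 0 <= p.1].

Let mD : measurable D.
Proof.
have -> : D = setT `&` fst @^-1` `[0, +oo[%classic.
  by rewrite setTI; apply/seteqP; split => p /=; rewrite in_itv /= andbT.
by apply: measurable_fst => //; exact: measurable_itv.
Qed.

(** Extension by 0 to negative times, so that Tonelli's theorem applies on the whole plane. *)
Let w := (fun p : R * R => rho p.1 p.2) \_ D.

Let w_ge0 p : 0 <= w p.
Proof.
rewrite /w patchE; case: ifPn => // /set_mem Dp; exact: (P2_ge0 p.2 (rP Dp)).
Qed.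

Lemma measurable_ge0_ev psi : measurable_fun setT psi -> (forall x, 0 <= psi x) ->
  measurable_fun (`[0, +oo[ : set R) (ev psi).
Proof.
move=> mp p0; pose F (p : R * R) : \bar R := (psi p.2 * w p)%:E.
have mF : measurable_fun setT F.
  apply/measurable_EFinP; apply: measurable_funM.
    by apply: measurableT_comp => //; exact: measurable_snd.
  have [h _] := measurable_restrictT (fun p : R * R => rho p.1 p.2) mD.
  exact: (h rM).
have F0 p : (0 <= F p)%E by rewrite lee_fin mulr_ge0.
have m1 : measurable_fun setT (fun s : R => fine (\int[mu]_y F (s, y))%E).
  apply: measurableT_comp; first exact: fine_measurable.
  exact: (@measurable_fun_fubini_tonelli_F _ _ (measurableTypeR R) (measurableTypeR R) R mu F mF F0).
apply: (@eq_measurable_fun _ _ _ _ _ (fun s => fine (\int[mu]_y F (s, y))%E)); last first.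
  exact: (measurable_funS measurableT _ m1).
move=> s; rewrite inE /= in_itv /= andbT => s0; rewrite /ev /Rintegral; congr fine.
by apply: eq_integral => x _; rewrite /F /w patchE ifT// inE.
Qed.

Lemma ev_integrable psi c s : 0 <= s -> measurable_fun setT psi ->
  (forall x, `|psi x| <= c * (1 + x ^+ 2)) ->
  mu.-integrable setT (EFin \o (fun x => psi x * rho s x)).
Proof. by move=> s0 mp pc; exact: (P2_integrable (rP s0) mp pc). Qed.

Lemma measurable_ev psi c : measurable_fun setT psi ->
  (forall x, `|psi x| <= c * (1 + x ^+ 2)) -> measurable_fun (`[0, +oo[ : set R) (ev psi).
Proof.
move=> mp pc.
pose pp x := (`|psi x| + psi x) / 2; pose pm x := (`|psi x| - psi x) / 2.
have mn : measurable_fun setT (fun x => `|psi x|) by exact: measurableT_comp.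
have mpp : measurable_fun setT pp by apply: measurable_funM => //; exact: measurable_funD.
have mpm : measurable_fun setT pm by apply: measurable_funM => //; exact: measurable_funB.
have nn x : 0 <= `|psi x| + psi x by have := ler_norm (- psi x); rewrite normrN; lra.
have nm x : 0 <= `|psi x| - psi x by have := ler_norm (psi x); lra.
have pp0 x : 0 <= pp x by rewrite divr_ge0.
have pm0 x : 0 <= pm x by rewrite divr_ge0.
have ppc x : `|pp x| <= c * (1 + x ^+ 2).
  rewrite ger0_norm// /pp ler_pdivrMr//.
  by have := ler_norm (psi x); have := pc x; lra.
have pmc x : `|pm x| <= c * (1 + x ^+ 2).
  rewrite ger0_norm// /pm ler_pdivrMr//.
  by have := ler_norm (- psi x); rewrite normrN; have := pc x; lra.
apply: (@eq_measurable_fun _ _ _ _ _ (fun s => ev pp s - ev pm s)); last first.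
  by apply: measurable_funB; exact: measurable_ge0_ev.
move=> s; rewrite inE /= in_itv /= andbT => s0.
rewrite /ev -RintegralB//; [|exact: (ev_integrable s0 mpp ppc)|exact: (ev_integrable s0 mpm pmc)].
by apply: (Rintegral_ext mu) => x _; rewrite -mulrBl /pp /pm; congr (_ * _); field.
Qed.

Lemma evD psi f c s : 0 <= s -> measurable_fun setT psi -> measurable_fun setT f ->
  (forall x, `|psi x| <= c * (1 + x ^+ 2)) -> (forall x, `|f x| <= c * (1 + x ^+ 2)) ->
  ev (fun x => psi x + f x) s = ev psi s + ev f s.
Proof.
move=> s0 m1 m2 b1 b2; rewrite /ev -RintegralD//; last 2 first.
- exact: (ev_integrable s0 m1 b1).
- exact: (ev_integrable s0 m2 b2).
by apply: (Rintegral_ext mu) => x _; rewrite mulrDl.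
Qed.

Lemma evZ psi a c s : 0 <= s -> measurable_fun setT psi ->
  (forall x, `|psi x| <= c * (1 + x ^+ 2)) ->
  ev (fun x => a * psi x) s = a * ev psi s.
Proof.
move=> s0 m1 b1; rewrite /ev -RintegralZl//; last exact: (ev_integrable s0 m1 b1).
by apply: (Rintegral_ext mu) => x _; rewrite mulrA.
Qed.

Lemma ev1 s : 0 <= s -> ev (fun=> 1) s = 1.
Proof.
move=> s0; rewrite -[RHS](P2_mass (rP s0)).
by apply: (Rintegral_ext mu) => x _; rewrite mul1r.
Qed.

Lemma ev_le psi f c s : 0 <= s -> measurable_fun setT psi -> measurable_fun setT f ->
  (forall x, `|psi x| <= c * (1 + x ^+ 2)) -> (forall x, `|f x| <= c * (1 + x ^+ 2)) ->
  (forall x, psi x <= f x) -> ev psi s <= ev f s.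
Proof.
move=> s0 m1 m2 b1 b2 h; apply: le_Rintegral => //.
- exact: (ev_integrable s0 m1 b1).
- exact: (ev_integrable s0 m2 b2).
- by move=> x _; rewrite ler_wpM2r//; exact: (P2_ge0 x (rP s0)).
Qed.

Lemma ev_abs_le psi f c s : 0 <= s -> measurable_fun setT psi -> measurable_fun setT f ->
  (forall x, `|f x| <= c * (1 + x ^+ 2)) -> (forall x, `|psi x| <= f x) ->
  `|ev psi s| <= ev f s.
Proof.
move=> s0 m1 m2 b2 h.
have b1 x : `|psi x| <= c * (1 + x ^+ 2).
  by rewrite (le_trans (h x))// (le_trans (ler_norm _)).
have i1 := ev_integrable s0 m1 b1; have i2 := ev_integrable s0 m2 b2.
apply: (@le_trans _ _ (\int[mu]_x `|psi x * rho s x|)); first exact: le_normr_Rintegral.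
apply: le_Rintegral => //; first exact: (integrable_nrm mu).
by move=> x _; have r0 := P2_ge0 x (rP s0); rewrite normrM (ger0_norm r0) ler_wpM2r.
Qed.

Lemma ev_bound psi c s : 0 <= s -> measurable_fun setT psi -> (forall x, `|psi x| <= c) ->
  `|ev psi s| <= c.
Proof.
move=> s0 mp b; have c0 : 0 <= c by exact: le_trans (b 0).
have bc x : `|(fun=> c) x : R| <= c * (1 + x ^+ 2).
  by rewrite ger0_norm// ler_peMr// lerDl sqr_ge0.
apply: le_trans (ev_abs_le s0 mp (measurable_cst _) bc b) _.
have -> : ev (fun=> c) s = ev (fun x => c * 1) s by apply: (Rintegral_ext mu) => x _; rewrite mulr1.
have b1 x : `|(fun=> 1) x : R| <= 1 * (1 + x ^+ 2).
  by rewrite normr1 mul1r lerDl sqr_ge0.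
by rewrite (@evZ (fun=> 1) c 1)// ev1// mulr1.
Qed.

Lemma ev_cvg (psi_ : nat -> R -> R) psi c s : 0 <= s ->
  (forall n, measurable_fun setT (psi_ n)) ->
  (forall x, psi_ n x @[n --> \oo] --> psi x) ->
  (forall n x, `|psi_ n x| <= c * (1 + x ^+ 2)) ->
  ev (psi_ n) s @[n --> \oo] --> ev psi s.
Proof.
move=> s0 m cv b.
have c0 : 0 <= c.
  by have := le_trans (normr_ge0 _) (b 0%N 0); rewrite expr0n /= addr0 mulr1.
have bc x : `|c * (1 + x ^+ 2)| <= c * (1 + x ^+ 2).
  by rewrite ger0_norm// mulr_ge0// addr_ge0// sqr_ge0.
have mc : measurable_fun setT (fun x : R => c * (1 + x ^+ 2)).
  by apply: measurable_funM => //; apply: measurable_funD => //; exact: measurable_funX.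
have m' n : measurable_fun setT (fun x => psi_ n x * rho s x).
  by apply: measurable_funM => //; exact: (P2_measurable (rP s0)).
have cv' x : setT x -> psi_ n x * rho s x @[n --> \oo] --> psi x * rho s x.
  by move=> _; apply: cvgMr_tmp; exact: cv.
have b' n x : setT x -> `|psi_ n x * rho s x| <= c * (1 + x ^+ 2) * rho s x.
  by move=> _; have r0 := P2_ge0 x (rP s0); rewrite normrM (ger0_norm r0) ler_wpM2r.
by have [] := Rdominated_cvg mu measurableT m' cv' (ev_integrable s0 mc bc) b'.
Qed.

(** The local L^2 continuity of [rho] enters through [|D| <= eta + D^2 / (4 eta)] on the support of
    [psi], in place of the Cauchy-Schwarz inequality; [eta] and [d] are chosen so that each of the
    two terms contributes at most [e / 2]. *)
Lemma ev_continuous psi t : time_continuous rho -> continuous psi -> csupp psi -> 0 < t ->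
  {for t, continuous (ev psi)}.
Proof.
move=> tc cpsi psiK t0.
have [c c0 bc] := csupp_bounded cpsi psiK; case: psiK => K HK.
have mp : measurable_fun setT psi by exact: continuous_measurable.
have bq x : `|psi x| <= c * (1 + x ^+ 2).
  by rewrite (le_trans (bc x))// ler_peMr// lerDl sqr_ge0.
pose L := `|K|; have L0 : 0 <= L by exact: normr_ge0.
apply/cvgrPdist_le => e e0.
pose eta := e / (4 * (L + 1) * (c + 1)).
have c1 : 0 < c + 1 by rewrite ltr_wpDl.
have L1 : 0 < L + 1 by rewrite ltr_wpDl.
have eta0 : 0 < eta by rewrite divr_gt0// mulr_gt0// mulr_gt0.
pose d := 2 * e * eta / (c + 1).
have d0 : 0 < d by rewrite divr_gt0// mulr_gt0// mulr_gt0.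
have /fine_cvgP[nfin cfin] := tc t L t0.
have mJ : measurable (`[- L, L] : set R) by exact: measurable_itv.
have muJ : mu `[- L, L]%classic = (2 * L)%:E.
  rewrite lebesgue_measure_itv /= lte_fin; case: ifPn => [_|].
    by rewrite -EFinB opprK; congr EFin; ring.
  rewrite -leNgt => h; have L00 : L = 0 by apply/eqP; rewrite eq_le L0 andbT; lra.
  by rewrite L00 mulr0.
near=> s.
have s0 : 0 <= s by apply/ltW; near: s; exact: lt_nbhsr.
have i2 : mu.-integrable `[- L, L] (EFin \o (fun x => (rho s x - rho t x) ^+ 2)).
  apply: (ge0_Rintegral_integrable mu) => //.
  - apply: measurable_funX; apply: measurable_funB; apply: (@measurable_funS _ _ _ _ setT) => //.
      exact: (P2_measurable (rP s0)).
    exact: (P2_measurable (rP (ltW t0))).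
  - by move=> x _; exact: sqr_ge0.
  - by rewrite ltey_eq; apply/orP; left; near: s; exact: nfin.
have I2 : \int[mu]_(x in `[- L, L]) (rho s x - rho t x) ^+ 2 < d.
  by near: s; apply: (cvgr_lt 0).
have is_ := ev_integrable s0 mp bq; have it_ := ev_integrable (ltW t0) mp bq.
rewrite /ev -RintegralB//.
have -> : \int[mu]_x (psi x * rho t x - psi x * rho s x) =
    \int[mu]_(x in `[- L, L]) (psi x * (rho t x - rho s x)).
  rewrite [RHS]Rintegral_mkcond; apply: (Rintegral_ext mu) => x _.
  rewrite patchE; case: ifPn => [_|]; first by rewrite mulrBr.
  rewrite notin_setE /= in_itv /= -ler_norml => /negP; rewrite -ltNge => Lx.
  by rewrite HK ?mul0r ?subrr// (le_lt_trans (ler_norm K)).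
have iD : mu.-integrable `[- L, L] (EFin \o (fun x => psi x * (rho t x - rho s x))).
  apply: (@integrableS _ _ _ _ setT) => //.
  apply: (integrable_ext mu (f := fun x => psi x * rho t x - psi x * rho s x)) => //.
    by move=> x _; rewrite mulrBr.
  exact: (integrable_sub mu).
apply: (@le_trans _ _ (\int[mu]_(x in `[- L, L]) `|psi x * (rho t x - rho s x)|)).
  exact: le_normr_Rintegral.
have ic : mu.-integrable `[- L, L] (EFin \o (fun=> eta)).
  by apply: continuous_integrable_itv; exact: cst_continuous.
have i3 := integrableZ mu (4 * eta)^-1 mJ i2.
have i4 := integrable_add mu mJ ic i3.
apply: (@le_trans _ _ (\int[mu]_(x in `[- L, L]) ((c + 1) *
    (eta + (4 * eta)^-1 * (rho s x - rho t x) ^+ 2)))).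
  apply: le_Rintegral => //; [exact: (integrable_nrm mu)|exact: (integrableZ mu)|].
  move=> x _; rewrite normrM; apply: ler_pM => //.
    by apply: le_trans (bc x) _; rewrite lerDl.
  set D0 := rho s x - rho t x; rewrite distrC -/D0.
  have sq : 0 <= (`|D0| - 2 * eta) ^+ 2 / (4 * eta).
    by rewrite divr_ge0 ?sqr_ge0// mulr_ge0// ltW.
  rewrite (_ : _ / _ = eta + (4 * eta)^-1 * D0 ^+ 2 - `|D0|) in sq.
    by rewrite subr_ge0 in sq.
  by rewrite -(real_normK (num_real D0)); field; rewrite gt_eqF.
rewrite (RintegralZl (c + 1) _ i4)// (RintegralD _ ic i3)// (RintegralZl _ _ i2)//.
rewrite (_ : \int[mu]_(x in `[- L, L]) eta = eta * (2 * L)); last first.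
  by rewrite Rintegral_cst// [X in fine X]muJ.
apply: (@le_trans _ _ ((c + 1) * (eta * (2 * L) + (4 * eta)^-1 * d))).
  by rewrite ler_pM2l// lerD2l ler_pM2l ?(ltW I2)// invr_gt0 mulr_gt0.
have -> : (c + 1) * (eta * (2 * L) + (4 * eta)^-1 * d) = e / 2 * (L / (L + 1)) + e / 2.
  by rewrite /d /eta; field; rewrite !gt_eqF.
rewrite [leRHS](splitr e) lerD2r ler_piMr ?divr_ge0 ?(ltW e0)//.
by rewrite ler_pdivrMr// mul1r lerDl.
Unshelve. all: by end_near. Qed.

End expectations.

Lemma integrable_continuousM {R : realType} (f g : R -> R) (a b : R) : continuous f ->
  (@lebesgue_measure R).-integrable `[a, b] (EFin \o g) ->
  (@lebesgue_measure R).-integrable `[a, b] (EFin \o (fun x => f x * g x)).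
Proof.
move=> cf gi.
have /compact_bounded[M [_ HM]] : compact (f @` `[a, b]).
  by apply: continuous_compact; [exact: continuous_subspaceT|exact: segment_compact].
apply: (integrable_le lebesgue_measure (g := fun x => (`|M| + 1) * `|g x|)) => //.
- apply: measurable_funM; last exact: (integrable_measurable lebesgue_measure gi).
  exact: continuous_measurable.
- apply: (integrableZ lebesgue_measure) => //; exact: (integrable_nrm lebesgue_measure).
- move=> x xab; rewrite normrM ler_wpM2r//.
  have hM : M < `|M| + 1 by rewrite (le_lt_trans (ler_norm M))// ltrDl.
  by apply: (HM _ hM); exists x.
Qed.

(** * The weak formulation as an evolution of expectations *)

Section weak_formulation.
Context {R : realType}.
Notation mu := (@lebesgue_measure R).
Variables (H : R -> R) (CH al be : R) (ell dell rho0 : R -> R) (rho : R -> R -> R).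
Notation h1 := (derive1 H).
Hypothesis cH : confining H h1 (derive1 h1) CH al be.
Hypothesis sol : solution H ell dell rho0 rho.
Hypothesis P0 : P2 rho0.
Implicit Types (phi p q : R -> R) (s t T : R).

Notation sig := (sigma H dell rho).
Notation ev := (ev rho).

Lemma sol_P2 t : 0 <= t -> P2 (rho t).
Proof. by move=> t0; have [] := solution_Ml sol t0. Qed.
Let rP := sol_P2.
Let rM : measurable_space_time rho := solution_measurable sol.

Let CH0 : 0 < CH. Proof. exact: conf_CH cH. Qed.

Let mh1 : measurable_fun setT h1. Proof. exact: measurable_h1 cH. Qed.

(* The time derivative of the expectation of an observable with first and
   second derivatives [p] and [q]. *)
Definition gen p q s : R := ev q s - ev (fun x => h1 x * p x) s + sig s * ev p s.

(** The derivatives [p] and [q] are independent arguments, so that the property passes to limits of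
    triples without differentiating the limit of [phi]. *)
Definition evolves phi p q := forall t, 0 < t ->
  mu.-integrable `[0, t] (EFin \o gen p q) /\
  ev phi t = \int[mu]_x (phi x * rho0 x) + \int[mu]_(s in `[0, t]) gen p q s.

Lemma sig_integrable t : 0 < t -> mu.-integrable `[0, t] (EFin \o sig).
Proof. exact: (solution_sigma sol). Qed.

Lemma measurable_ev_itv (psi : R -> R) c t : measurable_fun setT psi ->
  (forall x, `|psi x| <= c * (1 + x ^+ 2)) -> measurable_fun (`[0, t] : set R) (ev psi).
Proof.
move=> mp pc; have sub : (`[0, t] : set R) `<=` (`[0, +oo[ : set R).
  by move=> s /=; rewrite !in_itv /= => /andP[-> _].
exact: (measurable_funS (measurable_itv _) sub (measurable_ev rP rM mp pc)).
Qed.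

Lemma measurable_gen p q c t : 0 < t -> measurable_fun setT p -> measurable_fun setT q ->
  (forall x, `|p x| <= c * (1 + x ^+ 2)) -> (forall x, `|q x| <= c * (1 + x ^+ 2)) ->
  (forall x, `|h1 x * p x| <= c * (1 + x ^+ 2)) ->
  measurable_fun (`[0, t] : set R) (gen p q).
Proof.
move=> t0 mp mq bp bq bhp; apply: measurable_funD.
  apply: measurable_funB; first exact: (measurable_ev_itv mq bq).
  by apply: (measurable_ev_itv _ bhp); exact: measurable_funM.
apply: measurable_funM; last exact: (measurable_ev_itv mp bp).
exact: (integrable_measurable mu (sig_integrable t0)).
Qed.

(* [om] is a weight with locally bounded expectation dominating all the
   observables involved. *)
Lemma gen_bound (om : R -> R) p q c C M s : 0 <= s ->
  measurable_fun setT om -> measurable_fun setT p -> measurable_fun setT q ->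
  (forall x, 0 <= om x <= c * (1 + x ^+ 2)) -> 0 <= C -> ev om s <= M ->
  (forall x, `|p x| <= C * om x) -> (forall x, `|q x| <= C * om x) ->
  (forall x, `|h1 x * p x| <= C * om x) ->
  `|gen p q s| <= C * M * (2 + `|sig s|).
Proof.
move=> s0 mo mp mq bo C0 evM bp bq bhp.
have bo' x : `|om x| <= c * (1 + x ^+ 2).
  by have /andP[ om0 omc] := bo x; rewrite ger0_norm.
have bo2 x : `|C * om x| <= C * c * (1 + x ^+ 2).
  by rewrite normrM ger0_norm// -mulrA ler_wpM2l.
have mC : measurable_fun setT (fun x => C * om x) by exact: measurable_funM.
have E (psi : R -> R) : measurable_fun setT psi -> (forall x, `|psi x| <= C * om x) -> `|ev psi s| <= C * M.
  move=> mpsi bpsi; apply: le_trans (ev_abs_le rP s0 mpsi mC bo2 bpsi) _.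
  by rewrite (evZ rP _ s0 mo bo') ler_wpM2l.
have e1 := E _ mp bp; have e2 := E _ mq bq; have e3 := E _ (measurable_funM mh1 mp) bhp.
apply: (le_trans (ler_normD _ _)); rewrite mulrDr; apply: lerD.
  by apply: (le_trans (ler_normB _ _)); rewrite mulr_natr mulr2n lerD.
by rewrite normrM mulrC ler_wpM2r.
Qed.

(** Dominated convergence, in space at each time and then in time with majorant
    [C * M * (2 + |sig s|)]. For [phi] the finite second moment at a single time is enough, whereas
    the terms of the generator need the weight [om], whose expectation is bounded on compact time
    intervals. *)
Lemma evolves_limit (om : R -> R) c C (phi_ p_ q_ : nat -> R -> R) phi p q :
  measurable_fun setT om -> (forall x, 0 <= om x <= c * (1 + x ^+ 2)) -> 0 <= C ->
  (forall t, 0 < t -> exists M, forall s, 0 <= s <= t -> ev om s <= M) ->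
  (forall n, [/\ measurable_fun setT (phi_ n), measurable_fun setT (p_ n) &
      measurable_fun setT (q_ n)]) ->
  (forall n x, `|phi_ n x| <= C * (1 + x ^+ 2)) ->
  (forall n x, [/\ `|p_ n x| <= C * om x, `|q_ n x| <= C * om x &
     `|h1 x * p_ n x| <= C * om x]) ->
  (forall x, phi_ n x @[n --> \oo] --> phi x) ->
  (forall x, p_ n x @[n --> \oo] --> p x) ->
  (forall x, q_ n x @[n --> \oo] --> q x) ->
  (forall n, evolves (phi_ n) (p_ n) (q_ n)) -> evolves phi p q.
Proof.
move=> mo bo C0 evM mphi bphi bpq cphi cp cq evo t t0.
have [M HM] := evM t t0.
have bo1 x : `|C * om x| <= C * c * (1 + x ^+ 2).
  by have /andP[ om0 omc] := bo x; rewrite ger0_norm ?mulr_ge0// -mulrA ler_wpM2l.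
have q1 n x : `|p_ n x| <= C * c * (1 + x ^+ 2).
  by have [h _ _] := bpq n x; exact: le_trans (le_trans h (ler_norm _)) (bo1 x).
have q2 n x : `|q_ n x| <= C * c * (1 + x ^+ 2).
  by have [_ h _] := bpq n x; exact: le_trans (le_trans h (ler_norm _)) (bo1 x).
have q3 n x : `|h1 x * p_ n x| <= C * c * (1 + x ^+ 2).
  by have [_ _ h] := bpq n x; exact: le_trans (le_trans h (ler_norm _)) (bo1 x).
have mT : measurable (`[0, t] : set R) by exact: measurable_itv.
have cgen s : (`[0, t] : set R) s -> gen (p_ n) (q_ n) s @[n --> \oo] --> gen p q s.
  rewrite /= in_itv /= => /andP[s0 st].
  apply: cvgD; first apply: cvgB.
  - by apply: (ev_cvg rP s0 _ cq q2) => n; have [] := mphi n.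
  - apply: (ev_cvg rP s0 _ _ q3) => [n|x].
      by have [_ h _] := mphi n; exact: measurable_funM.
    by apply: cvgMl_tmp; exact: cp.
  - by apply: cvgMl_tmp; apply: (ev_cvg rP s0 _ cp q1) => n; have [] := mphi n.
have idom : mu.-integrable `[0, t] (EFin \o (fun s => C * M * (2 + `|sig s|))).
  apply: (integrableZ mu) => //; apply: (integrable_add mu) => //.
    by apply: continuous_integrable_itv; exact: cst_continuous.
  by apply: (integrable_nrm mu) => //; exact: sig_integrable.
have dom n s : (`[0, t] : set R) s -> `|gen (p_ n) (q_ n) s| <= C * M * (2 + `|sig s|).
  rewrite /= in_itv /= => /andP[s0 st]; have [_ m1 m2] := mphi n.
  apply: (gen_bound s0 mo m1 m2 bo C0).
  - by apply: HM; rewrite s0.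
  - by move=> x; have [] := bpq n x.
  - by move=> x; have [] := bpq n x.
  - by move=> x; have [] := bpq n x.
have mgen n : measurable_fun (`[0, t] : set R) (gen (p_ n) (q_ n)).
  by have [i _] := evo n t t0; exact: (integrable_measurable mu i).
have [ig cI] := Rdominated_cvg mu mT mgen cgen idom dom; split => //.
have cE : ev (phi_ n) t @[n --> \oo] --> ev phi t.
  by apply: (ev_cvg rP (ltW t0) _ cphi bphi) => n; have [] := mphi n.
have c0 : \int[mu]_x (phi_ n x * rho0 x) @[n --> \oo] --> \int[mu]_x (phi x * rho0 x).
  have P00 (s : R) : 0 <= s -> P2 ((fun=> rho0) s) by [].
  by apply: (ev_cvg P00 (lexx 0) _ cphi bphi) => n; have [] := mphi n.
have L : (fun n => \int[mu]_x (phi_ n x * rho0 x) + \int[mu]_(s in `[0, t]) gen (p_ n) (q_ n) s) @ \oo -->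
    \int[mu]_x (phi x * rho0 x) + \int[mu]_(s in `[0, t]) gen p q s.
  exact: cvgD.
rewrite (_ : (fun n => _ + _) = fun n => ev (phi_ n) t) in L; last first.
  by apply/funext => n; have [_ ->] := evo n t t0.
exact: (cvg_unique _ cE L).
Qed.

(** Tensor products [theta t * phi x] are admissible test functions and reduce the weak formulation
    to the hypothesis of [weak_pointwise]. *)
Lemma evolves_csupp phi p q : smooth phi -> csupp phi -> has_deriv phi p -> has_deriv p q ->
  evolves phi p q.
Proof.
move=> sphi kphi dphi dq t t0.
have sp := smooth_deriv sphi dphi; have sq := smooth_deriv sp dq.
have kp := csupp_deriv dphi kphi; have kq := csupp_deriv dq kp.
have cphi := smooth_continuous sphi; have cp := smooth_continuous sp.
have cq := smooth_continuous sq.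
have chp : continuous (fun x => h1 x * p x).
  by move=> x; apply: cvgM; [exact: conf_ch1 cH x|exact: cp].
have khp : csupp (fun x => h1 x * p x) by exact: csuppM.
have [c0 c00 b0] := csupp_bounded cphi kphi.
have [c1 c10 b1] := csupp_bounded cp kp.
have [c2 c20 b2] := csupp_bounded cq kq.
have [c3 c30 b3] := csupp_bounded chp khp.
have bnd (f : R -> R) c : 0 <= c -> (forall x, `|f x| <= c) -> forall x, `|f x| <= c * (1 + x ^+ 2).
  by move=> cc0 h x; rewrite (le_trans (h x))// ler_peMr// lerDl sqr_ge0.
(* The cut-offs in time vanish only from [t] on, and their support has to end strictly before the
   horizon. *)
pose T := t + 1; have tT : t < T by rewrite /T ltrDl.
have T0 : 0 < T by exact: lt_trans tT.
have mp := continuous_measurable measurableT cp; have mq := continuous_measurable measurableT cq.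
have mphi := continuous_measurable measurableT cphi.
have mhp := continuous_measurable measurableT chp.
have cst_i (r T' : R) : mu.-integrable `[0, T'] (EFin \o (fun=> r)).
  by apply: continuous_integrable_itv; exact: cst_continuous.
have igen T' : 0 < T' -> mu.-integrable `[0, T'] (EFin \o gen p q).
  move=> T'0; pose C := c1 + c2 + c3; have C0 : 0 <= C by rewrite /C !addr_ge0.
  have p1 x : `|p x| <= C by rewrite (le_trans (b1 x))// /C -addrA lerDl addr_ge0.
  have p2 x : `|q x| <= C by rewrite (le_trans (b2 x))// /C addrAC lerDr addr_ge0.
  have p3 x : `|h1 x * p x| <= C by rewrite (le_trans (b3 x))// /C lerDr addr_ge0.
  apply: (integrable_le mu (g := fun s => C * 1 * (2 + `|sig s|))) => //.
  - exact: (measurable_gen T'0 mp mq (bnd _ _ C0 p1) (bnd _ _ C0 p2) (bnd _ _ C0 p3)).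
  - apply: (integrableZ mu) => //; apply: (integrable_add mu) => //.
    by apply: (integrable_nrm mu) => //; exact: sig_integrable.
  - move=> s /=; rewrite in_itv /= => /andP[s0 _].
    have om1 (x : R) : 0 <= (1 : R) <= 1 * (1 + x ^+ 2).
      by rewrite ler01 /= mul1r lerDl sqr_ge0.
    have ev11 : ev (fun=> 1) s <= 1 by rewrite ev1.
    by apply: (gen_bound s0 _ mp mq om1 C0 ev11) => // x; rewrite mulr1.
split; first exact: igen.
have iev : mu.-integrable `[0, T] (EFin \o ev phi).
  apply: (integrable_le mu (g := fun=> c0)) => //.
    exact: (measurable_ev_itv mphi (bnd _ _ c00 b0)).
  by move=> s /=; rewrite in_itv /= => /andP[s0 _]; exact: (ev_bound rP s0 mphi b0).
apply: (weak_pointwise t0 tT iev (igen T T0)).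
- exact: (ev_continuous rP (solution_continuous sol) cphi kphi t0).
move=> theta beta sth dth cbeta thout.
have zt : space_time_test_function T (fun t x => theta t * phi x).
  split; first exact: smooth2_tensor.
  have [K HK] := kphi; exists t, K; split => // s x s0; rewrite mulf_eq0 negb_or => /andP[ths phx].
  split; rewrite leNgt; apply/negP => h.
    by move: ths; rewrite thout ?eqxx// ltW.
  by move: phx; rewrite HK ?eqxx.
have := solution_weak sol T0 zt; rewrite /=.
have ibe : mu.-integrable `[0, T] (EFin \o (fun s => beta s * ev phi s)).
  by apply: integrable_continuousM.
have ithg : mu.-integrable `[0, T] (EFin \o (fun s => theta s * gen p q s)).
  apply: integrable_continuousM; [exact: smooth_continuous|exact: igen].
have E0 : \int[mu]_x (theta 0 * phi x * rho0 x) = theta 0 * \int[mu]_x (phi x * rho0 x).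
  rewrite -RintegralZl//; last exact: (P2_integrable P0 mphi (bnd _ _ c00 b0)).
  by apply: (Rintegral_ext mu) => x _; rewrite mulrA.
have E1 : \int[mu]_(s in `[0, T]) \int[mu]_x (rho s x *
      partial_t (fun t x => theta t * phi x) s x) = - \int[mu]_(s in `[0, T]) (beta s * ev phi s).
  have pt s x : partial_t (fun t x => theta t * phi x) s x = - beta s * phi x.
    have d : has_deriv (fun s => theta s * phi x) (fun s => - beta s * phi x).
      by apply: (has_deriv_ext _ _ (has_derivZ (phi x) dth)) => u; rewrite mulrC.
    by rewrite /partial_t (has_deriv_derive1 d).
  rewrite -[RHS]mulN1r -RintegralZl//; apply: (Rintegral_ext mu) => s /=.
  rewrite in_itv /= => /andP[s0 _].
  rewrite (Rintegral_ext mu (g := fun x => - beta s * (phi x * rho s x))); last first.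
    by move=> x _; rewrite pt; ring.
  rewrite RintegralZl//; first by rewrite /ev; ring.
  exact: (ev_integrable rP s0 mphi (bnd _ _ c00 b0)).
have pxE : partial_x (fun t x => theta t * phi x) = fun t x => theta t * p x.
  apply/funext => s; apply/funext => x; rewrite /partial_x.
  by rewrite (has_deriv_derive1 (has_derivZ (theta s) dphi)).
have pxxE : partial_x (fun t x => theta t * p x) = fun t x => theta t * q x.
  apply/funext => s; apply/funext => x; rewrite /partial_x.
  by rewrite (has_deriv_derive1 (has_derivZ (theta s) dq)).
have E2 : \int[mu]_(s in `[0, T]) \int[mu]_x (rho s x * ((h1 x - sig s) *
      partial_x (fun t x => theta t * phi x) s x -
      partial_x (partial_x (fun t x => theta t * phi x)) s x)) =
    - \int[mu]_(s in `[0, T]) (theta s * gen p q s).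
  rewrite pxE pxxE -[RHS]mulN1r -RintegralZl//; apply: (Rintegral_ext mu) => s /=.
  rewrite in_itv /= => /andP[s0 _].
  have ip := ev_integrable rP s0 mp (bnd _ _ c10 b1).
  have iq := ev_integrable rP s0 mq (bnd _ _ c20 b2).
  have ihp := ev_integrable rP s0 mhp (bnd _ _ c30 b3).
  rewrite (Rintegral_ext mu (g := fun x => - theta s * (q x * rho s x - h1 x * p x * rho s x +
    sig s * (p x * rho s x)))); last by move=> x _; ring.
  have j1 := integrable_sub mu measurableT iq ihp.
  have j2 := integrableZ mu (sig s) measurableT ip.
  rewrite (RintegralZl (- theta s) _ (integrable_add mu measurableT j1 j2))//.
  rewrite (RintegralD _ j1 j2)// (RintegralB _ iq ihp)// (RintegralZl _ _ ip)//.
  by rewrite /gen /ev; ring.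
by rewrite E0 E1 E2 opprK.
Qed.

End weak_formulation.

(** * Unbounded observables *)

Section cutoffs.
Context {R : realType}.
Implicit Types (f p phi h : R -> R).

Lemma flat_deriv_bounded phi p : has_deriv phi p -> csupp p -> exists2 c, 0 <= c &
  forall x, `|phi x| <= c.
Proof.
move=> d [K HK]; pose L := `|K| + 1.
have L0 : 0 <= L by rewrite addr_ge0.
have [c c0 bc] : exists2 c, 0 <= c & forall x, `|x| <= L -> `|phi x| <= c.
  have /compact_bounded[M [_ HM]] : compact (phi @` `[- L, L]).
    apply: continuous_compact; last exact: segment_compact.
    exact/continuous_subspaceT/(has_deriv_continuous d).
  exists (`|M| + 1) => [|x xL]; first by rewrite addr_ge0.
  have hM : M < `|M| + 1 by rewrite (le_lt_trans (ler_norm M))// ltrDl.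
  by apply: (HM _ hM); exists x => //=; rewrite in_itv /= -ler_norml.
exists c => // x; have [|xL] := leP `|x| L; first exact: bc.
have KL : K < L by rewrite (le_lt_trans (ler_norm K))// ltrDl.
have bL : `|L| <= L by rewrite ger0_norm.
have bL' : `|- L| <= L by rewrite normrN.
have [x0|x0] := leP 0 x.
  rewrite ger0_norm// in xL.
  have [y /andP[Ly _] e] := mean_value d (ltW xL).
  move: e; rewrite HK ?mul0r; last by rewrite (lt_le_trans KL)// (le_trans Ly)// ler_norm.
  by move/eqP; rewrite subr_eq0 => /eqP ->; exact: bc.
rewrite ltr0_norm// in xL; have xL' : x <= - L by rewrite lerNr ltW.
have [y /andP[_ yL] e] := mean_value d xL'.
move: e; rewrite HK ?mul0r; last first.
  by rewrite (lt_le_trans KL)// (@le_trans _ _ (- y))// 1?lerNr// -normrN ler_norm.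
by move/eqP; rewrite subr_eq0 => /eqP <-; exact: bc.
Qed.

(** Modelled on the dilations [c0 (x / (n+1))]. The weighted bound on [d1 n] expresses that this
    derivative has size [1/(n+1)] and lives on [|x| <= n+1]; it absorbs one factor of linear growth,
    such as that of [H']. *)
Definition cutoffs (K : R) (chi d1 d2 : nat -> R -> R) :=
  [/\ 1 <= K,
   forall n, [/\ smooth (chi n), csupp (chi n), has_deriv (chi n) (d1 n) &
      has_deriv (d1 n) (d2 n)],
   forall n x, [/\ 0 <= chi n x, chi n x <= K, (1 + `|x|) * `|d1 n x| <= K & `|d2 n x| <= K],
   forall n x, `|chi n x - 1| <= K * `|x| * n.+1%:R^-1 &
   forall n x, `|d1 n x| <= K * n.+1%:R^-1 /\ `|d2 n x| <= K * n.+1%:R^-1].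

Lemma cutoff_exists : exists K chi d1 d2, cutoffs K chi d1 d2.
Proof.
pose g0 : R := sbump (-1) 1 1 0.
have g00 : 0 < g0 by apply: sbump_gt0 => //; apply/andP; split; rewrite ?ltrN10 ?ltr01.
(* Normalized to 1 at 0, so that the dilations tend to 1 pointwise. *)
pose c0 : R -> R := fun x => g0^-1 * sbump (-1) 1 1 x.
have s0 : smooth c0 by apply: smoothZ; exact: smooth_sbump.
have k0 x : 1 < `|x| -> c0 x = 0.
  move=> x1; rewrite /c0 sbump_out ?mulr0//; apply/negP => /andP[a b].
  by move: x1; rewrite ltNge => /negP; apply; rewrite ler_norml !ltW.
have kc0 : csupp c0 by exists 1.
have e0 : has_deriv c0 (derive1n 1 c0) by have := smooth_has_deriv 0 s0; rewrite derive1n0.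
have e1 := smooth_has_deriv 1 s0.
set c1 := derive1n 1 c0 in e0 e1; set c2 := derive1n 2 c0 in e1.
have s1 := smooth_deriv s0 e0; have s2 := smooth_deriv s1 e1.
have kc1 x : 1 < `|x| -> c1 x = 0.
  move=> x1; have nr : \near x, 0 = c0 x.
    have : \forall y \near x, 1 < `|y| by exact: (cvgr_norm_gt x cvg_id).
    by apply: filterS => y /k0 ->.
  have [_ f1] := near_eq_is_derive nr (is_derive_cst (0 : R) x 1).
  by have [_ f2] := e0 x; rewrite -f2.
have kc1' := csupp_deriv e0 kc0; have kc2 := csupp_deriv e1 kc1'.
have [K0 K00 B0] := csupp_bounded (smooth_continuous s0) kc0.
have [K1 K10 B1] := csupp_bounded (smooth_continuous s1) kc1'.
have [K2 K20 B2] := csupp_bounded (smooth_continuous s2) kc2.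
pose K := 1 + K0 + 2 * K1 + K2.
have c00 : c0 0 = 1 by rewrite /c0 mulVf// gt_eqF.
pose e (n : nat) : R := n.+1%:R^-1.
have e_0 n : 0 <= e n by rewrite invr_ge0.
have e_1 n : e n <= 1 by rewrite invf_le1// ler1n.
have dn n f f' : has_deriv f f' -> has_deriv (fun x => f (e n * x)) (fun x => e n * f' (e n * x)).
  move=> d; have da : has_deriv (fun x => e n * x) (fun=> e n).
    by apply: (has_deriv_eq (has_derivZ (e n) (@has_deriv_id R))) => x; rewrite mulr1.
  by apply: (has_deriv_eq (has_deriv_comp d da)) => x; rewrite mulrC.
have d1b n x : `|e n * c1 (e n * x)| <= K1 * e n.
  by rewrite normrM (ger0_norm (e_0 n)) mulrC ler_wpM2r.
have d2b n x : `|e n * (e n * c2 (e n * x))| <= K2 * e n.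
  rewrite !normrM !(ger0_norm (e_0 n)) mulrC ler_wpM2r//.
  by rewrite (le_trans (ler_piMl _ (e_1 n)))// B2.
have K1le : 1 <= K by rewrite /K -!addrA lerDl !addr_ge0// mulr_ge0.
exists K, (fun n x => c0 (e n * x)), (fun n x => e n * c1 (e n * x)),
  (fun n x => e n * (e n * c2 (e n * x))); split; first exact: K1le.
- move=> n; split.
  + rewrite (_ : (fun x => _) = fun x => c0 (e n * x + 0)); first exact: smooth_affine_comp.
    by apply/funext => x; rewrite addr0.
  + exists n.+1%:R => x nx; apply: k0; rewrite normrM (ger0_norm (e_0 n)).
    by rewrite /e -ltr_pdivrMl ?invr_gt0 ?ltr0n// invrK mulr1.
  + exact: dn.
  + exact/has_derivZ/dn.
- move=> n x; split.
  + by rewrite mulr_ge0 ?sbump_ge0// invr_ge0 ltW.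
  + rewrite (le_trans (ler_norm _))// (le_trans (B0 _))// /K addrAC -!addrA.
    by rewrite addrCA lerDl !addr_ge0// mulr_ge0.
  + rewrite mulrDl mul1r; apply: (@le_trans _ _ (K1 + K1)).
      apply: lerD; first by rewrite (le_trans (d1b n x))// ler_piMr.
      rewrite normrM (ger0_norm (e_0 n)) mulrA.
      have [h|h] := leP `|e n * x| 1; last by rewrite kc1// normr0 mulr0.
      rewrite normrM (ger0_norm (e_0 n)) mulrC in h.
      by rewrite (le_trans (ler_wpM2r _ h))// mul1r B1.
    by rewrite /K (_ : 2 * K1 = K1 + K1) 1?addrAC ?lerDr ?addr_ge0// mulr_natl mulr2n.
  + by rewrite (le_trans (d2b n x))// (le_trans (ler_piMr K20 (e_1 n)))// /K lerDr !addr_ge0// mulr_ge0.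
- move=> n x; have := @has_deriv_lip R c0 c1 K1 0 (e n * x) e0 B1.
  rewrite c00 subr0 normrM (ger0_norm (e_0 n)) => lip; apply: (le_trans lip).
  rewrite (_ : K1 * _ = K1 * (`|x| * e n)); last by ring.
  rewrite -mulrA ler_wpM2r ?mulr_ge0//.
  by rewrite /K mulr_natl mulr2n; move: K00 K10 K20; clear; lra.
- move=> n x; split.
    apply: (le_trans (d1b n x)); rewrite ler_wpM2r//.
    by rewrite /K mulr_natl mulr2n; move: K00 K10 K20; clear; lra.
  apply: (le_trans (d2b n x)); rewrite ler_wpM2r//.
  by rewrite /K mulr_natl mulr2n; move: K00 K10 K20; clear; lra.
Qed.

Lemma harmonic_bound_cvg (u : nat -> R) l c :
  (forall n, `|u n - l| <= c * n.+1%:R^-1) -> u n @[n --> \oo] --> l.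
Proof.
move=> h; apply/subr_cvg0/norm_cvg0P.
have l0 : c * n.+1%:R^-1 @[n --> \oo] --> (0 : R).
  rewrite -[X in _ --> X](mulr0 c); apply: cvgMl_tmp; exact: cvg_harmonic.
apply: (squeeze_cvgr _ (cvg_cst 0) l0).
by apply: nearW => n; rewrite normr_ge0 h.
Qed.

Lemma cutoffs_cvg K chi d1 d2 : cutoffs K chi d1 d2 -> forall x,
  [/\ chi n x @[n --> \oo] --> (1 : R), d1 n x @[n --> \oo] --> (0 : R) &
    d2 n x @[n --> \oo] --> (0 : R)].
Proof.
move=> [_ _ _ c1 c2] x; split.
- exact: (harmonic_bound_cvg (c1^~ x)).
- by apply: (@harmonic_bound_cvg _ _ K) => n; rewrite subr0; have [] := c2 n x.
- by apply: (@harmonic_bound_cvg _ _ K) => n; rewrite subr0; have [] := c2 n x.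
Qed.

Lemma has_deriv_bound0 (F f : R -> R) c x : has_deriv F f ->
  (forall y, `|y| <= `|x| -> `|f y| <= c) -> `|F x - F 0| <= c * `|x|.
Proof.
move=> d b; have [x0|x0] := leP 0 x.
  have [y /andP[y0 yx] ->] := mean_value d x0.
  rewrite subr0 normrM ler_wpM2r//.
  by apply: b; rewrite !ger0_norm.
have [y /andP[xy y0] e] := mean_value d (ltW x0).
rewrite distrC e sub0r normrM normrN ler_wpM2r//.
by apply: b; rewrite !ler0_norm ?lerN2// ltW.
Qed.

End cutoffs.

Lemma flat_sums {R : realFieldType} (a b c d e : R) :
  0 <= a -> 0 <= b -> 0 <= c -> 0 <= d -> 0 <= e ->
  [/\ b + a <= a + 2 * b + c + d + e, c + b + (b + a) <= a + 2 * b + c + d + e &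
      d + e <= a + 2 * b + c + d + e].
Proof. by move=> *; split; lra. Qed.

Lemma quad_of_lin {R : realFieldType} (x : R) : (1 + x) * x <= 2 * (1 + x ^+ 2).
Proof. by have := sqr_ge0 (x - 1); nra. Qed.

Lemma Rintegral_itv_le {R : realType} (f g : R -> R) (a b : R) :
  (@lebesgue_measure R).-integrable `[a, b] (EFin \o f) ->
  (@lebesgue_measure R).-integrable `[a, b] (EFin \o g) ->
  (forall s, a <= s <= b -> f s <= g s) ->
  \int[@lebesgue_measure R]_(s in `[a, b]) f s <=
  \int[@lebesgue_measure R]_(s in `[a, b]) g s.
Proof.
by move=> i j fg; exact: le_Rintegral.
Qed.

(** * Observables with derivatives of linear growth, and the first moment *)

Section observables.
Context {R : realType}.
Notation mu := (@lebesgue_measure R).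
Variables (H : R -> R) (CH al be : R) (ell dell rho0 : R -> R) (rho : R -> R -> R).
Notation h1 := (derive1 H).
Hypothesis cH : confining H h1 (derive1 h1) CH al be.
Hypothesis sol : solution H ell dell rho0 rho.
Hypothesis P0 : P2 rho0.
Implicit Types (phi p q h : R -> R) (s t T : R).

Notation sig := (sigma H dell rho).
Notation ev := (ev rho).
Notation gen := (gen H dell rho).
Notation evolves := (evolves H dell rho0 rho).

Let rP := sol_P2 sol.
Let CH0 : 0 < CH. Proof. exact: conf_CH cH. Qed.
Let mh1 : measurable_fun setT h1. Proof. exact: measurable_h1 cH. Qed.

Variables (K : R) (chi d1 d2 : nat -> R -> R).
Hypothesis cut : cutoffs K chi d1 d2.

Let K1 : 1 <= K. Proof. by have [] := cut. Qed.
Let K0 : 0 <= K. Proof. exact: le_trans ler01 K1. Qed.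

Lemma chi_norm n x : `|chi n x| <= K.
Proof. by have [_ _ /(_ n x)[c0 cK _ _] _ _] := cut; rewrite ger0_norm. Qed.

Lemma lin_cutoff_deriv n x (u B : R) : `|u| <= B * (1 + `|x|) -> `|u * d1 n x| <= B * K.
Proof.
move=> hu; have B0 : 0 <= B.
  by rewrite -(@pmulr_lge0 _ (1 + `|x|)) ?ltr_pwDl// (le_trans _ hu).
have [_ _ /(_ n x)[_ _ h _] _ _] := cut.
rewrite normrM (le_trans (ler_wpM2r (normr_ge0 _) hu))// -mulrA ler_wpM2l//.
Qed.

(** Here [phi] is constant near each infinity, hence bounded. The term [h1 * phi * d1 n] created by
    the cut-off stays bounded by [lin_cutoff_deriv], and the weight 1 suffices for the passage to
    the limit. *)
Lemma evolves_flat phi p q : smooth phi -> has_deriv phi p -> has_deriv p q -> csupp p ->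
  evolves phi p q.
Proof.
move=> sphi dphi dq kp.
have sp := smooth_deriv sphi dphi; have sq := smooth_deriv sp dq.
have cphi := smooth_continuous sphi; have cp := smooth_continuous sp.
have cq := smooth_continuous sq; have kq := csupp_deriv dq kp.
have [c0 c00 b0] := flat_deriv_bounded dphi kp.
have [c1 c10 b1] := csupp_bounded cp kp.
have [c2 c20 b2] := csupp_bounded cq kq.
have chp : continuous (fun x => h1 x * p x).
  by move=> x; apply: cvgM; [exact: conf_ch1 cH x|exact: cp].
have [c3 c30 b3] := csupp_bounded chp (csuppM h1 kp).
have [_ cutn cutb _ _] := cut.
pose phi_ n x := phi x * chi n x.
pose p_ n x := p x * chi n x + phi x * d1 n x.
pose q_ n x := (q x * chi n x + p x * d1 n x) + (p x * d1 n x + phi x * d2 n x).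
have dp_ n : has_deriv (phi_ n) (p_ n).
  by have [_ _ e1 _] := cutn n; exact: has_derivM.
have dq_ n : has_deriv (p_ n) (q_ n).
  by have [_ _ e1 e2] := cutn n; apply: has_derivD; exact: has_derivM.
have sphi_ n : smooth (phi_ n) by have [s1 _ _ _] := cutn n; exact: smoothM.
have d1K n x : `|d1 n x| <= K.
  have [_ _ h _] := cutb n x; apply: le_trans h.
  by rewrite ler_peMl// lerDl.
have e n : evolves (phi_ n) (p_ n) (q_ n).
  apply: (evolves_csupp cH sol P0 (sphi_ n)) => //; apply: csuppM.
  by have [] := cutn n.
pose C := K * (c0 + 2 * c1 + c2 + c3 + CH * c0).
have C0 : 0 <= C by rewrite /C mulr_ge0// !addr_ge0// mulr_ge0// ltW.
have cst1 (x : R) : 0 <= (1 : R) <= 1 * (1 + x ^+ 2) by rewrite ler01 mul1r lerDl sqr_ge0.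
have mul2 (a b c d : R) : `|a| <= c -> `|b| <= d -> `|a * b| <= c * d.
  by move=> ha hb; rewrite normrM ler_pM.
have CHc : 0 <= CH * c0 by rewrite mulr_ge0// ltW.
have [e1 e2 e3] := flat_sums c00 c10 c20 c30 CHc.
apply: (evolves_limit cH sol P0 (om := fun=> 1) (c := 1) (C := C) _ cst1 C0
  (phi_ := phi_) (p_ := p_) (q_ := q_)).
- exact: measurable_cst.
- move=> t t0; exists 1 => s /andP[s0 _]; by rewrite ev1.
- move=> n; have sp_ := smooth_deriv (sphi_ n) (dp_ n); have sq_ := smooth_deriv sp_ (dq_ n).
  split; apply: (continuous_measurable measurableT).
  + exact: smooth_continuous (sphi_ n).
  + exact: smooth_continuous sp_.
  + exact: smooth_continuous sq_.
- move=> n x; apply: (@le_trans _ _ C); last by rewrite ler_peMr// lerDl sqr_ge0.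
  apply: (le_trans (mul2 _ _ _ _ (b0 x) (chi_norm n x))).
  by rewrite mulrC /C ler_wpM2l// -!addrA lerDl !addr_ge0// mulr_ge0.
- move=> n x; rewrite mulr1; split.
  + apply: (le_trans (ler_normD _ _)).
    apply: (le_trans (lerD (mul2 _ _ _ _ (b1 x) (chi_norm n x)) (mul2 _ _ _ _ (b0 x) (d1K n x)))).
    by rewrite -mulrDl mulrC /C ler_wpM2l.
  + have [_ _ _ d2K] := cutb n x.
    apply: (le_trans (ler_normD _ _)).
    apply: (le_trans (lerD (ler_normD _ _) (ler_normD _ _))).
    apply: (le_trans (lerD (lerD (mul2 _ _ _ _ (b2 x) (chi_norm n x)) (mul2 _ _ _ _ (b1 x) (d1K n x)))
      (lerD (mul2 _ _ _ _ (b1 x) (d1K n x)) (mul2 _ _ _ _ (b0 x) d2K)))).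
    by rewrite -!mulrDl mulrC /C ler_wpM2l.
  + rewrite mulrDr mulrA [h1 x * (_ * _)]mulrCA.
    apply: (le_trans (ler_normD _ _)).
    apply: (le_trans (lerD (mul2 _ _ _ _ (b3 x) (chi_norm n x))
      (mul2 _ _ _ _ (b0 x) (lin_cutoff_deriv n (conf_h1 cH x))))).
    rewrite [c0 * _]mulrCA mulrA [CH * c0 * K]mulrC [c3 * K]mulrC -mulrDr /C.
    by rewrite ler_wpM2l.
- move=> x; have [l1 _ _] := cutoffs_cvg cut x.
  rewrite -[X in _ --> X]mulr1; exact: cvgMl_tmp.
- move=> x; have [l1 l2 _] := cutoffs_cvg cut x.
  rewrite -[X in _ --> X](_ : p x * 1 + phi x * 0 = _); last by rewrite mulr1 mulr0 addr0.
  by apply: cvgD; exact: cvgMl_tmp.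
- move=> x; have [l1 l2 l3] := cutoffs_cvg cut x.
  rewrite -[X in _ --> X](_ : (q x * 1 + p x * 0) + (p x * 0 + phi x * 0) = _); last by ring.
  by apply: cvgD; apply: cvgD; exact: cvgMl_tmp.
- exact: e.
Qed.

(** The derivative [h] is cut off and then integrated, rather than [phi] itself: no term
    [phi * d1 n] arises, and the drift term [h1 * h * chi n] keeps the sign of [h1 * h], which the
    moment estimates exploit. *)
Lemma lin_growth_approx phi h h' B : smooth h -> has_deriv phi h -> has_deriv h h' ->
  (forall x, `|h x| <= B * (1 + `|x|)) -> exists (C : R) (phi_ : nat -> R -> R),
  [/\ forall n, smooth (phi_ n), forall n x, `|phi_ n x| <= C * (1 + x ^+ 2),
    forall x, phi_ n x @[n --> \oo] --> phi x &
    forall n, evolves (phi_ n) (fun x => h x * chi n x)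
                               (fun x => h' x * chi n x + h x * d1 n x)].
Proof.
move=> sh dphi dh bh; have [_ cutn cutb cut1 _] := cut.
have B0 : 0 <= B by have := le_trans (normr_ge0 _) (bh 0); rewrite normr0 addr0 mulr1.
have sp_ n : smooth (fun x => h x * chi n x).
  by have [s1 _ _ _] := cutn n; exact: smoothM.
have A n : exists F, has_deriv F (fun x => h x * chi n x) /\ F 0 = phi 0.
  have [F d e] := antiderivative_exists (phi 0) (smooth_continuous (sp_ n)).
  by exists F.
have [phi_ Hphi] := choice A.
exists (`|phi 0| + 2 * (B * K)), phi_; split.
- by move=> n; have [d _] := Hphi n; exact: smooth_antideriv d (sp_ n).
- move=> n x; have [d e] := Hphi n.
  have b y : `|y| <= `|x| -> `|h y * chi n y| <= B * K * (1 + `|x|).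
    move=> yx; rewrite normrM mulrAC ler_pM ?chi_norm// (le_trans (bh y))//.
    by rewrite ler_wpM2l// lerD2l.
  have := has_deriv_bound0 d b; rewrite e => bd.
  have -> : phi_ n x = phi 0 + (phi_ n x - phi 0) by ring.
  apply: (le_trans (ler_normD _ _)); apply: (le_trans (lerD (lexx _) bd)).
  rewrite mulrDl lerD//; first by rewrite ler_peMr// lerDl sqr_ge0.
  rewrite (_ : 2 * (B * K) * _ = B * K * (2 * (1 + x ^+ 2))); last by ring.
  rewrite -[leLHS]mulrA ler_wpM2l ?mulr_ge0// -(real_normK (num_real x)).
  exact: quad_of_lin.
- move=> x; apply: (@harmonic_bound_cvg _ _ _ (B * (1 + `|x|) * (K * `|x|) * `|x|)) => n.
  have [d e] := Hphi n; have dd := has_derivB d dphi.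
  have b y : `|y| <= `|x| -> `|h y * chi n y - h y| <= B * (1 + `|x|) * (K * `|x| * n.+1%:R^-1).
    move=> yx; rewrite (_ : _ - _ = h y * (chi n y - 1)); last by ring.
    rewrite normrM ler_pM//; first by rewrite (le_trans (bh y))// ler_wpM2l// lerD2l.
    by rewrite (le_trans (cut1 n y))// ler_wpM2r ?invr_ge0// ler_wpM2l.
  have := has_deriv_bound0 dd b; rewrite e subrr subr0 => /le_trans; apply.
  by rewrite !mulrA mulrAC.
- move=> n; have [d e] := Hphi n; have [_ kn e1 _] := cutn n.
  apply: (evolves_flat (smooth_antideriv d (sp_ n)) d (has_derivM dh e1)).
  exact: csuppM.
Qed.

(** An upper bound on the generators of the approximations, uniform in [n], is enough for a
    one-sided conclusion. This starts the chain of moment bounds, where no majorant for a full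
    passage to the limit is available yet. *)
Lemma growth_bound phi h h' B g t : smooth h -> has_deriv phi h -> has_deriv h h' ->
  (forall x, `|h x| <= B * (1 + `|x|)) -> 0 < t -> mu.-integrable `[0, t] (EFin \o g) ->
  (forall n s, 0 <= s <= t ->
    gen (fun x => h x * chi n x) (fun x => h' x * chi n x + h x * d1 n x) s <= g s) ->
  ev phi t <= \int[mu]_x (phi x * rho0 x) + \int[mu]_(s in `[0, t]) g s.
Proof.
move=> sh dphi dh bh t0 ig bg.
have [C [phi_ [s_ b_ l_ e_]]] := lin_growth_approx sh dphi dh bh.
have m_ n : measurable_fun setT (phi_ n).
  exact: (continuous_measurable measurableT (smooth_continuous (s_ n))).
have P00 (s : R) : 0 <= s -> P2 ((fun=> rho0) s) by [].
have L1 := ev_cvg rP (ltW t0) m_ l_ b_.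
have L2 := ev_cvg P00 (lexx 0) m_ l_ b_.
rewrite -lerBlDl; apply: (cvgr_to_le (cvgB L1 L2)).
apply: nearW => n; have [i e] := e_ n t t0.
change (ev (phi_ n) t - \int[mu]_x (phi_ n x * rho0 x) <= \int[mu]_(s in `[0, t]) g s).
rewrite e addrAC subrr add0r.
by apply: (Rintegral_itv_le i ig) => s; exact: bg.
Qed.

(** Beyond [r0], [x^2 >= r0 >= |be| / al], so that the coercivity makes [x * h1 x] nonnegative. *)
Let r0 := 1 + `|be| / al.

Lemma conf_xh1_nonneg x : r0 <= `|x| -> 0 <= x * h1 x.
Proof.
move=> xr; apply: le_trans (conf_xh1_ge cH x); have al0 := conf_al cH.
rewrite subr_ge0 (le_trans (ler_norm be))// mulrC -ler_pdivrMr//.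
rewrite -(real_normK (num_real x)) expr2.
have r1 : 1 <= r0 by rewrite /r0 lerDl divr_ge0// ltW.
have br : `|be| / al <= r0 by rewrite /r0 lerDr.
apply: (le_trans br); apply: (le_trans xr); rewrite ler_peMr//; exact: le_trans xr.
Qed.

Lemma smooth_logistic : smooth (@logistic R).
Proof.
have d : has_deriv (@logistic R) (poly_ker 1 1).
  apply: (has_deriv_eq has_deriv_logistic) => x.
  by rewrite poly_ker1 /ker mul1r !mul1r.
apply: (smooth_antideriv d).
pose F := fix F n := if n is n.+1 then ker_step (F n) else 1%R : {poly R}.
apply: (deriv_seq_smooth (F := fun n => poly_ker 1 (F n))) => n.
by apply: (has_deriv_eq (has_deriv_poly_ker 1 (F n))) => x; rewrite mul1r.
Qed.

(** The observable is a smooth majorant of [|x|] with derivative bounded by 1: its force term is at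
    most a multiple of [|sig|], integrable in time without any moment bound, and the confinement
    bounds its drift term from above. *)
Lemma abs_moment_bounded t : 0 < t -> exists M, forall s, 0 <= s <= t ->
  ev (fun x => `|x|) s <= M.
Proof.
move=> t0.
(* This is [2 ln (2 cosh (x / 2))], and [h] is [tanh (x / 2)]. *)
pose phi (x : R) := x + 2 * ln (1 + expR (- x)).
pose h (x : R) := 2 * logistic x - 1.
pose h' (x : R) := 2 * (logistic x * (1 - logistic x)).
have den (x : R) : 0 < 1 + expR (- x) by exact: logistic_den_gt0.
have dphi : has_deriv phi h.
  have dm : has_deriv (fun x : R => expR (- x)) (fun x => - 1 * expR (- x)).
    exact: has_deriv_expR (has_derivN (@has_deriv_id R)).
  have dl := has_deriv_ln den (has_derivD (has_deriv_cst 1) dm).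
  apply: (has_deriv_eq (has_derivD (@has_deriv_id R) (has_derivZ 2 dl))) => x.
  by rewrite /h /logistic; have := den x; set e := expR _ => e0; field; rewrite gt_eqF.
have dh : has_deriv h h'.
  apply: (has_deriv_eq (has_derivB (has_derivZ 2 has_deriv_logistic) (has_deriv_cst 1))) => x.
  by rewrite /h' subr0.
have sh : smooth h.
  have e : has_deriv h (fun x => 2 * poly_ker 1 1 x).
    by apply: (has_deriv_eq dh) => x; rewrite /h' poly_ker1 /ker !mul1r.
  apply: (smooth_antideriv e); apply: smoothZ.
  apply: (smooth_deriv smooth_logistic); apply: (has_deriv_eq has_deriv_logistic) => x.
  by rewrite poly_ker1 /ker !mul1r.
have lg0 (x : R) : 0 < logistic x by exact: logistic_gt0.
have lg1 (x : R) : logistic x < 1 by exact: logistic_lt1.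
have h_1 x : `|h x| <= 1.
  by rewrite ler_norml /h; apply/andP; split; have := lg0 x; have := lg1 x; lra.
have h'_1 x : `|h' x| <= 1.
  have a := lg0 x; have b := lg1 x.
  have a0 : 0 <= h' x by rewrite /h' !mulr_ge0 ?subr_ge0// ltW.
  by rewrite ger0_norm// /h'; have := sqr_ge0 (logistic x - 1 / 2); nra.
have sgn x : 0 <= x * h x.
  have -> : x * h x = x * (2 * logistic x - 1) by [].
  have e : 2 * logistic x - 1 = (1 - expR (- x)) / (1 + expR (- x)).
    by rewrite /logistic; have := den x; set e := expR _ => e0; field; rewrite gt_eqF.
  rewrite e mulrA; apply: divr_ge0; last exact: ltW.
  have [x0|/ltW x0] := leP 0 x.
    by apply: mulr_ge0 => //; rewrite subr_ge0 -[leRHS]expR0 ler_expR oppr_le0.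
  by apply: mulr_le0 => //; rewrite subr_le0 -[leLHS]expR0 ler_expR oppr_ge0.
have r00 : 0 <= r0 by apply: addr_ge0 => //; apply: divr_ge0 => //; exact/ltW/(conf_al cH).
pose c := CH * (1 + r0).
have c0 : 0 <= c by apply: mulr_ge0; [exact: ltW|exact: addr_ge0].
have cK0 : 0 <= c * K by exact: mulr_ge0.
have h1h x : - (h1 x * h x) <= c.
  have [xr|xr] := leP r0 `|x|.
    rewrite (le_trans _ c0)// oppr_le0.
    have [->|x0] := eqVneq x 0; last first.
      have := mulr_ge0 (conf_xh1_nonneg xr) (sgn x).
      rewrite (_ : _ * _ = x ^+ 2 * (h1 x * h x)); last by ring.
      by rewrite pmulr_rge0// exprn_even_gt0.
    by rewrite /h /logistic oppr0 expR0 (_ : 2 * _ - 1 = 0 :> R) ?mulr0//; field.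
  rewrite (le_trans (ler_norm _))// normrN normrM -[leRHS]mulr1 ler_pM//.
  by rewrite (le_trans (conf_h1 cH x))// /c ler_wpM2l ?(ltW CH0)// lerD2l ltW.
pose g s := 2 * K + c * K + K * `|sig s|.
have ig t' : 0 < t' -> mu.-integrable `[0, t'] (EFin \o g).
  move=> t'0; apply: (integrable_add mu) => //.
    by apply: continuous_integrable_itv; exact: cst_continuous.
  apply: (integrableZ mu) => //; apply: (integrable_nrm mu) => //.
  exact: (sig_integrable sol).
have lin (u : R -> R) x : (forall x, `|u x| <= 1) -> `|u x| <= 1 * (1 + `|x|).
  by move=> hu; rewrite mul1r (le_trans (hu x))// lerDl.
have ex x : `|x| <= phi x.
  rewrite /phi; have [x0|x0] := leP 0 x.
    by rewrite ger0_norm// lerDl; apply: mulr_ge0 => //; apply: ln_ge0; rewrite lerDl expR_ge0.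
  rewrite ltr0_norm//; suff : - x <= ln (1 + expR (- x)) by lra.
  by rewrite -[leLHS]expRK ler_ln ?posrE ?expR_gt0// lerDr.
have ub t' : 0 < t' ->
    ev phi t' <= \int[mu]_x (phi x * rho0 x) + \int[mu]_(s in `[0, t']) g s.
  move=> t'0; apply: (growth_bound sh dphi dh (fun x => lin h x h_1) t'0 (ig t' t'0)).
  move=> n s /andP[s0 _].
  have [_ cutn _ _ _] := cut; have [s1 _ e1 _] := cutn n.
  have mchi : measurable_fun setT (chi n).
    exact: (continuous_measurable measurableT (smooth_continuous s1)).
  have md1 : measurable_fun setT (d1 n).
    exact: (continuous_measurable measurableT (smooth_continuous (smooth_deriv s1 e1))).
  have mh : measurable_fun setT h.
    exact: (continuous_measurable measurableT (smooth_continuous sh)).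
  have mh' : measurable_fun setT h'.
    exact: (continuous_measurable measurableT (smooth_continuous (smooth_deriv sh dh))).
  have bp x : `|h x * chi n x| <= K.
    by rewrite normrM -[leRHS]mul1r ler_pM ?chi_norm.
  have q1 : ev (fun x => h' x * chi n x + h x * d1 n x) s <= 2 * K.
    apply: le_trans (ler_norm _) _; apply: (ev_bound rP s0).
      by apply: measurable_funD; exact: measurable_funM.
    move=> x; rewrite mulr_natl mulr2n (le_trans (ler_normD _ _))// lerD//.
      by rewrite normrM -[leRHS]mul1r ler_pM ?chi_norm.
    by rewrite -[leRHS]mul1r lin_cutoff_deriv// lin.
  have q2 : - ev (fun x => h1 x * (h x * chi n x)) s <= c * K.
    have bb x : `|h1 x * (h x * chi n x)| <= 2 * CH * K * (1 + x ^+ 2).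
      rewrite normrM mulrAC ler_pM//; exact: h1_quad cH x.
    have m1 : measurable_fun setT (fun x => h1 x * (h x * chi n x)).
      by apply: measurable_funM => //; exact: measurable_funM.
    rewrite -mulN1r -(evZ rP (-1) s0 m1 bb).
    have cb (x : R) : `|(fun=> c * K) x| <= c * K * (1 + x ^+ 2).
      by rewrite (ger0_norm cK0) ler_peMr// lerDl sqr_ge0.
    apply: (@le_trans _ _ (ev (fun=> c * K) s)); last first.
      rewrite (le_trans (ler_norm _))//; apply: (ev_bound rP s0) => // x.
      by rewrite (ger0_norm cK0).
    apply: (ev_le rP (c := (2 * CH * K + c * K)) s0) => //.
    + exact: measurable_funM.
    + move=> x; rewrite mulN1r normrN (le_trans (bb x))// ler_wpM2r//.
        by rewrite addr_ge0// sqr_ge0.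
      by rewrite lerDl.
    + move=> x; rewrite (le_trans (cb x))// ler_wpM2r//.
        by rewrite addr_ge0// sqr_ge0.
      by rewrite lerDr !mulr_ge0// (ltW CH0).
    + move=> x; rewrite mulN1r /= mulrA -mulNr.
      have [_ _ /(_ n x)[c1 c2 _ _] _ _] := cut.
      by apply: (le_trans (ler_wpM2r c1 (h1h x))); exact: ler_wpM2l.
  have q3 : sig s * ev (fun x => h x * chi n x) s <= K * `|sig s|.
    rewrite (le_trans (ler_norm _))// normrM mulrC ler_wpM2r//.
    by apply: (ev_bound rP s0 _ bp); exact: measurable_funM.
  by rewrite /gen /g; apply: lerD => //; exact: lerD.
have cphi := has_deriv_continuous dphi.
have mphi := continuous_measurable measurableT cphi.
have bphi x : `|phi x| <= (phi 0 + 1) * (1 + x ^+ 2).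
  rewrite ger0_norm ?(le_trans _ (ex x))//.
  have := has_deriv_bound0 dphi (x := x) (fun y _ => h_1 y).
  rewrite mul1r => /(le_trans (ler_norm _)); rewrite lerBlDl => /le_trans; apply.
  rewrite mulrDl mul1r; apply: lerD (abs_le_quad x).
  by rewrite ler_peMr ?(le_trans (normr_ge0 _) (ex 0))// lerDl sqr_ge0.
have mabs : measurable_fun setT (fun x : R => `|x|) by exact: measurableT_comp.
have evle s : 0 <= s -> ev (fun x => `|x|) s <= ev phi s.
  move=> s0; apply: (ev_le rP s0 mabs mphi _ bphi ex) => x.
  rewrite normr_id (le_trans (ex x))// (le_trans (ler_norm _))//.
exists (Num.max (ev phi 0) (\int[mu]_x (phi x * rho0 x) + \int[mu]_(s in `[0, t]) g s)).
move=> s /andP[]; rewrite le_eqVlt => /predU1P[<-|s0] st.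
  by rewrite le_max evle.
rewrite le_max; apply/orP; right; rewrite (le_trans (evle s (ltW s0)))//.
rewrite (le_trans (ub s s0))// lerD2l.
rewrite (@Rintegral_itv_cat _ g 0 s t (ltW s0) st); last by apply: ig; exact: lt_le_trans st.
rewrite lerDl Rintegral_ge0// => u _.
by rewrite /g !addr_ge0// mulr_ge0.
Qed.

End observables.

(** * Essential bounds and integrals up to null sets *)

Section essential_bounds.
Context {R : realType}.
Notation mu := (@lebesgue_measure R).
Implicit Types (f g : R -> R) (P Q : R -> Prop).

Lemma ae_impl P Q : (forall t, P t -> Q t) -> {ae mu, forall t, P t} -> {ae mu, forall t, Q t}.
Proof. by move=> PQ; apply: (@filterS _ _ (ae_filter_ringOfSetsType mu)). Qed.

Lemma ae_and P Q : {ae mu, forall t, P t} -> {ae mu, forall t, Q t} ->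
  {ae mu, forall t, P t /\ Q t}.
Proof. by move=> aP aQ; apply: (@filterI _ _ (ae_filter_ringOfSetsType mu)). Qed.

Let Linfty_E f : Linfty_norm f = ess_sup mu (abse \o (EFin \o f \_ `[0, +oo[)).
Proof.
rewrite /Linfty_norm unlock /=; case: ifPn => // /negP[].
by rewrite -set_itvNyy lebesgue_measure_itv /= ltry.
Qed.

Lemma ae_le_Linfty f c : (Linfty_norm f <= c%:E)%E ->
  {ae mu, forall t, 0 <= t -> `|f t| <= c}.
Proof.
rewrite Linfty_E => /ess_supP; apply: ae_impl => t /= + t0; rewrite patchE ifT ?lee_fin//.
by rewrite inE /= in_itv /= andbT.
Qed.

Lemma Linfty_le f c : 0 <= c -> {ae mu, forall t, 0 <= t -> `|f t| <= c} ->
  (Linfty_norm f <= c%:E)%E.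
Proof.
move=> c0 h; rewrite Linfty_E; apply/ess_supP; apply: ae_impl h => t /= ht.
rewrite patchE; case: ifPn => /=.
  by rewrite inE /= in_itv /= andbT => /ht; rewrite lee_fin.
by rewrite normr0 lee_fin.
Qed.

Lemma Linfty_ge0 f : (0 <= Linfty_norm f)%E.
Proof. exact: Lnorm_ge0. Qed.

Lemma ae_le_fine_Linfty f : (Linfty_norm f < +oo)%E ->
  {ae mu, forall t, 0 <= t -> `|f t| <= fine (Linfty_norm f)}.
Proof.
move=> fo; apply: ae_le_Linfty; rewrite fineK//.
by rewrite ge0_fin_numE// Linfty_ge0.
Qed.

Lemma Rintegral_ae_eq f g (D : set R) : measurable D ->
  mu.-integrable D (EFin \o f) -> mu.-integrable D (EFin \o g) ->
  {ae mu, forall x, D x -> f x = g x} ->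
  \int[mu]_(x in D) f x = \int[mu]_(x in D) g x.
Proof.
move=> mD i j e; rewrite /Rintegral; congr fine; apply: ae_eq_integral => //.
- exact: (measurable_int mu i).
- exact: (measurable_int mu j).
- by apply: ae_impl e => x ex Dx; rewrite /= ex.
Qed.

Lemma ae_neq (a : R) : {ae mu, forall x, x != a}.
Proof.
exists [set a]; split => //; first by rewrite lebesgue_measure_set1.
by move=> x /= /negP; rewrite negbK => /eqP.
Qed.

Lemma Rintegral_ae_le f g a b :
  mu.-integrable `[a, b] (EFin \o f) -> mu.-integrable `[a, b] (EFin \o g) ->
  {ae mu, forall s, a < s -> s <= b -> f s <= g s} ->
  \int[mu]_(s in `[a, b]) f s <= \int[mu]_(s in `[a, b]) g s.
Proof.
(* The minimum coincides almost everywhere with [f] on the interval and lies below [g]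
   everywhere. *)
move=> i j fg; pose m s := Num.min (f s) (g s).
have mf := integrable_measurable mu i; have mg := integrable_measurable mu j.
have mab : measurable (`[a, b] : set R) by exact: measurable_itv.
have im : mu.-integrable `[a, b] (EFin \o m).
  apply: (integrable_le mu (g := fun s => `|f s| + `|g s|)) => //.
  - exact: measurable_minr.
  - by apply: (integrable_add mu) => //; exact: (integrable_nrm mu).
  - move=> s _; rewrite /m /Num.min; case: ifPn => _; first by rewrite lerDl.
    by rewrite lerDr.
rewrite (@Rintegral_ae_eq f m)//.
  by apply: Rintegral_itv_le => // s _; rewrite /m ge_min lexx orbT.
apply: ae_impl (ae_and fg (ae_neq a)) => s [fgs sa]; rewrite /= in_itv /= => /andP[s0 s1].
by rewrite /m min_l// fgs// lt_neqAle eq_sym sa.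
Qed.

End essential_bounds.

(** * Second moments, locally in time *)

Section second_moment.
Context {R : realType}.
Notation mu := (@lebesgue_measure R).
Variables (H : R -> R) (CH al be : R) (ell dell rho0 : R -> R) (rho : R -> R -> R).
Notation h1 := (derive1 H).
Hypothesis cH : confining H h1 (derive1 h1) CH al be.
Hypothesis sol : solution H ell dell rho0 rho.
Hypothesis P0 : P2 rho0.
Implicit Types (phi p q h : R -> R) (s t T : R).

Notation sig := (sigma H dell rho).
Notation ev := (ev rho).
Notation gen := (gen H dell rho).
Notation evolves := (evolves H dell rho0 rho).

Let rP := sol_P2 sol.
Let CH0 : 0 < CH. Proof. exact: conf_CH cH. Qed.
Let mh1 : measurable_fun setT h1. Proof. exact: measurable_h1 cH. Qed.

Lemma ev_le_cst (psi : R -> R) c a s : 0 <= s -> measurable_fun setT psi ->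
  (forall x, `|psi x| <= c * (1 + x ^+ 2)) -> (forall x, psi x <= a) -> ev psi s <= a.
Proof.
move=> s0 mpsi b h.
have b1 (x : R) : `|1 : R| <= 1 * (1 + x ^+ 2) by rewrite normr1 mul1r lerDl sqr_ge0.
have e : ev (fun x => a * 1) s = a by rewrite (evZ rP a s0 _ b1)// (ev1 rP s0) mulr1.
rewrite -[leRHS]e.
have c0 : 0 <= c by have := le_trans (normr_ge0 _) (b 0); rewrite expr0n addr0 mulr1.
apply: (ev_le rP (c := c + `|a|) s0 mpsi) => //.
- move=> x; rewrite (le_trans (b x))// ler_wpM2r ?lerDl//.
  by rewrite addr_ge0// sqr_ge0.
- by move=> x; rewrite mulr1 -[leLHS]mulr1 ler_pM// ?lerDr// lerDl sqr_ge0.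
- by move=> x; rewrite mulr1.
Qed.

(** For [x^2] the force term [2 sig x] is controlled by the first moment, already bounded, and the
    drift term [- 2 x H'] is at most [2 |be|]. *)
Lemma sq_moment_bounded t : 0 < t -> exists M, forall s, 0 <= s <= t ->
  ev (fun x => x ^+ 2) s <= M.
Proof.
move=> t0; have [K [chi [d1 [d2 cut]]]] := @cutoff_exists R.
have [K1 cutn cutb _ _] := cut; have K0 : 0 <= K by exact: le_trans K1.
have [M1 HM1] := abs_moment_bounded cH sol P0 cut t0.
have M10 : 0 <= M1.
  apply: le_trans (HM1 0 _); last by rewrite lexx ltW.
  by apply: Rintegral_ge0 => x _; rewrite mulr_ge0// (P2_ge0 x (rP (lexx 0))).
pose g s := 4 * K + 2 * `|be| * K + 2 * K * M1 * `|sig s|.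
have ig t' : 0 < t' -> mu.-integrable `[0, t'] (EFin \o g).
  move=> t'0; apply: (integrable_add mu) => //.
    by apply: continuous_integrable_itv; exact: cst_continuous.
  apply: (integrableZ mu) => //; apply: (integrable_nrm mu) => //.
  exact: (sig_integrable sol).
have sid : smooth (fun x : R => 2 * x) by exact/smoothZ/smooth_id.
have d2x : has_deriv (fun x : R => 2 * x) (fun=> 2).
  by apply: (has_deriv_eq (has_derivZ 2 (@has_deriv_id R))) => x; rewrite mulr1.
have b2x (x : R) : `|2 * x| <= 2 * (1 + `|x|).
  by rewrite normrM normr_nat ler_wpM2l// lerDr.
have msq : measurable_fun setT (fun x : R => x ^+ 2) by exact: measurable_sqr.
have ub t' : 0 < t' -> t' <= t ->
    ev (fun x => x ^+ 2) t' <= \int[mu]_x (x ^+ 2 * rho0 x) + \int[mu]_(s in `[0, t']) g s.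
  move=> t'0 t't.
  apply: (growth_bound cH sol P0 cut sid (@has_deriv_sqr R) d2x b2x t'0 (ig t' t'0)).
  move=> n s /andP[s0 st].
  have [s1 _ e1 _] := cutn n.
  have mchi : measurable_fun setT (chi n).
    exact: (continuous_measurable measurableT (smooth_continuous s1)).
  have md1 : measurable_fun setT (d1 n).
    exact: (continuous_measurable measurableT (smooth_continuous (smooth_deriv s1 e1))).
  have m2x : measurable_fun setT (fun x : R => 2 * x).
    exact: (continuous_measurable measurableT (smooth_continuous sid)).
  have q1 : ev (fun x => 2 * chi n x + 2 * x * d1 n x) s <= 4 * K.
    apply: le_trans (ler_norm _) _; apply: (ev_bound rP s0).
      by apply: measurable_funD; exact: measurable_funM.
    move=> x; rewrite (_ : 4 * K = 2 * K + 2 * K); last by ring.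
    rewrite (le_trans (ler_normD _ _))// lerD//.
      by rewrite normrM normr_nat ler_wpM2l// (chi_norm cut).
    exact: (lin_cutoff_deriv cut n (b2x x)).
  have q2 : - ev (fun x => h1 x * (2 * x * chi n x)) s <= 2 * `|be| * K.
    have bb x : `|h1 x * (2 * x * chi n x)| <= 4 * CH * K * (1 + x ^+ 2).
      rewrite mulrA normrM mulrAC ler_pM ?(chi_norm cut)//.
      rewrite normrM (le_trans (ler_pM (normr_ge0 _) (normr_ge0 _) (conf_h1 cH x) (lexx _)))//.
      rewrite normrM normr_nat -(real_normK (num_real x)).
      rewrite (_ : CH * _ * _ = 2 * CH * ((1 + `|x|) * `|x|)); last by ring.
      rewrite (_ : 4 * CH * _ = 2 * CH * (2 * (1 + `|x| ^+ 2))); last by ring.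
      by rewrite ler_wpM2l ?quad_of_lin// mulr_ge0// ltW.
    have m1 : measurable_fun setT (fun x => h1 x * (2 * x * chi n x)).
      by apply: measurable_funM => //; exact: measurable_funM.
    rewrite -mulN1r -(evZ rP (-1) s0 m1 bb).
    apply: (ev_le_cst (c := 4 * CH * K) s0); first exact: measurable_funM.
      by move=> x; rewrite mulN1r normrN.
    move=> x; have [c1 c2 _ _] := cutb n x.
    rewrite (_ : _ * _ = (- (2 * (x * h1 x))) * chi n x); last by ring.
    apply: (@le_trans _ _ (2 * `|be| * chi n x)); last first.
      by rewrite ler_wpM2l// mulr_ge0.
    rewrite ler_wpM2r//; have := conf_xh1_ge cH x; have := ler_norm be.
    by have := mulr_ge0 (ltW (conf_al cH)) (sqr_ge0 x); lra.
  have q3 : sig s * ev (fun x => 2 * x * chi n x) s <= 2 * K * M1 * `|sig s|.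
    rewrite (le_trans (ler_norm _))// normrM mulrC ler_wpM2r//.
    have mabs : measurable_fun setT (fun x : R => `|x|) by exact: measurableT_comp.
    have babs (x : R) : `| `|x| | <= 1 * (1 + x ^+ 2) by rewrite normr_id mul1r abs_le_quad.
    apply: (@le_trans _ _ (ev (fun x => 2 * K * `|x|) s)).
      apply: (ev_abs_le rP (c := 2 * K) s0).
      + exact: measurable_funM.
      + exact: measurable_funM.
      + by move=> x; rewrite normrM ger0_norm ?mulr_ge0// normr_id ler_wpM2l ?mulr_ge0// abs_le_quad.
      + move=> x; rewrite normrM (le_trans (ler_pM (normr_ge0 _) (normr_ge0 _) (lexx _) (chi_norm cut n x)))//.
        by rewrite normrM normr_nat mulrAC.
    rewrite (evZ rP (2 * K) s0 mabs babs) ler_wpM2l ?mulr_ge0// HM1// s0 /=.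
    exact: le_trans t't.
  by rewrite /gen /g; apply: lerD => //; exact: lerD.
exists (Num.max (ev (fun x => x ^+ 2) 0)
  (\int[mu]_x (x ^+ 2 * rho0 x) + \int[mu]_(s in `[0, t]) g s)).
move=> s /andP[]; rewrite le_eqVlt => /predU1P[<-|s0] st.
  by rewrite le_max lexx.
rewrite le_max; apply/orP; right.
rewrite (le_trans (ub s s0 st))// lerD2l.
rewrite (@Rintegral_itv_cat _ g 0 s t (ltW s0) st); last exact: ig.
rewrite lerDl Rintegral_ge0// => u _.
by rewrite /g !addr_ge0// !mulr_ge0.
Qed.

End second_moment.

(** * Bounds uniform in time *)

Section uniform_bounds.
Context {R : realType}.
Notation mu := (@lebesgue_measure R).
Variables (H : R -> R) (CH al be : R) (ell dell rho0 : R -> R) (rho : R -> R -> R).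
Notation h1 := (derive1 H).
Hypothesis cH : confining H h1 (derive1 h1) CH al be.
Hypothesis sol : solution H ell dell rho0 rho.
Hypothesis P0 : P2 rho0.
Implicit Types (phi p q h : R -> R) (s t T : R).

Notation sig := (sigma H dell rho).
Notation ev := (ev rho).
Notation gen := (gen H dell rho).
Notation evolves := (evolves H dell rho0 rho).

Let rP := sol_P2 sol.
Let CH0 : 0 < CH. Proof. exact: conf_CH cH. Qed.
Let mh1 : measurable_fun setT h1. Proof. exact: measurable_h1 cH. Qed.

(** With second moments locally bounded in time, the weight [1 + x^2] becomes available in
    [evolves_limit], and it covers [h1 * h], of quadratic growth. *)
Lemma evolves_growth phi h h' C : smooth h -> has_deriv phi h -> has_deriv h h' ->
  (forall x, `|h x| <= C * (1 + `|x|)) -> (forall x, `|h' x| <= C * (1 + x ^+ 2)) ->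
  evolves phi h h'.
Proof.
move=> sh dphi dh bh bh'; have [K [chi [d1 [d2 cut]]]] := @cutoff_exists R.
have [K1 cutn cutb _ _] := cut; have K0 : 0 <= K by exact: le_trans K1.
have C0 : 0 <= C by have := le_trans (normr_ge0 _) (bh 0); rewrite normr0 addr0 mulr1.
have [C' [phi_ [s_ b_ l_ e_]]] := lin_growth_approx cH sol P0 cut sh dphi dh bh.
have om_ (x : R) : 0 <= 1 + x ^+ 2 <= 1 * (1 + x ^+ 2).
  by rewrite mul1r lexx andbT addr_ge0// sqr_ge0.
have om1 (x : R) : 1 <= 1 + x ^+ 2 by rewrite lerDl sqr_ge0.
have om0 (x : R) : 0 <= 1 + x ^+ 2 by have /andP[] := om_ x.
have msq : measurable_fun setT (fun x : R => x ^+ 2) by exact: measurable_sqr.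
have mom : measurable_fun setT (fun x : R => 1 + x ^+ 2) by exact: measurable_funD.
pose D := C' + 2 * C * K + 2 * CH * C * K.
have e1 : 0 <= C' by have := le_trans (normr_ge0 _) (b_ 0%N 0); rewrite expr0n addr0 mulr1.
have e2 : 0 <= 2 * C * K by rewrite !mulr_ge0.
have e3 : 0 <= 2 * CH * C * K by rewrite !mulr_ge0// ltW.
have D0 : 0 <= D by rewrite !addr_ge0.
have lD1 : C' <= D by rewrite /D -addrA lerDl addr_ge0.
have lD2 : 2 * C * K <= D by rewrite /D addrAC lerDr addr_ge0.
have lD3 : 2 * CH * C * K <= D by rewrite /D lerDr addr_ge0.
have bq n x : `|h x * chi n x| <= 2 * C * K * (1 + x ^+ 2).
  rewrite normrM mulrAC ler_pM ?(chi_norm cut)//.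
  rewrite (le_trans (bh x))// [2 * C]mulrC -mulrA ler_wpM2l// mulr_natl mulr2n.
  by rewrite lerD// abs_le_quad.
apply: (evolves_limit cH sol P0 (om := fun x => 1 + x ^+ 2) (c := 1) (C := D) mom om_ D0
  (phi_ := phi_) (p_ := fun n x => h x * chi n x)
  (q_ := fun n x => h' x * chi n x + h x * d1 n x)).
- move=> t t0; have [M HM] := sq_moment_bounded cH sol P0 t0.
  exists (1 + M) => s st; have /andP[s0 _] := st.
  have b1 (x : R) : `|1 : R| <= 1 * (1 + x ^+ 2) by rewrite normr1 mul1r.
  have b2 (x : R) : `|x ^+ 2| <= 1 * (1 + x ^+ 2) by rewrite ger0_norm ?sqr_ge0// mul1r lerDr.
  by rewrite (evD rP s0 (measurable_cst _) msq b1 b2) (ev1 rP s0) lerD2l HM.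
- move=> n; have [s1 _ e4 _] := cutn n.
  have mchi := continuous_measurable measurableT (smooth_continuous s1).
  have md1 := continuous_measurable measurableT (smooth_continuous (smooth_deriv s1 e4)).
  have mh := continuous_measurable measurableT (smooth_continuous sh).
  have mh' := continuous_measurable measurableT (smooth_continuous (smooth_deriv sh dh)).
  split; first exact: (continuous_measurable measurableT (smooth_continuous (s_ n))).
    exact: measurable_funM.
  by apply: measurable_funD; exact: measurable_funM.
- by move=> n x; rewrite (le_trans (b_ n x))// ler_wpM2r.
- move=> n x; split.
  + by rewrite (le_trans (bq n x))// ler_wpM2r.
  + apply: (@le_trans _ _ (2 * C * K * (1 + x ^+ 2))); last by rewrite ler_wpM2r.
    rewrite (_ : 2 * C * K * _ = C * (1 + x ^+ 2) * K + C * K * (1 + x ^+ 2)); last by ring.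
    rewrite (le_trans (ler_normD _ _))// lerD//.
      by rewrite normrM ler_pM// (chi_norm cut).
    rewrite (le_trans (lin_cutoff_deriv cut n (bh x)))//.
    by rewrite ler_peMr// mulr_ge0.
  + apply: (@le_trans _ _ (2 * CH * C * K * (1 + x ^+ 2))); last by rewrite ler_wpM2r.
    rewrite mulrA normrM [leRHS]mulrAC ler_pM ?(chi_norm cut)//.
    rewrite normrM (le_trans (ler_pM (normr_ge0 _) (normr_ge0 _) (conf_h1 cH x) (bh x)))//.
    rewrite -(real_normK (num_real x)) (_ : CH * (1 + `|x|) * (C * (1 + `|x|)) = CH * C * ((1 + `|x|) * (1 + `|x|))); last by ring.
    rewrite (_ : 2 * CH * C * _ = CH * C * (2 * (1 + `|x| ^+ 2))); last by ring.
    rewrite ler_wpM2l//; first by rewrite mulr_ge0// ltW.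
    by have := sqr_ge0 (`|x| - 1); set y := `|x|; nra.
- exact: l_.
- move=> x; have [l1 _ _] := cutoffs_cvg cut x.
  rewrite -[X in _ --> X]mulr1; exact: cvgMl_tmp.
- move=> x; have [l1 l2 _] := cutoffs_cvg cut x.
  rewrite -[X in _ --> X](_ : h' x * 1 + h x * 0 = _); last by rewrite mulr1 mulr0 addr0.
  by apply: cvgD; exact: cvgMl_tmp.
- exact: e_.
Qed.

Lemma ev_initial phi c : measurable_fun setT phi ->
  (forall x, `|phi x| <= c * (1 + x ^+ 2)) -> ev phi 0 = \int[mu]_x (phi x * rho0 x).
Proof.
move=> m b; apply: Rintegral_ae_eq => //.
- exact: (ev_integrable rP (lexx 0) m b).
- exact: (P2_integrable P0 m b).
- by apply: ae_impl (solution_initial sol) => x ->.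
Qed.

Lemma evolves_incr phi p q c s t : evolves phi p q -> measurable_fun setT phi ->
  (forall x, `|phi x| <= c * (1 + x ^+ 2)) -> 0 <= s -> s <= t ->
  mu.-integrable `[s, t] (EFin \o gen p q) /\
  ev phi t - ev phi s = \int[mu]_(u in `[s, t]) gen p q u.
Proof.
move=> e m b s0 st; have t1 : 0 < t + 1 by rewrite ltr_pwDr// (le_trans s0).
have tt1 : t <= t + 1 by rewrite lerDl.
have [i1 _] := e _ t1; split; first exact: (integrable_subitv s0 tt1 i1).
move: st; rewrite le_eqVlt => /predU1P[<-|st]; first by rewrite subrr set_itv1 Rintegral_set1.
have t0 : 0 < t by exact: le_lt_trans st.
have [i et] := e t t0; rewrite et (Rintegral_itv_cat s0 (ltW st) i).
move: s0 {i}; rewrite le_eqVlt => /predU1P[<-|s0].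
  by rewrite (ev_initial m b) set_itv1 Rintegral_set1 add0r addrAC subrr add0r.
have [_ ->] := e s s0; ring.
Qed.

(** The observable [x] has generator [- ev h1 + sig], which is [dell] by the definition of
    [sigma]. *)
Lemma ell_incr s t : 0 <= s -> s <= t -> mu.-integrable `[s, t] (EFin \o dell) /\
  ell t - ell s = \int[mu]_(u in `[s, t]) dell u.
Proof.
move=> s0 st.
have e : evolves (fun x => x) (fun=> 1) (fun=> 0).
  apply: (evolves_growth (C := 1)); [exact: smooth_cst|exact: has_deriv_id|exact: has_deriv_cst| |].
  - by move=> x; rewrite normr1 mul1r lerDl.
  - by move=> x; rewrite normr0 mul1r addr_ge0// sqr_ge0.
have b (x : R) : `|x| <= 1 * (1 + x ^+ 2) by rewrite mul1r abs_le_quad.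
have [i ee] := evolves_incr e (@measurable_id _ _ _) b s0 st.
have ge u : (`[s, t] : set R) u -> gen (fun=> 1) (fun=> 0) u = dell u.
  rewrite /= in_itv /= => /andP[su _]; have u0 := le_trans s0 su.
  rewrite /gen (ev1 rP u0) mulr1 /sigma.
  have -> : ev (fun=> 0) u = 0.
    rewrite (_ : (fun=> 0) = (fun x : R => 0 * x)); last by apply/funext => x; rewrite mul0r.
    by rewrite (evZ rP 0 u0 (@measurable_id _ _ _) b) mul0r.
  have -> : ev (fun x => h1 x * 1) u = ev h1 u by apply: (Rintegral_ext mu) => x _; rewrite mulr1.
  by rewrite /ev; ring.
split; first exact: (integrable_ext mu _ ge i).
have le u : 0 <= u -> ev (fun x => x) u = ell u by move=> u0; have [] := solution_Ml sol u0.
rewrite -(le s)// -(le t) ?(le_trans s0)// ee.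
exact: (Rintegral_ext mu).
Qed.

Variables A L : R.
Hypothesis A_ge0 : 0 <= A.
Hypothesis L_ge0 : 0 <= L.
Hypothesis ell_A : {ae mu, forall t, 0 <= t -> `|ell t| <= A}.
Hypothesis dell_L : {ae mu, forall t, 0 <= t -> `|dell t| <= L}.

(** The force is rewritten as [sig = ev h1 + dell]: since the mean is [ell], the generator of [x^2]
    contains [2 ell h1], of linear growth, which Young's inequality absorbs into half of the
    confining term [- 2 al x^2]. The outcome is [f' <= C0 - al f]. *)
Lemma sq_moment_uniform : exists M, forall s, 0 <= s -> ev (fun x => x ^+ 2) s <= M.
Proof.
have al0 := conf_al cH.
have e : evolves (fun x => x ^+ 2) (fun x => 2 * x) (fun=> 2).
  apply: (evolves_growth (C := 2)).
  - exact/smoothZ/smooth_id.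
  - exact: has_deriv_sqr.
  - by apply: (has_deriv_eq (has_derivZ 2 (@has_deriv_id R))) => x; rewrite mulr1.
  - by move=> x; rewrite normrM normr_nat ler_wpM2l// lerDr.
  - by move=> x; rewrite normr_nat ler_peMr// lerDl sqr_ge0.
have msq : measurable_fun setT (fun x : R => x ^+ 2) by exact: measurable_sqr.
have bsq (x : R) : `|x ^+ 2| <= 1 * (1 + x ^+ 2) by rewrite ger0_norm ?sqr_ge0// mul1r lerDr.
have bid (x : R) : `|x| <= 1 * (1 + x ^+ 2) by rewrite mul1r abs_le_quad.
have mid : measurable_fun setT (fun x : R => x) by exact: measurable_id.
have b1 (x : R) : `|1 : R| <= 1 * (1 + x ^+ 2) by rewrite normr1 mul1r lerDl sqr_ge0.
pose C1 := 2 * be + 2 * A * CH + A ^+ 2 * CH ^+ 2 / al.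
pose C0 := 2 + C1 + 2 * A * L.
have genle : {ae mu, forall s, 0 <= s ->
    gen (fun x => 2 * x) (fun=> 2) s <= C0 - al * ev (fun x => x ^+ 2) s}.
  apply: ae_impl (ae_and ell_A dell_L) => s [sA sL] s0.
  have eA := sA s0; have eL := sL s0.
  have ez : ev (fun x => 2 * x) s = 2 * ell s.
    rewrite (evZ rP 2 s0 mid bid); congr (_ * _).
    by have [] := solution_Ml sol s0.
  have e2 : ev (fun=> 2) s = 2.
    have e21 : ev (fun x => 2 * 1) s = 2 by rewrite (evZ rP 2 s0 _ b1)// (ev1 rP s0) mulr1.
    by rewrite -[RHS]e21; apply: (Rintegral_ext mu) => x _; rewrite mulr1.
  rewrite /gen e2 ez /sigma.
  have bb x : `|h1 x * (2 * x)| <= 4 * CH * (1 + x ^+ 2).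
    rewrite normrM (le_trans (ler_pM (normr_ge0 _) (normr_ge0 _) (conf_h1 cH x) (lexx _)))//.
    rewrite normrM normr_nat -(real_normK (num_real x)).
    rewrite (_ : CH * _ * _ = 2 * CH * ((1 + `|x|) * `|x|)); last by ring.
    rewrite (_ : 4 * CH * _ = 2 * CH * (2 * (1 + `|x| ^+ 2))); last by ring.
    by rewrite ler_wpM2l ?quad_of_lin// mulr_ge0// ltW.
  have m2 : measurable_fun setT (fun x => h1 x * (2 * x)).
    by apply: measurable_funM => //; exact: measurable_funM.
  have b3 x : `|2 * ell s * h1 x| <= 4 * A * CH * (1 + x ^+ 2).
    rewrite normrM (_ : 4 * A * CH * _ = 2 * A * (2 * CH * (1 + x ^+ 2))); last by ring.
    by rewrite ler_pM ?(h1_quad cH)// normrM normr_nat ler_wpM2l.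
  have m3 : measurable_fun setT (fun x => 2 * ell s * h1 x) by exact: measurable_funM.
  have bal (x : R) : `|al * x ^+ 2| <= al * (1 + x ^+ 2).
    by rewrite normrM (gtr0_norm al0) ler_wpM2l ?(ltW al0)// ger0_norm ?sqr_ge0// lerDr.
  have mal : measurable_fun setT (fun x : R => al * x ^+ 2) by exact: measurable_funM.
  have main : ev (fun x => -1 * (h1 x * (2 * x)) + (2 * ell s * h1 x + al * x ^+ 2)) s <= C1.
    apply: (ev_le_cst (c := 4 * CH + (4 * A * CH + al)) sol s0).
    - apply: measurable_funD; first exact: measurable_funM.
      exact: measurable_funD.
    - move=> x; rewrite (le_trans (ler_normD _ _))// [leRHS]mulrDl lerD ?mulN1r ?normrN//.
      by rewrite (le_trans (ler_normD _ _))// [leRHS]mulrDl lerD.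
    - move=> x; have := conf_xh1_ge cH x.
      have : 2 * ell s * h1 x <= 2 * A * CH + (al * x ^+ 2 + A ^+ 2 * CH ^+ 2 / al).
        rewrite (le_trans (ler_norm _))// normrM.
        rewrite (@le_trans _ _ (2 * A * (CH * (1 + `|x|))))//.
          by rewrite ler_pM ?(conf_h1 cH)// normrM normr_nat ler_wpM2l.
        rewrite -(real_normK (num_real x)) -subr_ge0.
        rewrite (_ : _ - _ = al * (`|x| - A * CH / al) ^+ 2); last first.
          by field; rewrite gt_eqF.
        by rewrite mulr_ge0 ?sqr_ge0// ltW.
      by rewrite /C1; lra.
  have b23 (x : R) : `|2 * ell s * h1 x + al * x ^+ 2| <= (4 * A * CH + al) * (1 + x ^+ 2).
    by rewrite (le_trans (ler_normD _ _))// [leRHS]mulrDl lerD.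
  have m23 : measurable_fun setT (fun x => 2 * ell s * h1 x + al * x ^+ 2).
    exact: measurable_funD.
  have bN x : `|-1 * (h1 x * (2 * x))| <= 4 * CH * (1 + x ^+ 2) by rewrite mulN1r normrN.
  have mN : measurable_fun setT (fun x => -1 * (h1 x * (2 * x))) by exact: measurable_funM.
  have b3' x : `|2 * ell s * h1 x| <= (4 * A * CH + al) * (1 + x ^+ 2).
    by rewrite (le_trans (b3 x))// ler_wpM2r ?addr_ge0 ?sqr_ge0// lerDl ltW.
  have bal' (x : R) : `|al * x ^+ 2| <= (4 * A * CH + al) * (1 + x ^+ 2).
    by rewrite (le_trans (bal x))// ler_wpM2r ?addr_ge0 ?sqr_ge0// lerDr !mulr_ge0// ltW.
  have bN' x : `|-1 * (h1 x * (2 * x))| <= (4 * CH + (4 * A * CH + al)) * (1 + x ^+ 2).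
    rewrite (le_trans (bN x))// ler_wpM2r ?addr_ge0 ?sqr_ge0// lerDl addr_ge0 ?(ltW al0)//.
    by rewrite !mulr_ge0// ltW.
  have b23' x : `|2 * ell s * h1 x + al * x ^+ 2| <= (4 * CH + (4 * A * CH + al)) * (1 + x ^+ 2).
    by rewrite (le_trans (b23 x))// ler_wpM2r ?addr_ge0 ?sqr_ge0// lerDr mulr_ge0// ltW.
  move: main; rewrite (evD rP s0 mN m23 bN' b23') (evZ rP (-1) s0 m2 bb).
  rewrite (evD rP s0 m3 mal b3' bal') (evZ rP al s0 msq bsq).
  rewrite (evZ rP (2 * ell s) s0 mh1 (h1_quad cH)) -/(ev h1 s).
  have : dell s * ell s <= A * L.
    by rewrite (le_trans (ler_norm _))// normrM mulrC ler_pM.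
  rewrite /C0; set u := ev _ s; set v := ev _ s; set w := ev _ s => a b.
  rewrite -subr_ge0 (_ : _ - _ = (C1 - (-1 * u + (2 * ell s * v + al * w))) +
     2 * (A * L - dell s * ell s)); last by ring.
  by rewrite addr_ge0 ?mulr_ge0// subr_ge0.
pose f s := ev (fun x => x ^+ 2) s.
have f0 s : 0 <= s -> 0 <= f s.
  by move=> s0; apply: Rintegral_ge0 => x _; rewrite mulr_ge0 ?sqr_ge0// (P2_ge0 x (rP s0)).
have ici (c a b : R) : mu.-integrable `[a, b] (EFin \o (fun=> c)).
  by apply: continuous_integrable_itv; exact: cst_continuous.
have Ici (c a b : R) : a <= b -> \int[mu]_(u in `[a, b]) c = c * (b - a).
  move=> ab; rewrite (@FTC2 _ (fun x => c * x) (fun=> c) a b ab) ?mulrBr//.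
    by apply: (has_deriv_eq (has_derivZ c (@has_deriv_id R))) => x; rewrite mulr1.
  exact: cst_continuous.
(* Above [C0 / al] the generator is nonpositive, so that a constant is a barrier. *)
pose Y := Num.max (f 0) (C0 / al).
exists Y => t t0; apply: (@comparison _ f (fun=> Y) `|C0| t) => //.
- exact: cst_continuous.
- by rewrite /Y le_max lexx.
- move=> s r s0 sr rt; have [i ->] := evolves_incr e msq bsq s0 sr.
  rewrite -Ici//; apply: Rintegral_ae_le => //.
  apply: ae_impl genle => u gu su _; have u0 := le_trans s0 (ltW su).
  rewrite (le_trans (gu u0))// (le_trans _ (ler_norm _))//.
  by rewrite lerBlDr lerDl mulr_ge0// ?f0// ltW.
- move=> s r s0 sr rt Yf; have [i ->] := evolves_incr e msq bsq s0 sr.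
  rewrite subrr -[leRHS](mul0r (r - s)) -Ici//; apply: Rintegral_ae_le => //.
  apply: ae_impl genle => u gu su ur; have u0 := le_trans s0 (ltW su).
  rewrite (le_trans (gu u0))// subr_le0 -ler_pdivrMl// mulrC.
  by rewrite (le_trans _ (ltW (Yf u su ur)))// /Y le_max lexx orbT.
Qed.

(** This makes [fine (Linfty_norm sig)] in the theorem a genuine bound: on an infinite norm [fine]
    would return 0. *)
Lemma sigma_bounded : (Linfty_norm sig < +oo)%E.
Proof.
have [M HM] := sq_moment_uniform.
have M0 : 0 <= M.
  apply: le_trans (HM 0 (lexx 0)).
  by apply: Rintegral_ge0 => x _; rewrite mulr_ge0 ?sqr_ge0// (P2_ge0 x (rP (lexx 0))).
pose S := 2 * CH * (1 + M) + L.
have S0 : 0 <= S by rewrite addr_ge0// mulr_ge0 ?addr_ge0// mulr_ge0// ltW.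
apply: (@le_lt_trans _ _ S%:E); last exact: ltry.
apply: (Linfty_le S0); apply: ae_impl dell_L => s sL s0.
rewrite (le_trans (ler_normD _ _))// lerD ?sL//.
have msq : measurable_fun setT (fun x : R => x ^+ 2) by exact: measurable_sqr.
have b1 (x : R) : `|1 : R| <= 1 * (1 + x ^+ 2) by rewrite normr1 mul1r lerDl sqr_ge0.
have bsq (x : R) : `|x ^+ 2| <= 1 * (1 + x ^+ 2) by rewrite ger0_norm ?sqr_ge0// mul1r lerDr.
have mom : measurable_fun setT (fun x : R => 1 + x ^+ 2) by exact: measurable_funD.
have bom (x : R) : `|1 + x ^+ 2| <= 1 * (1 + x ^+ 2) by rewrite mul1r ger0_norm// addr_ge0 ?sqr_ge0.
apply: (@le_trans _ _ (ev (fun x => 2 * CH * (1 + x ^+ 2)) s)).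
  apply: (ev_abs_le rP (c := 2 * CH) s0 mh1); last exact: (h1_quad cH).
    exact: measurable_funM.
  by move=> x; rewrite ger0_norm// mulr_ge0 ?mulr_ge0 ?addr_ge0 ?sqr_ge0// ltW.
rewrite (evZ rP _ s0 mom bom) ler_wpM2l//; first by rewrite mulr_ge0// ltW.
by rewrite (evD rP s0 (measurable_cst _) msq b1 bsq) (ev1 rP s0) lerD2l HM.
Qed.

End uniform_bounds.

(** * Mollification *)

Section mollification.
Context {R : realType}.
Notation mu := (@lebesgue_measure R).
Variable b : R.
Hypothesis b_gt0 : 0 < b.
Implicit Types (f g rho : R -> R) (Q : {poly R}) (x y : R).

Lemma ker_swap x y : ker b (x - y) = ker b (y - x).
Proof. by rewrite -ker_even opprB. Qed.

Lemma ker_mass_left x : mu.-integrable setT (EFin \o (fun y => ker b (x - y))) /\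
  \int[mu]_y ker b (x - y) = 1.
Proof.
have [i e] := ker_mass x b_gt0; split.
  by apply: (integrable_ext mu _ _ i) => // y _; rewrite ker_swap.
by rewrite -e; apply: (Rintegral_ext mu) => y _; rewrite ker_swap.
Qed.

Lemma measurable_ker_shift x : measurable_fun setT (fun y => ker b (x - y)).
Proof.
by have [i _] := ker_mass_left x; exact: (integrable_measurable mu i).
Qed.

Lemma ker_sq_moment x : mu.-integrable setT (EFin \o (fun y => (x - y) ^+ 2 * ker b (x - y))) /\
  \int[mu]_y ((x - y) ^+ 2 * ker b (x - y)) <= 64 / b ^+ 2.
Proof.
have b2 : 0 < b / 2 by rewrite divr_gt0.
have [i e] := ker_mass x b2.
have j : mu.-integrable setT (EFin \o (fun y => 64 / b ^+ 2 * ker (b / 2) (x - y))).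
  apply: (integrableZ mu) => //.
  by apply: (integrable_ext mu _ _ i) => // y _; rewrite -ker_even opprB.
have le y : (x - y) ^+ 2 * ker b (x - y) <= 64 / b ^+ 2 * ker (b / 2) (x - y).
  exact: sqr_ker_le.
have ge y : 0 <= (x - y) ^+ 2 * ker b (x - y) by rewrite mulr_ge0 ?sqr_ge0// ker_ge0.
have k : mu.-integrable setT (EFin \o (fun y => (x - y) ^+ 2 * ker b (x - y))).
  apply: (integrable_le mu _ _ j) => //.
    apply: measurable_funM; last exact: measurable_ker_shift.
    by apply: measurable_funX; exact: measurable_funB.
  by move=> y _; rewrite ger0_norm.
split; first exact: k.
apply: (@le_trans _ _ (\int[mu]_y (64 / b ^+ 2 * ker (b / 2) (x - y)))).
  exact: (le_Rintegral _ k j).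
have i' : mu.-integrable setT (EFin \o (fun y => ker (b / 2) (x - y))).
  by apply: (integrable_ext mu _ _ i) => // y _; rewrite -ker_even opprB.
have e' : \int[mu]_y ker (b / 2) (x - y) = 1.
  by apply: (etrans _ e); apply: (Rintegral_ext mu) => y _; rewrite -ker_even opprB.
by rewrite (RintegralZl _ _ i')// e' mulr1.
Qed.

(* [mol Q f] is the convolution of [f] with [poly_ker b Q]; [mol 1 f] is the
   mollification of [f], and the other [Q] give its derivatives. *)
Definition mol Q f x := \int[mu]_y (poly_ker b Q (x - y) * f y).

Definition mollifiable f := measurable_fun setT f /\
  forall x, mu.-integrable setT (EFin \o (fun y => ker b (x - y) * f y)).

Lemma mol1E f x : mol 1 f x = \int[mu]_y (ker b (x - y) * f y).
Proof. by apply: (Rintegral_ext mu) => y _; rewrite poly_ker1. Qed.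

Lemma mollifiable_P2 rho : P2 rho -> mollifiable rho.
Proof.
move=> P; split => [|x]; first exact: P2_measurable P.
apply: (P2_bounded_integrable P (measurable_ker_shift x) (c := b)) => y.
by rewrite ger0_norm ?ker_ge0// ker_le_cst.
Qed.

Lemma quad_ker_moment x : mu.-integrable setT (EFin \o (fun y => (1 + y ^+ 2) * ker b (x - y))) /\
  \int[mu]_y ((1 + y ^+ 2) * ker b (x - y)) <= (2 + 128 / b ^+ 2) * (1 + x ^+ 2).
Proof.
have [i0 e0] := ker_mass_left x; have [i2 e2] := ker_sq_moment x.
have k0 y : 0 <= ker b (x - y) by exact: ker_ge0.
pose g y := (1 + 2 * x ^+ 2) * ker b (x - y) + 2 * ((x - y) ^+ 2 * ker b (x - y)).
have j0 : mu.-integrable setT (EFin \o (fun y => (1 + 2 * x ^+ 2) * ker b (x - y))).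
  exact: (integrableZ mu).
have j2 : mu.-integrable setT (EFin \o (fun y => 2 * ((x - y) ^+ 2 * ker b (x - y)))).
  exact: (integrableZ mu).
have j : mu.-integrable setT (EFin \o g) by exact: (integrable_add mu).
have le y : (1 + y ^+ 2) * ker b (x - y) <= g y.
  rewrite /g mulrA -mulrDl ler_wpM2r//.
  by have := sqr_ge0 (2 * x - y); nra.
have ge y : 0 <= (1 + y ^+ 2) * ker b (x - y) by rewrite mulr_ge0 ?addr_ge0 ?sqr_ge0.
have k : mu.-integrable setT (EFin \o (fun y => (1 + y ^+ 2) * ker b (x - y))).
  apply: (integrable_le mu _ _ j) => //.
    apply: measurable_funM; last exact: measurable_ker_shift.
    by apply: measurable_funD => //; exact: measurable_sqr.
  by move=> y _; rewrite ger0_norm.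
split; first exact: k.
apply: (@le_trans _ _ (\int[mu]_y g y)); first exact: (le_Rintegral _ k j).
rewrite (RintegralD _ j0 j2)// (RintegralZl _ _ i0)// (RintegralZl _ _ i2)// e0 mulr1.
apply: (@le_trans _ _ (1 + 2 * x ^+ 2 + 2 * (64 / b ^+ 2))).
  by rewrite lerD2l ler_wpM2l.
have c0 : 0 <= 128 / b ^+ 2 by rewrite divr_ge0 ?sqr_ge0.
rewrite (_ : 2 * (64 / b ^+ 2) = 128 / b ^+ 2); last by rewrite mulrA -natrM.
by have := sqr_ge0 x; set y := x ^+ 2 in c0 *; set d := 128 / _ in c0 *; nra.
Qed.

Lemma lin_ker_moment x : mu.-integrable setT (EFin \o (fun y => (1 + `|y|) * ker b (x - y))) /\
  \int[mu]_y ((1 + `|y|) * ker b (x - y)) <= (2 + 64 / b ^+ 2) * (1 + `|x|).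
Proof.
have [i0 e0] := ker_mass_left x; have [i2 e2] := ker_sq_moment x.
have k0 y : 0 <= ker b (x - y) by exact: ker_ge0.
pose g y := (2 + `|x|) * ker b (x - y) + ((x - y) ^+ 2 * ker b (x - y)).
have j0 : mu.-integrable setT (EFin \o (fun y => (2 + `|x|) * ker b (x - y))).
  exact: (integrableZ mu).
have j : mu.-integrable setT (EFin \o g) by exact: (integrable_add mu).
have le y : (1 + `|y|) * ker b (x - y) <= g y.
  rewrite /g -mulrDl ler_wpM2r//.
  have h1 : `|y| <= `|x| + `|x - y| by rewrite -{1}(subKr x y) (le_trans (ler_normB _ _)).
  by have := abs_le_quad (x - y); lra.
have ge y : 0 <= (1 + `|y|) * ker b (x - y) by rewrite mulr_ge0 ?addr_ge0.
have k : mu.-integrable setT (EFin \o (fun y => (1 + `|y|) * ker b (x - y))).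
  apply: (integrable_le mu _ _ j) => //.
    apply: measurable_funM; last exact: measurable_ker_shift.
    by apply: measurable_funD => //; exact: measurableT_comp.
  by move=> y _; rewrite ger0_norm.
split; first exact: k.
apply: (@le_trans _ _ (\int[mu]_y g y)); first exact: (le_Rintegral _ k j).
rewrite (RintegralD _ j0 i2)// (RintegralZl _ _ i0)// e0 mulr1.
have c0 : 0 <= 64 / b ^+ 2 by rewrite divr_ge0 ?sqr_ge0.
apply: (le_trans (lerD (lexx _) e2)).
by have := normr_ge0 x; set y := `|x|; set d := 64 / _ in c0 *; nra.
Qed.

Lemma mollifiable_quad f c : measurable_fun setT f ->
  (forall x, `|f x| <= c * (1 + x ^+ 2)) -> mollifiable f.
Proof.
move=> mf bf; split => // x; have [i _] := quad_ker_moment x.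
apply: (integrable_le mu (g := fun y => c * ((1 + y ^+ 2) * ker b (x - y)))) => //.
- by apply: measurable_funM => //; exact: measurable_ker_shift.
- exact: (integrableZ mu).
- move=> y _; rewrite normrM mulrC mulrA (ger0_norm (ker_ge0 (x - y) b_gt0)).
  by apply: ler_wpM2r => //; exact: ker_ge0.
Qed.

Lemma mol_dom Q f : mollifiable f -> exists2 M, 0 <= M &
  forall x y, `|poly_ker b Q (x - y) * f y| <= M * `|ker b (x - y) * f y|.
Proof.
move=> _; have [M M0 HM] := poly_ker_bounded Q b_gt0; exists M => // x y.
have -> : M * `|ker b (x - y) * f y| = M * ker b (x - y) * `|f y|.
  by rewrite normrM (ger0_norm (ker_ge0 (x - y) b_gt0)) mulrA.
by rewrite normrM; apply: ler_wpM2r (normr_ge0 _) _ _ (HM (x - y)).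
Qed.

Lemma measurable_poly_ker_shift Q x : measurable_fun setT (fun y => poly_ker b Q (x - y)).
Proof.
have c : continuous (fun y => poly_ker b Q (x - y)).
  move=> y; apply: (continuous_comp (f := fun y => x - y)); last exact: continuous_poly_ker.
  by apply: cvgB; [exact: cvg_cst|exact: cvg_id].
exact: (continuous_measurable measurableT c).
Qed.

Lemma mol_integrable Q f x : mollifiable f ->
  mu.-integrable setT (EFin \o (fun y => poly_ker b Q (x - y) * f y)).
Proof.
move=> mf; have [M M0 HM] := mol_dom Q mf; have [m i] := mf.
apply: (integrable_le mu (g := fun y => M * `|ker b (x - y) * f y|)) => //.
- by apply: measurable_funM => //; exact: measurable_poly_ker_shift.
- by apply: (integrableZ mu) => //; exact: (integrable_nrm mu).
Qed.

(** On a unit window around [a], [ker_shift] bounds all translated kernels by [expR b] times the one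
    at [a], and the derivatives of the kernel are bounded by the kernel. *)
Lemma has_deriv_mol Q f : mollifiable f ->
  has_deriv (mol Q f) (fun x => b * mol (ker_step Q) f x).
Proof.
move=> mf; have [M M0 HM] := mol_dom (ker_step Q) mf; have [m i] := mf.
apply: (@has_deriv_eq _ _ (fun x => \int[mu]_y (b * poly_ker b (ker_step Q) (x - y) * f y))).
  apply: (has_deriv_integral (f := fun x y => poly_ker b Q (x - y) * f y)
    (df := fun x y => b * poly_ker b (ker_step Q) (x - y) * f y)).
  - by move=> x; exact: mol_integrable.
  - move=> y; have d := has_deriv_shift y (has_deriv_poly_ker b Q).
    by apply: (has_deriv_ext _ _ (has_derivZ (f y) d)) => x; rewrite mulrC.
  - move=> a; exists (fun y => b * M * expR b * `|ker b (a - y) * f y|).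
      by apply: (integrableZ mu) => //; exact: (integrable_nrm mu).
    move=> x y /andP[xa ax].
    have k1 : ker b (x - y) <= expR b * ker b (a - y).
      rewrite (_ : x - y = a - y + (x - a)); last by ring.
      rewrite (le_trans (ker_shift _ _ b_gt0))// ler_wpM2r ?ker_ge0// ler_expR.
      rewrite -[leRHS]mulr1 ler_wpM2l ?(ltW b_gt0)// ler_norml.
      by apply/andP; split; lra.
    have k2 : `|ker b (x - y) * f y| <= expR b * `|ker b (a - y) * f y|.
      have E z : `|ker b z * f y| = ker b z * `|f y|.
        by rewrite normrM (ger0_norm (ker_ge0 z b_gt0)).
      by rewrite !E [leRHS]mulrA; exact: (ler_wpM2r (normr_ge0 _)).
    have -> : `|b * poly_ker b (ker_step Q) (x - y) * f y| =
        b * `|poly_ker b (ker_step Q) (x - y) * f y|.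
      by rewrite -[in LHS]mulrA normrM (gtr0_norm b_gt0).
    have -> : b * M * expR b * `|ker b (a - y) * f y| =
        b * (M * (expR b * `|ker b (a - y) * f y|)) by rewrite !mulrA.
    rewrite ler_wpM2l ?(ltW b_gt0)//; apply: (le_trans (HM x y)); exact: ler_wpM2l.
move=> x; rewrite -RintegralZl//; last exact: mol_integrable.
by apply: (Rintegral_ext mu) => y _; rewrite mulrA.
Qed.

Lemma smooth_mol Q f : mollifiable f -> smooth (mol Q f).
Proof.
move=> mf; pose P := fix P n := if n is n.+1 then ker_step (P n) else Q.
have -> : mol Q f = (fun n x => b ^+ n * mol (P n) f x) 0%N.
  by apply/funext => x; rewrite /= mul1r.
apply: (deriv_seq_smooth (F := fun n x => b ^+ n * mol (P n) f x)) => n.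
apply: (has_deriv_eq (has_derivZ (b ^+ n) (has_deriv_mol (P n) mf))) => x.
by rewrite mulrA exprSr.
Qed.

Lemma measurable_mol Q f : mollifiable f -> measurable_fun setT (mol Q f).
Proof.
move=> mf; have c := smooth_continuous (smooth_mol (Q := Q) mf).
exact: (continuous_measurable measurableT c).
Qed.

Lemma mol_quad Q c : 0 <= c -> exists2 C, 0 <= C & forall f, measurable_fun setT f ->
  (forall x, `|f x| <= c * (1 + x ^+ 2)) -> forall x, `|mol Q f x| <= C * (1 + x ^+ 2).
Proof.
move=> c0; have [M M0 HM] := poly_ker_bounded Q b_gt0.
exists (M * c * (2 + 128 / b ^+ 2)).
  by rewrite !mulr_ge0// addr_ge0// divr_ge0// sqr_ge0.
move=> f m bf x.
have [i e] := quad_ker_moment x.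
have mi := mol_integrable Q x (mollifiable_quad m bf).
apply: (@le_trans _ _ (\int[mu]_y `|poly_ker b Q (x - y) * f y|)); first exact: le_normr_Rintegral.
apply: (@le_trans _ _ (\int[mu]_y (M * c * ((1 + y ^+ 2) * ker b (x - y))))).
  apply: le_Rintegral => //; [exact: (integrable_nrm mu)|exact: (integrableZ mu)|].
  move=> y _; rewrite normrM (_ : M * c * _ = M * ker b (x - y) * (c * (1 + y ^+ 2))); last by ring.
  by rewrite ler_pM.
by rewrite (RintegralZl _ _ i)// -!mulrA ler_wpM2l// ler_wpM2l// mulrA.
Qed.

Lemma mol_lin Q c : 0 <= c -> exists2 C, 0 <= C & forall f, measurable_fun setT f ->
  (forall x, `|f x| <= c * (1 + `|x|)) -> forall x, `|mol Q f x| <= C * (1 + `|x|).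
Proof.
move=> c0; have [M M0 HM] := poly_ker_bounded Q b_gt0.
exists (M * c * (2 + 64 / b ^+ 2)).
  by rewrite !mulr_ge0// addr_ge0// divr_ge0// sqr_ge0.
move=> f m bf x.
have bq y : `|f y| <= 2 * c * (1 + y ^+ 2).
  rewrite (le_trans (bf y))// [2 * c]mulrC -mulrA ler_wpM2l// mulr_natl mulr2n lerD ?abs_le_quad//.
  by rewrite lerDl sqr_ge0.
have [i e] := lin_ker_moment x.
have mi := mol_integrable Q x (mollifiable_quad m bq).
apply: (@le_trans _ _ (\int[mu]_y `|poly_ker b Q (x - y) * f y|)); first exact: le_normr_Rintegral.
apply: (@le_trans _ _ (\int[mu]_y (M * c * ((1 + `|y|) * ker b (x - y))))).
  apply: le_Rintegral => //; [exact: (integrable_nrm mu)|exact: (integrableZ mu)|].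
  move=> y _; rewrite normrM (_ : M * c * _ = M * ker b (x - y) * (c * (1 + `|y|))); last by ring.
  by rewrite ler_pM.
by rewrite (RintegralZl _ _ i)// -!mulrA ler_wpM2l// ler_wpM2l// mulrA.
Qed.

Lemma quad_ker_cvg0 (F : R -> R) c y : (forall x, `|F x| <= c * (1 + x ^+ 2) * ker b (y - x)) ->
  F n%:R @[n --> \oo] --> (0 : R) /\ F (- n%:R) @[n --> \oo] --> (0 : R).
Proof.
move=> bF; have c0 : 0 <= c.
  have := le_trans (normr_ge0 _) (bF 0).
  by rewrite expr0n addr0 mulr1 pmulr_lge0// ker_gt0.
have kn (a : R) (n : nat) : 0 < a -> ker a n%:R <= (1 + a) * n.+1%:R^-1.
  move=> a0; rewrite (le_trans (ker_le _ a0))// ger0_norm// expRN.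
  have n1 : 0 < n.+1%:R :> R by [].
  rewrite ler_pdivrMr ?expR_gt0// mulrAC ler_pdivlMr//.
  have e1 := expR_ge1Dx (a * n%:R); have n0 : 0 <= n%:R :> R by [].
  rewrite (le_trans (y := (1 + a) * (1 + a * n%:R)))//; last first.
    by rewrite ler_wpM2l// addr_ge0// ltW.
  by rewrite -natr1; move: e1 n0; set m : R := n%:R => e1 n0; nra.
pose C := c * expR (b * `|y|) * ((1 + b) + 64 / b ^+ 2 * (1 + b / 2)).
have key x n : `|x| = n%:R -> `|F x - 0| <= C * n.+1%:R^-1.
  move=> xn; rewrite subr0 (le_trans (bF x))// -!mulrA ler_wpM2l//.
  have -> : y - x = - x + y by rewrite addrC.
  rewrite (le_trans (ler_wpM2l _ (ker_shift _ _ b_gt0)))//.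
    by rewrite addr_ge0// sqr_ge0.
  rewrite mulrCA ler_wpM2l ?expR_ge0// ker_even mulrDl mul1r [leRHS]mulrDl.
  have kx (a : R) : ker a x = ker a n%:R.
    rewrite -xn; have [x0|x0] := leP 0 x; first by rewrite ger0_norm.
    by rewrite ltr0_norm// ker_even.
  apply: lerD; first by rewrite kx kn.
  rewrite (le_trans (sqr_ker_le _ b_gt0))//.
  rewrite (_ : 64 * _ / _ = 64 / b ^+ 2 * ((1 + b / 2) / n.+1%:R)); last by rewrite !mulrA.
  by rewrite ler_wpM2l ?divr_ge0 ?sqr_ge0// kx kn// divr_gt0.
split; apply: (@harmonic_bound_cvg _ _ _ C) => n; apply: key.
  by rewrite ger0_norm.
by rewrite normrN ger0_norm.
Qed.

(** Integration by parts moves the derivative from the kernel to [f]; the exponential tails of the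
    kernel remove the boundary terms. *)
Lemma mol_deriv f f' c : has_deriv f f' -> continuous f' ->
  (forall x, `|f x| <= c * (1 + x ^+ 2)) -> (forall x, `|f' x| <= c * (1 + x ^+ 2)) ->
  has_deriv (mol 1 f) (mol 1 f').
Proof.
move=> d cf' bf bf'.
have mf := continuous_measurable measurableT (has_deriv_continuous d).
have mf' := continuous_measurable measurableT cf'.
have M1 := mollifiable_quad mf bf; have M2 := mollifiable_quad mf' bf'.
apply: (has_deriv_eq (has_deriv_mol 1 M1)) => x.
have i1 := mol_integrable (ker_step 1) x M1; have i2 := mol_integrable 1 x M2.
pose F y := poly_ker b 1 (x - y) * f y.
have dF : has_deriv F (fun y => poly_ker b 1 (x - y) * f' y - b * (poly_ker b (ker_step 1) (x - y) * f y)).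
  have dr : has_deriv (fun y : R => x - y) (fun=> - 1).
    by apply: (has_deriv_eq (has_derivB (has_deriv_cst x) (@has_deriv_id R))) => y; rewrite sub0r.
  have dk := has_deriv_comp (has_deriv_poly_ker b 1) dr.
  by apply: (has_deriv_eq (has_derivM dk d)) => y; ring.
have cF : continuous (fun y => poly_ker b 1 (x - y) * f' y - b * (poly_ker b (ker_step 1) (x - y) * f y)).
  have ck Q : continuous (fun y => poly_ker b Q (x - y)).
    move=> y; apply: (continuous_comp (f := fun y => x - y)); last exact: continuous_poly_ker.
    by apply: cvgB; [exact: cvg_cst|exact: cvg_id].
  move=> y; apply: cvgB; first by apply: cvgM; [exact: ck|exact: cf'].
  apply: cvgMl_tmp; apply: cvgM; [exact: ck|exact: (has_deriv_continuous d)].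
have iF : mu.-integrable setT (EFin \o
    (fun y => poly_ker b 1 (x - y) * f' y - b * (poly_ker b (ker_step 1) (x - y) * f y))).
  by apply: (integrable_sub mu) => //; exact: (integrableZ mu).
have bF y : `|F y| <= c * (1 + y ^+ 2) * ker b (x - y).
  by rewrite normrM mulrC poly_ker1 (ger0_norm (ker_ge0 _ b_gt0)) ler_wpM2r// ker_ge0.
have [lp lm] := quad_ker_cvg0 bF.
have := FTC_line dF cF iF lp lm; rewrite subrr.
rewrite (RintegralB _ i2 (integrableZ mu b measurableT i1))// (RintegralZl _ _ i1)//.
by move/eqP; rewrite subr_eq0 => /eqP <-.
Qed.

End mollification.

Lemma lin_le_quad {R : realFieldType} (x : R) : 1 + `|x| <= 2 * (1 + x ^+ 2).
Proof.
rewrite -(real_normK (num_real x)).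
by have := sqr_ge0 (`|x| - 1); have := normr_ge0 x; nra.
Qed.

Lemma lin_sqr_le_quad {R : realFieldType} (x : R) :
  (1 + `|x|) * (1 + `|x|) <= 2 * (1 + x ^+ 2).
Proof. by rewrite -(real_normK (num_real x)); have := sqr_ge0 (`|x| - 1); nra. Qed.

Lemma abs_mul_quad {R : realFieldType} (x y : R) :
  (1 + `|x|) * (1 + `|y|) <= 2 * (1 + x ^+ 2 + y ^+ 2).
Proof.
rewrite -(real_normK (num_real x)) -(real_normK (num_real y)).
set a := `|x|; set d := `|y|.
by have := sqr_ge0 (a - 1); have := sqr_ge0 (d - 1); have := sqr_ge0 (a - d); nra.
Qed.

(** * Mollified densities *)

Section mollified_density.
Context {R : realType}.
Notation mu := (@lebesgue_measure R).
Variables (b : R) (rho : R -> R).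
Hypothesis b_gt0 : 0 < b.
Hypothesis P : P2 rho.
Implicit Types (f : R -> R) (F : R -> R -> R) (x y : R).

Notation k := (ker b).
Notation r := (mol b 1 rho).
Let k_ge0 z : 0 <= k z. Proof. exact: ker_ge0. Qed.
Let Mrho : mollifiable b rho. Proof. exact: mollifiable_P2. Qed.
Let rho_ge0 y : 0 <= rho y. Proof. exact: P2_ge0. Qed.

Lemma measurable_section_r F x : measurable_fun setT (fun p : R * R => F p.1 p.2) ->
  measurable_fun setT (F x).
Proof.
move=> m; rewrite (_ : F x = (fun p : R * R => F p.1 p.2) \o (fun y => (x, y)))//.
by apply: measurableT_comp => //; exact: pair1_measurable.
Qed.

Lemma measurable_section_l F y : measurable_fun setT (fun p : R * R => F p.1 p.2) ->
  measurable_fun setT (F ^~ y).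
Proof.
move=> m; rewrite (_ : F ^~ y = (fun p : R * R => F p.1 p.2) \o (fun x => (x, y)))//.
by apply: measurableT_comp => //; exact: pair2_measurable.
Qed.

Lemma pair_integrable_r F c x : measurable_fun setT (fun p : R * R => F p.1 p.2) ->
  (forall x y, `|F x y| <= c * (1 + x ^+ 2 + y ^+ 2)) ->
  mu.-integrable setT (EFin \o (fun y => F x y * (k (x - y) * rho y))).
Proof.
move=> m bF.
have i : mu.-integrable setT (EFin \o (fun y => F x y * k (x - y) * rho y)).
  apply: (P2_integrable P (c := c * (1 + x ^+ 2) * b)).
    apply: measurable_funM; [exact: measurable_section_r|exact: measurable_ker_shift].
  move=> y; have c0 : 0 <= c.
    by have := le_trans (normr_ge0 _) (bF 0 0); rewrite expr0n !addr0 mulr1.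
  rewrite normrM (ger0_norm (k_ge0 _)).
  rewrite (_ : c * (1 + x ^+ 2) * b * _ = c * ((1 + x ^+ 2) * (1 + y ^+ 2)) * b); last by ring.
  apply: ler_pM => //; last exact: ker_le_cst.
  rewrite (le_trans (bF x y))// ler_wpM2l//.
  by have := mulr_ge0 (sqr_ge0 x) (sqr_ge0 y); lra.
by apply: (integrable_ext mu _ _ i) => // y _; rewrite mulrA.
Qed.

(** Integrating in [x] first costs a multiple of [1 + y^2] by the moments of the kernel, which the
    second moment of [rho] then controls. *)
Lemma pair_fubini F c : measurable_fun setT (fun p : R * R => F p.1 p.2) ->
  (forall x y, `|F x y| <= c * (1 + x ^+ 2 + y ^+ 2)) ->
  [/\ mu.-integrable setT (EFin \o (fun x => \int[mu]_y (F x y * (k (x - y) * rho y)))),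
      mu.-integrable setT (EFin \o (fun y => \int[mu]_x (F x y * (k (x - y) * rho y)))) &
      \int[mu]_x \int[mu]_y (F x y * (k (x - y) * rho y)) =
      \int[mu]_y \int[mu]_x (F x y * (k (x - y) * rho y))].
Proof.
move=> m bF; have c0 : 0 <= c.
  by have := le_trans (normr_ge0 _) (bF 0 0); rewrite expr0n !addr0 mulr1.
pose g y x := c * rho y * ((1 + x ^+ 2) * k (y - x) + y ^+ 2 * k (y - x)).
have bFy x y : `|F x y * (k (x - y) * rho y)| <= g y x.
  rewrite normrM (ger0_norm (mulr_ge0 (k_ge0 _) (rho_ge0 _))) ker_swap /g.
  rewrite (_ : c * rho y * _ = c * (1 + x ^+ 2 + y ^+ 2) * (k (y - x) * rho y)); last by ring.
  by apply: ler_wpM2r; first by rewrite mulr_ge0.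
have ig y : mu.-integrable setT (EFin \o g y) /\
    \int[mu]_x g y x <= c * (3 + 128 / b ^+ 2) * ((1 + y ^+ 2) * rho y).
  have [i e] := quad_ker_moment b_gt0 y; have [i0 e0] := ker_mass_left b_gt0 y.
  have i1 := integrableZ mu (y ^+ 2) measurableT i0.
  have j := integrable_add mu measurableT i i1.
  split; first exact: (integrableZ mu _ measurableT j).
  rewrite (RintegralZl _ _ j)// (RintegralD _ i i1)// (RintegralZl _ _ i0)// e0 mulr1.
  rewrite (_ : c * (3 + 128 / b ^+ 2) * _ =
    c * rho y * ((2 + 128 / b ^+ 2) * (1 + y ^+ 2) + (1 + y ^+ 2))); last by ring.
  by rewrite ler_wpM2l ?mulr_ge0// lerD// lerDr.
have mk : measurable_fun setT (fun p : R * R => k (p.1 - p.2)).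
  apply: measurableT_comp; first exact: (continuous_measurable measurableT (@continuous_ker R b)).
  exact: measurable_funB.
have mr : measurable_fun setT (fun p : R * R => rho p.2).
  by apply: measurableT_comp => //; exact: P2_measurable P.
have mF : measurable_fun setT (fun p : R * R => F p.1 p.2 * (k (p.1 - p.2) * rho p.2)).
  by apply: measurable_funM => //; exact: measurable_funM.
have ix y : mu.-integrable setT (EFin \o (fun x => F x y * (k (x - y) * rho y))).
  have [i _] := ig y; apply: (integrable_le mu (g := g y)) => //.
  exact: (measurable_section_l y (F := fun x y => F x y * (k (x - y) * rho y))).
apply: (@Rfubini _ (fun p => F p.1 p.2 * (k (p.1 - p.2) * rho p.2))
  (fun y => c * (3 + 128 / b ^+ 2) * ((1 + y ^+ 2) * rho y))) => //.
- by move=> x; exact: (pair_integrable_r x m bF).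
- move=> y; have [i e] := ig y; apply: le_trans e.
  apply: (le_Rintegral _ (integrable_nrm mu measurableT (ix y)) i) => //.
- apply: (integrableZ mu) => //; apply: (P2_integrable P (c := 1)).
    by apply: measurable_funD => //; exact: measurable_sqr.
  by move=> x; rewrite mul1r ger0_norm// addr_ge0 ?sqr_ge0.
Qed.

Definition pairable F := measurable_fun setT (fun p : R * R => F p.1 p.2) /\
  exists c, forall x y, `|F x y| <= c * (1 + x ^+ 2 + y ^+ 2).

(* Expectation of [F x y] for [y] distributed along [rho] and [x - y] along
   the kernel, independently. *)
Definition pairE F := \int[mu]_x \int[mu]_y (F x y * (k (x - y) * rho y)).

Lemma pairableD F G : pairable F -> pairable G -> pairable (fun x y => F x y + G x y).
Proof.
move=> [mF [c hc]] [mG [d hd]]; split; first exact: measurable_funD.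
by exists (c + d) => x y; rewrite (le_trans (ler_normD _ _))// mulrDl lerD.
Qed.

Lemma pairableZ a F : pairable F -> pairable (fun x y => a * F x y).
Proof.
move=> [mF [c hc]]; split; first exact: measurable_funM.
by exists (`|a| * c) => x y; rewrite normrM -mulrA ler_wpM2l.
Qed.

Lemma pairE_swap F : pairable F ->
  pairE F = \int[mu]_y \int[mu]_x (F x y * (k (x - y) * rho y)).
Proof. by move=> [mF [c hc]]; have [] := pair_fubini mF hc. Qed.

Lemma pairE_le F G : pairable F -> pairable G -> (forall x y, F x y <= G x y) ->
  pairE F <= pairE G.
Proof.
move=> [mF [c hc]] [mG [d hd]] FG.
have [i _ _] := pair_fubini mF hc; have [j _ _] := pair_fubini mG hd.
rewrite /pairE; apply: (le_Rintegral _ i j) => // x _.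
have ix := pair_integrable_r x mF hc; have jx := pair_integrable_r x mG hd.
by apply: (le_Rintegral _ ix jx) => // y _; rewrite ler_wpM2r// mulr_ge0.
Qed.

Lemma pairED F G : pairable F -> pairable G ->
  pairE (fun x y => F x y + G x y) = pairE F + pairE G.
Proof.
move=> [mF [c hc]] [mG [d hd]].
have [i _ _] := pair_fubini mF hc; have [j _ _] := pair_fubini mG hd.
rewrite /pairE -(RintegralD _ i j)//; apply: (Rintegral_ext mu) => x _.
have ix := pair_integrable_r x mF hc; have jx := pair_integrable_r x mG hd.
rewrite -(RintegralD _ ix jx)//.
by apply: (Rintegral_ext mu) => y _; rewrite mulrDl.
Qed.

Lemma pairEZ a F : pairable F -> pairE (fun x y => a * F x y) = a * pairE F.
Proof.
move=> [mF [c hc]]; have [i _ _] := pair_fubini mF hc.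
rewrite /pairE -(RintegralZl _ _ i)//; apply: (Rintegral_ext mu) => x _.
have ix := pair_integrable_r x mF hc; rewrite -(RintegralZl a _ ix)//.
by apply: (Rintegral_ext mu) => y _; rewrite -mulrA.
Qed.

(** Mollification is self-adjoint, by Fubini's theorem and the evenness of the kernel. *)
Lemma mol_expectation f c : measurable_fun setT f -> (forall x, `|f x| <= c * (1 + x ^+ 2)) ->
  mu.-integrable setT (EFin \o (fun x => f x * r x)) /\
  \int[mu]_x (f x * r x) = \int[mu]_y (mol b 1 f y * rho y).
Proof.
move=> mf bf; have c0 : 0 <= c.
  by have := le_trans (normr_ge0 _) (bf 0); rewrite expr0n addr0 mulr1.
have mF : measurable_fun setT (fun p : R * R => f p.1) by exact: measurableT_comp.
have bF x y : `|f x| <= c * (1 + x ^+ 2 + y ^+ 2).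
  by rewrite (le_trans (bf x))// ler_wpM2l// lerDl sqr_ge0.
have [i1 i2 e] := pair_fubini (F := fun x y => f x) mF bF.
have E1 x : \int[mu]_y (f x * (k (x - y) * rho y)) = f x * r x.
  rewrite mol1E RintegralZl//; by case: Mrho => _; exact.
have E2 y : \int[mu]_x (f x * (k (x - y) * rho y)) = mol b 1 f y * rho y.
  have [_ j] := mollifiable_quad b_gt0 mf bf.
  rewrite mol1E [RHS]mulrC -RintegralZl//; apply: (Rintegral_ext mu) => x _.
  by rewrite ker_swap; ring.
split; first by apply: (integrable_ext mu _ _ i1).
transitivity (\int[mu]_x \int[mu]_y (f x * (k (x - y) * rho y))).
  by apply: (Rintegral_ext mu) => x _; rewrite E1.
by rewrite e; apply: (Rintegral_ext mu) => y _; rewrite E2.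
Qed.

Lemma mol_cst (c : R) x : mol b 1 (fun=> c) x = c.
Proof.
have [i e] := ker_mass_left b_gt0 x; rewrite mol1E.
rewrite (Rintegral_ext mu (g := fun y => c * k (x - y))); last by move=> y _; rewrite mulrC.
by rewrite RintegralZl// e mulr1.
Qed.

Lemma mol_rho_ge0 x : 0 <= r x.
Proof. by rewrite mol1E; apply: Rintegral_ge0 => y _; rewrite mulr_ge0. Qed.

Lemma mol_rho_le x : r x <= b.
Proof.
rewrite mol1E -[leRHS]mulr1 -(P2_mass P) -RintegralZl//; last exact: P2_integrable1.
apply: le_Rintegral => //.
- by case: Mrho => _; exact.
- by apply: (integrableZ mu) => //; exact: P2_integrable1.
- by move=> y _; rewrite ler_wpM2r// ker_le_cst.
Qed.

Lemma P2_mol : P2 r.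
Proof.
have mr : measurable_fun setT r by exact: measurable_mol.
have b1 (x : R) : `|1 : R| <= 1 * (1 + x ^+ 2) by rewrite normr1 mul1r lerDl sqr_ge0.
have bsq (x : R) : `|x ^+ 2| <= 1 * (1 + x ^+ 2) by rewrite ger0_norm ?sqr_ge0// mul1r lerDr.
have m1 : measurable_fun setT (fun _ : R => 1 : R) by exact: measurable_cst.
have m2 : measurable_fun setT (fun x : R => x ^+ 2) by exact: measurable_sqr.
have [i1 e1] := mol_expectation m1 b1.
have [i2 e2] := mol_expectation m2 bsq.
have i : mu.-integrable setT (EFin \o r).
  by apply: (integrable_ext mu _ _ i1) => // x _; rewrite mul1r.
split.
- exact: mr.
- exact: mol_rho_ge0.
- rewrite -(EFin_Rintegral mu)//; congr EFin; rewrite -(P2_mass P).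
  transitivity (\int[mu]_x (1 * r x)).
    by apply: (Rintegral_ext mu) => x _; rewrite mul1r.
  by rewrite e1; apply: (Rintegral_ext mu) => y _; rewrite mol_cst mul1r.
- by rewrite -(EFin_Rintegral mu)// ltry.
Qed.

(* Jensen's inequality gives the exponential tails. *)
Lemma mol_rho_lower N x : \int[mu]_y (`|y| * rho y) <= N ->
  b / 4 * expR (- (b * `|x|) - b * N) <= r x.
Proof.
move=> HN; have iabs : mu.-integrable setT (EFin \o (fun y => `|y| * rho y)).
  have mabs : measurable_fun setT (fun x : R => `|x|) by exact: measurableT_comp.
  apply: (P2_integrable P (c := 1) mabs) => y.
  by rewrite normr_id mul1r abs_le_quad.
have irho := P2_integrable1 P.
set a := b / 4 * _.
have a0 : 0 <= a by apply: mulr_ge0; [apply: divr_ge0; [exact: ltW|]|exact: expR_ge0].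
have i1 := integrableZ mu (a * (1 + b * N)) measurableT irho.
have i2 := integrableZ mu (a * b) measurableT iabs.
rewrite mol1E.
apply: (@le_trans _ _ (\int[mu]_y (a * (1 + b * N) * rho y - a * b * (`|y| * rho y)))).
  rewrite (RintegralB _ i1 i2)// (RintegralZl _ _ irho)// (RintegralZl _ _ iabs)//.
  rewrite (P2_mass P) mulr1 -subr_ge0.
  rewrite (_ : _ - a = a * b * (N - \int[mu]_y (`|y| * rho y))); last by ring.
  by rewrite mulr_ge0 ?subr_ge0// mulr_ge0// (ltW b_gt0).
apply: le_Rintegral => //.
- exact: (integrable_sub mu).
- by case: Mrho => _; exact.
- move=> y _; rewrite mulrA -mulrBl ler_wpM2r//.
  apply: le_trans (ker_ge _ b_gt0).
  apply: (@le_trans _ _ (a * expR (b * N - b * `|y|))).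
    rewrite (_ : _ - _ = a * (1 + (b * N - b * `|y|))); last by ring.
    by rewrite ler_wpM2l// expR_ge1Dx.
  rewrite /a -mulrA -expRD ler_wpM2l ?divr_ge0 ?(ltW b_gt0)// ler_expR.
  have : b * `|x - y| <= b * (`|x| + `|y|) by rewrite ler_wpM2l ?(ltW b_gt0)// ler_normB.
  by rewrite mulrDr; lra.
Qed.

Lemma mol_rho_gt0 x : 0 < r x.
Proof.
apply: lt_le_trans (mol_rho_lower x (lexx _)).
by rewrite mulr_gt0 ?expR_gt0// divr_gt0.
Qed.

Lemma ln_mol_rho N x : \int[mu]_y (`|y| * rho y) <= N ->
  `|ln (r x)| <= (b + b * N + `|ln (b / 4)|) * (1 + `|x|).
Proof.
move=> HN; have r0 := mol_rho_gt0 x; have b4 : 0 < b / 4 by rewrite divr_gt0.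
have N0 : 0 <= N.
  by apply: le_trans HN; apply: Rintegral_ge0 => y _; rewrite mulr_ge0.
have bN : 0 <= b * N by rewrite mulr_ge0// ltW.
have bx : 0 <= b * `|x| by rewrite mulr_ge0// ltW.
have bNx : 0 <= b * N * `|x| by rewrite mulr_ge0.
have lx : 0 <= `|ln (b / 4)| * `|x| by rewrite mulr_ge0.
have up : ln (r x) <= b.
  apply: le_trans (mol_rho_le x).
  by rewrite -[leRHS]expRK ler_ln ?posrE ?expR_gt0// (le_trans _ (expR_ge1Dx _))// lerDr.
have lo : ln (b / 4) + (- (b * `|x|) - b * N) <= ln (r x).
  rewrite -{1}(expRK (- (b * `|x|) - b * N)) -lnM ?posrE ?expR_gt0//.
  rewrite ler_ln ?posrE ?mulr_gt0 ?expR_gt0//; exact: mol_rho_lower.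
have h1 := ler_norm (- ln (b / 4)); rewrite normrN in h1.
have h0 := normr_ge0 (ln (b / 4)); have b0 := ltW b_gt0.
by rewrite ler_norml !mulrDl !mulrDr !mulr1; apply/andP; split; lra.
Qed.

End mollified_density.

(** * Dissipation and entropy of the mollified density *)

Lemma young_sub {R : realFieldType} (u z c w d : R) : 0 < d -> `|w| <= c * `|z| ->
  - (u * w) <= d * u ^+ 2 + c ^+ 2 / (4 * d) * z ^+ 2.
Proof.
move=> d0 hw; have w2 : w ^+ 2 <= c ^+ 2 * z ^+ 2.
  rewrite -[w ^+ 2](real_normK (num_real w)) -[z ^+ 2](real_normK (num_real z)) -exprMn.
  by rewrite lerXn2r ?nnegrE// (le_trans _ hw).
apply: (@le_trans _ _ (d * u ^+ 2 + w ^+ 2 / (4 * d))).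
  rewrite -subr_ge0 (_ : _ - _ = d * (u + w / (2 * d)) ^+ 2); last by field; rewrite gt_eqF.
  by rewrite mulr_ge0 ?sqr_ge0// ltW.
by rewrite lerD2l [leRHS]mulrAC ler_wpM2r// invr_ge0 mulr_ge0// (ltW d0).
Qed.

Section dissipation_bound.
Context {R : realType}.
Notation mu := (@lebesgue_measure R).
Variables (H : R -> R) (CH al be b : R) (rho : R -> R).
Notation h1 := (derive1 H).
Hypothesis cH : confining H h1 (derive1 h1) CH al be.
Hypothesis b_gt0 : 0 < b.
Hypothesis P : P2 rho.
Implicit Types (f : R -> R) (F : R -> R -> R) (x y s : R).

Notation k := (ker b).
Notation r := (mol b 1 rho).
Notation dr := (fun x => b * mol b (ker_step 1) rho x).
Notation lam := (fun z => 1 - 2 * logistic (b * z)).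
Let k_ge0 z : 0 <= k z. Proof. exact: ker_ge0. Qed.
Let Mrho : mollifiable b rho. Proof. exact: mollifiable_P2. Qed.
Let rho_ge0 y : 0 <= rho y. Proof. exact: P2_ge0. Qed.
Let CH0 : 0 < CH. Proof. exact: conf_CH cH. Qed.
Let mh1 : measurable_fun setT h1. Proof. exact: measurable_h1 cH. Qed.
Let r0 x : 0 < r x. Proof. exact: mol_rho_gt0. Qed.

(** [b * lam] is the logarithmic derivative of the kernel, and [lam z = - tanh (b z / 2)]. *)
Lemma poly_ker_step1 z : poly_ker b (ker_step 1) z = lam z * k z.
Proof.
rewrite /poly_ker /ker_step derivC mulr0 add0r mulr1 !hornerE.
by congr (_ * _); rewrite mulr_natl.
Qed.

Lemma lam_odd z : lam (- z) = - lam z.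
Proof. by rewrite /= mulrN logistic_opp; ring. Qed.

Lemma lam_le1 z : `|lam z| <= 1.
Proof.
have := @logistic_gt0 R (b * z); have := @logistic_lt1 R (b * z).
by rewrite ler_norml => ? ?; apply/andP; split; lra.
Qed.

Lemma step1_swap x y : poly_ker b (ker_step 1) (y - x) = - (lam (x - y) * k (x - y)).
Proof.
have -> : y - x = - (x - y) by rewrite opprB.
have e := lam_odd (x - y); rewrite /= in e.
by rewrite poly_ker_step1 ker_even e mulNr.
Qed.

Lemma dr_le x : `|dr x| <= b * r x.
Proof.
rewrite normrM (gtr0_norm b_gt0) ler_wpM2l ?(ltW b_gt0)//.
have i := mol_integrable b_gt0 (ker_step 1) x Mrho; have [_ j] := Mrho.
apply: (@le_trans _ _ (\int[mu]_y `|poly_ker b (ker_step 1) (x - y) * rho y|)).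
  exact: le_normr_Rintegral.
rewrite mol1E; apply: le_Rintegral => //; first exact: (integrable_nrm mu).
move=> y _; rewrite normrM (ger0_norm (rho_ge0 y)) ler_wpM2r// poly_ker_step1.
by rewrite normrM (ger0_norm (k_ge0 _)) ler_piMl// lam_le1.
Qed.

(* The derivative of [ln (r / gamma H s)] *)
Definition score s x := dr x / r x + h1 x - s.

Lemma score_le s x : `|score s x| <= (b + CH + `|s|) * (1 + `|x|).
Proof.
have a1 : `|dr x / r x| <= b.
  by rewrite normrM normfV (gtr0_norm (r0 x)) ler_pdivrMr// dr_le.
rewrite /score (le_trans (ler_normB _ _))// (le_trans (lerD (ler_normD _ _) (lexx _)))//.
have s0 := normr_ge0 s; have x0 := normr_ge0 x.
have p1 := mulr_ge0 (ltW b_gt0) x0; have p2 := mulr_ge0 s0 x0.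
by have := conf_h1 cH x; rewrite !mulrDl !mulrDr !mulr1; lra.
Qed.

Lemma continuous_score s : continuous (score s).
Proof.
have c1 := smooth_continuous (smooth_mol (Q := ker_step 1) b_gt0 Mrho).
have c2 := smooth_continuous (smooth_mol (Q := 1) b_gt0 Mrho).
have ch1 := conf_ch1 cH.
move=> x; rewrite /score; apply: cvgB; last exact: cvg_cst.
apply: cvgD; last exact: ch1.
apply: cvgM; first by apply: cvgMl_tmp; exact: c1.
by apply: cvgV; [rewrite gt_eqF|exact: c2].
Qed.

Let mscore s : measurable_fun setT (score s).
Proof. exact: (continuous_measurable measurableT (@continuous_score s)). Qed.

Lemma score_sqr s : exists c, forall x, `|score s x ^+ 2| <= c * (1 + x ^+ 2).
Proof.
set c := b + CH + `|s|; exists (2 * c ^+ 2) => x.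
have h := score_le s x; rewrite -/c in h.
rewrite normrX expr2 (le_trans (ler_pM (normr_ge0 _) (normr_ge0 _) h h))//.
rewrite (_ : c * _ * _ = c ^+ 2 * ((1 + `|x|) * (1 + `|x|))); last by ring.
rewrite (_ : 2 * c ^+ 2 * _ = c ^+ 2 * (2 * (1 + x ^+ 2))); last by ring.
by rewrite ler_wpM2l ?sqr_ge0// lin_sqr_le_quad.
Qed.

Lemma score_quad s x : `|score s x| <= 2 * (b + CH + `|s|) * (1 + x ^+ 2).
Proof.
rewrite (le_trans (score_le s x))// [2 * _]mulrC -[leRHS]mulrA ler_wpM2l ?lin_le_quad//.
by rewrite !addr_ge0// ltW.
Qed.

Lemma mol_step1_cst x : mol b (ker_step 1) (fun=> 1) x = 0.
Proof.
have b1 (y : R) : `|1 : R| <= 1 * (1 + y ^+ 2) by rewrite normr1 mul1r lerDl sqr_ge0.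
have M1 : mollifiable b (fun=> 1) by exact: mollifiable_quad b1.
have d := has_deriv_mol b_gt0 1 M1.
have e : mol b 1 (fun=> 1) = (fun=> 1) by apply/funext => y; exact: mol_cst.
have := has_deriv_derive1 d; rewrite e (has_deriv_derive1 (has_deriv_cst 1)).
by move=> /(congr1 (fun f : R -> R => f x)) /esym/eqP; rewrite mulf_eq0 gt_eqF//= => /eqP.
Qed.

(** In the coupling of [pairE] the left-hand side is the expectation of [- v x * m x y]. Given [x],
    the mean of [b * lam (x - y)] is [dr x / r x]; if [h1 y] were [h1 x], the mean of [m] would be
    the score [u x], and [- u x * m x y] would give [- u^2]. The difference [h1 y - h1 x], Lipschitz
    in [x - y], is split by Young's inequality with weight [d], and [v - u = s - s0] produces the
    last term. *)
Lemma dissipation_estimate s s0 d : 0 < d ->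
  \int[mu]_y (b * mol b (ker_step 1) (score s0) y * rho y)
  - \int[mu]_y (h1 y * mol b 1 (score s0) y * rho y)
  + s * \int[mu]_y (mol b 1 (score s0) y * rho y) <=
  - (1 - d) * \int[mu]_x (score s x ^+ 2 * r x) + 16 * CH ^+ 2 / (d * b ^+ 2)
  - (s - s0) * (\int[mu]_y (h1 y * rho y) - s).
Proof.
move=> d0; pose u := score s; pose v := score s0.
pose m x y := b * lam (x - y) + (h1 y - s).
(* The main part, with the drift evaluated at [x], together with the share [d u^2] of Young's
   inequality. *)
pose T x y := - (u x * (b * lam (x - y) + (h1 x - s))) + d * u x ^+ 2.
pose S x y := (x - y) ^+ 2.
have mf1 (f : R -> R) : measurable_fun setT f -> measurable_fun setT (fun p : R * R => f p.1).
  by move=> mf; exact: measurableT_comp.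
have mf2 (f : R -> R) : measurable_fun setT f -> measurable_fun setT (fun p : R * R => f p.2).
  by move=> mf; exact: measurableT_comp.
have mlam : measurable_fun setT (fun p : R * R => lam (p.1 - p.2)).
  have cl : continuous (fun z : R => lam z).
    move=> z; apply: cvgB; first exact: cvg_cst.
    apply: cvgMl_tmp; apply: (continuous_comp (f := fun z : R => b * z)).
      by apply: cvgMl_tmp; exact: cvg_id.
    exact: (has_deriv_continuous (@has_deriv_logistic R)).
  have ml := continuous_measurable measurableT cl.
  have mb : measurable_fun setT (fun p : R * R => p.1 - p.2) by exact: measurable_funB.
  exact: (measurableT_comp ml mb).
have blam z : `|b * lam z| <= b.
  by rewrite normrM (gtr0_norm b_gt0) ler_piMr ?(ltW b_gt0)// lam_le1.
have lin x : `|h1 x - s| <= (CH + `|s|) * (1 + `|x|).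
  rewrite (le_trans (ler_normB _ _))// mulrDl lerD ?(conf_h1 cH)//.
  by rewrite ler_peMr// lerDl.
have linb x z : `|b * lam z + (h1 x - s)| <= (b + CH + `|s|) * (1 + `|x|).
  rewrite -[b + CH + _]addrA [leRHS]mulrDl (le_trans (ler_normD _ _))// lerD ?lin//.
  by rewrite (le_trans (blam z))// ler_peMr ?(ltW b_gt0)// lerDl.
have cs0 : 0 <= b + CH + `|s| by rewrite !addr_ge0// ltW.
have cs00 : 0 <= b + CH + `|s0| by rewrite !addr_ge0// ltW.
have mhs : measurable_fun setT (fun x => h1 x - s) by exact: measurable_funB.
have pm : pairable m.
  split.
    apply: measurable_funD; first exact: measurable_funM.
    exact: (mf2 _ mhs).
  exists (2 * (b + CH + `|s|)) => x y; rewrite (le_trans (linb y _))//.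
  rewrite [2 * _]mulrC -[leRHS]mulrA ler_wpM2l//.
  by have := abs_le_quad y; have := sqr_ge0 x; have := sqr_ge0 y; lra.
have pT : pairable T.
  split.
    apply: measurable_funD; last first.
      apply: measurable_funM => //; exact: (mf1 _ (measurable_funX 2 (mscore s))).
    apply: measurableT_comp => //; apply: measurable_funM; first exact: (mf1 _ (mscore s)).
    apply: measurable_funD; first exact: measurable_funM.
    exact: (mf1 _ mhs).
  have [c hc] := score_sqr s.
  have c0 : 0 <= c by have := le_trans (normr_ge0 _) (hc 0); rewrite expr0n addr0 mulr1.
  exists (2 * (b + CH + `|s|) ^+ 2 + d * c) => x y.
  rewrite (le_trans (ler_normD _ _))// [leRHS]mulrDl lerD//.
    rewrite normrN normrM (le_trans (ler_pM (normr_ge0 _) (normr_ge0 _) (score_le s x) (linb x _)))//.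
    set c' := b + CH + _.
    rewrite (_ : c' * _ * _ = c' ^+ 2 * ((1 + `|x|) * (1 + `|x|))); last by ring.
    rewrite [2 * _]mulrC -[leRHS]mulrA ler_wpM2l ?sqr_ge0//.
    rewrite -(real_normK (num_real x)); have := sqr_ge0 y.
    by have := sqr_ge0 (`|x| - 1); set z := `|x|; nra.
  rewrite normrM (gtr0_norm d0) -mulrA ler_wpM2l ?(ltW d0)//.
  by rewrite (le_trans (hc x))// ler_wpM2l// lerDl sqr_ge0.
have pS : pairable S.
  split; first by apply: measurable_funX; exact: measurable_funB.
  exists 2 => x y; rewrite ger0_norm ?sqr_ge0// /S.
  by have := sqr_ge0 (x + y); lra.
have pF : pairable (fun x y => -1 * (v x * m x y)).
  apply: pairableZ; split.
    by apply: measurable_funM; [exact: (mf1 _ (mscore s0))|case: pm].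
  exists (2 * ((b + CH + `|s0|) * (b + CH + `|s|))) => x y.
  rewrite normrM (le_trans (ler_pM (normr_ge0 _) (normr_ge0 _) (score_le s0 x) (linb y _)))//.
  set c1 := b + CH + _; set c2 := b + CH + _.
  rewrite (_ : c1 * _ * _ = c1 * c2 * ((1 + `|x|) * (1 + `|y|))); last by ring.
  by rewrite [2 * _]mulrC -[leRHS]mulrA ler_wpM2l ?abs_mul_quad// mulr_ge0.
have FT x y : -1 * (v x * m x y) <=
    (T x y + CH ^+ 2 / (4 * d) * S x y) + (- (s - s0)) * m x y.
  have hy : `|h1 y - h1 x| <= CH * `|x - y|.
    by rewrite [`|x - y|]distrC; exact: (has_deriv_lip _ _ (conf_d2 cH) (conf_h2 cH)).
  have := young_sub (u x) d0 hy.
  have -> : v x = u x + (s - s0) by rewrite /v /u /score; ring.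
  rewrite /m /T /S; set a := CH ^+ 2 / _ * _; set z := b * _; set w := u x ^+ 2.
  rewrite -subr_ge0 => hh; rewrite -subr_ge0.
  by rewrite (_ : _ - _ = d * w + a - - (u x * (h1 y - h1 x)))//; ring.
have main := pairE_le b_gt0 P pF (pairableD (pairableD pT (pairableZ _ pS)) (pairableZ _ pm)) FT.
rewrite (pairED b_gt0 P (pairableD pT (pairableZ _ pS)) (pairableZ _ pm)) in main.
rewrite (pairED b_gt0 P pT (pairableZ _ pS)) in main.
rewrite (pairEZ b_gt0 P _ pS) (pairEZ b_gt0 P _ pm) in main.
have ET : pairE b rho T = - (1 - d) * \int[mu]_x (u x ^+ 2 * r x).
  have [c hc] := score_sqr s.
  have iu := P2_integrable (P2_mol b_gt0 P) (measurable_funX 2 (mscore s)) hc.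
  rewrite -(RintegralZl _ _ iu)//; apply: (Rintegral_ext mu) => x _.
  have j1 := mol_integrable b_gt0 (ker_step 1) x Mrho; have [_ j2] := Mrho.
  rewrite (Rintegral_ext mu (g := fun y => - u x * b * (poly_ker b (ker_step 1) (x - y) * rho y)
    + (d * u x ^+ 2 - u x * (h1 x - s)) * (k (x - y) * rho y))); last first.
    by move=> y _; rewrite /T poly_ker_step1; ring.
  rewrite (RintegralD _ (integrableZ mu _ measurableT j1) (integrableZ mu _ measurableT (j2 x)))//.
  rewrite (RintegralZl _ _ j1)// (RintegralZl _ _ (j2 x))// -mol1E -/(mol b (ker_step 1) rho x).
  have : u x * r x = b * mol b (ker_step 1) rho x + (h1 x - s) * r x.
    by rewrite /u /score; field; rewrite gt_eqF.
  by rewrite expr2 => e; ring: e.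
have ES : pairE b rho S <= 64 / b ^+ 2.
  rewrite (pairE_swap b_gt0 P pS); have irho := P2_integrable1 P.
  have [_ iS _] := pair_fubini b_gt0 P (proj1 pS) (projT2 (cid (proj2 pS))).
  rewrite -[leRHS]mulr1 -[X in _ <= _ * X](P2_mass P) -(RintegralZl _ _ irho)//.
  apply: (le_Rintegral _ iS (integrableZ mu _ measurableT irho)) => // y _.
  have [j e] := ker_sq_moment b_gt0 y.
  rewrite (Rintegral_ext mu (g := fun x => rho y * ((y - x) ^+ 2 * k (y - x)))); last first.
    by move=> x _; rewrite /S ker_swap -sqrrN opprB; ring.
  rewrite (RintegralZl _ _ j)// [leRHS]mulrC; exact: (ler_wpM2l (rho_ge0 y) e).
have Em : pairE b rho m = \int[mu]_y (h1 y * rho y) - s.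
  rewrite (pairE_swap b_gt0 P pm); have irho := P2_integrable1 P.
  have ih1 := integrable_h1 cH P.
  transitivity (\int[mu]_y (h1 y * rho y - s * rho y)); last first.
    by rewrite (RintegralB _ ih1 (integrableZ mu _ measurableT irho))// (RintegralZl _ _ irho)// (P2_mass P) mulr1.
  apply: (Rintegral_ext mu) => y _.
  have b1 (z : R) : `|1 : R| <= 1 * (1 + z ^+ 2) by rewrite normr1 mul1r lerDl sqr_ge0.
  have M1 : mollifiable b (fun=> 1) by exact: mollifiable_quad b1.
  have j1 := mol_integrable b_gt0 (ker_step 1) y M1; have [_ j2] := M1.
  rewrite (Rintegral_ext mu (g := fun x => - b * rho y * (poly_ker b (ker_step 1) (y - x) * 1)
    + (h1 y - s) * rho y * (k (y - x) * 1))); last first.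
    by move=> x _; rewrite /m step1_swap [k (y - x)]ker_swap; ring.
  rewrite (RintegralD _ (integrableZ mu _ measurableT j1) (integrableZ mu _ measurableT (j2 y)))//.
  rewrite (RintegralZl _ _ j1)// (RintegralZl _ _ (j2 y))// -mol1E -/(mol b (ker_step 1) (fun=> 1) y).
  by rewrite mol_step1_cst mol_cst//; ring.
have EF : pairE b rho (fun x y => -1 * (v x * m x y)) =
    \int[mu]_y (b * mol b (ker_step 1) v y * rho y)
    - \int[mu]_y (h1 y * mol b 1 v y * rho y) + s * \int[mu]_y (mol b 1 v y * rho y).
  have Mv : mollifiable b v by apply: (mollifiable_quad b_gt0 (mscore s0)); exact: score_quad.
  have [C1 C10 B1] := mol_quad b_gt0 (ker_step 1) (mulr_ge0 (ler0n R 2) cs00).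
  have [C2 C20 B2] := mol_lin b_gt0 1 cs00.
  have l1 := B1 v (mscore s0) (score_quad s0); have l2 := B2 v (mscore s0) (score_le s0).
  have mm Q : measurable_fun setT (mol b Q v) by exact: measurable_mol.
  have q1 y : `|b * mol b (ker_step 1) v y| <= b * C1 * (1 + y ^+ 2).
    by rewrite normrM (gtr0_norm b_gt0) -[leRHS]mulrA ler_wpM2l ?(ltW b_gt0).
  have q2 y : `|h1 y * mol b 1 v y| <= CH * C2 * 2 * (1 + y ^+ 2).
    rewrite normrM (le_trans (ler_pM (normr_ge0 _) (normr_ge0 _) (conf_h1 cH y) (l2 y)))//.
    rewrite (_ : CH * (1 + `|y|) * _ = CH * C2 * ((1 + `|y|) * (1 + `|y|))); last by ring.
    rewrite -[leRHS]mulrA ler_wpM2l//; first by rewrite mulr_ge0// ltW.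
    exact: lin_sqr_le_quad.
  have q3 y : `|mol b 1 v y| <= 2 * C2 * (1 + y ^+ 2).
    rewrite (le_trans (l2 y))// [2 * _]mulrC -[leRHS]mulrA ler_wpM2l//.
    exact: lin_le_quad.
  have i1 := P2_integrable P (measurable_funM (measurable_cst b) (mm _)) q1.
  have i2 := P2_integrable P (measurable_funM mh1 (mm 1)) q2.
  have i3 := P2_integrable P (mm 1) q3.
  rewrite -(RintegralB _ i1 i2)// -(RintegralZl _ _ i3)//.
  rewrite -(RintegralD _ (integrable_sub mu measurableT i1 i2) (integrableZ mu _ measurableT i3))//.
  rewrite (pairE_swap b_gt0 P pF); apply: (Rintegral_ext mu) => y _.
  have j1 := mol_integrable b_gt0 (ker_step 1) y Mv; have [_ j2] := Mv.
  rewrite (Rintegral_ext mu (g := fun x => b * rho y * (poly_ker b (ker_step 1) (y - x) * v x)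
    + (s - h1 y) * rho y * (k (y - x) * v x))); last first.
    by move=> x _; rewrite /m step1_swap [k (y - x)]ker_swap; ring.
  rewrite (RintegralD _ (integrableZ mu _ measurableT j1) (integrableZ mu _ measurableT (j2 y)))//.
  rewrite (RintegralZl _ _ j1)// (RintegralZl _ _ (j2 y))// -mol1E -/(mol b (ker_step 1) v y).
  by rewrite /=; ring.
rewrite EF ET Em in main; apply: (le_trans main); rewrite -/u [- (s - s0) * _]mulNr lerD2r lerD2l.
(* The kernel has second moment at most [64 / b^2], and 64 / 4 = 16. *)
apply: (@le_trans _ _ (CH ^+ 2 / (4 * d) * (64 / b ^+ 2))).
  by rewrite ler_wpM2l// divr_ge0 ?sqr_ge0// mulr_ge0// ltW.
rewrite le_eqVlt; apply/orP; left; apply/eqP; field.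
by rewrite !gt_eqF.
Qed.

End dissipation_bound.

(** * Uniqueness of weak derivatives *)

Section weak_derivatives.
Context {R : realType}.
Notation mu := (@lebesgue_measure R).
Implicit Types f g h phi : R -> R.

Lemma locally_integrable_itv h a b : locally_integrable setT h ->
  mu.-integrable `[a, b] (EFin \o h).
Proof.
move=> [mh _ /(_ `[a, b] (@subsetT _ _) (@segment_compact _ a b)) ih].
apply/integrableP; split; first exact/measurable_EFinP/(measurable_funS measurableT).
exact: ih.
Qed.

Lemma continuous_locally_integrable f : continuous f -> locally_integrable setT f.
Proof.
move=> cf; split; [exact: (continuous_measurable measurableT)|exact: openT|].
move=> K _ cK; have [M [_ HM]] := compact_bounded cK.
have mK : measurable K by apply: closed_measurable; exact: compact_closed.
pose L := M + 1; pose L' := - L.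
apply: (@le_lt_trans _ _ (\int[mu]_(x in `[L', L]) `|f x|%:E)%E).
  apply: ge0_subset_integral => //.
  - apply/measurable_EFinP; apply: measurableT_comp => //.
    exact: (continuous_measurable (measurable_itv _)).
  - move=> x Kx; have := HM L _ x Kx; rewrite /= in_itv /= -ler_norml.
    by apply; rewrite ltrDl.
by have /integrableP[_] := @continuous_integrable_itv R f L' L cf.
Qed.

Lemma csupp_integrable f : continuous f -> csupp f -> mu.-integrable setT (EFin \o f).
Proof.
move=> cf [K HK].
have iK := @continuous_integrable_itv R f (- K) K cf.
have := proj1 (integrable_patch mu (measurable_itv _)) iK.
apply: (integrable_ext mu) => // x _; rewrite patchE; case: ifPn => // /negP xK.
rewrite HK// ltNge; apply/negP => h; apply: xK.
by rewrite inE /= in_itv /= -ler_norml.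
Qed.

Lemma smooth_weak_derivative f f' : has_deriv f f' -> continuous f' ->
  weak_derivative setT f f'.
Proof.
move=> d cf'; have cf := has_deriv_continuous d.
split; [exact: continuous_locally_integrable|exact: continuous_locally_integrable|].
move=> phi /test_functionP[sphi kphi].
have dphi := smooth_has_deriv 0 sphi; rewrite derive1n0 derive1n1 in dphi.
have sphi' := smooth_deriv sphi dphi; have kphi' := csupp_deriv dphi kphi.
have cphi := smooth_continuous sphi; have cphi' := smooth_continuous sphi'.
have c1 : continuous (fun x => f' x * phi x).
  by move=> x; apply: cvgM; [exact: cf'|exact: cphi].
have c2 : continuous (fun x => f x * derive1 phi x).
  by move=> x; apply: cvgM; [exact: cf|exact: cphi'].
have i1 := csupp_integrable c1 (csuppM f' kphi).
have i2 := csupp_integrable c2 (csuppM f kphi').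
have dF := has_derivM d dphi.
have cF : continuous (fun x => f' x * phi x + f x * derive1 phi x).
  by move=> x; apply: cvgD; [exact: c1|exact: c2].
have [K HK] := csuppM f kphi.
have l0 (u : nat -> R) : (forall n, `|u n| = n%:R) -> f (u n) * phi (u n) @[n --> \oo] --> (0 : R).
  move=> hu; apply: cvg_near_cst; near=> n; apply: HK; rewrite hu.
  by near: n; exact: nbhs_infty_gtr.
have := FTC_line dF cF (integrable_add mu measurableT i1 i2)
  (l0 (fun n => n%:R) _) (l0 (fun n => - n%:R) _).
rewrite subrr (RintegralD _ i1 i2)// => /(_ _ _)/eqP; rewrite addrC addr_eq0 => H.
by apply/eqP/H => n; rewrite ?normrN ger0_norm.
Unshelve. all: by end_near. Qed.

(** Testing with bumps that tend to the indicator function of an interval shows that the difference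
    has zero integral over every bounded open interval; it therefore vanishes at its Lebesgue
    points. *)
Lemma weak_derivative_unique f g g' : weak_derivative setT f g -> weak_derivative setT f g' ->
  {ae mu, forall x, g x = g' x}.
Proof.
move=> [_ lg wg] [_ lg' wg']; pose h x := g x - g' x.
have lh : locally_integrable setT h by exact: locally_integrableB.
have [mh _ _] := lh.
have zero a b : \int[mu]_(x in `]a, b[) h x = 0.
  pose u n x := h x * sbump a b n.+1%:R x.
  have sb n : test_function setT (sbump a b n.+1%:R) by exact: test_function_sbump.
  have msb n : measurable_fun setT (sbump a b n.+1%:R).
    exact: (continuous_measurable measurableT (smooth_continuous (proj1 (sb n)))).
  have iab := proj1 (integrable_patch mu (measurable_itv _)) (locally_integrable_itv a b lh).
  have loc (w : R -> R) n : locally_integrable setT w ->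
      mu.-integrable setT (EFin \o (fun x => w x * sbump a b n.+1%:R x)).
    move=> lw; have [mw _ _] := lw; have mwn := measurable_funM mw (msb n).
    have iw := proj1 (integrable_patch mu (measurable_itv _)) (locally_integrable_itv a b lw).
    apply: (integrable_le mu measurableT mwn (integrable_nrm mu measurableT iw)) => x _.
    rewrite normrM patchE; case: ifPn => [_|/negP xab].
      by rewrite ler_piMr// ger0_norm ?sbump_ge0// sbump_le1.
    rewrite sbump_out ?normr0 ?mulr0//; apply/negP => /andP[ax xb]; apply: xab.
    by rewrite inE /= in_itv /= !ltW.
  have cu x : u n x @[n --> \oo] --> (h \_ `]a, b[) x.
    rewrite patchE; case: ifPn => [|/negP xab].
      rewrite inE /= in_itv /= => axb; rewrite -[X in _ --> X]mulr1.
      by apply: cvgMl_tmp; exact: sbump_cvg.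
    rewrite (_ : (fun n => u n x) = fun=> 0); first exact: cvg_cst.
    apply/funext => n; rewrite /u sbump_out ?mulr0//; apply/negP => axb; apply: xab.
    by rewrite inE /= in_itv.
  have bu n x : setT x -> `|u n x| <= `|(h \_ `[a, b]) x|.
    move=> _; rewrite normrM patchE; case: ifPn => [_|/negP xab].
      by rewrite ler_piMr// ger0_norm ?sbump_ge0// sbump_le1.
    rewrite sbump_out ?normr0 ?mulr0//; apply/negP => /andP[ax xb]; apply: xab.
    by rewrite inE /= in_itv /= !ltW.
  have mu_ n : measurable_fun setT (u n) by exact: measurable_funM.
  have [_ L] := Rdominated_cvg mu measurableT mu_ (fun x _ => cu x)
    (integrable_nrm mu measurableT iab) bu.
  rewrite Rintegral_mkcond; apply: (cvg_unique _ L) => //.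
  rewrite (_ : (fun n => _) = fun=> 0); first exact: cvg_cst.
  apply/funext => n; have h1 := wg _ (sb n); have h2 := wg' _ (sb n).
  rewrite (Rintegral_ext mu (g := fun x => g x * sbump a b n.+1%:R x - g' x * sbump a b n.+1%:R x)).
    rewrite (RintegralB _ (loc g n lg) (loc g' n lg'))//; apply/eqP.
    by rewrite subr_eq0 -eqr_opp -h1 -h2.
  by move=> x _; rewrite /u /h mulrBl.
apply: ae_impl (lebesgue_differentiation lh) => x lx.
have xx : x < x + 1 by rewrite ltrDl.
have ih : mu.-integrable `]x - 1, x + 1] (EFin \o h).
  have := locally_integrable_itv (x - 1) (x + 1) lh.
  by apply: integrableS => //; exact: subset_itv_oc_cc.
have ax : (BRight (x - 1) < BRight x)%O by rewrite bnd_simp ltrBlDr ltrDl.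
have [_] := FTC1_lebesgue_pt xx ih ax lx.
rewrite (_ : (fun y => _) = fun=> 0); last first.
  apply/funext => y; rewrite -Rintegral_itv_bndo_bndc ?zero//.
  have := locally_integrable_itv (x - 1) y lh.
  by apply: integrableS => //; exact: subset_itv_oo_cc.
by rewrite derive1_cst => /esym/eqP; rewrite subr_eq0 => /eqP.
Qed.

End weak_derivatives.

(** * Entropy of the mollified density *)

Section mollified_entropy.
Context {R : realType}.
Notation mu := (@lebesgue_measure R).
Variables (H : R -> R) (CH al be b : R).
Notation h1 := (derive1 H).
Hypothesis cH : confining H h1 (derive1 h1) CH al be.
Hypothesis b_gt0 : 0 < b.
Implicit Types (f rho : R -> R) (x y s : R).

Let CH0 : 0 < CH. Proof. exact: conf_CH cH. Qed.

Definition log_ratio rho s x := ln (mol b 1 rho x) + H x - s * x + ln (Zf H s).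

Definition mol_entropy rho s := \int[mu]_x (log_ratio rho s x * mol b 1 rho x).

Lemma has_deriv_log_ratio rho s : P2 rho ->
  has_deriv (log_ratio rho s) (score H b rho s).
Proof.
move=> P; have dr := has_deriv_mol b_gt0 1 (mollifiable_P2 b_gt0 P).
have d1 := has_deriv_ln (mol_rho_gt0 b_gt0 P) dr.
have d2 := has_derivB (has_derivD d1 (conf_d1 cH)) (has_derivZ s (@has_deriv_id R)).
by apply: (has_deriv_eq (has_derivD d2 (has_deriv_cst _))) => x; rewrite mulr1 addr0.
Qed.

Definition log_ratio_cst N s :=
  2 * (b + b * N + `|ln (b / 4)|) + CH + 2 * `|s| + `|ln (Zf H s)|.

Lemma log_ratio_quad rho N s x : P2 rho -> \int[mu]_y (`|y| * rho y) <= N ->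
  `|log_ratio rho s x| <= log_ratio_cst N s * (1 + x ^+ 2).
Proof.
move=> P HN; have l := ln_mol_rho b_gt0 P x HN.
have N0 : 0 <= N.
  by apply: le_trans HN; apply: Rintegral_ge0 => y _; rewrite mulr_ge0// (P2_ge0 y P).
set c := b + b * N + `|ln (b / 4)| in l.
have c0 : 0 <= c by rewrite !addr_ge0 ?mulr_ge0 ?(ltW b_gt0).
have lq := lin_le_quad x; have o1 : 1 <= 1 + x ^+ 2 by rewrite lerDl sqr_ge0.
rewrite /log_ratio_cst -/c 3!mulrDl.
apply: (le_trans (ler_normD _ _)); apply: lerD; last by rewrite ler_peMr.
apply: (le_trans (ler_normB _ _)); apply: lerD; last first.
  rewrite normrM [2 * _]mulrC -[leRHS]mulrA ler_wpM2l//.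
  by rewrite (le_trans _ lq)// lerDr.
apply: (le_trans (ler_normD _ _)); apply: lerD; last first.
  by rewrite (ger0_norm (conf_ge0 cH x)) (conf_le cH).
by rewrite (le_trans l)// [2 * _]mulrC -[leRHS]mulrA ler_wpM2l.
Qed.

Let absN rho : P2 rho -> \int[mu]_y (`|y| * rho y) <= \int[mu]_y (`|y| * rho y).
Proof. by []. Qed.

Lemma measurable_log_ratio rho s : P2 rho -> measurable_fun setT (log_ratio rho s).
Proof.
move=> P; have c := has_deriv_continuous (has_deriv_log_ratio s P).
exact: (continuous_measurable measurableT c).
Qed.

Lemma log_ratio_integrable rho rho' s : P2 rho -> P2 rho' ->
  mu.-integrable setT (EFin \o (fun x => log_ratio rho s x * mol b 1 rho' x)).
Proof.
move=> P P'; apply: (P2_integrable (P2_mol b_gt0 P') (measurable_log_ratio s P)).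
by move=> x; exact: (log_ratio_quad s x P (absN P)).
Qed.

Lemma mol_relative_entropy rho s : P2 rho ->
  relative_entropy (mol b 1 rho) (gamma H s) = (mol_entropy rho s)%:E.
Proof.
move=> P; rewrite /relative_entropy /mol_entropy (EFin_Rintegral mu)//; last first.
  exact: log_ratio_integrable.
apply: eq_integral => x _; congr EFin; have r0 := mol_rho_gt0 b_gt0 P x.
have g0 := gamma_gt0 cH s x.
rewrite ln_div ?posrE// (ln_gamma cH) /log_ratio; ring.
Qed.

Lemma mol_entropy_ge0 rho s : P2 rho -> 0 <= mol_entropy rho s.
Proof.
move=> P; rewrite -lee_fin -mol_relative_entropy//.
exact: (relative_entropy_ge0 cH s (P2_mol b_gt0 P)).
Qed.

(** [xget] returns an unspecified weak derivative; uniqueness up to null sets identifies it with the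
    classical one. As the mollified density is positive, the domain of integration is the whole
    line. *)
Lemma dissipation_mol rho s : P2 rho -> dissipation H (mol b 1 rho) s =
  (\int[mu]_x (score H b rho s x ^+ 2 * mol b 1 rho x))%:E.
Proof.
move=> P; have M := mollifiable_P2 b_gt0 P.
have d := has_deriv_mol b_gt0 1 M.
have sp : smooth (mol b 1 rho) by exact: smooth_mol.
have wd := smooth_weak_derivative d (smooth_continuous (smooth_deriv sp d)).
rewrite /dissipation; case: pselect => [ex|nex]; last first.
  by exfalso; apply: nex; eexists; exact: wd.
set g := xget _ _.
have wg : weak_derivative setT (mol b 1 rho) g by exact: (xgetPex _ ex).
have eg := weak_derivative_unique wg wd.
have [c hc] := score_sqr cH b_gt0 P s.
have ms := continuous_measurable measurableT (@continuous_score _ _ _ _ _ _ _ cH b_gt0 P s).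
have is_ := P2_integrable (P2_mol b_gt0 P) (measurable_funX 2 ms) hc.
have mg : measurable_fun setT g by have [_ [mg _ _] _] := wg.
have mr := measurable_mol b_gt0 1 M.
have -> : [set x | 0 < mol b 1 rho x] = setT.
  by apply/seteqP; split=> // x _; exact: mol_rho_gt0.
rewrite (EFin_Rintegral mu)//; apply: ae_eq_integral => //.
- apply/measurable_EFinP; apply: measurable_funM => //; apply: measurable_funX.
  apply: measurable_funB => //; apply: measurable_funD; last exact: measurable_h1 cH.
  apply: measurable_funM => //; apply: continuous_measurable => // x.
  apply: cvgV; first by rewrite gt_eqF// mol_rho_gt0.
  exact: (smooth_continuous sp).
- exact: (measurable_int mu is_).
- by apply: ae_impl eg => x ex' _; rewrite ex' /score.
Qed.

Lemma LSI_mol rho M CLSI s : P2 rho -> LSI H M CLSI -> `|s| <= M ->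
  mol_entropy rho s <= CLSI * \int[mu]_x (score H b rho s x ^+ 2 * mol b 1 rho x).
Proof.
move=> P [C0 lsi] sM; have := lsi s _ sM (P2_mol b_gt0 P).
by rewrite dissipation_mol// mol_relative_entropy// => /(_ (ltry _)); rewrite -EFinM lee_fin.
Qed.

(** Changing the tilt adds a term linear in the mean and [ln (Zf s) - ln (Zf s0)]; the tangent of
    [ln Zf] at [s0] bounds the latter from below. *)
Lemma mol_entropy_tilt rho s s0 : P2 rho ->
  mol_entropy rho s0 - (s - s0) * (\int[mu]_x (x * mol b 1 rho x) - gmean H s0)
    <= mol_entropy rho s.
Proof.
move=> P; have Pr := P2_mol b_gt0 P.
have bid (x : R) : `|x| <= 1 * (1 + x ^+ 2) by rewrite mul1r abs_le_quad.
have ix := P2_integrable Pr (@measurable_id _ _ _) bid.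
have i0 := log_ratio_integrable s0 P P; have ir := P2_integrable1 Pr.
have -> : mol_entropy rho s = mol_entropy rho s0 + ((s0 - s) * \int[mu]_x (x * mol b 1 rho x)
    + (ln (Zf H s) - ln (Zf H s0))).
  have j1 := integrableZ mu (s0 - s) measurableT ix.
  have j2 := integrableZ mu (ln (Zf H s) - ln (Zf H s0)) measurableT ir.
  rewrite -[ln _ - ln _]mulr1 -[X in (ln _ - ln _) * X](P2_mass Pr).
  rewrite -(RintegralZl _ _ ix)// -(RintegralZl _ _ ir)// -(RintegralD _ j1 j2)//.
  rewrite /mol_entropy -(RintegralD _ i0 (integrable_add mu measurableT j1 j2))//.
  apply: (Rintegral_ext mu) => x _; rewrite /log_ratio; ring.
have := lnZ_tangent cH s0 s; set m := \int[mu]_x _; set e := mol_entropy _ _.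
by set z := ln _ - ln _; lra.
Qed.

(* Gibbs' inequality *)
Lemma mol_entropy_convex rho rho' s : P2 rho -> P2 rho' ->
  \int[mu]_x (log_ratio rho' s x * mol b 1 rho x) <= mol_entropy rho s.
Proof.
move=> P P'; have Pr := P2_mol b_gt0 P; have Pr' := P2_mol b_gt0 P'.
have i1 := log_ratio_integrable s P' P; have i2 := log_ratio_integrable s P P.
have ir := P2_integrable1 Pr; have ir' := P2_integrable1 Pr'.
have E0 : \int[mu]_x (mol b 1 rho' x - mol b 1 rho x) = 0.
  by rewrite (RintegralB _ ir' ir)// (P2_mass Pr) (P2_mass Pr') subrr.
rewrite -[leRHS]addr0 -E0 /mol_entropy -(RintegralD _ i2 (integrable_sub mu measurableT ir' ir))//.
apply: le_Rintegral => //.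
  by apply: (integrable_add mu) => //; exact: (integrable_sub mu).
move=> x _; have r0 := mol_rho_gt0 b_gt0 P x; have r0' := mol_rho_gt0 b_gt0 P' x.
set r := mol b 1 rho x in r0 *; set r' := mol b 1 rho' x in r0' *.
have h : ln r' - ln r <= r' / r - 1.
  rewrite -ln_div ?posrE//; have q0 : 0 < r' / r by rewrite divr_gt0.
  by have := expR_ge1Dx (ln (r' / r)); rewrite lnK ?posrE// -lerBrDl.
have : (ln r' - ln r) * r <= r' - r.
  have := ler_wpM2r (ltW r0) h; rewrite /= [leRHS]mulrBl mul1r divfK ?gt_eqF//.
rewrite -subr_ge0 => hh; rewrite /log_ratio -/r -/r' -subr_ge0.
by rewrite (_ : _ - _ = r' - r - (ln r' - ln r) * r)//; ring.
Qed.

(** From [|z| <= 1/(2b) + b z^2 / 2] and the second moment [64/b^2] of the kernel, the mean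
    displacement is at most [1/(2b) + 32/b <= 33/b]. *)
Lemma mol_close f rho c C : P2 rho -> 0 <= c -> measurable_fun setT f ->
  (forall x, `|f x| <= C * (1 + x ^+ 2)) -> (forall x y, `|f x - f y| <= c * `|x - y|) ->
  `|\int[mu]_x (f x * mol b 1 rho x) - \int[mu]_x (f x * rho x)| <= c * (33 / b).
Proof.
move=> P c0 mf bf lf; have M := mollifiable_quad b_gt0 mf bf.
have [_ ->] := mol_expectation b_gt0 P mf bf.
have C0 : 0 <= C by have := le_trans (normr_ge0 _) (bf 0); rewrite expr0n addr0 mulr1.
have [C' C'0 hC'] := mol_quad b_gt0 1 C0.
have i1 := P2_integrable P (measurable_mol b_gt0 1 M) (hC' f mf bf).
have i2 := P2_integrable P mf bf; have ir := P2_integrable1 P.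
have ij := integrable_sub mu measurableT i1 i2.
rewrite -(RintegralB _ i1 i2)//.
apply: (le_trans (le_normr_Rintegral _ ij)) => //.
rewrite -[leRHS]mulr1 -[X in _ <= _ * X](P2_mass P) -(RintegralZl _ _ ir)//.
apply: (le_Rintegral _ (integrable_nrm mu measurableT ij) (integrableZ mu _ measurableT ir)) => // y _.
rewrite -mulrBl normrM (ger0_norm (P2_ge0 y P)) ler_wpM2r ?(P2_ge0 y P)//.
have [ik ek] := ker_mass_left b_gt0 y; have [i3 e3] := ker_sq_moment b_gt0 y.
have [_ /(_ y) i4] := M.
rewrite mol1E -[X in _ - X]mulr1 -[X in _ - _ * X]ek -(RintegralZl _ _ ik)//.
have i5 := integrableZ mu (f y) measurableT ik; have i6 := integrable_sub mu measurableT i4 i5.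
rewrite -(RintegralB _ i4 i5)//; apply: (le_trans (le_normr_Rintegral _ i6)) => //.
have j1 := integrableZ mu (c / (2 * b)) measurableT ik.
have j2 := integrableZ mu (c * b / 2) measurableT i3.
apply: (@le_trans _ _ (\int[mu]_x (c / (2 * b) * ker b (y - x) +
    c * b / 2 * ((y - x) ^+ 2 * ker b (y - x))))).
  apply: (le_Rintegral _ (integrable_nrm mu measurableT i6) (integrable_add mu measurableT j1 j2)) => // x _.
  rewrite mulrC -mulrBl normrM (ger0_norm (ker_ge0 (y - x) b_gt0)) mulrA -mulrDl.
  rewrite ler_wpM2r ?ker_ge0// (le_trans (lf x y))// distrC.
  rewrite -subr_ge0 -(real_normK (num_real (y - x))).
  rewrite (_ : _ - _ = c * (b * (`|y - x| - b^-1) ^+ 2 / 2)); last by field; rewrite gt_eqF.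
  by rewrite mulr_ge0// divr_ge0// mulr_ge0 ?sqr_ge0// ltW.
rewrite (RintegralD _ j1 j2)// (RintegralZl _ _ ik)// (RintegralZl _ _ i3)// ek mulr1.
have cb : 0 <= c * b / 2 by rewrite divr_ge0// mulr_ge0// ltW.
apply: (le_trans (lerD (lexx _) (ler_wpM2l cb e3))).
rewrite -subr_ge0 (_ : _ - _ = c / (2 * b)); last by field; rewrite gt_eqF.
by rewrite divr_ge0// mulr_ge0// ltW.
Qed.

End mollified_entropy.

(** * Entropy of the mollified initial datum *)

Section initial_entropy.
Context {R : realType}.
Notation mu := (@lebesgue_measure R).
Variables (H : R -> R) (CH al be : R) (rho : R -> R).
Notation h1 := (derive1 H).
Hypothesis cH : confining H h1 (derive1 h1) CH al be.
Hypothesis P : P2 rho.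
Hypothesis fin : (free_energy H rho < +oo)%E.

(** Finiteness of the free energy only bounds the integral from above; the integrable minorant comes
    from [entropy_young] with exponent [ln (gamma H 0)] and reference density 1. *)
Lemma xlnx_integrable : mu.-integrable setT (EFin \o (fun x => rho x * ln (rho x))).
Proof.
have mrho := P2_measurable P.
have bH x : `|H x| <= CH * (1 + x ^+ 2).
  by rewrite (ger0_norm (conf_ge0 cH x)) (conf_le cH).
have mH := continuous_measurable measurableT (conf_cH cH).
have iH := P2_integrable P mH bH; have ir := P2_integrable1 P.
have ig := gamma_integrable cH 0.
pose z := ln (Zf H 0).
pose g x := (-1) * (H x * rho x) + (1 - z) * rho x - gamma H 0 x.
have jg : mu.-integrable setT (EFin \o g).
  by apply: (integrable_sub mu) => //; apply: (integrable_add mu) => //; exact: (integrableZ mu).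
apply: (integrable_minorant mu _ _ jg) => //.
- by apply: measurable_funM => //; exact: measurableT_comp.
- move=> x _; have g0 := gamma_gt0 cH 0 x.
  have := entropy_young (ln (gamma H 0 x)) (P2_ge0 x P) (@ltr01 R).
  rewrite divr1 mul1r lnK ?posrE// (ln_gamma cH) -/z; apply: le_trans.
  by rewrite /g le_eqVlt; apply/orP; left; apply/eqP; ring.
move: fin; rewrite /free_energy -(EFin_Rintegral mu measurableT iH).
set A := (\int[mu]_x (rho x * ln (rho x))%:E)%E; rewrite -/A.
by case: A => [r _|//|//]; exact: ltry.
Qed.

(* Jensen's inequality for the convolution with a probability density *)
Lemma mol_xlnx_le b : 0 < b ->
  mu.-integrable setT (EFin \o (fun x => mol b 1 rho x * ln (mol b 1 rho x))) /\
  \int[mu]_x (mol b 1 rho x * ln (mol b 1 rho x)) <= \int[mu]_x (rho x * ln (rho x)).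
Proof.
move=> b0; have iphi := xlnx_integrable; have Pr := P2_mol b0 P.
have mphi := integrable_measurable mu iphi.
have M := mollifiable_P2 b0 P; have sm := smooth_mol (Q := 1) b0 M.
have mr := measurable_mol b0 1 M.
set N := \int[mu]_y (`|y| * rho y).
have lnq x : `|ln (mol b 1 rho x)| <= 2 * (b + b * N + `|ln (b / 4)|) * (1 + x ^+ 2).
  have l := ln_mol_rho b0 P x (lexx N).
  rewrite (le_trans l)// [2 * _]mulrC -[leRHS]mulrA ler_wpM2l ?lin_le_quad//.
  by have := le_trans (normr_ge0 _) l; rewrite pmulr_lge0// ltr_pwDl.
have iln : mu.-integrable setT (EFin \o (fun x => mol b 1 rho x * ln (mol b 1 rho x))).
  have mln : measurable_fun setT (fun x => ln (mol b 1 rho x)) by exact: measurableT_comp.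
  have i := P2_integrable Pr mln lnq.
  by apply: (integrable_ext mu _ _ i) => // x _; rewrite mulrC.
split; first exact: iln.
have k0 z : 0 <= ker b z by exact: ker_ge0.
have Jx x : mu.-integrable setT (EFin \o (fun y => ker b (x - y) * (rho y * ln (rho y)))).
  apply: (integrable_le mu (g := fun y => b * `|rho y * ln (rho y)|)) => //.
  - by apply: measurable_funM => //; exact: measurable_ker_shift.
  - by apply: (integrableZ mu) => //; exact: (integrable_nrm mu).
  - by move=> y _; rewrite normrM (ger0_norm (k0 _)) ler_wpM2r// ker_le_cst.
have jensen x : mol b 1 rho x * ln (mol b 1 rho x) <=
    \int[mu]_y (ker b (x - y) * (rho y * ln (rho y))).
  have r0 := mol_rho_gt0 b0 P x; have [_ /(_ x) jk] := M.
  rewrite mol1E in r0 *; set a := Rintegral _ _ _ in r0 *.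
  have [jm em] := ker_mass_left b0 x.
  have j1 := integrableZ mu (1 + ln a) measurableT jk; have j2 := integrableZ mu a measurableT jm.
  have -> : a * ln a = \int[mu]_y ((1 + ln a) * (ker b (x - y) * rho y) - a * ker b (x - y)).
    rewrite (RintegralB measurableT j1 j2) (RintegralZl _ measurableT jk).
    by rewrite (RintegralZl _ measurableT jm) em -/a; ring.
  apply: (le_Rintegral measurableT (integrable_sub mu measurableT j1 j2) (Jx x)) => y _.
  have := entropy_young (ln a) (P2_ge0 y P) (@ltr01 R).
  rewrite divr1 mul1r (lnK r0) => h.
  apply: le_trans (ler_wpM2l (k0 (x - y)) h).
  by rewrite le_eqVlt; apply/orP; left; apply/eqP; ring.
pose F (p : R * R) := ker b (p.1 - p.2) * (rho p.2 * ln (rho p.2)).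
have mF : measurable_fun setT F.
  apply: measurable_funM.
    apply: measurableT_comp; first exact: (continuous_measurable measurableT (@continuous_ker R b)).
    exact: measurable_funB.
  have mrho := P2_measurable P.
  exact: (measurableT_comp mphi measurable_snd).
have Fx x : mu.-integrable setT (EFin \o (fun y => F (x, y))) by exact: Jx.
have Fy y : mu.-integrable setT (EFin \o (fun x => F (x, y))).
  have [i _] := ker_mass y b0; have := integrableZ mu (rho y * ln (rho y)) measurableT i.
  by apply: (integrable_ext mu) => // x _; rewrite mulrC.
have FG y : \int[mu]_x `|F (x, y)| <= `|rho y * ln (rho y)|.
  have [i e] := ker_mass y b0.
  rewrite (Rintegral_ext mu (g := fun x => `|rho y * ln (rho y)| * ker b (x - y))); last first.
    by move=> x _; rewrite normrM (ger0_norm (k0 _)) mulrC.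
  by rewrite (RintegralZl _ _ i)// e mulr1.
have [i1 i2 e] := Rfubini mF Fx Fy FG (integrable_nrm mu measurableT iphi).
apply: (@le_trans _ _ (\int[mu]_x \int[mu]_y F (x, y))); last first.
  rewrite e le_eqVlt; apply/orP; left; apply/eqP; apply: (Rintegral_ext mu) => y _.
  have [i e1] := ker_mass y b0.
  rewrite (Rintegral_ext mu (g := fun x => rho y * ln (rho y) * ker b (x - y))); last first.
    by move=> x _; rewrite mulrC.
  by rewrite (RintegralZl _ measurableT i) e1 mulr1.
apply: (le_Rintegral _ iln i1) => [|x _]; [exact: measurableT|exact: jensen].
Qed.

(** Uniformity in [b] is the point: the part [r ln r] is controlled by Jensen's inequality, the rest
    of [log_ratio] by second moments, and mollification multiplies [1 + x^2] by at most
    [2 + 128 / b^2 <= 130]. *)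
Lemma mol_entropy_initial s : exists C, forall b, 1 <= b -> mol_entropy H b rho s <= C.
Proof.
pose c := CH + `|s| + `|ln (Zf H s)|.
have CH0 := conf_CH cH.
have c0 : 0 <= c by rewrite !addr_ge0// ltW.
have mom : measurable_fun setT (fun x : R => 1 + x ^+ 2).
  by apply: measurable_funD => //; exact: measurable_sqr.
have bom (x : R) : `|1 + x ^+ 2| <= 1 * (1 + x ^+ 2) by rewrite mul1r ger0_norm// addr_ge0 ?sqr_ge0.
have iom := P2_integrable P mom bom.
exists (\int[mu]_x (rho x * ln (rho x)) + c * (130 * \int[mu]_x ((1 + x ^+ 2) * rho x))) => b b1.
have b0 : 0 < b by exact: lt_le_trans b1.
have Pr := P2_mol b0 P; have [iln eln] := mol_xlnx_le b0.
have [ir er] := mol_expectation b0 P mom bom.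
have jr := integrableZ mu c measurableT ir.
apply: (@le_trans _ _ (\int[mu]_x (mol b 1 rho x * ln (mol b 1 rho x) +
    c * ((1 + x ^+ 2) * mol b 1 rho x)))).
  apply: (le_Rintegral _ (log_ratio_integrable cH b0 s P P) (integrable_add mu measurableT iln jr)) => // x _.
  have r0 := ltW (mol_rho_gt0 b0 P x).
  rewrite [mol b 1 rho x * _]mulrC mulrA -mulrDl ler_wpM2r// /log_ratio.
  have o1 : 1 <= 1 + x ^+ 2 by rewrite lerDl sqr_ge0.
  rewrite /c !mulrDl -!addrA lerD2l; apply: lerD; first exact: conf_le cH x.
  apply: lerD; last by rewrite (le_trans (ler_norm _))// ler_peMr.
  by rewrite (le_trans (ler_norm _))// normrN normrM ler_wpM2l// abs_le_quad.
rewrite (RintegralD _ iln jr)// (RintegralZl _ _ ir)//; apply: lerD => //.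
rewrite ler_wpM2l// er -(RintegralZl _ _ iom)//.
have C130 : 2 + 128 / b ^+ 2 <= 130.
  have : 128 / b ^+ 2 <= 128 by rewrite ler_pdivrMr ?exprn_gt0// ler_peMr// exprn_ege1.
  by move=> h; rewrite (_ : 130 = 2 + 128) ?lerD2l// -natrD.
have [C C_0 hC] := mol_quad b0 1 (@ler01 R).
have M := mollifiable_quad b0 mom bom.
have i1 := P2_integrable P (measurable_mol b0 1 M) (hC _ mom bom).
apply: (le_Rintegral _ i1 (integrableZ mu 130 measurableT iom)) => // y _.
rewrite mulrA ler_wpM2r ?(P2_ge0 y P)//.
have [_ e] := quad_ker_moment b0 y; rewrite mol1E.
rewrite (Rintegral_ext mu (g := fun x => (1 + x ^+ 2) * ker b (y - x))); last by move=> x _; rewrite mulrC.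
by rewrite (le_trans e)// ler_wpM2r// addr_ge0// sqr_ge0.
Qed.

End initial_entropy.

(** * Increments along refining partitions *)

Section riemann_increments.
Context {R : realType}.
Notation mu := (@lebesgue_measure R).

(* Increments bounded by integrals of [B t], with the first argument frozen at
   the final time, are bounded by the integral on the diagonal. *)
Lemma riemann_increments (E : R -> R) (B : R -> R -> R) (g : R -> R) (a c : R) : a < c ->
  (forall t, a <= t <= c -> measurable_fun (`[a, c] : set R) (B t)) ->
  mu.-integrable `[a, c] (EFin \o g) ->
  (forall t s, a <= t <= c -> a <= s <= c -> `|B t s| <= g s) ->
  (forall s t, a <= s -> s <= t -> t <= c -> E t - E s <= \int[mu]_(u in `[s, t]) B t u) ->
  (forall (u : nat -> R) s, a < s <= c -> (forall n, s <= u n <= c) -> u n @[n --> \oo] --> s ->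
     B (u n) s @[n --> \oo] --> B s s) ->
  mu.-integrable `[a, c] (EFin \o (fun s => if a < s then B s s else 0)) /\
  E c - E a <= \int[mu]_(s in `[a, c]) (if a < s then B s s else 0).
Proof.
move=> ac mB ig Bg incr cB.
pose t n i : R := a + i%:R * ((c - a) / n.+1%:R).
have d0 n : 0 < (c - a) / n.+1%:R by rewrite divr_gt0// subr_gt0.
have t0 n : t n 0%N = a by rewrite /t mul0r addr0.
have tn n : t n n.+1 = c by rewrite /t mulrC divfK ?pnatr_eq0// addrC subrK.
have tS n i : t n i.+1 = t n i + (c - a) / n.+1%:R by rewrite /t -natr1; ring.
have tmono n i j : (i <= j)%N -> t n i <= t n j.
  by move=> ij; rewrite /t lerD2l ler_wpM2r ?ler_nat// ltW.
have tac n i : (i <= n.+1)%N -> a <= t n i <= c.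
  by move=> i_n; rewrite -{1}(t0 n) -(tn n) !tmono.
(* On each cell the first argument is frozen at the right endpoint, hence the approximation of [s]
   from above in the continuity hypothesis. *)
pose F n s := \sum_(i < n.+1) \1_(`]t n i, t n i.+1]%classic) s * B (t n i.+1) s.
have ex n s m : a < s -> s <= t n m -> exists2 j, (j < m)%N & t n j < s <= t n j.+1.
  move=> sa; elim: m => [|m IH]; first by rewrite t0 leNgt sa.
  move=> sm; have [/IH[j jm]|ms] := leP s (t n m); first by exists j => //; exact: ltnW.
  by exists m => //; rewrite ms.
have FE n s (j : 'I_n.+1) : t n j < s <= t n j.+1 -> F n s = B (t n j.+1) s.
  move=> js; rewrite /F (bigD1 j)//= big1 => [|i ij].
    by rewrite addr0 indicE mem_set ?mul1r//= in_itv.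
  rewrite indicE memNset ?mul0r//= in_itv /= => /andP[i1 i2].
  have /andP[j1 j2] := js; have [ij'|ji] := ltnP i j.
    by move: (le_lt_trans (le_trans i2 (tmono n _ _ ij')) j1); rewrite ltxx.
  have {}ji : (j < i)%N by rewrite ltn_neqAle eq_sym ij.
  by move: (le_lt_trans (le_trans j2 (tmono n _ _ ji)) i1); rewrite ltxx.
(* The half-open cells do not contain [a], whence the value 0 at [a] in the conclusion. *)
have Fa n : F n a = 0.
  rewrite /F big1// => i _; rewrite indicE memNset ?mul0r//= in_itv /= => /andP[h _].
  by move: h; rewrite ltNge -{1}(t0 n) tmono.
have mac : measurable (`[a, c] : set R) by exact: measurable_itv.
have mF n : measurable_fun (`[a, c] : set R) (F n).
  apply: measurable_sum => i; apply: measurable_funM.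
    by apply: measurable_indic; exact: measurable_itv.
  by apply: mB; exact: tac.
have Fg n s : (`[a, c] : set R) s -> `|F n s| <= g s.
  rewrite /= in_itv /= => /andP[]; rewrite le_eqVlt => /predU1P[<-|as_] sc.
    rewrite Fa normr0; apply: le_trans (normr_ge0 (B a a)) (Bg a a _ _); by rewrite lexx ltW.
  have sn : s <= t n n.+1 by rewrite tn.
  have [j jn js] := ex n s n.+1 as_ sn.
  rewrite (FE n s (Ordinal jn) js); apply: Bg; last by rewrite ltW.
  exact: tac.
have cF s : (`[a, c] : set R) s -> F n s @[n --> \oo] --> (if a < s then B s s else 0).
  rewrite /= in_itv /= => /andP[]; rewrite le_eqVlt => /predU1P[<-|as_] sc.
    by rewrite ltxx (_ : (fun n => F n a) = fun=> 0); [exact: cvg_cst|apply/funext => n; exact: Fa].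
  rewrite as_; have ex' n : exists j, (j < n.+1)%N /\ t n j < s <= t n j.+1.
    have sn : s <= t n n.+1 by rewrite tn.
    by have [j jn js] := ex n s n.+1 as_ sn; exists j.
  have [j Hj] := choice ex'.
  rewrite (_ : (fun n => F n s) = fun n => B (t n (j n).+1) s); last first.
    by apply/funext => n; have [jn js] := Hj n; rewrite (FE n s (Ordinal jn) js).
  apply: (cB (fun n => t n (j n).+1)); first by rewrite as_.
    move=> n; have [jn /andP[_ ->]] := Hj n; have := tac n (j n).+1 jn.
    by case/andP.
  apply: (@harmonic_bound_cvg _ _ _ (c - a)) => n; have [jn /andP[j1 j2]] := Hj n.
  rewrite ger0_norm ?subr_ge0// lerBlDr tS addrC lerD2l ltW//.
have [iI L] := Rdominated_cvg mu mac mF cF ig Fg; split; first exact: iI.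
have iF n : mu.-integrable `[a, c] (EFin \o F n) by exact: (integrable_le mu mac (mF n) ig (Fg n)).
apply: (cvgr_to_ge L); apply: nearW => n.
have key m : (m <= n.+1)%N -> E (t n m) - E a <= \int[mu]_(s in `[a, t n m]) F n s.
  elim: m => [|m IH] mn; first by rewrite t0 subrr set_itv1 Rintegral_set1.
  have /andP[am mc] := tac n m (ltnW mn); have /andP[am' mc'] := tac n m.+1 mn.
  have mm : t n m <= t n m.+1 by exact: tmono.
  rewrite (Rintegral_itv_cat am mm); last exact: (integrable_subitv (lexx a) mc' (iF n)).
  rewrite (_ : E _ - E a = E (t n m) - E a + (E (t n m.+1) - E (t n m))); last by ring.
  apply: lerD; first exact/IH/ltnW.
  apply: (le_trans (incr _ _ am mm mc')); apply: Rintegral_ae_le.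
  - apply: (integrable_subitv am mc' (integrable_le mu mac (mB _ _) ig _)); first by rewrite am'.
    by move=> x; rewrite /= in_itv /= => ?; apply: Bg => //; rewrite am'.
  - exact: (integrable_subitv am mc' (iF n)).
  - apply: ae_impl (ae_neq a) => x _ x1 x2.
    by rewrite (FE n x (Ordinal mn)) ?x1.
by have := key n.+1 (leqnn _); rewrite tn.
Qed.

End riemann_increments.

(** * Evolution of the mollified entropy *)

Lemma smooth_poly_ker {R : realType} (b : R) Q : smooth (poly_ker b Q).
Proof.
pose P := fix P n := if n is n.+1 then ker_step (P n) else Q.
have -> : poly_ker b Q = (fun n x => b ^+ n * poly_ker b (P n) x) 0%N.
  by apply/funext => x; rewrite /= mul1r.
apply: (deriv_seq_smooth (F := fun n x => b ^+ n * poly_ker b (P n) x)) => n.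
apply: (has_deriv_eq (has_derivZ (b ^+ n) (has_deriv_poly_ker b (P n)))) => x.
by rewrite mulrA exprSr.
Qed.

Lemma mol_cvg {R : realType} (b : R) Q (f_ : nat -> R -> R) f c y : 0 < b ->
  (forall n, measurable_fun setT (f_ n)) -> (forall n x, `|f_ n x| <= c * (1 + x ^+ 2)) ->
  (forall x, f_ n x @[n --> \oo] --> f x) -> mol b Q (f_ n) y @[n --> \oo] --> mol b Q f y.
Proof.
move=> b0 mf bf cf; have [M M0 HM] := poly_ker_bounded Q b0.
have [i _] := quad_ker_moment b0 y.
have j := integrableZ lebesgue_measure (M * c) measurableT i.
have m n : measurable_fun setT (fun x : R => poly_ker b Q (y - x) * f_ n x).
  by apply: measurable_funM => //; exact: measurable_poly_ker_shift.
have cv (x : R) : setT x -> poly_ker b Q (y - x) * f_ n x @[n --> \oo] --> poly_ker b Q (y - x) * f x.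
  by move=> _; apply: cvgMl_tmp; exact: cf.
have dom (n : nat) (x : R) : setT x -> `|poly_ker b Q (y - x) * f_ n x| <= M * c * ((1 + x ^+ 2) * ker b (y - x)).
  move=> _; rewrite normrM.
  rewrite (_ : M * c * _ = M * ker b (y - x) * (c * (1 + x ^+ 2))); last by ring.
  by rewrite ler_pM.
by have [] := Rdominated_cvg lebesgue_measure measurableT m cv j dom.
Qed.

Section entropy_evolution.
Context {R : realType}.
Notation mu := (@lebesgue_measure R).
Variables (H : R -> R) (CH al be : R) (ell dell rho0 : R -> R) (rho : R -> R -> R).
Notation h1 := (derive1 H).
Hypothesis cH : confining H h1 (derive1 h1) CH al be.
Hypothesis sol : solution H ell dell rho0 rho.
Hypothesis P0 : P2 rho0.
Implicit Types (phi p q h : R -> R) (s t T : R).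

Notation sig := (sigma H dell rho).
Notation ev := (ev rho).
Notation gen := (gen H dell rho).
Notation evolves := (evolves H dell rho0 rho).

Let rP := sol_P2 sol.
Let CH0 : 0 < CH. Proof. exact: conf_CH cH. Qed.
Let mh1 : measurable_fun setT h1. Proof. exact: measurable_h1 cH. Qed.

Variables M2 Sg : R.
Hypothesis hM2 : forall s, 0 <= s -> ev (fun x => x ^+ 2) s <= M2.
Hypothesis sig_Sg : {ae mu, forall s, 0 <= s -> `|sig s| <= Sg}.

Let M20 : 0 <= M2.
Proof.
apply: le_trans (hM2 (lexx 0)); apply: Rintegral_ge0 => x _.
by rewrite mulr_ge0 ?sqr_ge0// (P2_ge0 x (rP (lexx 0))).
Qed.

Let ev_om s : 0 <= s -> ev (fun x => 1 + x ^+ 2) s <= 1 + M2.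
Proof.
move=> s0; have msq : measurable_fun setT (fun x : R => x ^+ 2) by exact: measurable_sqr.
have b1 (x : R) : `|1 : R| <= 1 * (1 + x ^+ 2) by rewrite normr1 mul1r lerDl sqr_ge0.
have bsq (x : R) : `|x ^+ 2| <= 1 * (1 + x ^+ 2) by rewrite ger0_norm ?sqr_ge0// mul1r lerDr.
by rewrite (evD rP s0 (measurable_cst _) msq b1 bsq) (ev1 rP s0) lerD2l hM2.
Qed.

Lemma gen_quad_bound p q C s : 0 <= s -> measurable_fun setT p -> measurable_fun setT q ->
  (forall x, `|p x| <= C * (1 + x ^+ 2)) -> (forall x, `|q x| <= C * (1 + x ^+ 2)) ->
  (forall x, `|h1 x * p x| <= C * (1 + x ^+ 2)) ->
  `|gen p q s| <= C * (1 + M2) * (2 + `|sig s|).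
Proof.
move=> s0 mp mq bp bq bh.
have C0 : 0 <= C by have := le_trans (normr_ge0 _) (bp 0); rewrite expr0n addr0 mulr1.
have mom : measurable_fun setT (fun x : R => 1 + x ^+ 2).
  by apply: measurable_funD => //; exact: measurable_sqr.
have om_ (x : R) : 0 <= 1 + x ^+ 2 <= 1 * (1 + x ^+ 2).
  by rewrite mul1r lexx andbT addr_ge0// sqr_ge0.
exact: (gen_bound cH sol s0 mom mp mq om_ C0 (ev_om s0) bp bq bh).
Qed.

Let ici (c a d : R) : mu.-integrable `[a, d] (EFin \o (fun=> c)).
Proof. by apply: continuous_integrable_itv; exact: cst_continuous. Qed.

Let Ici (c a d : R) : a <= d -> \int[mu]_(u in `[a, d]) c = c * (d - a).
Proof.
move=> ad; rewrite (@FTC2 _ (fun x => c * x) (fun=> c) a d ad) ?mulrBr//.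
  by apply: (has_deriv_eq (has_derivZ c (@has_deriv_id R))) => x; rewrite mulr1.
exact: cst_continuous.
Qed.

Lemma evolves_lip phi p q c C s t : evolves phi p q -> measurable_fun setT phi ->
  measurable_fun setT p -> measurable_fun setT q -> (forall x, `|phi x| <= c * (1 + x ^+ 2)) ->
  (forall x, `|p x| <= C * (1 + x ^+ 2)) -> (forall x, `|q x| <= C * (1 + x ^+ 2)) ->
  (forall x, `|h1 x * p x| <= C * (1 + x ^+ 2)) -> 0 <= s -> s <= t ->
  `|ev phi t - ev phi s| <= C * (1 + M2) * (2 + Sg) * (t - s).
Proof.
move=> e m mp mq bphi bp bq bh s0 st; have [i ->] := evolves_incr sol P0 e m bphi s0 st.
apply: (le_trans (le_normr_Rintegral _ i)) => //; rewrite -Ici//.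
apply: (Rintegral_ae_le (integrable_nrm mu _ i) (ici _ _ _)) => //.
apply: ae_impl sig_Sg => u su us _; have u0 := le_trans s0 (ltW us).
rewrite (le_trans (gen_quad_bound u0 mp mq bp bq bh))// ler_wpM2l ?lerD2l ?su//.
have C0 : 0 <= C by have := le_trans (normr_ge0 _) (bp 0); rewrite expr0n addr0 mulr1.
by rewrite mulr_ge0// addr_ge0.
Qed.

Variables b s0 : R.
Hypothesis b_gt0 : 0 < b.

Let b0 := ltW b_gt0.

(** For fixed [x], [mol b Q (rho s) x] is the expectation of a translated kernel, a bounded
    observable with bounded derivatives; by [evolves_lip] it is Lipschitz in time, time 0
    included. *)
Lemma mol_time_cvg Q x s (u : nat -> R) : 0 <= s -> (forall n, s <= u n) ->
  u n @[n --> \oo] --> s -> mol b Q (rho (u n)) x @[n --> \oo] --> mol b Q (rho s) x.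
Proof.
move=> s_0 su us.
(* Up to the factor [(- b)^i], these are the successive derivatives of the observable. *)
pose psi i y := poly_ker b (iter i ker_step Q) (x - y).
have dpsi i : has_deriv (psi i) (fun y => - b * psi i.+1 y).
  have dr : has_deriv (fun y : R => x - y) (fun=> - 1).
    by apply: (has_deriv_eq (has_derivB (has_deriv_cst x) (@has_deriv_id R))) => y; rewrite sub0r.
  apply: (has_deriv_eq (has_deriv_comp (has_deriv_poly_ker b (iter i ker_step Q)) dr)) => y.
  by rewrite /psi iterS; ring.
have spsi i : smooth (psi i).
  rewrite (_ : psi i = fun y => poly_ker b (iter i ker_step Q) (-1 * y + x)).
    exact: (@smooth_affine_comp _ _ (-1) x (@smooth_poly_ker R b (iter i ker_step Q))).
  by apply/funext => y; rewrite /psi mulN1r addrC.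
have [c c0 hc] : exists2 c, 0 <= c & forall i y, (i < 3)%N -> `|psi i y| <= c.
  have B i : exists c, 0 <= c /\ forall y, `|psi i y| <= c.
    have [M M0 HM] := poly_ker_bounded (iter i ker_step Q) b_gt0.
    exists (M * b); split=> [|y]; first exact: mulr_ge0.
    by rewrite (le_trans (HM _))// ler_wpM2l// ker_le_cst.
  have [c1 [? ?]] := B 0%N; have [c2 [? ?]] := B 1%N; have [c3 [? ?]] := B 2%N.
  exists (c1 + c2 + c3); first by rewrite !addr_ge0.
  move=> [|[|[|i]]] y // _.
  - by rewrite (@le_trans _ _ c1)// -addrA lerDl addr_ge0.
  - by rewrite (@le_trans _ _ c2)// addrAC lerDr addr_ge0.
  - by rewrite (@le_trans _ _ c3)// lerDr addr_ge0.
pose p y := - b * psi 1%N y; pose q y := - b * (- b * psi 2%N y).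
have o1 (y : R) : 1 <= 1 + y ^+ 2 by rewrite lerDl sqr_ge0.
have pbi i y : (i < 3)%N -> `|- b * psi i y| <= b * c.
  by move=> i3; rewrite normrM normrN (gtr0_norm b_gt0) ler_wpM2l// hc.
have pb y : `|p y| <= b * c by exact: pbi.
have qb y : `|q y| <= b * (b * c).
  by rewrite normrM normrN (gtr0_norm b_gt0) ler_wpM2l// pbi.
pose C := b * c + b * (b * c) + 2 * CH * (b * c).
have e1 : 0 <= b * c by rewrite mulr_ge0.
have e2 : 0 <= b * (b * c) by rewrite mulr_ge0.
have e3 : 0 <= 2 * CH * (b * c) by rewrite !mulr_ge0// ltW.
have C0 : 0 <= C by rewrite !addr_ge0.
have pC y : `|p y| <= C by rewrite (le_trans (pb y))// /C -addrA lerDl addr_ge0.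
have qC y : `|q y| <= C by rewrite (le_trans (qb y))// /C addrAC lerDr addr_ge0.
have Cq (f : R -> R) : (forall y, `|f y| <= C) -> forall y, `|f y| <= C * (1 + y ^+ 2).
  by move=> h y; rewrite (le_trans (h y))// ler_peMr.
have dp : has_deriv p q by exact: has_derivZ (dpsi 1%N).
have sp : smooth p by exact: smoothZ.
have e : evolves (psi 0%N) p q.
  apply: (evolves_growth cH sol P0 (C := C) sp (dpsi 0%N) dp) => y; last exact: Cq.
  by rewrite (le_trans (pC y))// ler_peMr// lerDl.
have mp := continuous_measurable measurableT (smooth_continuous sp).
have mq := continuous_measurable measurableT (smooth_continuous (smooth_deriv sp dp)).
have mpsi := continuous_measurable measurableT (smooth_continuous (spsi 0%N)).
have bpsi y : `|psi 0%N y| <= c * (1 + y ^+ 2) by rewrite (le_trans (hc 0%N y _))// ler_peMr.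
have hpC y : `|h1 y * p y| <= C * (1 + y ^+ 2).
  rewrite normrM (le_trans (ler_pM (normr_ge0 _) (normr_ge0 _) (h1_quad cH y) (pb y)))//.
  rewrite mulrAC ler_wpM2r ?(le_trans ler01 (o1 y))// /C lerDr addr_ge0//.
have lip n : `|mol b Q (rho (u n)) x - mol b Q (rho s) x| <= C * (1 + M2) * (2 + Sg) * (u n - s).
  exact: (evolves_lip e mpsi mp mq bpsi (Cq _ pC) (Cq _ qC) hpC s_0 (su n)).
apply/subr_cvg0/norm_cvg0P.
have l0 : C * (1 + M2) * (2 + Sg) * (u n - s) @[n --> \oo] --> (0 : R).
  rewrite -[X in _ --> X](mulr0 (C * (1 + M2) * (2 + Sg))); apply: cvgMl_tmp.
  rewrite -[X in _ --> X](subrr s); apply: cvgB => //; exact: cvg_cst.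
apply: (squeeze_cvgr _ (cvg_cst 0) l0).
by apply: nearW => n; rewrite normr_ge0 lip.
Qed.

Notation sc := (fun t => score H b (rho t) s0).

Lemma score_time_cvg x s (u : nat -> R) : 0 <= s -> (forall n, s <= u n) ->
  u n @[n --> \oo] --> s -> sc (u n) x @[n --> \oo] --> sc s x.
Proof.
move=> s_0 su us; rewrite /score; apply: cvgB; last exact: cvg_cst.
apply: cvgD; last exact: cvg_cst.
apply: cvgM; first by apply: cvgMl_tmp; exact: mol_time_cvg.
by apply: cvgV; [rewrite gt_eqF// mol_rho_gt0//; exact: rP|exact: mol_time_cvg].
Qed.

(* The time derivative at [s] of the expectation of the mollified
   [log_ratio (rho t)]. *)
Definition entropy_gen t := gen (mol b 1 (sc t)) (fun y => b * mol b (ker_step 1) (sc t) y).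

Let cs := b + CH + `|s0|.
Let cs0 : 0 <= cs. Proof. by rewrite !addr_ge0// ltW. Qed.

Let msc t : 0 <= t -> measurable_fun setT (sc t).
Proof.
move=> t0; have c := @continuous_score _ _ _ _ _ _ _ cH b_gt0 (rP t0) s0.
exact: (continuous_measurable measurableT c).
Qed.

Lemma entropy_gen_obs : exists2 C, 0 <= C & forall t, 0 <= t ->
  [/\ smooth (mol b 1 (sc t)),
      has_deriv (mol b 1 (sc t)) (fun y => b * mol b (ker_step 1) (sc t) y),
      forall y, `|mol b 1 (sc t) y| <= C * (1 + `|y|),
      forall y, `|b * mol b (ker_step 1) (sc t) y| <= C * (1 + y ^+ 2) &
      forall y, `|mol b 1 (sc t) y| <= C * (1 + y ^+ 2) /\
                `|h1 y * mol b 1 (sc t) y| <= C * (1 + y ^+ 2)].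
Proof.
have [C1 C10 B1] := mol_lin b_gt0 1 cs0.
have [C2 C20 B2] := mol_quad b_gt0 (ker_step 1) (mulr_ge0 (ler0n R 2) cs0).
have e1 : 0 <= 2 * C1 by rewrite mulr_ge0.
have e2 : 0 <= b * C2 by rewrite mulr_ge0.
have e3 : 0 <= CH * C1 * 2 by rewrite !mulr_ge0// ltW.
exists (2 * C1 + b * C2 + CH * C1 * 2); first by rewrite !addr_ge0.
set C := 2 * C1 + _ + _; move=> t t0; have m := msc t0.
have l1 := B1 _ m (score_le cH b_gt0 (rP t0) s0).
have l2 := B2 _ m (score_quad cH b_gt0 (rP t0) s0).
have M := mollifiable_quad b_gt0 m (score_quad cH b_gt0 (rP t0) s0).
have om (y : R) : 0 <= 1 + y ^+ 2 by rewrite addr_ge0 ?sqr_ge0.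
have le1 : 2 * C1 <= C by rewrite /C -addrA lerDl addr_ge0.
have le2 : b * C2 <= C by rewrite /C addrAC lerDr addr_ge0.
have le3 : CH * C1 * 2 <= C by rewrite /C lerDr addr_ge0.
have le4 : C1 <= C by rewrite (le_trans _ le1)// ler_peMl// ler1n.
split.
- exact: smooth_mol.
- exact: has_deriv_mol.
- by move=> y; rewrite (le_trans (l1 y))// ler_wpM2r// addr_ge0.
- move=> y; apply: (@le_trans _ _ (b * C2 * (1 + y ^+ 2))); last by rewrite ler_wpM2r.
  by rewrite normrM (gtr0_norm b_gt0) -[leRHS]mulrA ler_wpM2l.
- move=> y; split.
    apply: (@le_trans _ _ (2 * C1 * (1 + y ^+ 2))); last by rewrite ler_wpM2r.
    by rewrite (le_trans (l1 y))// [2 * _]mulrC -[leRHS]mulrA ler_wpM2l// lin_le_quad.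
  apply: (@le_trans _ _ (CH * C1 * 2 * (1 + y ^+ 2))); last by rewrite ler_wpM2r.
  rewrite normrM (le_trans (ler_pM (normr_ge0 _) (normr_ge0 _) (conf_h1 cH y) (l1 y)))//.
  rewrite (_ : CH * (1 + `|y|) * _ = CH * C1 * ((1 + `|y|) * (1 + `|y|))); last by ring.
  by rewrite -[leRHS]mulrA ler_wpM2l ?lin_sqr_le_quad// mulr_ge0// ltW.
Qed.

Lemma entropy_gen_cvg s (u : nat -> R) : 0 <= s -> (forall n, s <= u n) ->
  u n @[n --> \oo] --> s -> entropy_gen (u n) s @[n --> \oo] --> entropy_gen s s.
Proof.
move=> s_0 su us; have u0 n := le_trans s_0 (su n).
have [C C0 HC] := entropy_gen_obs.
have cm Q y : mol b Q (sc (u n)) y @[n --> \oo] --> mol b Q (sc s) y.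
  apply: (mol_cvg (f_ := fun n => sc (u n)) (c := 2 * cs)) => //.
  - by move=> n; exact: msc.
  - by move=> n x; exact: (score_quad cH b_gt0 (rP (u0 n)) s0 x).
  - by move=> x; exact: score_time_cvg.
have mm n : measurable_fun setT (mol b 1 (sc (u n))).
  have [sm _ _ _ _] := HC _ (u0 n).
  exact: (continuous_measurable measurableT (smooth_continuous sm)).
have mm' n : measurable_fun setT (fun y => b * mol b (ker_step 1) (sc (u n)) y).
  have [sm d _ _ _] := HC _ (u0 n).
  exact: (continuous_measurable measurableT (smooth_continuous (smooth_deriv sm d))).
apply: cvgD; first apply: cvgB.
- apply: (ev_cvg rP s_0 mm' (c := C)).
    by move=> x; apply: cvgMl_tmp; exact: cm.
  by move=> n x; have [_ _ _ h _] := HC _ (u0 n).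
- apply: (ev_cvg rP s_0 (psi_ := fun n x => h1 x * mol b 1 (sc (u n)) x) (c := C)).
  + by move=> n; exact: (measurable_funM mh1 (mm n)).
  + by move=> x; apply: cvgMl_tmp; exact: cm.
  + by move=> n x; have [_ _ _ _ h] := HC _ (u0 n); have [] := h x.
- apply: cvgMl_tmp; apply: (ev_cvg rP s_0 mm (c := C)).
    by move=> x; exact: cm.
  by move=> n x; have [_ _ _ _ h] := HC _ (u0 n); have [] := h x.
Qed.

Let Nabs t : 0 <= t -> \int[mu]_y (`|y| * rho t y) <= 1 + M2.
Proof.
move=> t0; apply: le_trans (ev_om t0).
have bom (x : R) : `|1 + x ^+ 2| <= 1 * (1 + x ^+ 2) by rewrite mul1r ger0_norm// addr_ge0 ?sqr_ge0.
have mom : measurable_fun setT (fun x : R => 1 + x ^+ 2).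
  by apply: measurable_funD => //; exact: measurable_sqr.
have mabs : measurable_fun setT (fun x : R => `|x|) by exact: measurableT_comp.
apply: (ev_le rP t0 mabs mom _ bom) => x; last exact: abs_le_quad.
by rewrite normr_id mul1r abs_le_quad.
Qed.

Notation ent := (fun t => mol_entropy H b (rho t) s0).

Lemma entropy_incr s t : 0 <= s -> s <= t ->
  ent t - ent s <= \int[mu]_(u in `[s, t]) entropy_gen t u.
Proof.
move=> s_0 st; have t0 := le_trans s_0 st.
have [C C0 HC] := entropy_gen_obs; have [sm d b1 b2 _] := HC t t0.
pose w := log_ratio H b (rho t) s0.
have lq x := log_ratio_quad cH b_gt0 s0 x (rP t0) (Nabs t0).
have mw := measurable_log_ratio cH b_gt0 s0 (rP t0).
set cw := log_ratio_cst _ _ _ _ _ in lq.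
have cw0 : 0 <= cw by have := le_trans (normr_ge0 _) (lq 0); rewrite expr0n addr0 mulr1.
have dw := has_deriv_log_ratio cH b_gt0 s0 (rP t0).
have csc := @continuous_score _ _ _ _ _ _ _ cH b_gt0 (rP t0) s0.
have dphi : has_deriv (mol b 1 w) (mol b 1 (sc t)).
  have omx (x : R) : 0 <= 1 + x ^+ 2 by rewrite addr_ge0 ?sqr_ge0.
  have cc0 : 0 <= 2 * cs by rewrite mulr_ge0.
  apply: (mol_deriv b_gt0 dw csc (c := cw + 2 * cs)) => x.
    by rewrite (le_trans (lq x))// ler_wpM2r// lerDl.
  by rewrite (le_trans (score_quad cH b_gt0 (rP t0) s0 x))// ler_wpM2r// lerDr.
have e : evolves (mol b 1 w) (mol b 1 (sc t)) (fun y => b * mol b (ker_step 1) (sc t) y).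
  exact: (evolves_growth cH sol P0 sm dphi d b1 b2).
have Mw := mollifiable_quad b_gt0 mw lq.
have [c' c'0 hc'] := mol_quad b_gt0 1 cw0.
have [i <-] := evolves_incr sol P0 e (measurable_mol b_gt0 1 Mw) (hc' _ mw lq) s_0 st.
have exp r : 0 <= r -> ev (mol b 1 w) r = \int[mu]_x (w x * mol b 1 (rho r) x).
  by move=> r0; have [_ ->] := mol_expectation b_gt0 (rP r0) mw lq.
rewrite (exp _ t0) (exp _ s_0); apply: lerB; first exact: lexx.
exact: (mol_entropy_convex cH b_gt0 s0 (rP s_0) (rP t0)).
Qed.

Lemma entropy_diag (y : R -> R) a c : 0 <= a -> a < c ->
  mu.-integrable `[a, c] (EFin \o y) ->
  {ae mu, forall s, a < s -> s <= c -> entropy_gen s s <= y s} ->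
  ent c - ent a <= \int[mu]_(s in `[a, c]) y s.
Proof.
move=> a0 ac iy hy; have [C C0 HC] := entropy_gen_obs.
have c0 : 0 < c by exact: le_lt_trans ac.
have obs t : 0 <= t -> measurable_fun setT (mol b 1 (sc t)) /\
    measurable_fun setT (fun y => b * mol b (ker_step 1) (sc t) y).
  move=> t0; have [sm d _ _ _] := HC _ t0; split.
    exact: (continuous_measurable measurableT (smooth_continuous sm)).
  exact: (continuous_measurable measurableT (smooth_continuous (smooth_deriv sm d))).
have sub : (`[a, c] : set R) `<=` (`[0, c] : set R).
  by move=> x /=; rewrite !in_itv /= => /andP[ax ->]; rewrite (le_trans a0).
have m t : a <= t <= c -> measurable_fun (`[a, c] : set R) (entropy_gen t).
  move=> /andP[at_ _]; have t0 := le_trans a0 at_; have [m1 m2] := obs t t0.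
  have [_ _ _ b2 b3] := HC t t0.
  have mg : measurable_fun (`[0, c] : set R) (entropy_gen t).
    apply: (measurable_gen cH sol c0 m1 m2 (c := C)) => // x; by have [] := b3 x.
  exact: (measurable_funS (measurable_itv _) sub mg).
have ig : mu.-integrable `[a, c] (EFin \o (fun s => C * (1 + M2) * (2 + `|sig s|))).
  apply: (integrableZ mu) => //; apply: (integrable_add mu) => //.
  apply: (integrable_nrm mu) => //; apply: (integrable_subitv a0 (lexx c)).
  exact: (sig_integrable sol).
have bd t s : a <= t <= c -> a <= s <= c -> `|entropy_gen t s| <= C * (1 + M2) * (2 + `|sig s|).
  move=> /andP[at_ _] /andP[as_ _]; have t0 := le_trans a0 at_; have [m1 m2] := obs t t0.
  have [_ _ _ b2 b3] := HC t t0.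
  apply: (gen_quad_bound (le_trans a0 as_) m1 m2) => // x; by have [] := b3 x.
have inc s t : a <= s -> s <= t -> t <= c -> ent t - ent s <= \int[mu]_(u in `[s, t]) entropy_gen t u.
  by move=> as_ st _; exact: (entropy_incr (le_trans a0 as_) st).
have cv (u : nat -> R) s : a < s <= c -> (forall n, s <= u n <= c) -> u n @[n --> \oo] --> s ->
    entropy_gen (u n) s @[n --> \oo] --> entropy_gen s s.
  move=> /andP[as_ _] su; apply: entropy_gen_cvg; first exact: (le_trans a0 (ltW as_)).
  by move=> n; have /andP[] := su n.
have [j le] := riemann_increments ac m ig bd inc cv; apply: (le_trans le).
apply: Rintegral_ae_le => //; apply: ae_impl hy => s hs as_ sc'.
by rewrite as_ hs.
Qed.

End entropy_evolution.

(** * Exponential decay of the entropy *)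

Section exponential_decay.
Context {R : realType}.
Notation mu := (@lebesgue_measure R).
Variables (H : R -> R) (CH al be : R) (ell dell rho0 : R -> R) (rho : R -> R -> R).
Notation h1 := (derive1 H).
Hypothesis cH : confining H h1 (derive1 h1) CH al be.
Hypothesis sol : solution H ell dell rho0 rho.
Hypothesis P0 : P2 rho0.
Implicit Types (s t : R).

Notation sig := (sigma H dell rho).
Notation ev := (ev rho).

Let rP := sol_P2 sol.
Let CH0 : 0 < CH. Proof. exact: conf_CH cH. Qed.
Let mh1 : measurable_fun setT h1. Proof. exact: measurable_h1 cH. Qed.

(** In the dissipation estimate the tilt is the current force [sig s], so that
    [ev h1 s - sig s = - dell s], and the logarithmic Sobolev inequality is applied at this tilt;
    [mol_entropy_tilt] then returns to the fixed tilt [s0]. *)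
Lemma entropy_gen_le b s0 d M CLSI s : 0 < b -> 0 < d -> d <= 1 -> 0 <= s ->
  LSI H M CLSI -> `|sig s| <= M ->
  entropy_gen H dell rho b s0 s s <=
    - ((1 - d) * CLSI^-1) * (mol_entropy H b (rho s) s0
       - (sig s - s0) * (\int[mu]_x (x * mol b 1 (rho s) x) - gmean H s0))
    + 16 * CH ^+ 2 / (d * b ^+ 2) + (sig s - s0) * dell s.
Proof.
move=> b_gt0 d0 d1 s_0 lsi sM; have P := rP s_0; have [C0 _] := lsi.
have main := dissipation_estimate cH b_gt0 P (sig s) s0 d0.
rewrite (_ : _ - sig s = - dell s) in main; last by rewrite /sigma; ring.
have e1 := LSI_mol cH b_gt0 P lsi sM; have e2 := mol_entropy_tilt cH b_gt0 (sig s) s0 P.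
have e3 := le_trans e2 e1.
have Ci : 0 <= (1 - d) * CLSI^-1 by rewrite mulr_ge0 ?invr_ge0 ?(ltW C0)// subr_ge0.
have := ler_wpM2l Ci e3; rewrite -[X in _ <= X]mulrA mulKf ?gt_eqF// => e4.
apply: (le_trans main); rewrite mulrN opprK lerD2r lerD2r !mulNr lerN2//.
Qed.

Lemma ell_tail lstar L0 kappa s : 0 < kappa -> 0 <= s -> 0 <= L0 ->
  ell t @[t --> +oo] --> lstar ->
  {ae mu, forall t, 0 <= t -> `|dell t| <= L0 * expR (- kappa * t)} ->
  `|ell s - lstar| <= L0 / kappa * expR (- kappa * s).
Proof.
move=> k0 s0 L00 cl hd.
have cv : `|ell s - ell t| @[t --> +oo] --> `|ell s - lstar|.
  by apply: cvg_norm; apply: cvgB => //; exact: cvg_cst.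
apply: (cvgr_to_le cv); near=> t.
have st : s <= t by near: t; apply: nbhs_pinfty_ge; exact: num_real.
have [i e] := ell_incr cH sol P0 s0 st.
have d : has_deriv (fun u => - (L0 / kappa) * expR (- kappa * u))
    (fun u => L0 * expR (- kappa * u)).
  have dk : has_deriv (fun u : R => - kappa * u) (fun=> - kappa).
    by apply: (has_deriv_eq (has_derivZ (- kappa) (@has_deriv_id R))) => u; rewrite mulr1.
  apply: (has_deriv_eq (has_derivZ _ (has_deriv_expR dk))) => u.
  by field; rewrite gt_eqF.
have c : continuous (fun u => L0 * expR (- kappa * u)).
  move=> u; apply: cvgMl_tmp; apply: (continuous_comp (f := fun u : R => - kappa * u)).
    by apply: cvgMl_tmp; exact: cvg_id.
  exact: continuous_expR.
rewrite distrC e; apply: (le_trans (le_normr_Rintegral _ i)) => //.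
apply: (@le_trans _ _ (\int[mu]_(u in `[s, t]) (L0 * expR (- kappa * u)))).
  have j := @continuous_integrable_itv R _ s t c.
  apply: (Rintegral_ae_le (integrable_nrm mu (measurable_itv _) i) j).
  by apply: ae_impl hd => u hu su _; rewrite hu// (le_trans s0)// ltW.
rewrite (FTC2 st d c) -subr_ge0.
rewrite (_ : _ - _ = L0 / kappa * expR (- kappa * t)); last by ring.
by rewrite mulr_ge0 ?expR_ge0// divr_ge0// ltW.
Unshelve. all: by end_near. Qed.

Lemma mol_initial b : 0 < b -> mol b 1 (rho 0) = mol b 1 rho0.
Proof.
move=> b_gt0; apply/funext => x.
apply: Rintegral_ae_eq => //.
- by apply: mol_integrable => //; apply: mollifiable_P2 => //; exact: rP.
- by apply: mol_integrable => //; exact: mollifiable_P2.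
- by apply: ae_impl (solution_initial sol) => y ->.
Qed.

Variables M2 M CLSI lstar L0 kappa : R.
Hypothesis hM2 : forall s, 0 <= s -> ev (fun x => x ^+ 2) s <= M2.
Hypothesis M_ge0 : 0 <= M.
Hypothesis sig_M : {ae mu, forall s, 0 <= s -> `|sig s| <= M}.
Hypothesis lsi : LSI H M CLSI.
Hypothesis ell_lim : ell t @[t --> +oo] --> lstar.
Hypothesis L0_gt0 : 0 < L0.
Hypothesis kappa_gt : CLSI^-1 < kappa.
Hypothesis dell_decay : {ae mu, forall t, 0 <= t -> `|dell t| <= L0 * expR (- kappa * t)}.
Hypothesis fin : (free_energy H rho0 < +oo)%E.

Let s0 := lambda H lstar.
Let tau := CLSI^-1.
Let tau0 : 0 < tau. Proof. by rewrite invr_gt0; have [] := lsi. Qed.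
Let kappa0 : 0 < kappa. Proof. exact: lt_trans kappa_gt. Qed.
Let S := M + `|s0|.
Let S0 : 0 <= S. Proof. exact: addr_ge0. Qed.
(** [K1] collects the terms decaying like [expR (- kappa * s)]: [ell - lstar], through [ell_tail],
    and [dell]. [K2] collects those of order [1/b]: the displacement of the mean by mollification
    and the commutator with the drift. *)
Let K1 := S * (tau * L0 / kappa + L0).
Let K2 := 33 * tau * S + 16 * CH ^+ 2.
Let K10 : 0 <= K1.
Proof.
by apply: mulr_ge0 => //; apply: addr_ge0; [apply: divr_ge0; [apply: mulr_ge0|]|]; exact: ltW.
Qed.
Let K20 : 0 <= K2.
Proof.
apply: addr_ge0; last by apply: mulr_ge0 => //; exact: sqr_ge0.
by apply: mulr_ge0 => //; apply: mulr_ge0 => //; exact: ltW.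
Qed.

Lemma entropy_gen_decay b : 1 <= b -> {ae mu, forall s, 0 <= s ->
  entropy_gen H dell rho b s0 s s <= - (tau * (1 - b^-1)) * mol_entropy H b (rho s) s0
    + K1 * expR (- kappa * s) + K2 / b}.
Proof.
move=> b1; have b_gt0 : 0 < b by exact: lt_le_trans b1.
apply: ae_impl (ae_and sig_M dell_decay) => s [hs hd] s_0.
have sM := hs s_0; have dL := hd s_0.
have bi0 : 0 < b^-1 by rewrite invr_gt0.
have bi1 : b^-1 <= 1 by rewrite invf_le1.
(* The Young weight is [d = 1/b]: the loss in the rate and the commutator term [16 CH^2 / (d b^2)]
   are then both of order [1/b]. *)
have main := entropy_gen_le s0 b_gt0 bi0 bi1 s_0 lsi sM.
apply: (le_trans main); rewrite (mean_lambda cH).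
have sS : `|sig s - s0| <= S by rewrite (le_trans (ler_normB _ _))// lerD2r.
have P := rP s_0.
have bid (x : R) : `|x| <= 1 * (1 + x ^+ 2) by rewrite mul1r abs_le_quad.
have lid (x y : R) : `|x - y| <= 1 * `|x - y| by rewrite mul1r.
have close := mol_close b_gt0 P ler01 (@measurable_id _ _ _) bid lid.
have eM : \int[mu]_x (x * rho s x) = ell s by have [] := solution_Ml sol s_0.
rewrite mul1r eM in close.
have tail := ell_tail kappa0 s_0 (ltW L0_gt0) ell_lim dell_decay.
set m := \int[mu]_x _ in close *.
have mL : `|m - lstar| <= 33 / b + L0 / kappa * expR (- kappa * s).
  rewrite (_ : m - lstar = (m - ell s) + (ell s - lstar)); last by ring.
  by rewrite (le_trans (ler_normD _ _))// lerD.
set e := expR _ in dL tail mL *; have e0 : 0 <= e by exact: expR_ge0.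
have t1 : 0 <= (1 - b^-1) * tau by rewrite mulr_ge0 ?(ltW tau0)// subr_ge0.
have A1 : (1 - b^-1) * tau * ((sig s - s0) * (m - lstar)) <= tau * (S * (33 / b + L0 / kappa * e)).
  rewrite (le_trans (ler_norm _))// normrM (ger0_norm t1) normrM.
  apply: (ler_pM t1 (mulr_ge0 (normr_ge0 _) (normr_ge0 _))); last exact: ler_pM.
  by rewrite ler_piMl ?(ltW tau0)// lerBlDr lerDl ltW.
have A2 : (sig s - s0) * dell s <= S * (L0 * e).
  by rewrite (le_trans (ler_norm _))// normrM ler_pM.
have A3 : 16 * CH ^+ 2 / (b^-1 * b ^+ 2) = 16 * CH ^+ 2 / b by field; rewrite gt_eqF.
rewrite A3 -/tau.
have -> : - ((1 - b^-1) * tau) * (mol_entropy H b (rho s) s0 - (sig s - s0) * (m - lstar)) =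
    - (tau * (1 - b^-1)) * mol_entropy H b (rho s) s0 + (1 - b^-1) * tau * ((sig s - s0) * (m - lstar)).
  by ring.
set X1 := (1 - b^-1) * tau * ((sig s - s0) * _) in A1 *.
set X2 := (sig s - s0) * dell s in A2 *.
rewrite -!addrA lerD2l.
apply: (@le_trans _ _ (tau * (S * (33 / b + L0 / kappa * e)) + (16 * CH ^+ 2 / b + S * (L0 * e)))).
  by apply: lerD; [exact: A1|apply: lerD; [exact: lexx|exact: A2]].
by rewrite le_eqVlt; apply/orP; left; apply/eqP; rewrite /K1 /K2; field; rewrite !gt_eqF.
Qed.

Let ic (f : R -> R) (a c : R) : continuous f -> mu.-integrable `[a, c] (EFin \o f).
Proof. exact: continuous_integrable_itv. Qed.

(** Comparison with [(C0 + K3) e^(- tp u) - K3 e^(- kappa u) + eta]. Since [tp <= tau],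
    [K3 (kappa - tp) >= K1], so that the second term compensates the decaying source with a [K3]
    independent of [b]; [eta] is the equilibrium for the constant source [K2 / b]. At time 0 the
    value is [C0 + eta]. *)
Lemma entropy_decay : exists2 A1, 0 <= A1 & forall b t, 2 <= b -> 0 <= t ->
  mol_entropy H b (rho t) s0 <=
    A1 * expR (- (tau * (1 - b^-1)) * t) + K2 / b / (tau * (1 - b^-1)).
Proof.
have [C0 HC0] := mol_entropy_initial cH P0 fin s0.
pose K3 := K1 / (kappa - tau).
have kt : 0 < kappa - tau by rewrite subr_gt0.
have K30 : 0 <= K3 by rewrite divr_ge0// ltW.
have C00 : 0 <= C0 by apply: le_trans (HC0 1 (lexx 1)); exact: (mol_entropy_ge0 cH ltr01 s0 P0).
exists (C0 + K3); first exact: addr_ge0.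
move=> b t b2 t0; have b1 : 1 <= b by apply: le_trans b2; rewrite ler1n.
have b_gt0 : 0 < b by exact: lt_le_trans b1.
have bi : b^-1 < 1 by rewrite invf_lt1// (lt_le_trans _ b2)// ltr1n.
pose tp := tau * (1 - b^-1); have tp0 : 0 < tp by rewrite mulr_gt0// subr_gt0.
have tpt : tp <= tau by rewrite /tp ler_piMr ?(ltW tau0)// lerBlDr lerDl invr_ge0 ltW.
pose eta := K2 / b / tp; have eta0 : 0 <= eta by rewrite !divr_ge0// ltW.
rewrite -/tp -/eta.
pose ex c u := expR (- c * u) : R.
have dex c : has_deriv (ex c) (fun u => - c * ex c u).
  have dk : has_deriv (fun u : R => - c * u) (fun=> - c).
    by apply: (has_deriv_eq (has_derivZ (- c) (@has_deriv_id R))) => u; rewrite mulr1.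
  exact: has_deriv_expR dk.
pose y u := (C0 + K3) * ex tp u - K3 * ex kappa u + eta.
pose y' u := (C0 + K3) * (- tp * ex tp u) - K3 * (- kappa * ex kappa u).
have dy : has_deriv y y'.
  apply: (has_deriv_eq (has_derivD (has_derivB (has_derivZ (C0 + K3) (dex tp))
    (has_derivZ K3 (dex kappa))) (has_deriv_cst eta))) => u; by rewrite addr0.
have cex c := has_deriv_continuous (dex c).
have cy' : continuous y'.
  by move=> u; apply: cvgB; do 2 (apply: cvgMl_tmp); exact: cex.
pose ent u := mol_entropy H b (rho u) s0.
have ent0 u : 0 <= u -> 0 <= ent u by move=> u0; exact: (mol_entropy_ge0 cH b_gt0 s0 (rP u0)).
have gd := entropy_gen_decay b1.
have diag := @entropy_diag R H CH al be ell dell rho0 rho cH sol P0 M2 M hM2 sig_M b s0 b_gt0.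
have jump s r : 0 <= s -> s <= r -> r <= t -> ent r - ent s <= (K1 + K2 / b) * (r - s).
  move=> s_0; rewrite le_eqVlt => /predU1P[->|sr] _; first by rewrite !subrr mulr0.
  have i1 : mu.-integrable `[s, r] (EFin \o (fun=> K1 + K2 / b)) by apply: ic; exact: cst_continuous.
  apply: (le_trans (diag (fun=> K1 + K2 / b) s r s_0 sr i1 _)).
    apply: ae_impl gd => u gu su _; have u0 := le_trans s_0 (ltW su).
    rewrite (le_trans (gu u0))// lerD2r.
    rewrite -[leRHS]add0r lerD//; first by rewrite mulNr oppr_le0 mulr_ge0 ?ent0// ltW.
    by rewrite ler_piMr// -[leRHS]expR0 ler_expR mulNr oppr_le0 mulr_ge0// ltW.
  rewrite (@FTC2 _ (fun x => (K1 + K2 / b) * x) (fun=> K1 + K2 / b) s r (ltW sr)) ?mulrBr//.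
    by apply: (has_deriv_eq (has_derivZ (K1 + K2 / b) (@has_deriv_id R))) => x; rewrite mulr1.
  exact: cst_continuous.
have prop s r : 0 <= s -> s <= r -> r <= t -> (forall u, s < u -> u <= r -> y u < ent u) ->
    ent r - ent s <= y r - y s.
  move=> s_0; rewrite le_eqVlt => /predU1P[->|sr] _ ylt; first by rewrite !subrr.
  have iy' : mu.-integrable `[s, r] (EFin \o y') by exact: ic.
  rewrite -(FTC2 (ltW sr) dy cy'); apply: (le_trans (diag y' s r s_0 sr iy' _)); last exact: lexx.
  apply: ae_impl gd => u gu su ur; have u0 := le_trans s_0 (ltW su).
  rewrite (le_trans (gu u0))//; have yu := ltW (ylt u su ur).
  have e0 : 0 <= ex kappa u by exact: expR_ge0.
  have h1' : - tp * ent u <= - tp * y u by rewrite !mulNr lerN2 ler_wpM2l// ltW.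
  have h2' : K1 + tp * K3 <= kappa * K3.
    have -> : K1 = (kappa - tau) * K3 by rewrite /K3 mulrC divfK// gt_eqF.
    by rewrite -mulrDl ler_wpM2r// -addrA gerDl addrC subr_le0.
  have h3' := ler_wpM2r e0 h2'.
  have h4' : tp * eta = K2 / b by rewrite /eta mulrC divfK// gt_eqF.
  rewrite -h4' -/tp; apply: (le_trans (lerD (lerD h1' (lexx _)) (lexx _))).
  rewrite /y /y' -/(ex kappa u) -subr_ge0.
  rewrite (_ : _ - _ = kappa * K3 * ex kappa u - (K1 + tp * K3) * ex kappa u); last by ring.
  by rewrite subr_ge0.
have f0y : ent 0 <= y 0.
  rewrite /y /ex !mulr0 expR0 !mulr1 addrK.
  apply: (@le_trans _ _ C0); last by rewrite lerDl.
  by have := HC0 b b1; rewrite /ent /mol_entropy /log_ratio (mol_initial b_gt0).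
have jc : 0 <= K1 + K2 / b by rewrite addr_ge0// divr_ge0// ltW.
have := comparison (has_deriv_continuous dy) t0 f0y jc jump prop.
move=> /le_trans; apply; rewrite /y lerD2r gerDl oppr_le0 mulr_ge0//; exact: expR_ge0.
Qed.

(** The limit [b = n + 2] to infinity is taken at fixed [t]: the mollified force converges because
    [H'] is Lipschitz, and the rate [tau (1 - 1/b)] tends to [tau], although each single [b] gives a
    smaller one. *)
Lemma force_decay : exists2 C, 0 <= C & forall t, 0 <= t ->
  (\int[mu]_x (h1 x * rho t x) - s0) ^+ 2 <= C * expR (- tau * t).
Proof.
have [A1 A10 HA] := entropy_decay.
pose c := ckp_cst CH al be `|s0|; have c0 : 0 < c by exact: ckp_cst_gt0 cH _.
exists (c * A1); first by rewrite mulr_ge0// ltW.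
move=> t t0; have P := rP t0; set X := \int[mu]_x _.
pose bb (n : nat) : R := n.+2%:R.
have bb0 n : 0 < bb n by [].
pose Y n := \int[mu]_x (h1 x * mol (bb n) 1 (rho t) x).
have inv0 : (bb n)^-1 @[n --> \oo] --> (0 : R).
  apply: (@harmonic_bound_cvg _ _ _ 1) => n; rewrite subr0 mul1r gtr0_norm ?invr_gt0//.
  by rewrite lef_pV2 ?posrE// ler_nat.
have lip x y : `|h1 x - h1 y| <= CH * `|x - y|.
  exact: (has_deriv_lip _ _ (conf_d2 cH) (conf_h2 cH)).
have YX : Y n - s0 @[n --> \oo] --> X - s0.
  apply: cvgB; last exact: cvg_cst.
  apply: (@harmonic_bound_cvg _ _ _ (CH * 33)) => n.
  apply: (le_trans (mol_close (bb0 n) P (ltW CH0) mh1 (h1_quad cH) lip)).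
  by rewrite mulrA ler_wpM2l ?mulr_ge0 ?(ltW CH0)// lef_pV2 ?posrE// ler_nat.
have L1 : (Y n - s0) ^+ 2 @[n --> \oo] --> (X - s0) ^+ 2.
  by rewrite expr2; apply: cvg_trans (cvgM YX YX); apply: near_eq_cvg; apply: nearW => n; rewrite /= -expr2.
(* The factor 2 bounds [1 / (1 - 1/b)] for [b >= 2]. *)
pose U n := c * (A1 * expR (- (tau * (1 - (bb n)^-1)) * t) + 2 * K2 / tau * (bb n)^-1).
have L2 : U n @[n --> \oo] --> c * (A1 * expR (- (tau * (1 - 0)) * t) + 2 * K2 / tau * 0).
  apply: cvgMl_tmp; apply: cvgD; last exact: cvgMl_tmp.
  apply: cvgMl_tmp; have L3 : - (tau * (1 - (bb n)^-1)) * t @[n --> \oo] -->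
      - (tau * (1 - 0)) * t.
    apply: cvgMr_tmp; apply: cvgN; apply: cvgMl_tmp; apply: cvgB => //; exact: cvg_cst.
  exact: (cvg_comp _ _ L3 (@continuous_expR R _)).
rewrite subr0 mulr1 mulr0 addr0 mulrA mulNr -mulNr in L2.
apply: (ler_cvg_to L1 L2); apply: nearW => n.
have b2 : 2 <= bb n by rewrite ler_nat.
have := ckp cH (lexx `|s0|) (P2_mol (bb0 n) P).
rewrite (mol_relative_entropy cH (bb0 n) s0 P) -EFinM lee_fin => /le_trans; apply.
rewrite ler_wpM2l ?(ltW c0)//; apply: (le_trans (HA (bb n) t b2 t0)); rewrite lerD2l.
have i0 : 0 <= (bb n)^-1 by rewrite invr_ge0 ltW.
have i2 : (bb n)^-1 <= 2^-1 by rewrite lef_pV2 ?posrE.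
have h0 : 0 < 1 - (bb n)^-1 by rewrite subr_gt0 (le_lt_trans i2)// invf_lt1 ?ltr1n.
have hh : 1 <= 2 * (1 - (bb n)^-1) by move: i2; set v := (bb n)^-1; lra.
rewrite ler_pdivrMr ?mulr_gt0//; set v := (bb n)^-1 in i0 hh *.
have -> : 2 * K2 / tau * v * (tau * (1 - v)) = K2 * v * (2 * (1 - v)).
  by field; rewrite gt_eqF.
by rewrite ler_peMr// mulr_ge0.
Qed.

End exponential_decay.

(** * Estimates of the multiplier *)

Lemma sqr_sum3_le {R : realFieldType} (a d e : R) :
  (a + d + e) ^+ 2 <= 4 * a ^+ 2 + (4 * d ^+ 2 + 2 * e ^+ 2).
Proof.
rewrite -subr_ge0 (_ : _ - _ = (a + d - e) ^+ 2 + 2 * (a - d) ^+ 2); last by ring.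
by rewrite addr_ge0 ?sqr_ge0// mulr_ge0 ?sqr_ge0.
Qed.

Section final_estimates.
Context {R : realType}.
Notation mu := (@lebesgue_measure R).
Variables (H : R -> R) (CH al be : R) (ell dell rho0 : R -> R) (rho : R -> R -> R).
Notation h1 := (derive1 H).
Hypothesis cH : confining H h1 (derive1 h1) CH al be.
Hypothesis sol : solution H ell dell rho0 rho.

Notation sig := (sigma H dell rho).
Let rP := sol_P2 sol.

Lemma sigma_entropy_bound A lstar t : 0 <= t -> `|ell t| <= A ->
  (((sig t - lambda H lstar) ^+ 2)%:E <=
    (4 * ckp_cst CH al be (CH * (A + `|gmean H 0|)))%:E *
      relative_entropy (rho t) (gamma H (lambda H (ell t)))
    + (4 * `|dell t| ^+ 2 + 2 / cVar H ^+ 2 * `|ell t - lstar| ^+ 2)%:E)%E.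
Proof.
move=> t0 tA; have P := rP t0; have CH0 := conf_CH cH.
set S := CH * _; set l := lambda H (ell t).
have lS : `|l| <= S.
  by rewrite (le_trans (lambda_bounded cH _))// ler_wpM2l ?(ltW CH0)// lerD2r.
have c0 := ckp_cst_gt0 cH S; have k := ckp cH lS P.
have e0 := relative_entropy_ge0 cH l P.
case E : (relative_entropy _ _) => [h| |]; last by rewrite E in e0.
- rewrite E -EFinM lee_fin in k; rewrite -EFinM -EFinD lee_fin.
  set a := \int[mu]_x (h1 x * rho t x) - l in k.
  (* The three errors are the distance of the force to the tilt of the current equilibrium, the rate
     of the constraint, and the distance of this tilt to its limit. *)
  have -> : sig t - lambda H lstar = a + dell t + (l - lambda H lstar).
    by rewrite /a /sigma; ring.
  (* The inequality [(p + q)^2 <= 2 p^2 + 2 q^2], used twice, gives the weights 4, 4 and 2 of the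
     statement. *)
  apply: (le_trans (sqr_sum3_le _ _ _)).
  apply: lerD; first by rewrite -mulrA ler_wpM2l.
  rewrite real_normK ?num_real// lerD2l -[_ ^+ 2](real_normK (num_real _)) -mulrA ler_wpM2l//.
  have := lambda_lipschitz cH (ell t) lstar; rewrite -/l => lip.
  have q0 : 0 <= `|ell t - lstar| / cVar H by rewrite divr_ge0// ltW// (cVar_gt0 cH).
  rewrite mulrC -exprVn -exprMn; exact: (lerXn2r 2).
(* An infinite entropy makes the right-hand side infinite, its coefficient being positive. *)
- by rewrite gt0_muley ?lte_fin ?mulr_gt0// addye// leey.
Qed.

Hypothesis P0 : P2 rho0.

Lemma sigma_decay A L lstar CLSI L0 kappa : (free_energy H rho0 < +oo)%E ->
  0 <= A -> 0 <= L ->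
  {ae mu, forall t, 0 <= t -> `|ell t| <= A} -> {ae mu, forall t, 0 <= t -> `|dell t| <= L} ->
  ell t @[t --> +oo] --> lstar -> LSI H (fine (Linfty_norm sig)) CLSI ->
  0 < L0 -> CLSI^-1 < kappa ->
  {ae mu, forall t, 0 <= t -> `|dell t| <= L0 * expR (- kappa * t)} ->
  exists Ct : R, {ae mu, forall t, 0 <= t ->
    (sig t - lambda H lstar) ^+ 2 <= Ct * expR (- CLSI^-1 * t)}.
Proof.
move=> fin A0 L_0 hA hL lim lsi L00 kt hd.
have [M2 hM2] := sq_moment_uniform cH sol P0 A0 hA hL.
have sb := sigma_bounded cH sol P0 A0 L_0 hA hL.
have hS := ae_le_fine_Linfty sb.
have M0 : 0 <= fine (Linfty_norm sig) by rewrite fine_ge0// Linfty_ge0.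
have [C C0 HC] := force_decay cH sol P0 hM2 M0 hS lsi lim L00 kt hd fin.
have tau0 : 0 < CLSI^-1 by rewrite invr_gt0; have [] := lsi.
(* [sig - lambda H lstar] is the force error, whose square decays at rate [tau], plus [dell], whose
   square decays at least as fast. *)
exists (2 * C + 2 * L0 ^+ 2); apply: ae_impl hd => t dt t0.
have {}dt := dt t0; have Xt := HC t t0.
set X := \int[mu]_x _ - _ in Xt.
have -> : sig t - lambda H lstar = X + dell t by rewrite /sigma /X; ring.
have e1 : expR (- kappa * t) <= expR (- CLSI^-1 * t).
  by rewrite ler_expR !mulNr lerN2 ler_wpM2r// ltW.
have e2 : expR (- kappa * t) <= 1.
  by rewrite -[leRHS]expR0 ler_expR mulNr oppr_le0 mulr_ge0// ltW// (lt_trans tau0).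
have ek := expR_ge0 (- kappa * t).
have d2 : dell t ^+ 2 <= L0 ^+ 2 * expR (- CLSI^-1 * t).
  rewrite -(real_normK (num_real _)) (@le_trans _ _ ((L0 * expR (- kappa * t)) ^+ 2))//.
    by rewrite (lerXn2r 2) ?nnegrE// mulr_ge0// ltW.
  rewrite exprMn ler_wpM2l ?sqr_ge0// (le_trans _ e1)// expr2 ler_piMl//.
apply: (@le_trans _ _ (2 * X ^+ 2 + 2 * dell t ^+ 2)).
  by rewrite -subr_ge0 (_ : _ - _ = (X - dell t) ^+ 2) ?sqr_ge0//; ring.
rewrite [leRHS]mulrDl -[2 * C * _]mulrA -[2 * L0 ^+ 2 * _]mulrA.
by apply: lerD; exact: ler_wpM2l.
Qed.

End final_estimates.

Theorem corollary4p13 (R : realType) (H : R -> R) (cHm cHp CH A : R) :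
  potential_assumptions H cHm cHp CH ->
  exists C : R,
  forall (ell dell : R -> R) (lstar : R) (rho0 : R -> R) (rho : R -> R -> R),
  constraint_assumptions ell dell lstar ->
  (Linfty_norm ell <= A%:E)%E ->
  initial_assumptions H ell rho0 ->
  solution H ell dell rho0 rho ->
  let sigma_star := lambda H lstar in
  let sig := sigma H dell rho in
  {ae @lebesgue_measure R, forall t, 0 <= t ->
    (((sig t - sigma_star) ^+ 2)%:E <=
      C%:E * relative_entropy (rho t) (gamma H (lambda H (ell t)))
      + (4 * `|dell t| ^+ 2 + 2 / cVar H ^+ 2 * `|ell t - lstar| ^+ 2)%:E)%E}
  /\
  (forall CLSI : R,
   LSI H (fine (Linfty_norm sig)) CLSI ->
   let tau := CLSI^-1 in
   forall L0 kappa : R, 0 < L0 -> tau < kappa ->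
   {ae @lebesgue_measure R, forall t, 0 <= t ->
     `|dell t| <= L0 * expR (- kappa * t)} ->
   exists Ct : R,
   {ae @lebesgue_measure R, forall t, 0 <= t ->
     (sig t - sigma_star) ^+ 2 <= Ct * expR (- tau * t)}).
Proof.
move=> pot; have [CH' [al [be cH]]] := confining_of_potential pot.
(* [lambda_bounded] bounds the tilts [lambda H (ell t)] by [CH' (|A| + |gmean H 0|)], uniformly over
   the admissible constraints; hence a constant that depends only on the potential and [A]. *)
exists (4 * ckp_cst CH' al be (CH' * (`|A| + `|gmean H 0|))).
move=> ell dell lstar rho0 rho cons hA init sol.
have hA' := ae_le_Linfty hA.
have aA : {ae @lebesgue_measure R, forall t, 0 <= t -> `|ell t| <= `|A|}.
  by apply: ae_impl hA' => t h t0; exact: le_trans (h t0) (ler_norm A).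
split; first by apply: ae_impl aA => t h t0; exact: (sigma_entropy_bound cH sol lstar t0 (h t0)).
move=> CLSI lsi tau L0 kappa L00 kt hd; have [P0 _] := initial_Ml init.
have hL := ae_le_fine_Linfty (constraint_derivative_bounded cons).
have L_0 : 0 <= fine (Linfty_norm dell) by rewrite fine_ge0// Linfty_ge0.
exact: (sigma_decay cH sol P0 (initial_free_energy init) (normr_ge0 A) L_0 aA hL
  (constraint_lim cons) lsi L00 kt hd).
Qed.
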